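(* Let $G$ be a simply-connected nilpotent Lie group with quadratic Dehn function and let $\mathfrak{g}$ be its Lie algebra. Suppose $\mathfrak{g}$ has a grading $\mathfrak{g}=V_1\oplus V_2$, let $W\subset V_2$ be a linear subspace, and let $G'$ be the simply-connected nilpotent Lie group with Lie algebra $\mathfrak{g}/W$. Then $$\delta_{G'}(\ell)\precsim \ell^2\log\ell.$$
   Context: A grading $\mathfrak{g}=V_1\oplus V_2$ is a direct sum decomposition with $[V_1,V_1]\subset V_2$, $[V_1,V_2]=[V_2,V_2]=0$ and $[\mathfrak{g},\mathfrak{g}]=V_2$. A simply-connected Lie group is given a left-invariant riemannian metric. For such a group $X$ and a Lipschitz closed curve $f:S^1\to X$, let $\delta_X(f)$ be the infimum of the areas of Lipschitz discs $g:D^2\to X$ with $g|_{S^1}=f$, and let $\delta_X(\ell)=\sup\{\delta_X(f)\mid \operatorname{length}(f)\le \ell\}$ be the Dehn function. $X$ has quadratic Dehn function if $\delta_X(\ell)\sim\ell^2$. For $f,g:\mathbb{R}^+\to\mathbb{R}^+$, $f\precsim g$ means there is a constant $c$ with $f(x)\le c\,g(cx+c)+cx+c$ for all $x$; $f\sim g$ means $f\precsim g$ and $g\precsim f$. *)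

(* Defs.v *)
From HB Require Import structures.
From mathcomp Require Import all_boot all_order all_algebra.
From mathcomp Require Import all_classical all_reals all_analysis.
Import Order.TTheory GRing.Theory Num.Theory.
Import numFieldNormedType.Exports.

Set Implicit Arguments.
Unset Strict Implicit.
Unset Printing Implicit Defensive.

Local Open Scope classical_set_scope.
Local Open Scope ring_scope.

HB.mixin Record isTopologicalGroup G of Group G & Topological G := {
  mulg_continuous : continuous (fun p : G * G => (p.1 * p.2)%g);
  invg_continuous : continuous (fun x : G => x^-1%g)
}.

#[short(type="topologicalGroupType")]
HB.structure Definition TopologicalGroup :=
  {G of Group G & Topological G & isTopologicalGroup G}.

Section smooth.
Context {R : realType} {V W : normedModType R}.

(* Class C^k on an open set [U].  The spaces used are finite-dimensional, so
   that continuity of all the directional derivatives is continuity of the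
   differential. *)
Fixpoint Ck_on (k : nat) (U : set V) (f : V -> W) : Prop :=
  match k with
  | 0 => forall x, U x -> {for x, continuous f}
  | k'.+1 => (forall x, U x -> differentiable f x) /\
             (forall v : V, Ck_on k' U (fun x => 'D_v f x))
  end.

Definition smooth_on (U : set V) (f : V -> W) := forall k, Ck_on k U f.

End smooth.

(* The functions [chart_map] and [chart_inv] are total; their values outside
   [chart_dom] and [chart_cod] carry no information. *)
Record chart (R : realType) (n : nat) (T : topologicalType) := Chart {
  chart_dom : set T;
  chart_map : T -> 'rV[R]_n;
  chart_inv : 'rV[R]_n -> T;
  chart_cod := chart_map @` chart_dom;
  chart_dom_open : open chart_dom;
  chart_cod_open : open chart_cod;
  chart_mapK : forall x, chart_dom x -> chart_inv (chart_map x) = x;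
  chart_map_continuous : forall x, chart_dom x -> {for x, continuous chart_map};
  chart_inv_continuous : forall y, chart_cod y -> {for y, continuous chart_inv}
}.

Definition smooth_atlas (R : realType) (n : nat) (T : topologicalType)
    (A : set (chart R n T)) :=
  (forall x, exists2 a, A a & chart_dom a x) /\
  (forall a b, A a -> A b ->
     smooth_on [set y | chart_cod a y /\ chart_dom b (chart_inv a y)]
               (fun y => chart_map b (chart_inv a y))).

Record lieGroup (R : realType) (n : nat) := LieGroup {
  lie_sort :> topologicalGroupType;
  lie_atlas : set (chart R n lie_sort);
  lie_hausdorff : hausdorff_space lie_sort;
  lie_second_countable : @second_countable lie_sort;
  lie_atlas_smooth : smooth_atlas lie_atlas;
  lie_mul_smooth : forall a b c,
    lie_atlas a -> lie_atlas b -> lie_atlas c ->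
    smooth_on
      [set p : 'rV[R]_n * 'rV[R]_n |
        [/\ chart_cod a p.1, chart_cod b p.2 &
            chart_dom c (chart_inv a p.1 * chart_inv b p.2)%g]]
      (fun p => chart_map c (chart_inv a p.1 * chart_inv b p.2)%g);
  lie_inv_smooth : forall a b, lie_atlas a -> lie_atlas b ->
    smooth_on
      [set y | chart_cod a y /\ chart_dom b (chart_inv a y)^-1%g]
      (fun y => chart_map b (chart_inv a y)^-1%g)
}.

Definition simply_connected (R : realType) (T : topologicalType) :=
  (forall x y : T, exists c : R -> T,
     [/\ {within `[0, 1], continuous c}, c 0 = x & c 1 = y]) /\
  (forall c : R -> T, {within `[0, 1], continuous c} -> c 0 = c 1 ->
     exists H : R * R -> T,
       [/\ {within `[0, 1] `*` `[0, 1], continuous H},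
           forall t, t \in `[0, 1] -> H (0, t) = c t,
           forall t, t \in `[0, 1] -> H (1, t) = c 0 &
           forall s, s \in `[0, 1] -> H (s, 0) = c 0 /\ H (s, 1) = c 0]).

Fixpoint upper_central (G : groupType) (k : nat) : set G :=
  match k with
  | 0 => [set 1%g]
  | k'.+1 => [set x | forall y, upper_central k' (x^-1 * y^-1 * x * y)%g]
  end.

Definition nilpotent_group (G : groupType) :=
  exists k, @upper_central G k = setT.

(* The chart [e] below is a chart at the identity of the group; its
   differential identifies the Lie algebra, i.e. the tangent space at the
   identity, with 'rV[R]_n. *)
Definition chart_at_one (R : realType) (n : nat) (G : lieGroup R n)
    (e : chart R n G) := lie_atlas e /\ chart_dom e 1%g.

Section lie_algebra.
Context {R : realType} {n : nat} {G : lieGroup R n}.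
Variable e : chart R n G.
Implicit Types (u v x : 'rV[R]_n).

(* The left-invariant vector field with value [v] at the identity. *)
Definition left_inv_field v x : 'rV[R]_n :=
  'D_v (fun y => chart_map e (chart_inv e x * chart_inv e y)%g)
       (chart_map e 1%g).

Definition field_bracket (X Y : 'rV[R]_n -> 'rV[R]_n) x : 'rV[R]_n :=
  'D_(X x) Y x - 'D_(Y x) X x.

Definition lie_bracket u v : 'rV[R]_n :=
  field_bracket (left_inv_field u) (left_inv_field v) (chart_map e 1%g).

End lie_algebra.

(* [A, B] is the linear span of the brackets of elements of A and B; for a
   bilinear bracket it is spanned by the brackets of basis vectors. *)
Definition lie_prod (R : realType) (n : nat)
    (br : 'rV[R]_n -> 'rV[R]_n -> 'rV[R]_n) (A B : {vspace 'rV[R]_n}) :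
    {vspace 'rV[R]_n} :=
  <<[seq br x y | x <- vbasis A, y <- vbasis B]>>%VS.

Definition grading (R : realType) (n : nat)
    (br : 'rV[R]_n -> 'rV[R]_n -> 'rV[R]_n) (V1 V2 : {vspace 'rV[R]_n}) :=
  [/\ (V1 + V2 = fullv)%VS, (V1 :&: V2 = 0)%VS,
      (lie_prod br V1 V1 <= V2)%VS,
      lie_prod br V1 V2 = 0%VS /\ lie_prod br V2 V2 = 0%VS &
      lie_prod br fullv fullv = V2].

Section riemannian.
Context {R : realType} {n : nat} {G : lieGroup R n}.
Variables (e : chart R n G) (q : {dot 'rV[R]_n for idfun}).

(* The derivative at [t] of the curve [c], left-translated to the identity.
   The left-invariant metric defined by the inner product [q] on the Lie
   algebra gives it the length [Num.sqrt (q w w)], w = velocity c t. *)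
Definition velocity (c : R -> G) (t : R) : 'rV[R]_n :=
  derive1 (fun s => chart_map e ((c t)^-1 * c s)%g) t.

Definition speed (c : R -> G) (t : R) : R :=
  Num.sqrt (q (velocity c t) (velocity c t)).

(* Lipschitz curves are differentiable almost everywhere, so that the values
   of [speed] at the other points do not matter. *)
Definition curve_length (a b : R) (c : R -> G) : \bar R :=
  (\int[lebesgue_measure]_(t in `[a, b]) (speed c t)%:E)%E.

Definition C1_curve (c : R -> G) :=
  continuous c /\
  forall a, lie_atlas a ->
    @Ck_on R R^o _ 1 (c @^-1` chart_dom a) (chart_map a \o c).

Definition riem_dist (x y : G) : \bar R :=
  ereal_inf [set curve_length 0 1 c |
              c in [set c | [/\ C1_curve c, c 0 = x & c 1 = y]]].

Definition euclid_dist (p p' : R * R) : R :=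
  Num.sqrt ((p.1 - p'.1) ^+ 2 + (p.2 - p'.2) ^+ 2).

Definition circle : set (R * R) := [set p | p.1 ^+ 2 + p.2 ^+ 2 = 1].
Definition disc : set (R * R) := [set p | p.1 ^+ 2 + p.2 ^+ 2 <= 1].

Definition lipschitz_map (D : set (R * R)) (g : R * R -> G) :=
  exists L : R, forall p p', D p -> D p' ->
    (riem_dist (g p) (g p') <= (L * euclid_dist p p')%:E)%E.

Definition circle_length (f : R * R -> G) : \bar R :=
  curve_length 0 (2 * pi) (fun t => f (cos t, sin t)).

(* The area of the parallelogram spanned by the two partial derivatives. *)
Definition jacobian2 (g : R * R -> G) (p : R * R) : R :=
  let u := velocity (fun s => g (s, p.2)) p.1 in
  let v := velocity (fun s => g (p.1, s)) p.2 in
  Num.sqrt (q u u * q v v - q u v ^+ 2).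

Definition disc_area (g : R * R -> G) : \bar R :=
  (\int[(@lebesgue_measure R \x @lebesgue_measure R)%E]_(p in disc)
     (jacobian2 g p)%:E)%E.

Definition filling_area (f : R * R -> G) : \bar R :=
  ereal_inf [set disc_area g |
              g in [set g | lipschitz_map disc g /\
                            forall p, circle p -> g p = f p]].

Definition dehn (l : R) : \bar R :=
  ereal_sup [set filling_area f |
              f in [set f | lipschitz_map circle f /\
                            (circle_length f <= l%:E)%E]].

End riemannian.

Section asymptotics.
Context {R : realType}.
Implicit Types f g : R -> \bar R.

Definition preceq f g :=
  exists2 c : R, 0 < c &
    forall x, 0 <= x -> (f x <= c%:E * g (c * x + c)%R + (c * x + c)%R%:E)%E.

Definition asymp_equiv f g := preceq f g /\ preceq g f.

End asymptotics.

Definition quadratic_dehn (R : realType) (n : nat) (G : lieGroup R n)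
    (e : chart R n G) (q : {dot 'rV[R]_n for idfun}) :=
  asymp_equiv (dehn e q) (fun l => (l ^+ 2)%:E).

(* [pr] exhibits the Lie algebra with bracket [br'] as the quotient of the one
   with bracket [br] by the subspace [W]. *)
Definition lie_quotient (R : realType) (n n' : nat)
    (br : 'rV[R]_n -> 'rV[R]_n -> 'rV[R]_n)
    (br' : 'rV[R]_n' -> 'rV[R]_n' -> 'rV[R]_n')
    (W : {vspace 'rV[R]_n}) (pr : 'Hom('rV[R]_n, 'rV[R]_n')) :=
  [/\ forall u v, pr (br u v) = br' (pr u) (pr v),
      limg pr = fullv & lker pr = W].

(* Main.v *)
(* Exponential coordinates identify G and G' with their Lie algebras, carrying
   the two-step Baker-Campbell-Hausdorff product, and the projection of Lie
   algebras becomes a Lipschitz homomorphism G -> G'.  A closed curve of length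
   l in G' lifts to a curve in G whose end point w lies in W, and |w| is at most
   of order l^2.  Closing the lift by a curve of length of order sqrt |w| gives
   a loop in G, which has a filling of area of order l^2 because the Dehn
   function of G is quadratic; projecting it, what is left to fill in G' is the
   projection of a short curve from 1 to w.  As w is central and dies in G', this
   loop may be replaced, again by the quadratic Dehn function of G, by two copies
   of the one belonging to w/2 at a cost of order |w|.  Each of the log l rounds
   of this halving costs in total order |w|, hence l^2, and the loops that remain
   at the end are so short that they can be coned off. *)
Require Import Defs.
From HB Require Import structures.
From mathcomp Require Import all_boot all_order all_algebra.
From mathcomp Require Import all_classical all_reals all_analysis.
From mathcomp Require Import measurable_realfun ring lra.
Import Order.TTheory GRing.Theory Num.Theory.
Import numFieldNormedType.Exports.

Set Implicit Arguments.
Unset Strict Implicit.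
Unset Printing Implicit Defensive.

Local Open Scope classical_set_scope.
Local Open Scope ring_scope.

(** * Calculus in normed spaces *)

(** Everything is moved to row vectors with the product [bch], without solving a flow. In a chart
    the Maurer-Cartan form is integrated by the Poincare lemma, first modulo brackets, then as a
    whole after adding half a bracket. Taking powers makes the exponential global, and simple
    connectedness makes it injective.

    Left-translated increments are measured by [ndist], which is not a metric: its triangle
    inequality has a quadratic error. Lipschitz conditions are therefore imposed on germs, which can
    be glued, and a curve of length lam moves by at most the order of lam + lam^2.

    The areas in the statement integrate functions not known to be measurable, built from
    derivatives that default to 0. Bounds go through measurable majorants, and the connecting pieces
    of a map factor through a curve, so that they have rank one and no area.

    Lifting a loop by a linear section makes an error that grows with the distance from the base
    point; it is compensated on pieces of bounded length. Fillings live on squares with three sides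
    at the base point, because squares can be juxtaposed; a collar turns the last one into a
    disc. *)

(** Matrix products, Lie brackets, inner products and [adr] are all instances, so that the Leibniz
    rule, continuity and measurability are proved once. *)
Record bounded_bilinear (R : realType) (U V W : normedModType R)
    (B : U -> V -> W) (C : R) := {
  bblDl : forall x y z, B (x + y) z = B x z + B y z;
  bblDr : forall x y z, B x (y + z) = B x y + B x z;
  bblZl : forall (a : R) x y, B (a *: x) y = a *: B x y;
  bblZr : forall (a : R) x y, B x (a *: y) = a *: B x y;
  bbl_ge0 : 0 <= C;
  bbl_le : forall x y, `|B x y| <= C * `|x| * `|y| }.

Section bounded_bilinear.
Context {R : realType} {U V W : normedModType R} {B : U -> V -> W} {C : R}.
Hypothesis hB : bounded_bilinear B C.

Lemma bbl0l y : B 0 y = 0.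
Proof. by rewrite -(scale0r 0) (bblZl hB) scale0r. Qed.
Lemma bbl0r x : B x 0 = 0.
Proof. by rewrite -(scale0r 0) (bblZr hB) scale0r. Qed.
Lemma bblNl x y : B (- x) y = - B x y.
Proof. by rewrite -scaleN1r (bblZl hB) scaleN1r. Qed.
Lemma bblNr x y : B x (- y) = - B x y.
Proof. by rewrite -scaleN1r (bblZr hB) scaleN1r. Qed.
Lemma bblBl x y z : B (x - y) z = B x z - B y z.
Proof. by rewrite (bblDl hB) bblNl. Qed.
Lemma bblBr x y z : B x (y - z) = B x y - B x z.
Proof. by rewrite (bblDr hB) bblNr. Qed.

Lemma bbl_cvg (T : Type) (F : set_system T) {FF : Filter F} (f : T -> U) (g : T -> V) a b :
  f @ F --> a -> g @ F --> b -> B (f t) (g t) @[t --> F] --> B a b.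
Proof.
move=> fa gb; apply/subr_cvg0; apply: norm_cvg0.
have h0 : C * `|f t - a| * `|g t| + C * `|a| * `|g t - b| @[t --> F] --> (0 : R).
  have -> : (0 : R) = C * 0 * `|b| + C * `|a| * 0 by rewrite !mulr0 mul0r addr0.
  apply: cvgD; apply: cvgM.
  - by apply: cvgM; [exact: cvg_cst|apply/norm_cvg0P/subr_cvg0].
  - exact: cvg_norm.
  - exact: cvg_cst.
  - by apply/norm_cvg0P/subr_cvg0.
apply: (squeeze_cvgr _ (cvg_cst (0 : R)) h0).
apply: nearW => t; rewrite normr_ge0/=.
have -> : B (f t) (g t) - B a b = B (f t - a) (g t) + B a (g t - b).
  by rewrite bblBl bblBr addrA subrK.
by rewrite (le_trans (ler_normD _ _))// lerD// (bbl_le hB).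
Qed.

Lemma bbl_is_derive (Z : normedModType R) (f : Z -> U) (g : Z -> V) x v df dg :
  is_derive x v f df -> is_derive x v g dg ->
  is_derive x v (fun y => B (f y) (g y)) (B df (g x) + B (f x) dg).
Proof.
move=> [f' <-] [g' <-].
(* Splitting the increment of [B f g] leaves [g] at the displaced point, so [g] must be continuous
   along the line; derivability in direction [v] gives exactly that. *)
have gx : g (h *: v + x) @[h --> (0 : R)^'] --> g x.
  have /derivable1P/derivable1_diffP/differentiable_continuous/= := g'.
  rewrite /prop_for /continuous_at/= scale0r add0r => gc.
  exact: cvg_within_filter gc.
have H : (fun h => h^-1 *: (B (f (h *: v + x)) (g (h *: v + x)) - B (f x) (g x)))
    @ (0 : R)^' --> B ('D_v f x) (g x) + B (f x) ('D_v g x).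
  rewrite (_ : (fun h => _) = (fun h => B (h^-1 *: (f (h *: v + x) - f x)) (g (h *: v + x))
     + B (f x) (h^-1 *: (g (h *: v + x) - g x)))); last first.
    apply/funext => h; rewrite (bblZl hB) (bblZr hB) -scalerDr; congr (_ *: _).
    by rewrite bblBl bblBr addrA subrK.
  by apply: cvgD; apply: bbl_cvg => //; exact: cvg_cst.
split; first by apply/cvg_ex; eexists; exact: H.
by apply/cvg_lim => //; exact: norm_hausdorff.
Qed.

End bounded_bilinear.

Section pointwise_continuity.
Context {R : realType} {T : topologicalType} {U V W : normedModType R}.
Implicit Types (x : T).

Lemma cont_cst (S : topologicalType) (a : S) x : {for x, continuous (fun _ : T => a)}.
Proof. by move=> A; exact: cvg_cst. Qed.

Lemma cont_add (f g : T -> U) x : {for x, continuous f} -> {for x, continuous g} ->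
  {for x, continuous (fun y => f y + g y)}.
Proof. by move=> hf hg; apply: cvgD. Qed.

Lemma cont_bbl (B : U -> V -> W) C (hB : bounded_bilinear B C) (f : T -> U) (g : T -> V) x :
  {for x, continuous f} -> {for x, continuous g} ->
  {for x, continuous (fun y => B (f y) (g y))}.
Proof. by move=> hf hg; exact: (bbl_cvg hB hf hg). Qed.

Lemma cont_comp (S Z : topologicalType) (f : T -> S) (g : S -> Z) x : {for x, continuous f} ->
  {for f x, continuous g} -> {for x, continuous (fun y => g (f y))}.
Proof. by move=> hf hg; apply: (continuous_comp hf hg). Qed.

Lemma cont_pair (S Z : topologicalType) (f : T -> S) (g : T -> Z) x : {for x, continuous f} ->
  {for x, continuous g} -> {for x, continuous (fun y => (f y, g y))}.
Proof. by move=> hf hg; exact: (cvg_pair hf hg). Qed.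

Lemma cont_fst (S Z : topologicalType) (p : S * Z) : {for p, continuous (fun q : S * Z => q.1)}.
Proof. by move=> A; exact: cvg_fst. Qed.

Lemma cont_snd (S Z : topologicalType) (p : S * Z) : {for p, continuous (fun q : S * Z => q.2)}.
Proof. by move=> A; exact: cvg_snd. Qed.

Lemma cont_near_eq (S : topologicalType) (f g : T -> S) x :
  (\forall y \near x, f y = g y) -> {for x, continuous f} -> {for x, continuous g}.
Proof.
move=> fg; rewrite /prop_for /continuous_at -(nbhs_singleton fg) => fx.
by apply: cvg_trans fx; apply: near_eq_cvg.
Qed.

Lemma near_forall (I : finType) (P : I -> T -> Prop) x :
  (forall i, \forall y \near x, P i y) -> \forall y \near x, forall i, P i y.
Proof. exact: filter_forall. Qed.

Lemma cont_near (S : topologicalType) (f : T -> S) (P : S -> Prop) x : {for x, continuous f} ->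
  (\forall y \near f x, P y) -> \forall y \near x, P (f y).
Proof. by move=> hf hP; exact: hf hP. Qed.

End pointwise_continuity.

(** * Matrices with the sup norm, and mean value estimates *)

Section matrices.
Context {R : realType}.

Lemma mx_norm_leP m n (A : 'M[R]_(m, n)) (M : R) : 0 <= M ->
  `|A| <= M <-> forall i j, `|A i j| <= M.
Proof.
move=> M0; rewrite [`|A|]/Num.Def.normr/= mx_normrE; split.
  by move=> + i j; apply: le_trans; apply: (le_bigmax _ _ (i, j)).
by move=> h; apply: bigmax_le => // -[i j] _; exact: h.
Qed.

Lemma mx_norm_coord m n (A : 'M[R]_(m, n)) i j : `|A i j| <= `|A|.
Proof. by have /(mx_norm_leP A (normr_ge0 _)) := lexx `|A|. Qed.

Lemma mulmx_bounded m n p :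
  bounded_bilinear (@mulmx R m n p : 'M[R]_(m, n) -> 'M[R]_(n, p) -> 'M[R]_(m, p)) n%:R.
Proof.
split=> [x y z|x y z|a x y|a x y||x y].
- exact: mulmxDl.
- exact: mulmxDr.
- by rewrite scalemxAl.
- by rewrite scalemxAr.
- by [].
apply/mx_norm_leP; first by rewrite !mulr_ge0.
move=> i j; rewrite mxE (le_trans (ler_norm_sum _ _ _))//.
rewrite (le_trans (y := \sum_(k < n) `|x| * `|y|))//; last first.
  by rewrite sumr_const card_ord -mulrA mulr_natl.
by apply: ler_sum => k _; rewrite normrM ler_pM// mx_norm_coord.
Qed.

Lemma mulmx_norm_le m n p (A : 'M[R]_(m, n)) (B : 'M[R]_(n, p)) :
  `|A *m B| <= n%:R * `|A| * `|B|.
Proof. exact: (bbl_le (mulmx_bounded m n p)). Qed.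

Lemma is_derive_mulmx (V : normedModType R) m n p (f : V -> 'M[R]_(m, n))
    (g : V -> 'M[R]_(n, p)) x v df dg :
  is_derive x v f df -> is_derive x v g dg ->
  is_derive x v (fun y => f y *m g y) (df *m g x + f x *m dg).
Proof. exact: (bbl_is_derive (mulmx_bounded m n p)). Qed.

Lemma is_derive_mulmxr (V : normedModType R) m n p (f : V -> 'M[R]_(m, n))
    (A : 'M[R]_(n, p)) x v df :
  is_derive x v f df -> is_derive x v (fun y => f y *m A) (df *m A).
Proof.
move=> h; have := is_derive_mulmx h (is_derive_cst A x v).
by rewrite mulmx0 addr0.
Qed.

Lemma is_derive_mulmxl (V : normedModType R) m n p (f : V -> 'M[R]_(m, n))
    (A : 'M[R]_(p, m)) x v df :
  is_derive x v f df -> is_derive x v (fun y => A *m f y) (A *m df).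
Proof.
move=> h; have := is_derive_mulmx (is_derive_cst A x v) h.
by rewrite mul0mx add0r.
Qed.

Lemma cvg_mulmx (T : Type) (F : set_system T) {FF : Filter F} m n p
   (f : T -> 'M[R]_(m, n)) (g : T -> 'M[R]_(n, p)) (a : 'M[R]_(m, n)) (b : 'M[R]_(n, p)) :
  f @ F --> a -> g @ F --> b -> f t *m g t @[t --> F] --> a *m b.
Proof. exact: (bbl_cvg (mulmx_bounded m n p)). Qed.

Lemma cvg_mxP (T : Type) (F : set_system T) {FF : Filter F} m n
   (f : T -> 'M[R]_(m, n)) (a : 'M[R]_(m, n)) :
  f @ F --> a <-> forall i j, f t i j @[t --> F] --> a i j.
Proof.
split.
  move=> h i j; apply/subr_cvg0; apply: norm_cvg0.
  move/subr_cvg0/norm_cvg0P : h => h.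
  apply: (squeeze_cvgr _ (cvg_cst (0 : R)) h).
  apply: nearW => t; rewrite normr_ge0/=.
  by rewrite (le_trans _ (mx_norm_coord _ i j))// !mxE.
move=> h; apply/cvgrPdist_le => e e0.
have H : \forall t \near F, forall ij : 'I_m * 'I_n, `|a ij.1 ij.2 - f t ij.1 ij.2| <= e.
  apply: filter_forall => -[i j] /=.
  by move/cvgrPdist_le : (h i j); exact.
apply: filterS H => t H; apply/mx_norm_leP; first exact: ltW.
by move=> i j; rewrite !mxE; exact: (H (i, j)).
Qed.

Lemma cont_mxP (T : topologicalType) m n (f : T -> 'M[R]_(m, n)) x :
  {for x, continuous f} <-> forall i j, {for x, continuous (fun y => f y i j)}.
Proof. exact: (@cvg_mxP T (nbhs x) _ m n f (f x)). Qed.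

Lemma is_derive_mxP (V : normedModType R) m n (f : V -> 'M[R]_(m, n)) x v df :
  is_derive x v f df <-> forall i j, is_derive x v (fun y => f y i j) (df i j).
Proof.
split=> [[h <-] i j|h].
  split; first by move/derivable_mxP : h; exact.
  by rewrite (derive_mx h) mxE.
have h' : derivable f x v by apply/derivable_mxP => i j; have [] := h i j.
by split=> //; rewrite (derive_mx h'); apply/matrixP => i j; rewrite mxE; have [] := h i j.
Qed.

(** The norm is the largest entry, so the scalar mean value theorem applied to each entry loses no
    constant, although the intermediate point depends on the entry. *)
Lemma mvt_le m n (f df : R -> 'M[R]_(m, n)) (a b M : R) : a <= b ->
  (forall t, t \in `[a, b] -> is_derive t 1 f (df t)) ->
  (forall t, t \in `[a, b] -> `|df t| <= M) ->
  `|f b - f a| <= M * (b - a).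
Proof.
move=> ab hd hM.
have M0 : 0 <= M by rewrite (le_trans _ (hM a _))// in_itv/= lexx.
apply/mx_norm_leP; first by rewrite mulr_ge0// subr_ge0.
move=> i j; rewrite !mxE.
have [c cab ->] : exists2 c, c \in `[a, b] & f b i j - f a i j = df c i j * (b - a).
  have hdij t : t \in `[a, b] -> is_derive t 1 (fun t => f t i j) (df t i j).
    by move=> /hd /is_derive_mxP; exact.
  have [|c cab e] := MVT_segment ab (fun t h => hdij t (subset_itv_oo_cc h)).
    by apply: derivable_within_continuous => t tab; have [] := hdij t tab.
  by exists c.
rewrite normrM (ger0_norm (_ : 0 <= b - a)) ?subr_ge0// ler_wpM2r ?subr_ge0//.
by rewrite (le_trans (mx_norm_coord _ i j))// hM.
Qed.

End matrices.

Lemma is_derive_line (R : realType) (V W : normedModType R) (f : V -> W) x v t d :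
  is_derive (x + t *: v) v f d -> is_derive t 1 (fun s : R => f (x + s *: v)) d.
Proof.
have E : (fun h : R => h^-1 *: (f (x + (h *: 1 + t) *: v) - f (x + t *: v))) =
   (fun h : R => h^-1 *: (f (h *: v + (x + t *: v)) - f (x + t *: v))).
  by apply/funext => h; rewrite [h *: 1]mulr1 scalerDl addrCA.
move=> [h1 h2]; split; first by rewrite /derivable/= E.
by rewrite -h2 /derive/= E.
Qed.

Lemma ball_line (R : realType) (V : normedModType R) (p x y : V) r (t : R) :
  ball p r x -> ball p r y -> 0 <= t <= 1 -> ball p r (x + t *: (y - x)).
Proof.
rewrite -!ball_normE /ball_/= => hx hy /andP[t0 t1].
have -> : p - (x + t *: (y - x)) = (1 - t) *: (p - x) + t *: (p - y).
  rewrite [in RHS]scalerBl scale1r -addrA -scalerN -scalerDr opprB addrA subrK.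
  by rewrite opprD addrA -scalerN opprB.
rewrite (le_lt_trans (ler_normD _ _))// !normrZ !ger0_norm ?subr_ge0//.
have [->|tn0] := eqVneq t 0; first by rewrite mul0r addr0 subr0 mul1r.
have -> : r = (1 - t) * r + t * r by rewrite -mulrDl subrK mul1r.
by rewrite ler_ltD// ?ltr_pM2l// ?lt0r ?tn0// ler_wpM2l ?subr_ge0// ltW.
Qed.

Lemma lipschitz_ball (R : realType) (V : normedModType R) m n (f : V -> 'M[R]_(m, n))
    (df : V -> V -> 'M[R]_(m, n)) p r (M : R) :
  (forall x v, ball p r x -> is_derive x v f (df x v)) ->
  (forall x v, ball p r x -> `|df x v| <= M * `|v|) ->
  forall x y, ball p r x -> ball p r y -> `|f y - f x| <= M * `|y - x|.
Proof.
move=> hd hM x y hx hy.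
have inb t : t \in `[0, 1] -> ball p r (x + t *: (y - x)).
  by rewrite in_itv/=; exact: ball_line.
have := @mvt_le _ _ _ (fun t => f (x + t *: (y - x)))
  (fun t => df (x + t *: (y - x)) (y - x)) 0 1 (M * `|y - x|) ler01.
rewrite scale1r scale0r addr0 subr0 mulr1 (addrC x) subrK; apply.
  by move=> t t01; apply/is_derive_line/hd/inb.
by move=> t t01; apply/hM/inb.
Qed.

(** * Symmetry of mixed directional derivatives *)

Section schwarz.
Context {R : realType} {V : normedModType R}.

(** The mean value theorem is used twice on the second difference over a parallelogram: in [s] for
    the difference [g] of two parallel segments, then in [t] for [fu]. *)
Lemma mixed_difference (f fu fuv : V -> R) u v x r h : 0 < h -> h * (`|u| + `|v|) < r ->
  (forall y, ball x r y -> is_derive y u f (fu y)) ->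
  (forall y, ball x r y -> is_derive y v fu (fuv y)) ->
  exists s t, [/\ 0 <= s <= h, 0 <= t <= h &
    f (x + h *: u + h *: v) - f (x + h *: u) - (f (x + h *: v) - f x) =
    h * h * fuv (x + s *: u + t *: v)].
Proof.
move=> h0 hr fu_ fuv_.
have inb s t : 0 <= s <= h -> 0 <= t <= h -> ball x r (x + s *: u + t *: v).
  move=> /andP[s0 sh] /andP[t0 th]; rewrite -ball_normE /ball_/= -addrA opprD addrA subrr sub0r normrN.
  rewrite (le_lt_trans _ hr)// (le_trans (ler_normD _ _))// !normrZ mulrDr.
  by rewrite !ger0_norm// lerD// ler_wpM2r.
have inb0 s : 0 <= s <= h -> ball x r (x + s *: u).
  by move=> sh; have := inb s 0 sh; rewrite scale0r addr0 lexx (ltW h0); exact.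
pose g s := f (x + h *: v + s *: u) - f (x + s *: u).
have hh : 0 <= h <= h by rewrite lexx ltW.
have dg s : s \in `[0, h] -> is_derive s 1 g (fu (x + h *: v + s *: u) - fu (x + s *: u)).
  rewrite in_itv/= => sh; apply: is_deriveB; apply: is_derive_line; apply: fu_.
    by rewrite addrAC; exact: inb.
  exact: inb0.
have [|s /itvP sh es] := MVT_segment (ltW h0) (fun t ht => dg t (subset_itv_oo_cc ht)).
  by apply: derivable_within_continuous => t tab; have [] := dg t tab.
have shh : 0 <= s <= h by rewrite !sh.
have dk t : t \in `[0, h] -> is_derive t 1 (fun t => fu (x + s *: u + t *: v))
    (fuv (x + s *: u + t *: v)).
  by rewrite in_itv/= => th; apply: is_derive_line; apply: fuv_; exact: inb.
have [|t /itvP th et] := MVT_segment (ltW h0) (fun t ht => dk t (subset_itv_oo_cc ht)).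
  by apply: derivable_within_continuous => t tab; have [] := dk t tab.
exists s, t; split => //; first by rewrite !th.
move: es; rewrite /g scale0r !addr0 subr0.
rewrite (addrAC x (h *: v) (h *: u)) (addrAC x (h *: v)) => ->.
move: et; rewrite scale0r addr0 => ->.
by rewrite subr0 mulrC mulrA (mulrC _ h) mulrA.
Qed.

(** The second difference is symmetric in [u] and [v]. In either order it is h^2 times a value of a
    mixed derivative near [x], and both mixed derivatives are continuous at [x]. *)
Lemma schwarz_theorem (f fu fv fuv fvu : V -> R) u v x r : 0 < r ->
  (forall y, ball x r y -> is_derive y u f (fu y)) ->
  (forall y, ball x r y -> is_derive y v f (fv y)) ->
  (forall y, ball x r y -> is_derive y v fu (fuv y)) ->
  (forall y, ball x r y -> is_derive y u fv (fvu y)) ->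
  {for x, continuous fuv} -> {for x, continuous fvu} -> fuv x = fvu x.
Proof.
move=> r0 fu_ fv_ fuv_ fvu_ /cvgrPdist_lt c1 /cvgrPdist_lt c2.
apply/eqP; rewrite -subr_eq0 -normr_le0; apply/ler_addgt0Pl => e e0; rewrite addr0.
have e20 : 0 < e / 2 by rewrite divr_gt0.
have [d /= d0 hd] := (nbhs_ballP x _).1 (filterI (c1 _ e20) (c2 _ e20)).
pose rho := Num.min d r; have rho0 : 0 < rho by rewrite lt_min d0 r0.
(* Small enough for every intermediate point to lie in the ball of radius [rho]; the added 1 keeps
   the denominator positive when [u] and [v] vanish. *)
pose h := rho / (2 * (`|u| + `|v| + 1)).
have n0 : 0 < `|u| + `|v| + 1 by rewrite ltr_wpDl// addr_ge0.
have h0 : 0 < h by rewrite divr_gt0// mulr_gt0.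
have hr : h * (`|u| + `|v|) < rho.
  rewrite /h -mulrA gtr_pMr// mulrC ltr_pdivrMr ?mulr_gt0// mul1r.
  have := normr_ge0 u; have := normr_ge0 v; lra.
have hr' : h * (`|v| + `|u|) < rho by rewrite (addrC `|v|).
have rr : rho <= r by rewrite ge_min lexx orbT.
have rd : rho <= d by rewrite ge_min lexx.
have [s [t [sh th E1]]] := mixed_difference h0 (lt_le_trans hr rr) fu_ fuv_.
have [s' [t' [sh' th' E2]]] := mixed_difference h0 (lt_le_trans hr' rr) fv_ fvu_.
have inb a b w z : `|w| + `|z| = `|u| + `|v| -> 0 <= a <= h -> 0 <= b <= h -> ball x d (x + a *: w + b *: z).
  move=> wz /andP[a0 ah] /andP[b0 bh]; rewrite -ball_normE /ball_/= -addrA opprD addrA subrr sub0r normrN.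
  rewrite (lt_le_trans _ rd)// (le_lt_trans _ hr)// (le_trans (ler_normD _ _))// !normrZ -wz mulrDr.
  by rewrite !ger0_norm// lerD// ler_wpM2r.
have [/= A _] := hd _ (inb s t u v erefl sh th).
have [/= _ B] := hd _ (inb s' t' v u (addrC _ _) sh' th').
have E : fuv (x + s *: u + t *: v) = fvu (x + s' *: v + t' *: u).
  apply: (@mulfI _ (h * h)); first by rewrite mulf_neq0// gt_eqF.
  rewrite -E1 -E2 (addrAC x (h *: v)); ring.
rewrite -E in B.
have -> : fuv x - fvu x = (fuv x - fuv (x + s *: u + t *: v)) -
   (fvu x - fuv (x + s *: u + t *: v)) by ring.
by rewrite (le_trans (ler_normB _ _))// (splitr e) lerD// ltW.
Qed.

End schwarz.

Ltac mx_ring := apply/matrixP => ? ?; rewrite !mxE; ring.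

HB.instance Definition _ (R : realType) m n := Complete.on 'M[R]_(m, n).

Section inverse_function.
Context {R : realType} {n : nat}.
Let X : completeNormedModType R := 'rV[R]_n.

(* [y |-> z + (y - f y)] is a contraction whose fixed point solves [f y = z]. *)
Lemma near_identity_surjective (f : 'rV[R]_n -> 'rV[R]_n) p r : 0 < r ->
  (forall x y, ball p r x -> ball p r y ->
     `|(f y - f x) - (y - x)| <= 2^-1 * `|y - x|) ->
  forall z, `|z - f p| < r / 4 -> exists2 y, `|y - p| <= r / 2 & f y = z.
Proof.
move=> r0 hf z hz.
have r20 : 0 < r / 2 by rewrite divr_gt0.
pose U : set X := closed_ball p (r / 2).
have pU : U p by exact: closed_ballxx.
have UE y : U y = (`|y - p| <= r / 2).
  by rewrite /U closed_ballE//= /closed_ball_/= distrC.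
have sub y : U y -> ball p r y.
  by apply: closed_ball_subset => //; rewrite ltr_pdivrMr// ltr_pMr// ltr1n.
pose g (y : X) : X := z + (y - f y).
(* The closed ball of radius r/2 is stable: r/4 comes from [z], and another r/4 from contracting a
   displacement of at most r/2. *)
have gU : set_fun U U g.
  move=> y Uy; rewrite UE.
  have -> : g y - p = (z - f p) - ((f y - f p) - (y - p)) by rewrite /g; mx_ring.
  rewrite (le_trans (ler_normB _ _))//.
  have := hf _ _ (sub _ pU) (sub _ Uy); rewrite UE in Uy.
  have : 2^-1 * `|y - p| <= 2^-1 * (r / 2) by rewrite ler_pM2l// invr_gt0.
  by move: hz; lra.
have cg : is_contraction (mkfun_fun gU).
  have h2 : 0 <= (2^-1 : R) by rewrite invr_ge0.
  exists (NngNum h2); split => /=; first by lra.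
  move=> [x y] [/= Ux Uy]; rewrite /g.
  have -> : z + (x - f x) - (z + (y - f y)) = (f y - f x) - (y - x) by mx_ring.
  by rewrite (distrC x); exact: (hf _ _ (sub _ Ux) (sub _ Uy)).
have [|/= y Uy yE] := banach_fixed_point cg (@closed_ball_closed _ _ _ _); first by exists p.
exists y; first by rewrite -UE.
have : y + (z - f y) = y by rewrite [RHS]yE /g/=; mx_ring.
by move=> /(canRL (addKr _)); rewrite addNr => /eqP; rewrite subr_eq0 => /eqP.
Qed.

End inverse_function.

Lemma lipschitz_ball_continuous (R : realType) (V W : normedModType R) (f : V -> W) p r (M : R) x :
  (forall x y, ball p r x -> ball p r y -> `|f y - f x| <= M * `|y - x|) ->
  ball p r x -> {for x, continuous f}.
Proof.
move=> L hx; apply/(@cvgrPdist_le _ _ _ (nbhs x)) => e e0.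
have M0 : 0 <= `|M| + 1 by rewrite addr_ge0.
have r0 : 0 < r by move: hx; rewrite -ball_normE/=; apply: le_lt_trans.
have : nbhs x (ball x (e / (`|M| + 1)) `&` ball p r).
  apply: filterI; first by apply: nbhsx_ballx; rewrite divr_gt0// ltr_wpDl.
  apply: open_nbhs_nbhs; split => //; by have [] := ball_open_nbhs p r0.
apply: filterS => y [xy hy].
rewrite distrC (le_trans (L _ _ hx hy))//.
rewrite (le_trans (y := (`|M| + 1) * `|y - x|))//.
  by rewrite ler_wpM2r// (le_trans (ler_norm _))// lerDl.
move: xy; rewrite -ball_normE/= ltr_pdivlMr ?ltr_wpDl// mulrC distrC; exact: ltW.
Qed.

Lemma nbhs_in_ball (R : realType) (V : normedModType R) (p x : V) r : ball p r x -> nbhs x (ball p r).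
Proof.
move=> hx; apply: open_nbhs_nbhs; split => //.
have r0 : 0 < r by move: hx; rewrite -ball_normE/=; apply: le_lt_trans.
by have [] := ball_open_nbhs p r0.
Qed.

Lemma line_is_derive (R : realType) (V W : normedModType R) (f : V -> W) x v d :
  is_derive (0 : R) 1 (fun s : R => f (x + s *: v)) d -> is_derive x v f d.
Proof.
have E : (fun h : R => h^-1 *: (f (x + (h *: 1 + 0) *: v) - f (x + 0 *: v))) =
   (fun h : R => h^-1 *: (f (h *: v + x) - f x)).
  by apply/funext => h; rewrite scale0r !addr0 [_%:A]mulr1 (addrC x).
move=> [h1 h2]; split; first by move: h1; rewrite /derivable/= E.
by rewrite -h2 /derive/= E.
Qed.

(** * Poincare lemma on a ball *)

Section poincare.
Context {R : realType} {n m : nat}.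
Notation V := 'rV[R]_n.
Variables (eta : V -> 'M[R]_(n, m)) (deta : V -> V -> 'M[R]_(n, m)) (p : V) (r M : R).
Hypothesis eta_derive : forall (x v : V), ball p r x -> is_derive x v eta (deta x v).
Hypothesis deta_continuous : forall (x v : V), ball p r x -> {for x, continuous (deta ^~ v)}.
Hypothesis deta_bounded : forall (x v : V), ball p r x -> `|deta x v| <= M * `|v|.

Lemma ray_in_ball (x : V) (t : R) : ball p r x -> 0 <= t <= 1 ->
  ball p r (p + t *: (x - p)).
Proof.
move=> hx ht; apply: ball_line => //; apply: ballxx.
by move: hx; rewrite -ball_normE/=; apply: le_lt_trans.
Qed.

Let eta_continuous (x : V) : ball p r x -> {for x, continuous eta}.
Proof. exact: (lipschitz_ball_continuous (lipschitz_ball eta_derive deta_bounded)). Qed.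

Lemma ray_continuous (x : V) (t : R) (W : topologicalType) (g : V -> W) :
  {for p + t *: (x - p), continuous g} -> {for t, continuous (fun t : R => g (p + t *: (x - p)))}.
Proof.
move=> gc; apply: (@continuous_comp _ _ _ (fun t : R => p + t *: (x - p)) g) => //.
by apply: cvgD; [exact: cvg_cst|apply: cvgZr_tmp; exact: cvg_id].
Qed.

Hypothesis eta_closed : forall (x u v : V), ball p r x -> u *m deta x v = v *m deta x u.

(** [eta] encodes the vector-valued one-form sending [a] to [a *m eta x]; this is its cone primitive
    based at [p]. *)
Let psi (x : V) : 'rV[R]_m := \row_j
  (\int[lebesgue_measure]_(t in `[0, 1]) ((x - p) *m eta (p + t *: (x - p))) ord0 j).

(** For a closed form, the derivative in direction [a] of the integrand of [psi] is [dK], the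
    [t]-derivative of [K]. Its integral over the unit interval is therefore K(1) - K(0), the form at
    [x] applied to [a]. *)
Let K (x a : V) j (t : R) : R := t * (a *m eta (p + t *: (x - p))) ord0 j.
Let dK (x a : V) j (t : R) : R := (a *m eta (p + t *: (x - p))) ord0 j +
  t * (a *m deta (p + t *: (x - p)) (x - p)) ord0 j.

Let K_derive (x a : V) j (t : R) : ball p r x -> 0 <= t <= 1 -> is_derive t 1 (K x a j) (dK x a j t).
Proof.
move=> hx ht.
have h1 := is_derive_mulmxl a (is_derive_line (eta_derive (x - p) (ray_in_ball hx ht))).
have h2 := (is_derive_mxP _ _ _ _).1 h1 ord0 j.
have h3 := is_deriveM (is_derive_id t 1) h2.
apply: is_derive_eq h3 _.
by rewrite /dK /GRing.scale/= mulr1 addrC.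
Qed.

Let mulmx_entry_continuous (a : V) (g : R -> 'M[R]_(n, m)) j t : {for t, continuous g} ->
  {for t, continuous (fun t => (a *m g t) ord0 j)}.
Proof.
move=> gc; have H : a *m g u @[u --> t] --> a *m g t by apply: cvg_mulmx => //; exact: cvg_cst.
exact: ((cvg_mxP _ _).1 H).
Qed.

Let dK_continuous (x a : V) j (t : R) : ball p r x -> 0 <= t <= 1 -> {for t, continuous (dK x a j)}.
Proof.
move=> hx ht; apply: cvgD.
  by apply: mulmx_entry_continuous; apply: ray_continuous; apply: eta_continuous; exact: ray_in_ball.
apply: cvgM; first exact: cvg_id.
apply: mulmx_entry_continuous.
by apply: (ray_continuous (g := deta ^~ (x - p))); apply/deta_continuous/ray_in_ball.
Qed.

Let int_dK (x a : V) j : ball p r x ->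
  \int[lebesgue_measure]_(t in `[0, 1]) dK x a j t = (a *m eta x) ord0 j.
Proof.
move=> hx; rewrite /Rintegral.
rewrite (@continuous_FTC2 R (dK x a j) (K x a j) 0 1 ltr01).
- by rewrite /K mul0r mul1r sube0/= scale1r addrC subrK.
- apply: continuous_in_subspaceT => t; rewrite inE/= in_itv/=; exact: dK_continuous.
- have kc (t : R) : 0 <= t <= 1 -> {for t, continuous (K x a j)}.
    move=> ht; apply: differentiable_continuous; apply/derivable1_diffP.
    by have [] := K_derive a j hx ht.
  split.
  + by move=> t; rewrite in_itv/= => /andP[t0 t1]; have [] := K_derive a j hx (_ : 0 <= t <= 1); rewrite ?(ltW t0) ?(ltW t1).
  + by apply: cvg_at_right_filter; apply: kc; rewrite lexx ler01.
  + by apply: cvg_at_left_filter; apply: kc; rewrite lexx ler01.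
- move=> t; rewrite in_itv/= => /andP[t0 t1].
  rewrite derive1E; have [] := K_derive a j hx (_ : 0 <= t <= 1) => //.
  by rewrite (ltW t0) (ltW t1).
Qed.

Let psi_derive (x a : V) : ball p r x -> is_derive x a psi (a *m eta x).
Proof.
move=> hx; apply/is_derive_mxP => i j; rewrite (ord1 i).
apply: line_is_derive.
pose f (s t : R) := (((x + s *: a) - p) *m eta (p + t *: ((x + s *: a) - p))) ord0 j.
under [X in is_derive _ _ X _]eq_fun do rewrite mxE.
rewrite -/(f _ _).
have r0 : 0 < r by move: hx; rewrite -ball_normE/=; apply: le_lt_trans.
have rho0 : 0 < r - `|p - x| by rewrite subr_gt0; move: hx; rewrite -ball_normE.
have a1 : 0 < `|a| + 1 by rewrite ltr_wpDl.
pose d := (r - `|p - x|) / (`|a| + 1).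
have d0 : 0 < d by rewrite divr_gt0.
have xs (s : R) : `]-d, d[%classic s -> ball p r (x + s *: a).
  rewrite /= in_itv/= -ltr_norml => sd; rewrite -ball_normE/= opprD addrA.
  rewrite (le_lt_trans (ler_normB _ _))// -ltrBrDl normrZ.
  rewrite (le_lt_trans (y := `|s| * (`|a| + 1)))//; first by rewrite ler_wpM2l// lerDl.
  by rewrite -ltr_pdivlMr.
have fd (s t : R) : `]-d, d[%classic s -> `[0, 1]%classic t -> is_derive s 1 (f ^~ t)
   ((a *m eta (p + t *: ((x + s *: a) - p))) ord0 j +
    (t *: (a *m deta (p + t *: ((x + s *: a) - p)) ((x + s *: a) - p))) ord0 j).
  move=> hs; rewrite /= in_itv/= => ht.
  have E u : p + t *: (x + u *: a - p) = (p + t *: (x - p)) + u *: (t *: a).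
    by apply/matrixP => k l; rewrite !mxE; ring.
  have h1 : is_derive s 1 (fun u : R => eta (p + t *: (x + u *: a - p)))
      (deta (p + t *: (x + s *: a - p)) (t *: a)).
    under [X in is_derive _ _ X _]eq_fun do rewrite E.
    rewrite E; apply: is_derive_line; apply: eta_derive; rewrite -E.
    by apply: ray_in_ball => //; exact: xs.
  have h2 : is_derive s 1 (fun u : R => x + u *: a - p) a.
    have h : is_derive s 1 (fun u : R => x + u *: a) a.
      by apply: (is_derive_line (f := id)); exact: is_derive_id.
    by have := is_deriveB h (is_derive_cst p s 1); rewrite subr0.
  have h3 := (is_derive_mxP _ _ _ _).1 (is_derive_mulmx h2 h1) ord0 j.
  apply: is_derive_eq h3 _; rewrite mxE; congr (_ + _).
  (* Closedness turns the derivative of [eta] along [a] into a derivative along the ray. *)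
  by rewrite eta_closed ?scalemxAl//; apply: ray_in_ball => //; exact: xs.
have I0 : `]-d, d[%classic (0 : R) by rewrite /= in_itv/= oppr_lt0 d0.
(* Dominates the derivative of the integrand for all [s] and [t], as differentiation under the
   integral sign requires. *)
pose C := n%:R * `|a| * (`|eta p| + `|M| * r) + n%:R * `|a| * (`|M| * r).
have Mr0 : 0 <= `|M| * r by rewrite mulr_ge0// ltW.
have C0 : 0 <= C by rewrite addr_ge0// mulr_ge0// ?mulr_ge0// addr_ge0.
have mI : measurable (`[0, 1]%classic : set (measurableTypeR R)) by exact: measurable_itv.
have intf (s : R) : `]-d, d[%classic s -> (@lebesgue_measure R).-integrable `[0, 1] (EFin \o f s).
  move=> hs; apply: continuous_compact_integrable; first exact: segment_compact.
  apply: continuous_in_subspaceT => t; rewrite inE/= in_itv/= => ht.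
  apply: mulmx_entry_continuous; apply: ray_continuous; apply: eta_continuous; apply: ray_in_ball => //.
  exact: xs.
have derf (s t : R) : `]-d, d[%classic s -> `[0, 1]%classic t -> derivable (f ^~ t) s 1.
  by move=> hs ht; have [] := fd s t hs ht.
have intC : (@lebesgue_measure R).-integrable `[0, 1] (EFin \o (fun _ : R => C)).
  apply: continuous_compact_integrable; first exact: segment_compact.
  by apply: continuous_subspaceT => t; exact: cvg_cst.
have dub (s t : R) : `]-d, d[%classic s -> `[0, 1]%classic t -> `|partial1of2 f s t| <= C.
  move=> hs ht; rewrite partial1of2E; have [_ ->] := fd s t hs ht.
  have hxs := xs s hs.
  have ht' : 0 <= t <= 1 by move: ht; rewrite /= in_itv.
  have hb := ray_in_ball hxs ht'.
  have t01 : `|t| <= 1 by case/andP: ht' => t0 t1; rewrite ger0_norm.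
  have xr : `|x + s *: a - p| <= r by move: hxs; rewrite -ball_normE/= distrC => /ltW.
  have pr : `|(p + t *: (x + s *: a - p)) - p| <= r.
    rewrite addrC addKr normrZ -[r]mul1r; exact: ler_pM.
  rewrite (le_trans (ler_normD _ _))// lerD//.
    rewrite (le_trans (mx_norm_coord _ _ _))// (le_trans (mulmx_norm_le _ _))// ler_wpM2l//.
    have -> : eta (p + t *: (x + s *: a - p)) = eta p + (eta (p + t *: (x + s *: a - p)) - eta p).
      by rewrite [RHS]addrC subrK.
    rewrite (le_trans (ler_normD _ _))// lerD2l.
    rewrite (le_trans (lipschitz_ball eta_derive deta_bounded _ hb))//; first exact: ballxx.
    rewrite (le_trans (y := `|M| * `|p + t *: (x + s *: a - p) - p|))//.
      by rewrite ler_wpM2r// ler_norm.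
    by rewrite ler_wpM2l.
  rewrite (le_trans (mx_norm_coord _ _ _))// normrZ -[leRHS]mul1r ler_pM//.
  rewrite (le_trans (mulmx_norm_le _ _))// ler_wpM2l//.
  rewrite (le_trans (deta_bounded _ hb))//.
  rewrite (le_trans (y := `|M| * `|x + s *: a - p|))//.
    by rewrite ler_wpM2r// ler_norm.
  by rewrite ler_wpM2l.
have D1 := @derivable_under_integral R _ (measurableTypeR R) (@lebesgue_measure R) f _ mI 0 (- d) d I0 intf derf _ (fun=> C0) intC dub.
have D2 := @differentiation_under_integral R _ (measurableTypeR R) (@lebesgue_measure R) f _ mI 0 (- d) d I0 intf derf _ (fun=> C0) intC dub.
split; first exact: D1.
rewrite -derive1E [LHS]D2 -(int_dK a j hx).
apply: eq_Rintegral => t; rewrite inE => ht.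
rewrite partial1of2E; have [_ ->] := fd 0 t I0 ht.
by rewrite scale0r addr0 /dK; congr (_ + _); rewrite mxE.
Qed.

Lemma poincare_lemma : exists psi : V -> 'rV[R]_m,
  psi p = 0 /\ forall (x a : V), ball p r x -> is_derive x a psi (a *m eta x).
Proof.
exists psi; split; last by move=> x a; exact: psi_derive.
apply/rowP => j; rewrite !mxE.
rewrite (@eq_Rintegral _ _ _ _ _ (fun=> 0)); last by move=> t _; rewrite subrr mul0mx mxE.
by rewrite Rintegral_cst// mul0r.
Qed.

End poincare.

(** * The two-step Baker-Campbell-Hausdorff product *)

Record two_step (R : realType) (n : nat) (br : 'rV[R]_n -> 'rV[R]_n -> 'rV[R]_n)
    (C : R) := {
  ts_bbl :> bounded_bilinear (br : 'rV[R]_n -> 'rV[R]_n -> 'rV[R]_n) C;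
  ts_alt : forall x, br x x = 0;
  ts_nil : forall x y z, br (br x y) z = 0 }.

(** Sorting the alternating word of [(a * b) ^+ k] into [a ^+ k * b ^+ k] exchanges an [a] and a [b]
    once for each of the 'C(k, 2) pairs, and each exchange costs one factor [d], which commutes with
    everything. *)
Lemma expg_two_step (G : groupType) (a b d : G) k :
  (a * b = b * a * d)%g -> commute d a -> commute d b ->
  ((a * b) ^+ k * d ^+ 'C(k, 2) = a ^+ k * b ^+ k)%g.
Proof.
move=> ab da db.
have H j : (b ^+ j * a * d ^+ j = a * b ^+ j)%g.
  elim: j => [|j IH]; first by rewrite !expg0 mul1g !mulg1.
  have -> : (b ^+ j.+1 * a * d ^+ j.+1 = b * (b ^+ j * a * d ^+ j) * d)%g.
    by rewrite expgS expgSr !mulgA.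
  rewrite IH -!mulgA -(commuteX j db) !mulgA -ab -mulgA -expgS//.
elim: k => [|k IH]; first by rewrite !expg0 !mulg1.
rewrite binS bin1 addnC.
have cd : commute (a * b)%g (d ^+ 'C(k, 2))%g.
  by apply/commuteX/commute_sym/commuteM.
have -> : ((a * b) ^+ k.+1 * d ^+ (k + 'C(k, 2)) =
    ((a * b) ^+ k * d ^+ 'C(k, 2)) * (a * b * d ^+ k))%g.
  rewrite expgSr -!mulgA; congr (_ * _)%g; rewrite addnC expgnDr !mulgA; congr (_ * _)%g.
  by rewrite cd mulgA.
rewrite IH -[(a * b * _)%g]mulgA (commuteX k (commute_sym db)).
have -> : (a ^+ k * b ^+ k * (a * (d ^+ k * b)) = a ^+ k * (b ^+ k * a * d ^+ k) * b)%g.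
  by rewrite !mulgA.
by rewrite H (expgSr a) (expgSr b) !mulgA.
Qed.

Ltac mx_field := apply/matrixP => ? ?; rewrite !mxE; field.

Section two_step.
Context {R : realType} {n : nat}.
Notation V := 'rV[R]_n.
Variables (br : V -> V -> V) (C : R).
Hypothesis ts : two_step br C.

(* The simply connected group with Lie algebra [br], in exponential coordinates. *)
Definition bch (x y : V) : V := x + y + 2^-1 *: br x y.

Lemma br_anti x y : br x y = - br y x.
Proof.
have := ts_alt ts (x + y).
rewrite (bblDl ts) !(bblDr ts) !(ts_alt ts) add0r addr0 => /eqP.
by rewrite addr_eq0 => /eqP.
Qed.

Lemma br_nilr x y z : br z (br x y) = 0.
Proof. by rewrite br_anti (ts_nil ts) oppr0. Qed.

Definition brE := (bblDl ts, bblDr ts, bblZl ts, bblZr ts, bblNl ts, bblNr ts,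
  bbl0l ts, bbl0r ts, ts_nil ts, br_nilr, ts_alt ts).

Lemma bchA x y z : bch x (bch y z) = bch (bch x y) z.
Proof. by rewrite /bch !brE; mx_ring. Qed.

Lemma bch0x x : bch 0 x = x.
Proof. by rewrite /bch !brE scaler0 add0r addr0. Qed.

Lemma bchx0 x : bch x 0 = x.
Proof. by rewrite /bch !brE scaler0 !addr0. Qed.

Lemma bchxN x : bch x (- x) = 0.
Proof. by rewrite /bch !brE oppr0 scaler0 addr0 subrr. Qed.

Lemma bchNx x : bch (- x) x = 0.
Proof. by rewrite /bch !brE oppr0 scaler0 addr0 addNr. Qed.

Lemma bchKl x y : bch (- x) (bch x y) = y.
Proof. by rewrite bchA bchNx bch0x. Qed.

Lemma bchNKl x y : bch x (bch (- x) y) = y.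
Proof. by rewrite bchA bchxN bch0x. Qed.

Lemma bchN x y : - bch x y = bch (- y) (- x).
Proof. by rewrite /bch !brE opprK (br_anti y x); mx_ring. Qed.

Lemma bchZ (s t : R) x : bch (s *: x) (t *: x) = (s + t) *: x.
Proof. by rewrite /bch !brE !scaler0 addr0 scalerDl. Qed.

Lemma bch_central x w : (forall y, br w y = 0) -> bch x w = x + w.
Proof. by move=> hw; rewrite /bch br_anti hw oppr0 scaler0 addr0. Qed.

Lemma bch_translate x y : bch (- x) y = (y - x) - 2^-1 *: br x (y - x).
Proof. by rewrite /bch !brE; mx_ring. Qed.

Lemma bch_norm x y : `|bch x y| <= `|x| + `|y| + C * `|x| * `|y|.
Proof.
rewrite (le_trans (ler_normD _ _))// lerD ?ler_normD// normrZ.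
rewrite (le_trans _ (bbl_le ts _ _))// ler_piMl// ger0_norm ?invr_ge0//.
by rewrite invf_le1// ler1n.
Qed.

Section exponential.
Variables (G : groupType) (sigma : V -> G) (r : R).
Hypothesis r0 : 0 < r.
Hypothesis sigmaM : forall x y, `|x| < r -> `|y| < r -> sigma (bch x y) = (sigma x * sigma y)%g.

(** [sigma] is multiplicative only near 0, so the exponential is defined as a power of [sigma] at a
    fraction of [x] that is short enough. By [exp_ofE] any larger number of factors gives the same
    value. *)
Definition exp_of (x : V) : G :=
  let j := (Num.truncn (`|x| / r)).+1 in (sigma (j%:R^-1 *: x) ^+ j)%g.

Lemma sigma_pow j w : j%:R * `|w| < r -> sigma (j%:R *: w) = (sigma w ^+ j)%g.
Proof.
have s0 : sigma 0 = 1%g.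
  have := sigmaM (x := 0) (y := 0); rewrite bchx0 normr0 => /(_ r0 r0).
  by move/(congr1 (fun z => (sigma 0)^-1 * z)%g); rewrite mulgA mulVg mul1g.
elim: j => [|j IH hj]; first by rewrite scale0r s0 expg0.
have jw : j%:R * `|w| < r by rewrite (le_lt_trans _ hj)// ler_wpM2r// ler_nat.
have w1 : `|w| < r by rewrite (le_lt_trans _ hj)// ler_peMl// ler1n.
rewrite expgSr -IH// -sigmaM//; last by rewrite normrZ ger0_norm.
by rewrite -[w in bch _ w]scale1r bchZ -natr1.
Qed.

Lemma norm_div_nat j x : (0 < j)%N -> `|x| < j%:R * r -> `|j%:R^-1 *: x : V| < r.
Proof.
by move=> j0 xj; rewrite normrZ normfV ger0_norm// mulrC ltr_pdivrMr ?ltr0n// mulrC.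
Qed.

(** Refining [i] factors into [i * j] changes nothing; two admissible numbers of factors are
    compared through their product. *)
Lemma sigma_root i j x : (0 < i)%N -> (0 < j)%N -> `|x| < i%:R * r ->
  (sigma (i%:R^-1 *: x) ^+ i)%g = (sigma ((i * j)%:R^-1 *: x) ^+ (i * j))%g.
Proof.
move=> i0 j0 xi; rewrite mulnC expgnA; congr (_ ^+ _)%g.
have j0' : (j%:R : R) != 0 by rewrite pnatr_eq0 -lt0n.
have i0' : (0 : R) < i%:R by rewrite ltr0n.
rewrite -sigma_pow.
  by rewrite scalerA natrM invfM mulrA mulfV// mul1r.
rewrite natrM invfM -scalerA normrZ mulrA normfV (ger0_norm (ler0n _ _)).
by rewrite mulfV// mul1r norm_div_nat.
Qed.

Lemma exp_ofE j x : (0 < j)%N -> `|x| < j%:R * r ->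
  exp_of x = (sigma (j%:R^-1 *: x) ^+ j)%g.
Proof.
move=> j0 xj; rewrite /exp_of; set i := (Num.truncn _).+1.
have xi : `|x| < i%:R * r.
  by rewrite -ltr_pdivrMr// /i truncnS_gt.
by rewrite (sigma_root (j := j))// mulnC -sigma_root.
Qed.

Lemma exp_of_small x : `|x| < r -> exp_of x = sigma x.
Proof. by move=> xr; rewrite (exp_ofE (j := 1))// ?mul1r// invr1 scale1r expg1. Qed.

Lemma large_nat (b : R) : exists2 j : nat, (0 < j)%N & b < j%:R * r.
Proof.
exists (Num.truncn (`|b| / r)).+1 => //.
by rewrite (le_lt_trans (ler_norm _))// -ltr_pdivrMr// truncnS_gt.
Qed.

Lemma exp_of_pow j x : exp_of (j%:R *: x) = (exp_of x ^+ j)%g.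
Proof.
have [k k0 hk] := large_nat (j%:R * `|x| + `|x|).
have h1 : `|x| < k%:R * r by rewrite (le_lt_trans _ hk)// lerDr mulr_ge0.
have h2 : j%:R * `|x| < k%:R * r by rewrite (le_lt_trans _ hk)// lerDl.
rewrite (exp_ofE k0 h1) (exp_ofE k0); last by rewrite normrZ ger0_norm.
rewrite -expgnA mulnC expgnA; congr (_ ^+ _)%g.
rewrite scalerA mulrC -scalerA sigma_pow//.
have := norm_div_nat k0 (_ : `|j%:R *: x| < k%:R * r).
by rewrite !normrZ (ger0_norm (ler0n R j)) mulrCA; exact.
Qed.

Lemma exp_of_central u w : (forall y, br w y = 0) -> exp_of (u + w) = (exp_of u * exp_of w)%g.
Proof.
move=> hw; have [k k0 hk] := large_nat (`|u| + `|w|).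
have h1 : `|u| < k%:R * r by rewrite (le_lt_trans _ hk)// lerDl.
have h2 : `|w| < k%:R * r by rewrite (le_lt_trans _ hk)// lerDr.
have small x := @norm_div_nat k x k0.
rewrite (exp_ofE k0 h1) (exp_ofE k0 h2) (exp_ofE k0); last first.
  exact: le_lt_trans (ler_normD _ _) hk.
rewrite -expgMn; last first.
  rewrite /commute -!sigmaM ?small//; congr sigma.
  by rewrite /bch !brE hw br_anti hw oppr0 !scaler0 !addr0 addrC.
rewrite -sigmaM ?small//; congr (sigma _ ^+ _)%g.
by rewrite bch_central ?scalerDr// => y; rewrite brE hw scaler0.
Qed.

(** With [k] factors, [a] and [b] at [x / k] and [y / k] satisfy [a b = b a d], where [d] is at
    [br x y / k^2]. In [expg_two_step] the power of [a b] contributes 1/(2k) of the bracket and the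
    power of [d] contributes (k-1)/(2k); together they make the 1/2 of [bch]. The bound on [k]
    includes the bracket so that all these vectors are short. *)
Lemma exp_ofM x y : exp_of (bch x y) = (exp_of x * exp_of y)%g.
Proof.
have [k k0 hk] := large_nat (`|x| + `|y| + `|br x y|).
have k1 : (1 : R) <= k%:R by rewrite ler1n.
have kn0 : (k%:R : R) != 0 by rewrite gt_eqF// ltr0n.
have hx : `|x| < k%:R * r by rewrite (le_lt_trans _ hk)// -!addrA lerDl !addr_ge0.
have hy : `|y| < k%:R * r by rewrite (le_lt_trans _ hk)// addrAC lerDr !addr_ge0.
have small x := @norm_div_nat k x k0.
pose K : R := k%:R^-1.
have K0 : 0 < K by rewrite invr_gt0 ltr0n.
have K1 : K <= 1 by rewrite invf_le1// ltr0n.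
pose B := br x y.
have hB (s : R) : `|s| <= 1 -> `|s *: B| < k%:R * r.
  move=> s1; rewrite (le_lt_trans _ hk)// normrZ (le_trans (y := `|B|))//.
    by rewrite ler_piMl.
  by rewrite lerDr addr_ge0.
have hKB (s : R) : `|s| <= 1 -> `|(K * s) *: B| < r.
  by move=> s1; rewrite -scalerA; apply: small; exact: hB.
have nK : `|K| <= 1 by rewrite ger0_norm// ltW.
pose a := sigma (K *: x); pose b := sigma (K *: y); pose d := sigma ((K * K) *: B).
have hd : `|(K * K) *: B| < r by exact: hKB.
have Bc (s : R) z : br (s *: B) z = 0 by rewrite !brE scaler0.
have cen (s : R) u : bch (s *: B) u = bch u (s *: B).
  by rewrite /bch Bc br_anti Bc oppr0 (addrC u).
have da : commute d a by rewrite /commute -!sigmaM ?small// cen.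
have db : commute d b by rewrite /commute -!sigmaM ?small// cen.
have hyx : `|bch (K *: y) (K *: x)| < r.
  have -> : bch (K *: y) (K *: x) = K *: (y + x - (2^-1 * K) *: B).
    by rewrite /bch !brE (br_anti y x) -/B; mx_ring.
  apply: small; rewrite (le_lt_trans _ hk)//.
  rewrite (le_trans (ler_normB _ _))// lerD//; first by rewrite addrC ler_normD.
  by rewrite normrZ ler_piMl// ger0_norm; lra.
have ab : (a * b = b * a * d)%g.
  rewrite -!sigmaM ?small//; congr sigma.
  by rewrite /bch /B !brE (br_anti y x); mx_field.
have := expg_two_step k ab da db.
rewrite -(exp_ofE k0 hx) -(exp_ofE k0 hy) => <-.
pose u := x + y + (2^-1 * K) *: B.
have -> : ((a * b) ^+ k)%g = exp_of u.
  rewrite (exp_ofE k0).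
    by rewrite -sigmaM ?small//; congr (sigma _ ^+ _)%g; rewrite -/K /bch !brE -/B /u; mx_ring.
  rewrite (le_lt_trans _ hk)// (le_trans (ler_normD _ _))// lerD ?ler_normD//.
  by rewrite normrZ ler_piMl// ger0_norm; lra.
rewrite /d -exp_of_small// -exp_of_pow -exp_of_central; last first.
  by move=> z; rewrite !brE !scaler0.
congr exp_of; rewrite /u /bch -/B !scalerA -!addrA -scalerDl; congr (_ + (_ + _ *: _)).
have : ('C(k, 2)%:R : R) * 2 = k%:R * (k%:R - 1).
  have := mul_bin_diag k 1; rewrite bin1 => e.
  by rewrite -[2]/(2%:R) -natrM mulnC -e natrM -subn1 natrB.
have -> : (k%:R : R) = K^-1 by rewrite invrK.
move=> e; have -> : ('C(k, 2)%:R : R) = K^-1 * (K^-1 - 1) / 2 by rewrite -e mulfK.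
by field; rewrite gt_eqF.
Qed.

End exponential.
End two_step.

(** * Local Lie groups *)

Section derivatives.
Context {R : realType}.

Lemma is_derive_diff_comp (U V W : normedModType R) (g : U -> V) (f : V -> W) x v dg :
  is_derive x v g dg -> differentiable f (g x) ->
  is_derive x v (fun y => f (g y)) ('d f (g x) dg).
Proof.
move=> [gd <-] fd; apply: line_is_derive.
have hg : is_derive (0 : R) 1 (fun s : R => g (x + s *: v)) ('D_v g x).
  by apply: is_derive_line; rewrite scale0r addr0; exact: derivableP.
have gdiff : differentiable (fun s : R => g (x + s *: v)) (0 : R).
  by apply/derivable1_diffP; have [] := hg.
have fd' : differentiable f (g (x + (0 : R) *: v)) by rewrite scale0r addr0.
have cd := differentiable_comp gdiff fd'.
split; first exact: diff_derivable.
rewrite deriveE// (_ : (fun s : R => f (g (x + s *: v))) = f \o (fun s : R => g (x + s *: v)))//.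
rewrite diff_comp//= -[in RHS](_ : 'D_1 (fun s : R => g (x + s *: v)) 0 = 'D_v g x); last first.
  by have [] := hg.
by rewrite deriveE// scale0r addr0.
Qed.

Lemma is_derive_pair (U V W : normedModType R) (f : U -> V) (g : U -> W) x v df dg :
  is_derive x v f df -> is_derive x v g dg ->
  is_derive x v (fun y => (f y, g y)) (df, dg).
Proof.
move=> [fd <-] [gd <-].
have H : (fun h : R => h^-1 *: ((f (h *: v + x), g (h *: v + x)) - (f x, g x)))
    @ (0 : R)^' --> ('D_v f x, 'D_v g x).
  exact: (cvg_pair fd gd).
split; first by apply/cvg_ex; eexists; exact: H.
by apply/cvg_lim => //; exact: norm_hausdorff.
Qed.

Lemma derive_slice1 (V W X : normedModType R) (f : V * W -> X) x y a d :
  is_derive (x, y) (a, 0) f d -> is_derive x a (fun x => f (x, y)) d.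
Proof.
have E : (fun h : R => h^-1 *: (f (h *: a + x, y) - f (x, y))) =
    (fun h : R => h^-1 *: (f (h *: (a, 0) + (x, y)) - f (x, y))).
  apply/funext => h; congr (_ *: (f _ - _)).
  by congr pair; rewrite /= scaler0 add0r.
move=> [h1 h2]; split; first by rewrite /derivable/= E.
by rewrite -h2 /derive/= E.
Qed.

Lemma derive_slice2 (V W X : normedModType R) (f : V * W -> X) x y b d :
  is_derive (x, y) (0, b) f d -> is_derive y b (fun y => f (x, y)) d.
Proof.
have E : (fun h : R => h^-1 *: (f (x, h *: b + y) - f (x, y))) =
    (fun h : R => h^-1 *: (f (h *: (0, b) + (x, y)) - f (x, y))).
  apply/funext => h; congr (_ *: (f _ - _)).
  by congr pair; rewrite /= scaler0 add0r.
move=> [h1 h2]; split; first by rewrite /derivable/= E.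
by rewrite -h2 /derive/= E.
Qed.

End derivatives.

(** Directional derivatives alone do not even give continuity. The uniform bound adds a Lipschitz
    estimate on the ball, and the whole bundle is stable under sums, bilinear products and
    primitives. *)
Record C1b (R : realType) n k l (f : 'rV[R]_n -> 'M[R]_(k, l))
    (df : 'rV[R]_n -> 'rV[R]_n -> 'M[R]_(k, l)) (p : 'rV[R]_n) (r M : R) := {
  C1b_d : forall x v : 'rV[R]_n, ball p r x -> is_derive x v f (df x v);
  C1b_c : forall x v : 'rV[R]_n, ball p r x -> {for x, continuous (df ^~ v)};
  C1b_b : forall x v : 'rV[R]_n, ball p r x -> `|df x v| <= M * `|v| }.

Section C1b.
Context {R : realType} {n : nat}.
Notation V := 'rV[R]_n.
Implicit Types (p x v : V) (r M : R).

Lemma C1b_cont k l (f : V -> 'M[R]_(k, l)) df p r M x : C1b f df p r M ->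
  ball p r x -> {for x, continuous f}.
Proof. by move=> [a b c]; apply: lipschitz_ball_continuous; exact: (lipschitz_ball a c). Qed.

Lemma C1b_lip k l (f : V -> 'M[R]_(k, l)) df p r M (x y : V) : C1b f df p r M ->
  ball p r x -> ball p r y -> `|f y - f x| <= M * `|y - x|.
Proof. by move=> [a b c]; exact: (lipschitz_ball a c). Qed.

Lemma C1b_bounded k l (f : V -> 'M[R]_(k, l)) df p r M x : C1b f df p r M ->
  ball p r x -> `|f x| <= `|f p| + `|M| * r.
Proof.
move=> h hx.
have r0 : 0 < r by move: hx; rewrite -ball_normE/=; apply: le_lt_trans.
have := C1b_lip h (ballxx _ r0) hx => h1.
have -> : f x = f p + (f x - f p) by rewrite [RHS]addrC subrK.
rewrite (le_trans (ler_normD _ _))// lerD2l (le_trans h1)//.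
move: hx; rewrite -ball_normE/= distrC => hx.
rewrite (le_trans (y := `|M| * `|x - p|))//; first by rewrite ler_wpM2r// ler_norm.
by rewrite ler_wpM2l// ltW.
Qed.

Lemma C1b_sub k l (f : V -> 'M[R]_(k, l)) df p r r' M : r' <= r ->
  C1b f df p r M -> C1b f df p r' M.
Proof.
move=> rr [a b c]; have s x : ball p r' x -> ball p r x by exact: le_ball.
by split=> x v /s; [exact: a|exact: b|exact: c].
Qed.

Lemma C1b_add k l (f g : V -> 'M[R]_(k, l)) df dg p r M N :
  C1b f df p r M -> C1b g dg p r N ->
  C1b (fun x => f x + g x) (fun x v => df x v + dg x v) p r (M + N).
Proof.
move=> [a b c] [a' b' c']; split=> x v hx.
- by apply: is_deriveD; [exact: a|exact: a'].
- exact: (cont_add (b x v hx) (b' x v hx)).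
- by rewrite mulrDl; apply: le_trans (ler_normD _ _) _; apply: lerD; [exact: c|exact: c'].
Qed.

Lemma C1b_cst k l (A : 'M[R]_(k, l)) p r : C1b (fun=> A) (fun _ _ => 0) p r 0.
Proof.
split=> x v hx; first exact: is_derive_cst.
  exact: cont_cst.
by rewrite normr0 mul0r.
Qed.

Lemma C1b_bbl k l k' l' k'' l'' (B : 'M[R]_(k, l) -> 'M[R]_(k', l') -> 'M[R]_(k'', l'')) C
    (hB : bounded_bilinear (B : 'M[R]_(k, l) -> 'M[R]_(k', l') -> 'M[R]_(k'', l'')) C)
    (f : V -> 'M[R]_(k, l)) (g : V -> 'M[R]_(k', l')) df dg p r M N :
  C1b f df p r M -> C1b g dg p r N ->
  exists K, C1b (fun x => B (f x) (g x)) (fun x v => B (df x v) (g x) + B (f x) (dg x v)) p r K.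
Proof.
move=> hf hg; exists (C * `|M| * (`|g p| + `|N| * r) + C * (`|f p| + `|M| * r) * `|N|).
have [a b c] := hf; have [a' b' c'] := hg.
have C0 := bbl_ge0 hB.
split=> x v hx.
- by apply: (bbl_is_derive hB); [exact: a|exact: a'].
- exact: (cont_add (cont_bbl hB (b x v hx) (C1b_cont hg hx)) (cont_bbl hB (C1b_cont hf hx) (b' x v hx))).
- have hM : `|df x v| <= `|M| * `|v| by rewrite (le_trans (c _ _ hx))// ler_wpM2r// ler_norm.
  have hN : `|dg x v| <= `|N| * `|v| by rewrite (le_trans (c' _ _ hx))// ler_wpM2r// ler_norm.
  rewrite (le_trans (ler_normD _ _))// mulrDl lerD//.
    have -> : C * `|M| * (`|g p| + `|N| * r) * `|v| = C * (`|M| * `|v|) * (`|g p| + `|N| * r) by ring.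
    apply: le_trans (bbl_le hB _ _) _; apply: ler_pM => //; first exact: mulr_ge0.
      exact: ler_wpM2l.
    exact: C1b_bounded hg hx.
  rewrite (le_trans (bbl_le hB _ _))// -!mulrA ler_wpM2l//; apply: ler_pM => //.
  exact: C1b_bounded hf hx.
Qed.

Lemma C1b_mulmxr k l l' (A : 'M[R]_(l, l')) (f : V -> 'M[R]_(k, l)) df p r M :
  C1b f df p r M -> exists K, C1b (fun x => f x *m A) (fun x v => df x v *m A) p r K.
Proof.
move=> hf; have [K] := C1b_bbl (mulmx_bounded k l l') hf (C1b_cst A p r).
move=> [a b c]; exists K; split => x v hx.
- by have := a x v hx; rewrite mulmx0 addr0.
- have := b x v hx; rewrite (_ : (fun _ => _) = (fun x => df x v *m A))//.
  by apply/funext => y; rewrite mulmx0 addr0.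
- by have := c x v hx; rewrite mulmx0 addr0.
Qed.

Lemma C1b_primitive l (eta : V -> 'M[R]_(n, l)) deta p r M :
  C1b eta deta p r M -> (forall x u v : V, ball p r x -> u *m deta x v = v *m deta x u) ->
  exists (psi : V -> 'rV[R]_l) K, psi p = 0 /\ C1b psi (fun x a => a *m eta x) p r K.
Proof.
move=> h cl; have [a b c] := h.
have [psi [p0 hpsi]] := poincare_lemma a b c cl.
exists psi, (n%:R * (`|eta p| + `|M| * r)); split; first exact: p0.
split=> x v hx.
- exact: hpsi.
- by apply: (cont_bbl (mulmx_bounded 1 n l)); [exact: cont_cst|exact: (C1b_cont h hx)].
- rewrite (le_trans (mulmx_norm_le _ _))// mulrAC ler_wpM2r// ler_wpM2l//.
  exact: C1b_bounded h hx.
Qed.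

End C1b.

Section linear_forms.
Context {R : realType} {n : nat}.

Lemma lin1_mxE m (f : 'rV[R]_n -> 'rV[R]_m) : (forall (s : R) u v, f (s *: u + v) = s *: f u + f v) ->
  forall v, v *m lin1_mx f = f v.
Proof.
move=> lf v.
have f0 : f 0 = 0 by have := lf (-1) 0 0; rewrite scaler0 addr0 scaleN1r addNr.
have fD u w : f (u + w) = f u + f w by have := lf 1 u w; rewrite !scale1r.
rewrite [in RHS](row_sum_delta v) (big_morph f fD f0) mulmx_sum_row; apply: eq_bigr => i _.
rewrite -[v 0 i *: delta_mx _ _]addr0 lf f0 addr0; congr (_ *: _).
by apply/rowP => j; rewrite !mxE.
Qed.

Lemma lin1_mx_linear m (f g h : 'rV[R]_n -> 'rV[R]_m) (s : R) :
  (forall b, f b = s *: g b + h b) -> lin1_mx f = s *: lin1_mx g + lin1_mx h.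
Proof. by move=> H; apply/matrixP => i j; rewrite !mxE H !mxE. Qed.

Lemma row_norm_delta m k (f : 'rV[R]_n -> 'M[R]_(m, k)) (M : 'I_n -> R) :
  (forall (s : R) u v, f (s *: u + v) = s *: f u + f v) ->
  (forall i, `|f (delta_mx 0 i)| <= M i) -> forall v, `|f v| <= (\sum_i M i) * `|v|.
Proof.
move=> lf hM v.
have f0 : f 0 = 0 by have := lf (-1) 0 0; rewrite scaler0 addr0 scaleN1r addNr.
have fD u w : f (u + w) = f u + f w by have := lf 1 u w; rewrite !scale1r.
rewrite [in leLHS](row_sum_delta v) (big_morph f fD f0).
apply: le_trans (ler_norm_sum _ _ _) _; rewrite mulr_suml; apply: ler_sum => i _.
rewrite -[v 0 i *: delta_mx _ _]addr0 lf f0 addr0 normrZ mulrC.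
by apply: ler_pM => //; exact: mx_norm_coord.
Qed.

Lemma bilinear_bounded (B : 'rV[R]_n -> 'rV[R]_n -> 'rV[R]_n) :
  (forall (s : R) u v w, B (s *: u + v) w = s *: B u w + B v w) ->
  (forall (s : R) u v w, B w (s *: u + v) = s *: B w u + B w v) ->
  exists C, bounded_bilinear (B : 'rV[R]_n -> 'rV[R]_n -> 'rV[R]_n) C.
Proof.
move=> Bl Br; pose C := \sum_i \sum_j `|B (delta_mx 0 i) (delta_mx 0 j)|.
have B0l w : B 0 w = 0 by have := Bl (-1) 0 0 w; rewrite scaler0 addr0 scaleN1r addNr.
have B0r w : B w 0 = 0 by have := Br (-1) 0 0 w; rewrite scaler0 addr0 scaleN1r addNr.
exists C; split.
- by move=> x y z; have := Bl 1 x y z; rewrite !scale1r.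
- by move=> x y z; have := Br 1 y z x; rewrite !scale1r.
- by move=> a x y; have := Bl a x 0 y; rewrite B0l !addr0.
- by move=> a x y; have := Br a y 0 x; rewrite B0r !addr0.
- by apply: sumr_ge0 => i _; apply: sumr_ge0.
move=> x y; rewrite mulrAC.
have h1 u : `|B u y| <= (\sum_i `|B (delta_mx 0 i) y|) * `|u|.
  by apply: (@row_norm_delta 1 n (B ^~ y) (fun i => `|B (delta_mx 0 i) y|)).
apply: le_trans (h1 x) _; rewrite ler_wpM2r// /C mulr_suml; apply: ler_sum => i _.
by apply: (@row_norm_delta 1 n (B (delta_mx 0 i)) (fun j => `|B (delta_mx 0 i) (delta_mx 0 j)|)).
Qed.

End linear_forms.

(** * Left-invariant fields of a local group *)

Section local_group.
Local Opaque derive.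
Context {R : realType} {n : nat}.
Notation V := 'rV[R]_n.
Variables (m : V * V -> V) (O : set (V * V)) (x0 : V).
Hypothesis Oopen : forall p, O p -> nbhs p O.
Hypothesis O00 : O (x0, x0).
Hypothesis msm : smooth_on O m.
Hypothesis mx0 : forall x, O (x, x0) -> m (x, x0) = x.
Hypothesis m0x : forall x, O (x0, x) -> m (x0, x) = x.
Hypothesis mA : forall x y z, O (x, y) -> O (y, z) -> O (m (x, y), z) -> O (x, m (y, z)) ->
  m (m (x, y), z) = m (x, m (y, z)).

(** Derivative in the second factor alone: at [(x, x0)] it is the left-invariant field at [x],
    elsewhere it is the differential of the left translation by the first factor. *)
Definition dmul2 (b : V) (p : V * V) : V := 'D_(0, b) m p.
Definition lfield (b x : V) : V := 'D_b (fun y => m (x, y)) x0.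
Definition dlfield (b x a : V) : V := 'D_(a, 0) (dmul2 b) (x, x0).

Lemma mul_diff p : O p -> differentiable m p.
Proof. by have [h _] := msm 1; exact: h. Qed.

Lemma dmul2_diff b p : O p -> differentiable (dmul2 b) p.
Proof. by have [_ /(_ (0, b))[h _]] := msm 2; exact: h. Qed.

Lemma ddmul2_cont b w p : O p -> {for p, continuous (fun q => 'D_w (dmul2 b) q)}.
Proof. by have [_ /(_ (0, b))[_ /(_ w)]] := msm 2; exact. Qed.

Lemma mul_cont p : O p -> {for p, continuous m}.
Proof. by move=> /mul_diff/differentiable_continuous. Qed.

Lemma dmul2_lin p : O p -> forall (s : R) u v, dmul2 (s *: u + v) p = s *: dmul2 u p + dmul2 v p.
Proof.
move=> Op s u v; rewrite /dmul2 !deriveE; try exact: mul_diff.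
rewrite (_ : (0, s *: u + v) = s *: (0, u) + (0, v) :> V * V) ?linearP//.
by congr pair; rewrite /= scaler0 addr0.
Qed.

Lemma dmul2_derive x y b : O (x, y) -> is_derive y b (fun y => m (x, y)) (dmul2 b (x, y)).
Proof. by move=> Oxy; apply/derive_slice2/derivableP/diff_derivable/mul_diff. Qed.

Lemma lfieldE b x : O (x, x0) -> lfield b x = dmul2 b (x, x0).
Proof. by move=> Ox; have [_] := dmul2_derive b Ox. Qed.

Lemma nbhs_slice1 x y : O (x, y) -> \forall z \near x, O (z, y).
Proof.
by move=> /Oopen Oxy; apply: (cont_near (f := fun z => (z, y))) => //; apply: cont_pair => //; exact: cont_cst.
Qed.

Lemma nbhs_slice2 x y : O (x, y) -> \forall z \near y, O (x, z).
Proof.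
by move=> /Oopen Oxy; apply: (cont_near (f := fun z => (x, z))) => //; apply: cont_pair => //; exact: cont_cst.
Qed.

Lemma lfield_derive b x a : O (x, x0) -> is_derive x a (lfield b) (dlfield b x a).
Proof.
move=> Ox; apply: (near_eq_is_derive (f := fun x => dmul2 b (x, x0))).
  by apply: filterS (nbhs_slice1 Ox) => z Oz; rewrite lfieldE.
by apply/derive_slice1/derivableP/diff_derivable/dmul2_diff.
Qed.

Lemma lfield_lin x : O (x, x0) -> forall (s : R) u v, lfield (s *: u + v) x = s *: lfield u x + lfield v x.
Proof. by move=> Ox s u v; rewrite !lfieldE// dmul2_lin. Qed.

Lemma lfield_x0 b : lfield b x0 = b.
Proof.
have h : is_derive x0 b (fun y => m (x0, y)) b.
  have nid : \forall z \near x0, id z = m (x0, z) by apply: filterS (nbhs_slice2 O00) => z Oz; rewrite m0x.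
  exact: (near_eq_is_derive nid (is_derive_id x0 b)).
by have [] := h.
Qed.

Lemma ddmul2_lin x a : O x -> forall (s : R) u v,
  'D_a (dmul2 (s *: u + v)) x = s *: 'D_a (dmul2 u) x + 'D_a (dmul2 v) x.
Proof.
move=> Ox s u v.
have h : is_derive x a (dmul2 (s *: u + v)) (s *: 'D_a (dmul2 u) x + 'D_a (dmul2 v) x).
  apply: (near_eq_is_derive (f := s \*: dmul2 u + dmul2 v)).
    by apply: filterS (Oopen Ox) => z Oz; rewrite dmul2_lin.
  apply: is_deriveD; last by apply/derivableP/diff_derivable/dmul2_diff.
  by apply: is_deriveZ; apply/derivableP/diff_derivable/dmul2_diff.
by have [] := h.
Qed.

Lemma dlfield_linl x a : O (x, x0) -> forall (s : R) u v, dlfield (s *: u + v) x a = s *: dlfield u x a + dlfield v x a.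
Proof. by move=> Ox; exact: ddmul2_lin. Qed.

Lemma dlfield_linr x b : O (x, x0) -> forall (s : R) u v, dlfield b x (s *: u + v) = s *: dlfield b x u + dlfield b x v.
Proof.
move=> Ox s u v; rewrite /dlfield !deriveE; try exact: dmul2_diff.
rewrite (_ : (s *: u + v, 0) = s *: (u, 0) + (v, 0) :> V * V) ?linearP//.
by congr pair; rewrite /= scaler0 addr0.
Qed.

Lemma ddmul2_sym p a b : O p -> 'D_(0, a) (dmul2 b) p = 'D_(0, b) (dmul2 a) p.
Proof.
move=> Op; have [r /= r0 rO] := (nbhs_ballP p _).1 (Oopen Op).
apply/rowP => j.
have c (u v : V) q : O q -> is_derive q (0, u) (fun q => dmul2 v q 0 j) ('D_(0, u) (dmul2 v) q 0 j).
  by move=> Oq; apply: (is_derive_mxP _ _ _ _).1; apply/derivableP/diff_derivable/dmul2_diff.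
have c0 (u : V) q : O q -> is_derive q (0, u) (fun q => m q 0 j) (dmul2 u q 0 j).
  by move=> Oq; apply: (is_derive_mxP _ _ _ _).1; apply/derivableP/diff_derivable/mul_diff.
have cc (u v : V) : {for p, continuous (fun q => 'D_(0, u) (dmul2 v) q 0 j)}.
  by apply: (cont_mxP _ _).1; exact: ddmul2_cont.
apply: (@schwarz_theorem R _ (fun q => m q 0 j) (fun q => dmul2 b q 0 j) (fun q => dmul2 a q 0 j)
  (fun q => 'D_(0, a) (dmul2 b) q 0 j) (fun q => 'D_(0, b) (dmul2 a) q 0 j) (0, b) (0, a) p r r0) => //.
- by move=> y /rO; exact: c0.
- by move=> y /rO; exact: c0.
- by move=> y /rO; exact: c.
- by move=> y /rO; exact: c.
Qed.

Definition lframe (x : V) : 'M[R]_n := lin1_mx (lfield ^~ x).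
Definition dlframe (x a : V) : 'M[R]_n := lin1_mx (fun b => dlfield b x a).
Definition lbracket (a b : V) : V := dlfield b x0 a - dlfield a x0 b.

Lemma lframeE x v : O (x, x0) -> v *m lframe x = lfield v x.
Proof. by move=> Ox; rewrite lin1_mxE//; exact: lfield_lin. Qed.

Lemma dlframeE x a v : O (x, x0) -> v *m dlframe x a = dlfield v x a.
Proof. by move=> Ox; rewrite lin1_mxE//; exact: dlfield_linl. Qed.

Lemma lframe_x0 : lframe x0 = 1%:M.
Proof. by apply/row_matrixP => i; rewrite rowE lframeE// lfield_x0 rowE mulmx1. Qed.

Lemma lframe_derive x a : O (x, x0) -> is_derive x a lframe (dlframe x a).
Proof.
move=> Ox; apply/is_derive_mxP => i j; rewrite mxE.
under [X in is_derive _ _ X _]eq_fun do rewrite mxE.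
exact: ((is_derive_mxP _ _ _ _).1 (lfield_derive (delta_mx 0 i) a Ox)).
Qed.

Lemma dlframe_cont x a : O (x, x0) -> {for x, continuous (dlframe ^~ a)}.
Proof.
move=> Ox; apply/cont_mxP => i j.
rewrite (_ : (fun y => _) = (fun y => dlfield (delta_mx 0 i) y a 0 j)); last first.
  by apply/funext => y; rewrite mxE.
have H : {for x, continuous (fun y => dlfield (delta_mx 0 i) y a)}.
  apply: (cont_comp (f := fun y => (y, x0)) (g := fun q => 'D_(a, 0) (dmul2 (delta_mx 0 i)) q)).
    by apply: cont_pair; [by []|exact: cont_cst].
  exact: ddmul2_cont.
exact: ((cont_mxP _ _).1 H 0 j).
Qed.

Lemma dmul2E b p : O p -> dmul2 b p = 'd m p (0, b).
Proof. by move=> Op; rewrite /dmul2 deriveE//; exact: mul_diff. Qed.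

Lemma dlfieldE b x a : O (x, x0) -> dlfield b x a = 'd (dmul2 b) (x, x0) (a, 0).
Proof. by move=> Op; rewrite /dlfield deriveE//; exact: dmul2_diff. Qed.

Lemma dlframe_lin x : O (x, x0) -> forall (s : R) u v,
  dlframe x (s *: u + v) = s *: dlframe x u + dlframe x v.
Proof. by move=> Ox s u v; apply: lin1_mx_linear => b; exact: dlfield_linr.
Qed.

Lemma dlfield_sym x a b : O (x, x0) ->
  b *m lin1_mx (fun w => 'D_(0, a) (dmul2 w) (x, x0)) =
  a *m lin1_mx (fun w => 'D_(0, b) (dmul2 w) (x, x0)).
Proof. by move=> Op; rewrite !lin1_mxE; [exact: ddmul2_sym|exact: ddmul2_lin|exact: ddmul2_lin]. Qed.

Local Opaque dmul2 lfield dlfield lframe dlframe.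

Lemma dlframe_bounded : exists M, \forall x \near x0, forall a, `|dlframe x a| <= M * `|a|.
Proof.
exists (\sum_i (`|dlframe x0 (delta_mx 0 i)| + 1)).
have h : \forall x \near x0, forall i : 'I_n, `|dlframe x (delta_mx 0 i)| <= `|dlframe x0 (delta_mx 0 i)| + 1.
  apply: near_forall => i.
  have /(@cvgrPdist_le _ _ _ (nbhs x0)) := @dlframe_cont x0 (delta_mx 0 i) O00.
  move=> /(_ _ ltr01); apply: filterS => x; set A := dlframe x0 _; set B := dlframe x _ => hx.
  have -> : B = A - (A - B) by rewrite opprB addrC subrK.
  by rewrite (le_trans (ler_normB _ _))// lerD2l.
apply: filterS2 h (nbhs_slice1 O00) => x hx Ox a.
by apply: row_norm_delta hx a; exact: dlframe_lin.
Qed.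

Lemma assoc_ball x : O (x, x0) -> exists2 e : R, 0 < e & forall y z, ball x0 e y -> ball x0 e z ->
  [/\ O (y, z), O (x, m (y, z)), O (x, y) & O (m (x, y), z)].
Proof.
move=> Ox.
have P : \forall p \near (x0, x0), [/\ O p, O (x, m p), O (x, p.1) & O (m (x, p.1), p.2)].
  near=> p; split; near: p.
  - exact: Oopen.
  - apply: (cont_near (f := fun p => (x, m p))).
      by apply: cont_pair; [exact: cont_cst|exact: mul_cont].
    by rewrite mx0//; exact: Oopen.
  - by apply: (cont_near (f := fun p : V * V => p.1) (P := fun y => O (x, y))); [exact: cont_fst|exact: nbhs_slice2].
  - apply: (cont_near (f := fun p : V * V => (m (x, p.1), p.2))).
      apply: cont_pair; last exact: cont_snd.
      apply: (cont_comp (f := fun p : V * V => (x, p.1))); last exact: mul_cont.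
      by apply: cont_pair; [exact: cont_cst|exact: cont_fst].
    by rewrite /= mx0//; exact: Oopen.
have [e /= e0 he] := (nbhs_ballP _ _).1 P; exists e => // y z hy hz.
by apply: (he (y, z)).
Unshelve. all: by end_near. Qed.

(** Derivative of the associativity law [m (m (x, y), z) = m (x, m (y, z))] with respect to [z] at
    [x0]. *)
Lemma lfield_equivariant x y b e : (forall y z, ball x0 e y -> ball x0 e z ->
  [/\ O (y, z), O (x, m (y, z)), O (x, y) & O (m (x, y), z)]) -> 0 < e ->
  ball x0 e y -> lfield b (m (x, y)) = dmul2 (lfield b y) (x, y).
Proof.
move=> he e0 hy; have xx := ballxx x0 e0.
have [Oy Oxy' Oxy Omy] := he y x0 hy xx.
have my := mx0 Oy.
have h1 : is_derive x0 b (fun z => m (x, m (y, z))) (dmul2 (lfield b y) (x, y)).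
  have hp := is_derive_pair (is_derive_cst x x0 b) (dmul2_derive b Oy).
  have h : is_derive x0 b (fun z => m (x, m (y, z))) ('d m (x, m (y, x0)) (0, dmul2 b (y, x0))).
    exact: (is_derive_diff_comp hp (mul_diff Oxy')).
  have -> : dmul2 (lfield b y) (x, y) = 'd m (x, m (y, x0)) (0, dmul2 b (y, x0)); last exact: h.
  by rewrite my -lfieldE// dmul2E.
have h2 : is_derive x0 b (fun z => m (m (x, y), z)) (lfield b (m (x, y))).
  by rewrite lfieldE//; exact: (dmul2_derive b Omy).
have E : \forall z \near x0, m (m (x, y), z) = m (x, m (y, z)).
  apply: filterS (nbhsx_ballx x0 e e0) => z hz; have [? ? ? ?] := he y z hy hz.
  exact: mA.
by have [_ <-] := h2; rewrite (near_eq_derive _ E); have [_ ->] := h1.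
Qed.

(** The bracket of left-invariant fields is left-invariant: a second derivative of associativity,
    now in [y], relates the derivatives of the fields at [x] to those at [x0]. *)
Lemma lbracket_invariant x a b : O (x, x0) -> lbracket a b *m lframe x = dlfield b x (lfield a x) - dlfield a x (lfield b x).
Proof.
move=> Ox; have [e e0 he] := assoc_ball Ox.
have mx := mx0 Ox.
(* Chain rule on the two sides of [lfield_equivariant], in [y] at [x0] along [c]. The last term is a
   second derivative in the second factor, symmetric in [c] and [d], so it cancels in the
   bracket. *)
have F (c d : V) : dlfield d x (lfield c x) = dlfield d x0 c *m lframe x +
    d *m lin1_mx (fun w => 'D_(0, c) (dmul2 w) (x, x0)).
  pose m2m p := lin1_mx (dmul2 ^~ p).
  have m2mE p v : O p -> v *m m2m p = dmul2 v p by move=> Op; rewrite lin1_mxE//; exact: dmul2_lin.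
  have h1 : is_derive x0 c (fun y => dmul2 d (m (x, y), x0)) (dlfield d x (lfield c x)).
    have hp := is_derive_pair (dmul2_derive c Ox) (is_derive_cst x0 x0 c).
    have dm : differentiable (dmul2 d) (m (x, x0), x0) by rewrite mx; exact: dmul2_diff.
    have h : is_derive x0 c (fun y => dmul2 d (m (x, y), x0)) ('d (dmul2 d) (m (x, x0), x0) (dmul2 c (x, x0), 0)).
      exact: (is_derive_diff_comp hp dm).
    have -> : dlfield d x (lfield c x) = 'd (dmul2 d) (m (x, x0), x0) (dmul2 c (x, x0), 0); last exact: h.
    by rewrite mx -lfieldE// dlfieldE.
  have h2 : is_derive x0 c (fun y => lfield d y *m m2m (x, y))
      (dlfield d x0 c *m m2m (x, x0) + lfield d x0 *m lin1_mx (fun w => 'D_(0, c) (dmul2 w) (x, x0))).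
    have h2a : is_derive x0 c (fun y => m2m (x, y)) (lin1_mx (fun w => 'D_(0, c) (dmul2 w) (x, x0))).
      apply/is_derive_mxP => i j; rewrite mxE.
      under [X in is_derive _ _ X _]eq_fun do rewrite mxE.
      have H : is_derive x0 c (fun y => dmul2 (delta_mx 0 i) (x, y)) ('D_(0, c) (dmul2 (delta_mx 0 i)) (x, x0)).
        by apply: derive_slice2; apply/derivableP/diff_derivable; exact: dmul2_diff.
      exact: ((is_derive_mxP _ _ _ _).1 H 0 j).
    exact: (is_derive_mulmx (lfield_derive d c O00) h2a).
  have E : \forall y \near x0, dmul2 d (m (x, y), x0) = lfield d y *m m2m (x, y).
    apply: filterS (nbhsx_ballx x0 e e0) => y hy.
    have [Oy _ Oxy Omy] := he y x0 hy (ballxx _ e0).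
    by rewrite m2mE// -lfieldE//; exact: (lfield_equivariant _ he).
  have [_ <-] := h1; rewrite (near_eq_derive _ E); have [_ ->] := h2.
  have -> : m2m (x, x0) = lframe x.
    by apply/row_matrixP => i; rewrite !rowE m2mE// lframeE// lfieldE.
  by rewrite lfield_x0.
rewrite (F a b) (F b a) (dlfield_sym a b Ox) /lbracket mulmxBl.
have C (u v w : V) : u - v = u + w - (v + w) by rewrite opprD addrACA subrr addr0.
exact: C.
Qed.

Lemma lbracket_frame x a b : O (x, x0) -> lbracket a b *m lframe x =
  b *m dlframe x (a *m lframe x) - a *m dlframe x (b *m lframe x).
Proof.
move=> Ox; rewrite lbracket_invariant// (dlframeE _ b Ox) (dlframeE _ a Ox).
by rewrite (lframeE a Ox) (lframeE b Ox).
Qed.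

End local_group.

Section inverse_matrix.
Context {R : realType} {n : nat}.

Lemma mx1_norm : `|1%:M : 'M[R]_n| <= 1.
Proof.
apply/mx_norm_leP => // i j; rewrite mxE; case: (i == j) => /=; first by rewrite normr1.
by rewrite normr0.
Qed.

(** A vector killed by [A] satisfies [|v| <= |v| / 2], hence vanishes. The same perturbation
    estimate bounds the inverse, without a Neumann series; the factor [n] is the norm constant of
    the matrix product. *)
Lemma near_one_unit (A : 'M[R]_n) : n%:R * `|A - 1%:M| <= 2^-1 ->
  A \in unitmx /\ `|invmx A| <= 2.
Proof.
move=> hA.
have inj (v : 'rV[R]_n) : v *m A = 0 -> v = 0.
  move=> vA; have E : v = - (v *m (A - 1%:M)) by rewrite mulmxBr vA mulmx1 sub0r opprK.
  apply/eqP; rewrite -normr_eq0; apply/eqP.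
  have : `|v| <= 2^-1 * `|v|.
    rewrite {1}E normrN (le_trans (mulmx_norm_le _ _))//.
    by rewrite mulrAC ler_wpM2r.
  by have := normr_ge0 v; lra.
have uA : A \in unitmx.
  rewrite -row_free_unit -kermx_eq0; apply/eqP/row_matrixP => i; rewrite row0.
  by apply: inj; rewrite -row_mul mulmx_ker row0.
split => //.
have E : invmx A = 1%:M - invmx A *m (A - 1%:M) by rewrite mulmxBr mulVmx// mulmx1 subKr.
have : `|invmx A| <= 1 + 2^-1 * `|invmx A|.
  rewrite {1}E (le_trans (ler_normB _ _))// lerD//; first exact: mx1_norm.
  rewrite (le_trans (mulmx_norm_le _ _))// mulrAC ler_wpM2r//.
by have := normr_ge0 (invmx A); lra.
Qed.

Lemma mulmx3_le (A B D : 'M[R]_n) c : `|A| <= 2 -> `|B| <= c -> `|D| <= 2 ->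
  `|A *m B *m D| <= 4 * n%:R ^+ 2 * c.
Proof.
move=> hA hB hD; have c0 : 0 <= c := le_trans (normr_ge0 _) hB.
have -> : 4 * n%:R ^+ 2 * c = n%:R * (n%:R * 2 * c) * 2 :> R by ring.
apply: le_trans (mulmx_norm_le _ _) _; apply: ler_pM; rewrite ?mulr_ge0//.
apply: ler_wpM2l => //; apply: le_trans (mulmx_norm_le _ _) _.
by apply: ler_pM; rewrite ?mulr_ge0//; exact: ler_wpM2l.
Qed.

Lemma invmxB (A B : 'M[R]_n) : A \in unitmx -> B \in unitmx ->
  invmx A - invmx B = - (invmx A *m (A - B) *m invmx B).
Proof.
move=> uA uB; rewrite mulmxBr mulVmx// mulmxBl mul1mx -mulmxA mulmxV// mulmx1.
by rewrite opprB.
Qed.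

Lemma is_derive_invmx (V : normedModType R) (f : V -> 'M[R]_n) x v df :
  is_derive x v f df -> (\forall y \near x, f y \in unitmx) ->
  {for x, continuous (fun y => invmx (f y))} ->
  is_derive x v (fun y => invmx (f y)) (- (invmx (f x) *m df *m invmx (f x))).
Proof.
move=> [fd <-] fu fc.
have line : h *: v + x @[h --> (0 : R)^'] --> x.
  have : {for (0 : R), continuous (fun h : R => h *: v + x)}.
    apply: cont_add; last exact: cont_cst.
    by apply: cvgZr_tmp; exact: cvg_id.
  rewrite /prop_for /continuous_at scale0r add0r => H.
  exact: cvg_within_filter H.
have H : (fun h => h^-1 *: (invmx (f (h *: v + x)) - invmx (f x)))
    @ (0 : R)^' --> - (invmx (f x) *m 'D_v f x *m invmx (f x)).
  have K : (fun h => - (invmx (f (h *: v + x)) *m (h^-1 *: (f (h *: v + x) - f x)) *m invmx (f x)))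
    @ (0 : R)^' --> - (invmx (f x) *m 'D_v f x *m invmx (f x)).
    apply: cvgN; apply: cvg_mulmx; last exact: cvg_cst.
    apply: cvg_mulmx fd.
    exact: (@cvg_comp _ _ _ (fun h : R => h *: v + x) (fun y => invmx (f y)) _ _ _ line fc).
  apply: cvg_trans K; apply: near_eq_cvg.
  have fu' : \forall h \near (0 : R)^', f (h *: v + x) \in unitmx by exact: line fu.
  apply: filterS fu' => h hu; have ux := nbhs_singleton fu.
  by rewrite invmxB// -scalemxAr -scalemxAl scalerN.
split; first by apply/cvg_ex; eexists; exact: H.
by apply/cvg_lim => //; exact: norm_hausdorff.
Qed.

End inverse_matrix.

Section frechet.
Context {R : realType} {n m : nat}.
Notation V := 'rV[R]_n.
Notation W := 'rV[R]_m.

(** A directional derivative only sees straight lines. This uniform first-order expansion is what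
    composes with an arbitrary differentiable curve, as in [frechet_chain]. *)
Definition frechet (f : V -> W) (x : V) (A : 'M[R]_(n, m)) :=
  forall e : R, 0 < e -> \forall y \near x, `|f y - f x - (y - x) *m A| <= e * `|y - x|.

Lemma frechet_C1 (f : V -> W) (A : V -> 'M[R]_(n, m)) p r (x : V) :
  (forall y v : V, ball p r y -> is_derive y v f (v *m A y)) -> ball p r x ->
  {for x, continuous A} -> frechet f x (A x).
Proof.
move=> hd hx /(@cvgrPdist_le _ _ _ (nbhs x)) cA e e0.
have n1 : 0 < (n%:R : R) + 1 by rewrite ltr_wpDl.
have e1 : 0 < e / (n%:R + 1) by rewrite divr_gt0.
have [d /= d0 hd'] := (nbhs_ballP x _).1 (filterI (cA _ e1) (nbhs_in_ball hx)).
apply: filterS (nbhsx_ballx x d d0) => y hy.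
pose g z := f z - (z - x) *m A x.
have dg (z v : V) : ball x d z -> is_derive z v g (v *m A z - v *m A x).
  move=> /hd'[_ hz]; apply: is_deriveB; first exact: hd.
  apply: is_derive_mulmxr.
  by have := is_deriveB (is_derive_id z v) (is_derive_cst x z v); rewrite subr0.
have bg (z v : V) : ball x d z -> `|v *m A z - v *m A x| <= e * `|v|.
  move=> /hd'[hz _]; rewrite -mulmxBr (le_trans (mulmx_norm_le _ _))// mulrAC ler_wpM2r//.
  rewrite distrC (le_trans (ler_wpM2l _ hz))// mulrC mulrAC ler_pdivrMr// ler_wpM2l ?ltW//.
  by rewrite ltrDl.
have := lipschitz_ball dg bg (ballxx x d0) hy.
by rewrite /g subrr mul0mx subr0 addrAC.
Qed.

Lemma frechet_chain (f : V -> W) (A : 'M[R]_(n, m)) (c : R -> V) t w :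
  frechet f (c t) A -> is_derive t 1 c w -> is_derive t 1 (fun s => f (c s)) (w *m A).
Proof.
move=> hf [cd cw].
have cc : {for t, continuous c}.
  by apply: differentiable_continuous; apply/derivable1_diffP.
have line : h *: 1 + t @[h --> (0 : R)^'] --> t.
  have : {for (0 : R), continuous (fun h : R => h *: 1 + t)}.
    apply: cont_add; last exact: cont_cst.
    by apply: cvgZr_tmp; exact: cvg_id.
  rewrite /prop_for /continuous_at scale0r add0r => H.
  exact: cvg_within_filter H.
pose u (h : R) := h^-1 *: (c (h *: 1 + t) - c t).
have uw : u @ (0 : R)^' --> w by rewrite -cw; exact: cd.
pose q (h : R) := h^-1 *: (f (c (h *: 1 + t)) - f (c t)).
have H : q @ (0 : R)^' --> w *m A.
  have K : (fun h => q h - u h *m A) @ (0 : R)^' --> (0 : W).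
    apply/cvgr0Pnorm_le => e e0.
    have w1 : 0 < `|w| + 1 by rewrite ltr_wpDl.
    have e1 : 0 < e / (`|w| + 1) by rewrite divr_gt0.
    have n1 : \forall h \near (0 : R)^', `|u h| <= `|w| + 1.
      move/cvgrPdist_le : uw => /(_ _ ltr01); apply: filterS => h hh.
      have -> : u h = w - (w - u h) by rewrite subKr.
      by rewrite (le_trans (ler_normB _ _))// lerD2l.
    have n2 : \forall h \near (0 : R)^', `|f (c (h *: 1 + t)) - f (c t) - (c (h *: 1 + t) - c t) *m A|
        <= e / (`|w| + 1) * `|c (h *: 1 + t) - c t|.
      exact: line (cont_near cc (hf _ e1)).
    apply: filterS2 n1 n2 => h h1 h2.
    have -> : q h - u h *m A = h^-1 *: (f (c (h *: 1 + t)) - f (c t) - (c (h *: 1 + t) - c t) *m A).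
      by rewrite /q /u -scalemxAl -scalerBr.
    rewrite normrZ (le_trans (ler_wpM2l (normr_ge0 _) h2))// mulrCA -normrZ.
    by rewrite (le_trans (ler_wpM2l (ltW e1) h1))// divfK ?gt_eqF.
  have -> : w *m A = 0 + w *m A by rewrite add0r.
  rewrite (_ : q = (fun h => (q h - u h *m A) + u h *m A)); last first.
    by apply/funext => h; rewrite subrK.
  by apply: cvgD K _; apply: cvg_mulmx uw _; exact: cvg_cst.
split; first by apply/cvg_ex; eexists; exact: H.
by apply/cvg_lim => //; exact: norm_hausdorff.
Qed.

End frechet.

(** * The Maurer-Cartan form and its developing map *)

Section maurer_cartan.
Context {R : realType} {n : nat}.
Notation V := 'rV[R]_n.
Variables (L : V -> 'M[R]_n) (dL : V -> V -> 'M[R]_n) (p : V) (r M : R).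
Variables (br : V -> V -> V) (C : R) (P : 'M[R]_n).
Hypothesis r0 : 0 < r.
Hypothesis hL : C1b L dL p r M.
Hypothesis L1 : L p = 1%:M.
Hypothesis ts : two_step br C.
Hypothesis brP : forall x y, br x y *m P = 0.
Hypothesis Pbr : forall x y, br (x *m P) y = br x y.
Hypothesis L_invariant : forall x a b : V, ball p r x ->
  br a b *m L x = b *m dL x (a *m L x) - a *m dL x (b *m L x).

(** The Maurer-Cartan form: since [a *m L x] is the left-invariant field of [a] at [x], the inverse
    matrix carries tangent vectors back to the identity. *)
Let Om x := invmx (L x).
Let dOm x v := - (Om x *m dL x v *m Om x).

Lemma frame_invertible : exists2 r', 0 < r' <= r & forall x : V, ball p r' x ->
  L x \in unitmx /\ `|Om x| <= 2.
Proof.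
pose c := (2 * (n%:R * `|M| + 1))^-1.
have c1 : 0 < n%:R * `|M| + 1 by rewrite ltr_wpDl// mulr_ge0.
have c0 : 0 < c by rewrite invr_gt0 mulr_gt0.
exists (Num.min r c); first by rewrite lt_min r0 c0 ge_min lexx.
move=> x hx; apply: near_one_unit.
have hxr : ball p r x by apply: le_ball hx; rewrite ge_min lexx.
have hxc : ball p c x by apply: le_ball hx; rewrite ge_min lexx orbT.
have := C1b_lip hL (ballxx p r0) hxr; rewrite L1 => h.
apply: le_trans (_ : n%:R * (`|M| * c) <= _).
  rewrite ler_wpM2l// (le_trans h)//.
  rewrite (le_trans (y := `|M| * `|x - p|))//; first by rewrite ler_wpM2r// ler_norm.
  by rewrite ler_wpM2l//; move: hxc; rewrite -ball_normE/= distrC => /ltW.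
rewrite mulrA /c invfM mulrCA ler_piMr ?invr_ge0//.
by rewrite ler_pdivrMr// mul1r lerDl.
Qed.

Lemma Om_C1b : exists r' K, [/\ 0 < r' <= r, C1b Om dOm p r' K & forall x : V, ball p r' x ->
  L x \in unitmx].
Proof.
have [r' /andP[r'0 rr] hu] := frame_invertible.
have hL' := C1b_sub rr hL.
have lip (x y : V) : ball p r' x -> ball p r' y -> `|Om y - Om x| <= (4 * n%:R ^+ 2 * `|M|) * `|y - x|.
  move=> hx hy; have [ux bx] := hu x hx; have [uy bY] := hu y hy.
  have h3 : `|L y - L x| <= `|M| * `|y - x|.
    by rewrite (le_trans (C1b_lip hL' hx hy))// ler_wpM2r// ler_norm.
  by rewrite /Om invmxB// normrN -mulrA; exact: mulmx3_le.
have Oc (x : V) : ball p r' x -> {for x, continuous Om}.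
  exact: (lipschitz_ball_continuous lip).
exists r', (4 * n%:R ^+ 2 * `|M|); split; first by rewrite r'0.
  split=> x v hx.
  - apply: is_derive_invmx.
    + exact: (C1b_d hL').
    + by apply: filterS (nbhs_in_ball hx) => y /hu[].
    + exact: Oc.
  - have c1 := cont_bbl (mulmx_bounded n n n) (Oc x hx) (C1b_c (v := v) hL' hx).
    have c2 := cont_bbl (mulmx_bounded n n n) c1 (Oc x hx).
    exact: continuousN c2.
  - have [_ bx] := hu x hx.
    have h3 : `|dL x v| <= `|M| * `|v|.
      by rewrite (le_trans (C1b_b hL' v hx))// ler_wpM2r// ler_norm.
    rewrite /dOm normrN (_ : _ * `|v| = 4 * n%:R ^+ 2 * (`|M| * `|v|)); last by ring.
    exact: (mulmx3_le bx h3 bx).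
by move=> x /hu[].
Qed.

(** Maurer-Cartan equation: the invariance of the bracket, evaluated on [a *m Om x] and [b *m Om x]
    and multiplied by the inverse frame. *)
Lemma structure_equation (x a b : V) : ball p r x -> L x \in unitmx ->
  a *m dOm x b - b *m dOm x a = br (a *m Om x) (b *m Om x).
Proof.
move=> hx ux.
have := L_invariant (a *m Om x) (b *m Om x) hx.
rewrite -!mulmxA mulVmx// !mulmx1 => /(congr1 (mulmx^~ (Om x))).
rewrite mulmxK// mulmxBl => ->.
by rewrite /dOm !mulmxN opprK addrC !mulmxA.
Qed.

(** The matrix of [a |-> br u (a *m w)]; it keeps the bracket correction of the form matrix-valued,
    so that [C1b_primitive] applies to it. *)
Let adr (u : V) (w : 'M[R]_n) : 'M[R]_n := \matrix_(i, j) br u (row i w) 0 j.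

Lemma mul_adr u w (a : V) : a *m adr u w = br u (a *m w).
Proof.
have row_adr i : row i (adr u w) = br u (row i w) by apply/rowP => j; rewrite !mxE.
rewrite !mulmx_sum_row (big_morph _ (bblDr ts u) (bbl0r ts u)).
by apply: eq_bigr => i _; rewrite (bblZr ts) row_adr.
Qed.

Lemma adr_bounded : bounded_bilinear (adr : 'rV[R]_n -> 'M[R]_n -> 'M[R]_n) C.
Proof.
have E (f g : 'M[R]_n) : (forall a : V, a *m f = a *m g) -> f = g.
  by move=> h; apply/row_matrixP => i; rewrite !rowE.
split.
- by move=> x y z; apply: E => a; rewrite mulmxDr !mul_adr (bblDl ts).
- by move=> x y z; apply: E => a; rewrite mulmxDr !mul_adr mulmxDr (bblDr ts).
- by move=> s x y; apply: E => a; rewrite -scalemxAr !mul_adr (bblZl ts).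
- by move=> s x y; apply: E => a; rewrite -scalemxAr !mul_adr -scalemxAr (bblZr ts).
- exact: (bbl_ge0 ts).
move=> x y; have C0 := bbl_ge0 ts; apply/mx_norm_leP; first by rewrite !mulr_ge0.
move=> i j; rewrite mxE; apply: le_trans (mx_norm_coord _ _ _) _.
apply: le_trans (bbl_le ts _ _) _; apply: ler_wpM2l; first by rewrite mulr_ge0.
by apply/mx_norm_leP => // k l; rewrite mxE; exact: mx_norm_coord.
Qed.

(** [psi] is the logarithm in the chart. Its derivative has to carry the left-invariant field of [a]
    to [a + br (psi x) a / 2], the left-invariant field of [bch]. Since the bracket only sees
    [psi x *m P], that part is integrated first, as [psi1]; with it the right-hand side becomes an
    explicit closed form. *)
Lemma developing_map : exists (psi : V -> V) (A : V -> 'M[R]_n) r', [/\ 0 < r' <= r, psi p = 0 /\ A p = 1%:M,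
  forall x : V, ball p r' x -> L x \in unitmx /\ {for x, continuous A},
  forall x a : V, ball p r' x -> is_derive x a psi (a *m A x) &
  forall x a : V, ball p r' x -> (a *m L x) *m A x = a + 2^-1 *: br (psi x) a].
Proof.
have [r' [K [/andP[r'0 rr] hO hu]]] := Om_C1b.
have inr x : ball p r' x -> ball p r x by exact: le_ball.
have [K1 h1] := C1b_mulmxr P hO.
(* Modulo brackets the structure equation says that the Maurer-Cartan form is closed. *)
have cl1 (x u v : V) : ball p r' x -> u *m (dOm x v *m P) = v *m (dOm x u *m P).
  move=> hx; apply/eqP; rewrite -subr_eq0 !mulmxA -mulmxBl.
  by rewrite structure_equation ?brP//; [exact: inr|exact: hu].
have [psi1 [K1' [psi1p hpsi1]]] := C1b_primitive h1 cl1.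
have [K2 h2] := C1b_bbl adr_bounded hpsi1 hO.
have [K3 h3] := C1b_bbl (mulmx_bounded n n n) (C1b_cst (2^-1%:M) p r') h2.
have h4 := C1b_add hO h3.
(* Antisymmetrizing the correction gives [- br a b], which cancels the structure equation; what
   remains is a double bracket, hence 0. *)
have cl2 (x u v : V) : ball p r' x ->
  u *m (dOm x v + (0 *m adr (psi1 x) (Om x) + 2^-1%:M *m (adr (v *m (Om x *m P)) (Om x) + adr (psi1 x) (dOm x v)))) =
  v *m (dOm x u + (0 *m adr (psi1 x) (Om x) + 2^-1%:M *m (adr (u *m (Om x *m P)) (Om x) + adr (psi1 x) (dOm x u)))).
  move=> hx; apply/eqP; rewrite -subr_eq0 !mul0mx !add0r !mul_scalar_mx !mulmxDr -!scalemxAr !mulmxDr !mul_adr.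
  rewrite !mulmxA !Pbr.
  set a := u *m Om x; set b := v *m Om x.
  have S := structure_equation u v (inr _ hx) (hu _ hx); rewrite -/a -/b in S.
  have -> : u *m dOm x v = v *m dOm x u + br a b by rewrite -S addrC subrK.
  rewrite (bblDr ts) (br_nilr ts) addr0 (br_anti ts b a).
  apply/eqP; move: (v *m dOm x u) (br a b) (br _ _) => A B D.
  by mx_field.
have [psi [K4 [psip hpsi]]] := C1b_primitive h4 cl2.
(* Both sides vanish at [p] and have the same derivative. Hence [br (psi1 x)] can be read as
   [br (psi x)], which closes the apparent circularity. *)
have psiP (x : V) : ball p r' x -> psi x *m P = psi1 x.
  move=> hx.
  have d (y v : V) : ball p r' y -> is_derive y v (fun z => psi z *m P - psi1 z) (0 : V).
    move=> hy; have e1 := is_derive_mulmxr P (C1b_d hpsi v hy).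
    apply: is_derive_eq (is_deriveB e1 (C1b_d hpsi1 v hy)) _.
    by rewrite mulmxDr mulmxDl mul_scalar_mx -scalemxAr -scalemxAl mul_adr brP scaler0 addr0 mulmxA subrr.
  have z : `|(psi x *m P - psi1 x) - (psi p *m P - psi1 p)| <= 0 * `|x - p|.
    apply: (lipschitz_ball d) => //; last exact: ballxx.
    by move=> *; rewrite normr0 mul0r.
  move: z; rewrite mul0r normr_le0 psip psi1p mul0mx subrr subr0 subr_eq0.
  by move/eqP.
exists psi, (fun x => Om x + 2^-1%:M *m adr (psi1 x) (Om x)), r'; split; first by rewrite r'0.
- split => //; have -> : Om p = 1%:M by rewrite /Om L1 invmx1.
  apply/row_matrixP => i; rewrite !rowE mulmxDr mul_scalar_mx -scalemxAr mul_adr psi1p.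
  by rewrite (bbl0l ts) scaler0 addr0.
- by move=> x hx; split; [exact: hu|exact: (C1b_cont h4)].
- by move=> x a; exact: (C1b_d hpsi).
- move=> x a hx; rewrite mulmxDr mul_scalar_mx -scalemxAr mul_adr -(psiP x hx) Pbr.
  by rewrite /Om mulmxK//; exact: hu.
Qed.

End maurer_cartan.

Section horizontal_projection.
Context {R : realType} {n : nat} (br : 'rV[R]_n -> 'rV[R]_n -> 'rV[R]_n) (C : R).
Hypothesis ts : two_step br C.

(** [P] is a projection along the span [B] of the brackets of basis vectors: [x *m P] differs from
    [x] by an element of [B], and [B] is central. *)
Lemma horizontal_projection : exists P : 'M[R]_n,
  (forall x y, br x y *m P = 0) /\ (forall x y, br (x *m P) y = br x y).
Proof.
pose b (k : 'I_n * 'I_n) := br (delta_mx 0 k.1) (delta_mx 0 k.2).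
pose B := (\sum_k <<b k>>)%MS.
have subB x y : (br x y <= B)%MS.
  rewrite (row_sum_delta x) (row_sum_delta y).
  rewrite (big_morph (br ^~ _) (fun u v => bblDl ts u v _) (bbl0l ts _)).
  apply: summx_sub => i _; rewrite (big_morph _ (bblDr ts _) (bbl0r ts _)).
  apply: summx_sub => j _; rewrite (bblZl ts) (bblZr ts) !scalemx_sub//.
  by apply: submx_trans (sumsmx_sup (i, j) _ (submx_refl _)) => //; rewrite genmxE.
have Bc u z : (u <= B)%MS -> br u z = 0.
  move=> /sub_sums_genmxP[c ->].
  rewrite (big_morph (br ^~ z) (fun u v => bblDl ts u v z) (bbl0l ts z)).
  by rewrite big1// => k _; rewrite (mx11_scalar (c k)) mul_scalar_mx (bblZl ts) (ts_nil ts) scaler0.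
exists (1%:M - pinvmx B *m B); split=> x y.
  by rewrite mulmxBr mulmx1 mulmxA mulmxKpV ?subrr.
by rewrite mulmxBr mulmx1 (bblBl ts) mulmxA (Bc (_ *m B)) ?submxMl// subr0.
Qed.

(** The derivative of the discrepancy [D] of [local_logarithm], with [X], [Z], [Y] the images of
    [x], of the product and of the moving point, and [u] their common velocity. It is again a
    bracket with the discrepancy itself. *)
Lemma ode_difference (X Z Y u : 'rV[R]_n) :
  u + 2^-1 *: br Z u - 0 - 2^-1 *: (br 0 Z + br X (u + 2^-1 *: br Z u)) - (u + 2^-1 *: br Y u) =
  2^-1 *: br (Z - X - 2^-1 *: br X Z - Y) u.
Proof.
rewrite !(brE ts) !scaler0 !addr0.
by move: (br Z u) (br X u) (br Y u) => a b c; mx_ring.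
Qed.

End horizontal_projection.

(** * The logarithm is a local homomorphism *)

Section local_homomorphism.
Local Opaque derive dmul2 lfield dlfield lframe dlframe lbracket.
Context {R : realType} {n : nat}.
Notation V := 'rV[R]_n.
Variables (m : V * V -> V) (O : set (V * V)) (x0 : V) (C : R).
Hypothesis Oopen : forall p, O p -> nbhs p O.
Hypothesis O00 : O (x0, x0).
Hypothesis msm : smooth_on O m.
Hypothesis mx0 : forall x, O (x, x0) -> m (x, x0) = x.
Hypothesis m0x : forall x, O (x0, x) -> m (x0, x) = x.
Hypothesis mA : forall x y z, O (x, y) -> O (y, z) -> O (m (x, y), z) -> O (x, m (y, z)) ->
  m (m (x, y), z) = m (x, m (y, z)).
Notation br := (lbracket m x0).
Hypothesis ts : two_step br C.

Lemma local_group_ball r : 0 < r -> exists2 e : R, 0 < e <= r & forall x y z : V,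
  ball x0 e x -> ball x0 e y -> ball x0 e z ->
  [/\ O (y, z), O (x, m (y, z)), O (x, y), O (m (x, y), z) & ball x0 r (m (x, y))].
Proof.
move=> r0; have mc := mul_cont msm O00.
have m00 := mx0 O00.
have H : \forall p \near (x0, x0), O p /\ ball x0 r (m p).
  apply: filterI; first exact: Oopen.
  apply: (cont_near mc); rewrite m00; exact: nbhsx_ballx.
have P : \forall p \near (x0, (x0, x0)), [/\ O p.2, O (p.1, m p.2), O (p.1, p.2.1) &
     O (m (p.1, p.2.1), p.2.2) /\ ball x0 r (m (p.1, p.2.1))].
  have c1 : {for (x0, (x0, x0)), continuous (fun p : V * (V * V) => p.2)} by exact: cont_snd.
  have c0 : {for (x0, (x0, x0)), continuous (fun p : V * (V * V) => p.1)} by exact: cont_fst.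
  have c2 : {for (x0, (x0, x0)), continuous (fun p : V * (V * V) => (p.1, p.2.1))}.
    by apply: cont_pair; [exact: c0|apply: (cont_comp c1); exact: cont_fst].
  near=> p; split; near: p.
  - by apply: (cont_near c1); exact: Oopen.
  - apply: (cont_near (f := fun p : V * (V * V) => (p.1, m p.2))).
      by apply: cont_pair; [exact: c0|apply: (cont_comp c1); exact: mc].
    by rewrite /= m00; exact: Oopen.
  - by apply: (cont_near c2); exact: Oopen.
  - apply: filterI.
      apply: (cont_near (f := fun p : V * (V * V) => (m (p.1, p.2.1), p.2.2))).
        apply: cont_pair; first by apply: (cont_comp c2); exact: mc.
        by apply: (cont_comp c1); exact: cont_snd.
      by rewrite /= m00; exact: Oopen.
    apply: (cont_near (f := fun p : V * (V * V) => m (p.1, p.2.1))).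
      by apply: (cont_comp c2); exact: mc.
    by rewrite /= m00; exact: nbhsx_ballx.
have [e /= e0 he] := (nbhs_ballP _ _).1 P.
exists (Num.min e r); first by rewrite lt_min e0 r0 ge_min lexx orbT.
have sub x : ball x0 (Num.min e r) x -> ball x0 e x by apply: le_ball; rewrite ge_min lexx.
move=> x y z /sub hx /sub hy /sub hz.
by have [//|a b c [d f]] := he (x, (y, z)).
Unshelve. all: by end_near. Qed.

(** For [y] moving on a segment from [x0], the images of [m (x, y)] and of [y] obey the same
    left-invariant equation. Their discrepancy starts at 0, and two-step nilpotency makes uniqueness
    elementary. *)
Lemma local_logarithm : exists (psi : V -> V) (r : R), [/\ 0 < r,
  psi x0 = 0, frechet psi x0 1%:M,
  forall x y : V, ball x0 r x -> ball x0 r y ->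
    `|(psi y - psi x) - (y - x)| <= 2^-1 * `|y - x| &
  exists2 r', 0 < r' <= r & forall x y : V, ball x0 r' x -> ball x0 r' y ->
    [/\ O (x, y), ball x0 r (m (x, y)) & psi (m (x, y)) = bch br (psi x) (psi y)]].
Proof.
have [M hM] := dlframe_bounded Oopen O00 msm.
have [r1 /= r10 hr1] := (nbhs_ballP x0 _).1 (filterI hM (nbhs_slice1 Oopen O00)).
have O1 (x : V) : ball x0 r1 x -> O (x, x0) by move=> /hr1[].
have hL : C1b (lframe m x0) (dlframe m x0) x0 r1 M.
  split=> x v hx.
  - exact: lframe_derive (O1 x hx).
  - exact: dlframe_cont (O1 x hx).
  - by have [h _] := hr1 x hx; exact: h.
have [P [brP Pbr]] := horizontal_projection ts.
have inv (x a b : V) : ball x0 r1 x -> br a b *m lframe m x0 x =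
    b *m dlframe m x0 x (a *m lframe m x0 x) - a *m dlframe m x0 x (b *m lframe m x0 x).
  by move=> /O1; exact: (lbracket_frame Oopen O00 msm mx0 m0x mA).
have := developing_map r10 hL (lframe_x0 Oopen O00 msm m0x) ts brP Pbr inv.
move=> [psi [A [r2 [/andP[r20 r21] [psi0 A0] hu dpsi psiE]]]].
have Ac : {for x0, continuous A} by have [] := hu x0 (ballxx _ r20).
(* Here [A] is so close to the identity that [psi - id] contracts by 1/2; the local inverse of [psi]
   will come from this. *)
have [r3 /andP[r30 r32] near1] : exists2 r3, 0 < r3 <= r2 & forall x : V, ball x0 r3 x -> n%:R * `|A x - 1%:M| <= 2^-1.
  have n1 : 0 < (n%:R : R) + 1 by rewrite ltr_wpDl.
  have e1 : 0 < 2^-1 / ((n%:R : R) + 1) by rewrite divr_gt0// invr_gt0.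
  have /(@cvgrPdist_le _ _ _ (nbhs x0)) /(_ _ e1) := Ac.
  move=> /(nbhs_ballP x0 _).1[d /= d0 hd].
  exists (Num.min d r2); first by rewrite lt_min d0 r20 ge_min lexx orbT.
  move=> x hx; have /hd : ball x0 d x by apply: le_ball hx; rewrite ge_min lexx.
  rewrite A0 distrC => h; rewrite (le_trans (ler_wpM2l _ h))// mulrCA ler_piMr ?invr_ge0//.
  by rewrite ler_pdivrMr// mul1r lerDl.
have sub32 (x : V) : ball x0 r3 x -> ball x0 r2 x by exact: le_ball.
have [e /andP[e0 e3] he] := local_group_ball r30.
exists psi, r3; split => //.
- rewrite -A0; apply: (frechet_C1 dpsi (ballxx x0 r20)) => //.
- move=> x y hx hy.
  have dg (z v : V) : ball x0 r3 z -> is_derive z v (fun y => psi y - y) (v *m A z - v).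
    by move=> /sub32 hz; apply: (is_deriveB (dpsi z v hz) (is_derive_id z v)).
  have bg (z v : V) : ball x0 r3 z -> `|v *m A z - v| <= 2^-1 * `|v|.
    move=> hz; rewrite -[X in _ - X]mulmx1 -mulmxBr (le_trans (mulmx_norm_le _ _))//.
    by rewrite mulrAC ler_wpM2r// near1.
  have := lipschitz_ball dg bg hx hy.
  by rewrite (_ : psi y - psi x - (y - x) = psi y - y - (psi x - x))//; mx_ring.
exists e; first by rewrite e0.
move=> x y hx hy; have [Oy0 _ Oxy _ mr] := he x y x0 hx hy (ballxx x0 e0); split => //.
pose yt (t : R) : V := x0 + t *: (y - x0).
have yte (t : R) : 0 <= t <= 1 -> ball x0 e (yt t).
  by move=> ht; apply: ball_line => //; exact: ballxx.
pose w : V := y - x0.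
pose v (t : R) : V := w *m invmx (lframe m x0 (yt t)).
have L2 (z : V) : ball x0 e z -> ball x0 r2 z by move=> hz; apply/sub32; apply: le_ball hz.
have dY (t : R) : 0 <= t <= 1 -> is_derive t 1 (fun t => psi (yt t)) (v t + 2^-1 *: br (psi (yt t)) (v t)).
  move=> ht; have hy2 := L2 _ (yte t ht); have [uL _] := hu _ hy2.
  rewrite -psiE// /v mulmxKV//.
  by apply: is_derive_line; exact: dpsi.
(* By equivariance, left translation by [x] does not change the left-invariant velocity [v t] of the
   moving point. *)
have dm (t : R) : 0 <= t <= 1 -> is_derive t 1 (fun t => m (x, yt t)) (v t *m lframe m x0 (m (x, yt t))).
  move=> ht; have hy2 := L2 _ (yte t ht); have [uL _] := hu _ hy2.
  have [Oy _ Oxyt Omy mr3] := he x (yt t) x0 hx (yte t ht) (ballxx x0 e0).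
  have E : v t *m lframe m x0 (m (x, yt t)) = dmul2 m w (x, yt t).
    rewrite (lframeE msm (v t) Omy).
    have heq (a b : V) : ball x0 e a -> ball x0 e b -> [/\ O (a, b), O (x, m (a, b)), O (x, a) & O (m (x, a), b)].
      by move=> ha hb; have [? ? ? ? ?] := he x a b hx ha hb; split.
    rewrite (lfield_equivariant msm mx0 mA (v t) heq e0 (yte t ht)) -(lframeE msm (v t) Oy).
    by rewrite /v mulmxKV.
  rewrite E; exact: (is_derive_line (f := fun y => m (x, y)) (dmul2_derive msm w Oxyt)).
have dZ (t : R) : 0 <= t <= 1 -> is_derive t 1 (fun t => psi (m (x, yt t)))
   (v t + 2^-1 *: br (psi (m (x, yt t))) (v t)).
  move=> ht; have [_ _ _ _ mr3] := he x (yt t) x0 hx (yte t ht) (ballxx x0 e0).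
  have m2 := sub32 _ mr3; have [_ cA] := hu _ m2.
  rewrite -psiE//; apply: (frechet_chain (c := fun t => m (x, yt t))); last exact: dm.
  exact: (frechet_C1 dpsi).
pose D (t : R) : V := bch br (- psi x) (psi (m (x, yt t))) - psi (yt t).
have DE (t : R) : D t = (psi (m (x, yt t)) - psi x - 2^-1 *: br (psi x) (psi (m (x, yt t)))) - psi (yt t).
  by rewrite /D (bch_translate ts) (bblBr ts) (ts_alt ts) subr0.
have dD (t : R) : 0 <= t <= 1 -> is_derive t 1 D (2^-1 *: br (D t) (v t)).
  move=> ht; have z := dZ t ht.
  have hbr := bbl_is_derive ts (is_derive_cst (psi x) t 1) z.
  have := is_deriveB (is_deriveB (is_deriveB z (is_derive_cst (psi x) t 1)) (is_deriveZ (2^-1) hbr)) (dY t ht).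
  rewrite (_ : (_ - _ - _ - _) = D); last by apply/funext => s; rewrite DE.
  move=> h; apply: is_derive_eq h _.
  rewrite DE; exact: (ode_difference ts).
have D0 : D 0 = 0.
  have y00 : yt 0 = x0 by rewrite /yt scale0r addr0.
  rewrite DE y00 psi0 mx0; last by have [] := he x0 x x0 (ballxx _ e0) hx (ballxx _ e0).
  by rewrite (ts_alt ts) scaler0 !subr0 subrr.
(* The derivative of [D] is a bracket, so [P] kills it and [D t *m P] stays 0. But the bracket only
   depends on [D t *m P], so the derivative vanishes and [D] itself is constant. *)
have DP (t : R) : 0 <= t <= 1 -> D t *m P = 0.
  move=> /andP[t0 t1].
  have h : `|D t *m P - D 0 *m P| <= 0 * (t - 0).
    apply: (@mvt_le R _ _ (fun s => D s *m P) (fun s => (2^-1 *: br (D s) (v s)) *m P)) => // s.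
      rewrite in_itv/= => /andP[s0 st]; apply: is_derive_mulmxr; apply: dD.
      by rewrite s0 (le_trans st).
    by rewrite -scalemxAl brP scaler0 normr0.
  by move: h; rewrite mul0r normr_le0 D0 mul0mx subr0 => /eqP.
have D1 : D 1 = 0.
  have h : `|D 1 - D 0| <= 0 * (1 - 0).
    apply: (@mvt_le R _ _ D (fun s => (2^-1 *: br (D s) (v s)))) => // s; rewrite in_itv/= => hs.
    by rewrite -Pbr DP// (bbl0l ts) scaler0 normr0.
  by move: h; rewrite mul0r normr_le0 D0 subr0 => /eqP.
have y1 : yt 1 = y by rewrite /yt scale1r addrC subrK.
move: D1; rewrite /D y1 => /eqP; rewrite subr_eq0 => /eqP <-.
by rewrite (bchNKl ts).
Qed.

End local_homomorphism.

(** * Global exponential coordinates *)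

Section global_exponential.
Context {R : realType} {n : nat} {G : topologicalGroupType}.
Notation V := 'rV[R]_n.
Variables (br : V -> V -> V) (C : R) (E : V -> G) (s : G -> V) (U : set G).
Hypothesis ts : two_step br C.
Hypothesis EM : forall x y, E (bch br x y) = (E x * E y)%g.
Hypothesis U1 : nbhs 1%g U.
Hypothesis sK : forall g, U g -> E (s g) = g.
Hypothesis sM : forall g h, U g -> U h -> s (g * h)%g = bch br (s g) (s h).
Hypothesis Es : \forall x \near (0 : V), s (E x) = x.
Hypothesis Ec : {for 0, continuous E}.

Lemma exp0 : E 0 = 1%g.
Proof.
have := EM 0 0; rewrite (bch0x ts) => /(congr1 (fun z => (E 0)^-1 * z)%g).
by rewrite mulgA mulVg mul1g.
Qed.

Lemma expN x : E (- x) = (E x)^-1%g.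
Proof.
have := EM (- x) x; rewrite (bchNx ts) exp0 => /(congr1 (fun z => z * (E x)^-1)%g).
by rewrite mul1g -mulgA mulgV mulg1.
Qed.

(** Uniform continuity for a map into the group: near each point of the compact square the
    increments lie in [U], and a covering argument gives one mesh for all points. *)
Lemma small_increments (H : R * R -> G) : {within `[0, 1] `*` `[0, 1], continuous H} ->
  exists m0 : nat, forall m : nat, (m0 <= m)%N -> forall p p' : R * R,
    (`[0, 1] `*` `[0, 1]) p -> (`[0, 1] `*` `[0, 1]) p' -> `|p - p'| <= m.+1%:R^-1 ->
    U ((H p)^-1 * H p')%g.
Proof.
set K := (X in {within X, continuous H}) => /subspace_continuousP Hc.
have cK : compact K by apply: compact_setX; exact: segment_compact.
pose P (d : R) (p : R * R) := forall p', K p -> K p' -> `|p - p'| <= d -> U ((H p)^-1 * H p')%g.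
have : \forall d \near (0 : R)^'+, K `<=` P d.
  apply: (compact_near_coveringP K).1 => // p0 Kp0.
  have [N N0 hN] : exists2 N, nbhs (H p0) N & forall a b, N a -> N b -> U (a^-1 * b)%g.
    have c : {for (H p0, H p0), continuous (fun p : G * G => (p.1^-1 * p.2)%g)}.
      apply: (cont_comp (f := fun p : G * G => (p.1^-1%g, p.2)) (g := fun p : G * G => (p.1 * p.2)%g)).
        apply: cont_pair; last exact: cont_snd.
        by apply: (cont_comp (f := fun p : G * G => p.1) (g := fun a => a^-1%g)); [exact: cont_fst|exact: invg_continuous].
      exact: mulg_continuous.
    have [] : nbhs (H p0, H p0) (fun p : G * G => U (p.1^-1 * p.2)%g).
      by apply: (cont_near c); rewrite /= mulVg.
    move=> [A B] /= [hA hB] hAB; exists (A `&` B); first exact: filterI.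
    by move=> a b [Aa _] [_ Bb]; apply: (hAB (a, b)).
  have := Hc _ Kp0 _ N0; rewrite /= /within/= => /(nbhs_ballP p0 _).1[d /= d0 hd].
  have d20 : 0 < d / 2 by rewrite divr_gt0.
  exists (ball p0 (d / 2), [set t | 0 < t < d / 2]) => /=.
    split; first exact: nbhsx_ballx.
    by near=> t; apply/andP; split; near: t; [exact: nbhs_right_gt|exact: nbhs_right_lt].
  move=> [p t] [/= hp /andP[t0 td]] p' Kp Kp' hpp'.
  have hp1 : ball p0 d p by apply: le_ball hp; lra.
  have hp2 : ball p0 d p'.
    rewrite (splitr d); apply: ball_triangle hp _.
    by rewrite -ball_normE /=; apply: le_lt_trans td.
  by apply: hN; [exact: (hd p)|exact: (hd p')].
move=> [e /= e0 he].
have [m0 _ hm0] := near_infty_natSinv_lt (PosNum e0).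
exists m0 => m hm p p' Kp Kp' hp.
have m1 : 0 < (m.+1%:R^-1 : R) by rewrite invr_gt0 ltr0n.
apply: (he m.+1%:R^-1 _ m1) => //.
by rewrite /= sub0r normrN gtr0_norm//; exact: (hm0 m).
Unshelve. all: by end_near. Qed.

Lemma log1 : s 1%g = 0.
Proof. by have := nbhs_singleton Es; rewrite exp0. Qed.

Lemma exp_line_continuous z : continuous (fun t : R => E (t *: z)).
Proof.
move=> t; rewrite (_ : (fun t => _) = fun u => (E (t *: z) * E ((u - t) *: z))%g); last first.
  by apply/funext => u; rewrite -EM (bchZ ts) addrC subrK.
apply: (cont_comp (f := fun u => (E (t *: z), E ((u - t) *: z))) (g := fun p : G * G => (p.1 * p.2)%g)); last first.
  exact: mulg_continuous.
apply: cont_pair; first exact: cont_cst.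
apply: (cont_comp (f := fun u : R => (u - t) *: z)).
  have : {for t, continuous (fun u : R => u - t)} by apply: cont_add; [exact: cvg_id|exact: cont_cst].
  by move=> h; apply: cvgZr_tmp; exact: h.
by rewrite subrr scale0r.
Qed.

(** A path from the identity is cut into increments lying in [U]; each is in the image of [E], and
    the image is closed under products. *)
Lemma exp_surjective g : (exists c : R -> G, [/\ {within `[0, 1], continuous c}, c 0 = 1%g & c 1 = g]) ->
  exists x, E x = g.
Proof.
move=> [c [cc c0 c1]].
(* The path is viewed as a map on the square that ignores the first coordinate, so that
   [small_increments] applies. *)
have cH : {within `[0, 1] `*` `[0, 1], continuous (fun p : R * R => c p.2)}.
  apply/subspace_continuousP => -[a b] [/= ha hb].
  have /subspace_continuousP/(_ b hb) := cc.
  move=> h A /h /(nbhs_ballP b _).1[d /= d0 hd].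
  apply/(nbhs_ballP (a, b) _); exists d => //= -[u v] [/= hu hv] [/= ku kv].
  exact: (hd v).
have [m /(_ m (leqnn _)) hm] := small_increments cH.
have m1 : (0 : R) < m.+1%:R by rewrite ltr0n.
have I j : (j <= m.+1)%N -> exists x, E x = c (j%:R / m.+1%:R).
  elim: j => [|j IH hj]; first by exists 0; rewrite exp0 mul0r c0.
  have [x Ex] := IH (ltnW hj).
  pose pt (j : nat) : R * R := (0, j%:R / m.+1%:R).
  have ptin k : (k <= m.+1)%N -> (`[0, 1] `*` `[0, 1]) (pt k).
    move=> hk; split; rewrite /= in_itv/= ?lexx ?ler01// divr_ge0//=.
    by rewrite ler_pdivrMr// mul1r ler_nat.
  have : U ((c (pt j).2)^-1 * c (pt j.+1).2)%g.
    apply: (hm (pt j) (pt j.+1)); [exact/ptin/ltnW|exact: ptin|].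
    rewrite /= /pt prod_normE/= subrr normr0 -mulrBl -natr1 opprD addrA subrr sub0r mulN1r normrN.
    by rewrite gtr0_norm ?invr_gt0// max_r// invr_ge0 ltW.
  move=> /sK h; exists (bch br x (s ((c (pt j).2)^-1 * c (pt j.+1).2)%g)).
  by rewrite EM h Ex mulgA mulgV mul1g.
by have := I m.+1 (leqnn _); rewrite mulfV ?gt_eqF// c1.
Qed.

(** If [E z = 1], then [t |-> E (t *: z)] is a loop, and it bounds a homotopy. On a fine grid the
    local logarithm multiplies along edges and is consistent around each cell, so the total product
    along a row does not depend on the row. *)
Lemma exp_injective : simply_connected R G -> injective E.
Proof.
move=> [_ sc].
suff ker z : E z = 1%g -> z = 0.
  move=> a b Eab; have := ker (bch br (- a) b); rewrite EM expN Eab mulVg => /(_ erefl) h.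
  by rewrite -(bchNKl ts a b) h (bchx0 ts).
move=> Ez; have cz : continuous (fun t : R => E (t *: z)) by exact: exp_line_continuous.
have [] := sc (fun t => E (t *: z)) (continuous_subspaceT cz).
  by rewrite scale0r exp0 scale1r Ez.
move=> H [cH H0 H1 Hs]; rewrite scale0r exp0 in H1 Hs.
have [m0 hm0] := small_increments cH.
have [d /= d0 hd] := (nbhs_ballP (0 : V) _).1 Es.
have [m1 _ hm1] := near_infty_natSinv_lt (PosNum (divr_gt0 d0 (ltr_wpDl (normr_ge0 z) ltr01))).
pose m := maxn m0 m1; pose M : R := m.+1%:R.
have M0 : 0 < M by rewrite ltr0n.
have hz : ball (0 : V) d (M^-1 *: z).
  rewrite -ball_normE /= sub0r normrN normrZ ger0_norm ?invr_ge0 ?ltW//.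
  have := hm1 m (leq_maxr _ _); rewrite /= ltr_pdivlMr ?ltr_wpDl// -/M.
  by apply: le_lt_trans; apply: ler_wpM2l; [rewrite invr_ge0 ltW|rewrite lerDl].
pose pt (i j : nat) : R * R := (i%:R / M, j%:R / M).
have in01 k : (k <= m.+1)%N -> (k%:R / M) \in `[0, 1].
  by move=> hk; rewrite in_itv/= divr_ge0 ?(ltW M0)//= ler_pdivrMr// mul1r ler_nat.
have ptin i j : (i <= m.+1)%N -> (j <= m.+1)%N -> (`[0, 1] `*` `[0, 1]) (pt i j).
  by move=> hi hj; split; rewrite /=; exact: in01.
have step (k : nat) : `|k%:R / M - k.+1%:R / M| = M^-1.
  rewrite -mulrBl -natr1 opprD addrA subrr sub0r mulN1r normrN.
  by rewrite gtr0_norm// invr_gt0.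
have near1 (k : nat) : `|k%:R / M - k.+1%:R / M| <= M^-1 by rewrite step.
have near0 (k : nat) : `|k%:R / M - k%:R / M| <= M^-1 by rewrite subrr normr0 invr_ge0 ltW.
have Uh i j i' j' : (i <= m.+1)%N -> (j <= m.+1)%N -> (i' <= m.+1)%N -> (j' <= m.+1)%N ->
  `|i%:R / M - i'%:R / M| <= M^-1 -> `|j%:R / M - j'%:R / M| <= M^-1 ->
  U ((H (pt i j))^-1 * H (pt i' j'))%g.
  move=> h1 h2 h3 h4 h5 h6; apply: (hm0 m (leq_maxl _ _)); try exact: ptin.
  by rewrite prod_normE /= ge_max h5 h6.
pose h i j := s ((H (pt i j))^-1 * H (pt i j.+1))%g.
pose v i j := s ((H (pt i j))^-1 * H (pt i.+1 j))%g.
(* Both sides are the logarithm of the increment across the diagonal of one cell. *)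
have hv i j : (i < m.+1)%N -> (j < m.+1)%N -> bch br (h i j) (v i j.+1) = bch br (v i j) (h i.+1 j).
  move=> hi hj; rewrite -!sM.
  - by congr s; rewrite -!mulgA; congr (_ * _)%g; rewrite !mulgA !mulgV.
  - exact: (Uh i j i.+1 j (ltnW hi) (ltnW hj) hi (ltnW hj) (near1 i) (near0 j)).
  - exact: (Uh i.+1 j i.+1 j.+1 hi (ltnW hj) hi hj (near0 i.+1) (near1 j)).
  - exact: (Uh i j i j.+1 (ltnW hi) (ltnW hj) (ltnW hi) hj (near0 i) (near1 j)).
  - exact: (Uh i j.+1 i.+1 j.+1 (ltnW hi) hj hi hj (near1 i) (near0 j.+1)).
(* Product of the logarithms of the first [j] increments of row [i]. Full rows agree because the
   lateral sides are constant; the bottom row gives [z] and the top row 0. *)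
pose P i := fix P j := if j is j'.+1 then bch br (P j') (h i j') else 0.
have HL k : (k <= m.+1)%N -> H (pt k 0) = 1%g.
  by move=> hk; rewrite /pt mul0r; have [] := Hs _ (in01 k hk).
have HR k : (k <= m.+1)%N -> H (pt k m.+1) = 1%g.
  by move=> hk; rewrite /pt mulfV ?gt_eqF//; have [] := Hs _ (in01 k hk).
have HT k : (k <= m.+1)%N -> H (pt m.+1 k) = 1%g.
  by move=> hk; rewrite /pt mulfV ?gt_eqF// H1// in01.
have key i j : (i < m.+1)%N -> (j <= m.+1)%N -> bch br (P i j) (v i j) = P i.+1 j.
  move=> hi; elim: j => [|j IH] hj /=.
    by rewrite /v (HL i (ltnW hi)) (HL i.+1 hi) mulVg log1 (bch0x ts).
  by rewrite -(bchA ts) hv// (bchA ts) IH// ltnW.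
have rows i : (i <= m.+1)%N -> P i m.+1 = P 0%N m.+1.
  elim: i => // i IH hi; rewrite -IH ?(ltnW hi)// -key//.
  by rewrite /v (HR i (ltnW hi)) (HR i.+1 hi) mulVg log1 (bchx0 ts).
have top j : (j <= m.+1)%N -> P m.+1 j = 0.
  elim: j => // j IH hj /=; rewrite IH ?(ltnW hj)// /h (HT j (ltnW hj)) (HT j.+1 hj).
  by rewrite mulVg log1 (bch0x ts).
have bot j : (j <= m.+1)%N -> P 0%N j = (j%:R / M) *: z.
  elim: j => [|j IH] hj /=; first by rewrite mul0r scale0r.
  rewrite IH ?(ltnW hj)// /h /pt mul0r H0 ?in01 ?(ltnW hj)// H0 ?in01//.
  rewrite -expN -EM -scaleNr (bchZ ts) -mulNr -mulrDl -natr1 addrA addNr add0r mul1r.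
  by rewrite (hd _ hz) (bchZ ts) mulrDl mul1r.
by have := bot m.+1 (leqnn _); rewrite -(rows m.+1)// top// mulfV ?gt_eqF// scale1r.
Qed.

End global_exponential.

(** * The chart at the identity as a local group *)

Section chart_at_identity.
Context {R : realType} {n : nat} {G : lieGroup R n}.
Notation V := 'rV[R]_n.
Variable e : chart R n G.
Hypothesis he : chart_at_one e.

Definition chart_mul (p : V * V) : V := chart_map e (chart_inv e p.1 * chart_inv e p.2)%g.
Definition chart_mul_dom : set (V * V) :=
  [set p | [/\ chart_cod e p.1, chart_cod e p.2 & chart_dom e (chart_inv e p.1 * chart_inv e p.2)%g]].
Notation m := chart_mul.
Notation O := chart_mul_dom.
Notation x0 := (chart_map e 1%g).

Lemma chart_cod_inv y : chart_cod e y -> chart_dom e (chart_inv e y) /\ chart_map e (chart_inv e y) = y.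
Proof. by move=> [g hg <-]; rewrite chart_mapK. Qed.

Lemma chart_cod_one : chart_cod e x0.
Proof. by exists 1%g => //; exact: he.2. Qed.

Lemma chart_inv_one : chart_inv e x0 = 1%g.
Proof. by rewrite chart_mapK//; exact: he.2. Qed.

Lemma chart_mul_open p : O p -> nbhs p O.
Proof.
move=> [h1 h2 h3].
have c1 : {for p, continuous (fun p : V * V => p.1)} by exact: cont_fst.
have c2 : {for p, continuous (fun p : V * V => p.2)} by exact: cont_snd.
have n1 : \forall q \near p, chart_cod e q.1.
  by apply: (cont_near c1); apply: open_nbhs_nbhs; split => //; exact: chart_cod_open.
have n2 : \forall q \near p, chart_cod e q.2.
  by apply: (cont_near c2); apply: open_nbhs_nbhs; split => //; exact: chart_cod_open.
have n3 : \forall q \near p, chart_dom e (chart_inv e q.1 * chart_inv e q.2)%g.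
  apply: (cont_near (f := fun q : V * V => (chart_inv e q.1 * chart_inv e q.2)%g)); last first.
    by apply: open_nbhs_nbhs; split => //; exact: chart_dom_open.
  apply: (cont_comp (f := fun q : V * V => (chart_inv e q.1, chart_inv e q.2)) (g := fun p : G * G => (p.1 * p.2)%g)).
    apply: cont_pair.
      by apply: (cont_comp c1); exact: chart_inv_continuous.
    by apply: (cont_comp c2); exact: chart_inv_continuous.
  exact: mulg_continuous.
by apply: filterS2 (filterI n1 n2) n3 => q [? ?] ?; split.
Qed.

Lemma chart_mul_00 : O (x0, x0).
Proof. by split; rewrite /= ?chart_inv_one ?mulg1; [exact: chart_cod_one|exact: chart_cod_one|exact: he.2]. Qed.

Lemma chart_mul_smooth : smooth_on O m.
Proof. exact: (lie_mul_smooth (proj1 he) (proj1 he) (proj1 he)). Qed.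

Lemma chart_mulx0 x : O (x, x0) -> m (x, x0) = x.
Proof. by move=> [/= /chart_cod_inv[_ h] _ _]; rewrite /m/= chart_inv_one mulg1 h. Qed.

Lemma chart_mul0x x : O (x0, x) -> m (x0, x) = x.
Proof. by move=> [/= _ /chart_cod_inv[_ h] _]; rewrite /m/= chart_inv_one mul1g h. Qed.

Lemma chart_mulA x y z : O (x, y) -> O (y, z) -> O (m (x, y), z) -> O (x, m (y, z)) ->
  m (m (x, y), z) = m (x, m (y, z)).
Proof. by move=> [_ _ h1] [_ _ h2] _ _; rewrite /m/= !chart_mapK// mulgA. Qed.

Lemma lie_bracketE : lie_bracket e = lbracket m x0.
Proof.
have L v : left_inv_field e v = lfield m x0 v by [].
apply/funext => u; apply/funext => v.
rewrite /lie_bracket /field_bracket !L !(lfield_x0 chart_mul_open chart_mul_00 chart_mul0x).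
have d a b := lfield_derive chart_mul_open chart_mul_smooth a b chart_mul_00.
by rewrite (derive_val (is_derive := d v u)) (derive_val (is_derive := d u v)).
Qed.

Lemma lie_bracket_bilinear : exists C, bounded_bilinear (lie_bracket e : V -> V -> V) C.
Proof.
rewrite lie_bracketE.
have dl x (s : R) u v := dlfield_linl chart_mul_open chart_mul_smooth x chart_mul_00 s u v.
have dr x (s : R) u v := dlfield_linr chart_mul_smooth x chart_mul_00 s u v.
have cmb (V : lmodType R) (s : R) (a b c d : V) : s *: a + b - (s *: c + d) = s *: (a - c) + (b - d).
  by rewrite scalerBr opprD addrACA.
by apply: bilinear_bounded => s u v w; rewrite /lbracket dl dr; exact: cmb.
Qed.

Lemma lie_bracket_two_step :
  (forall x y z, lie_bracket e (lie_bracket e x y) z = 0) -> exists C, two_step (lie_bracket e) C.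
Proof.
have [C hC] := lie_bracket_bilinear; move=> nil.
by exists C; split => // x; rewrite /lie_bracket /field_bracket subrr.
Qed.

Local Opaque lbracket.

(** Collects what the globalization needs: a local exponential [sigma] inverse to [psi] read in the
    chart, multiplicativity in both directions, and first-order expansions equal to the identity. *)
Lemma chart_exponential C : two_step (lie_bracket e) C ->
  exists (sigma : V -> G) (psi : V -> V) (U : set G) (r : R), [/\ 0 < r,
   (forall x y, `|x| < r -> `|y| < r -> sigma (bch (lie_bracket e) x y) = (sigma x * sigma y)%g),
   nbhs 1%g U /\ (forall g, U g -> [/\ chart_dom e g, `|psi (chart_map e g)| < r & sigma (psi (chart_map e g)) = g]) /\
     (forall g h, U g -> U h -> psi (chart_map e (g * h)%g) =
        bch (lie_bracket e) (psi (chart_map e g)) (psi (chart_map e h))),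
   (forall x, `|x| < r -> chart_dom e (sigma x) /\ psi (chart_map e (sigma x)) = x) /\
     {for 0, continuous sigma} /\ frechet (fun x => chart_map e (sigma x)) 0 1%:M
  & [/\ psi x0 = 0, frechet psi x0 1%:M &
     exists2 d : R, 0 < d & forall x y : V, ball x0 d x -> ball x0 d y -> `|psi y - psi x| <= 2 * `|y - x|]].
Proof.
rewrite lie_bracketE => ts.
have := local_logarithm chart_mul_open chart_mul_00 chart_mul_smooth chart_mulx0 chart_mul0x chart_mulA ts.
move=> [psi [r [r0 psi0 dpsi psiL [r' /andP[r'0 r'r] psiM]]]].
have C0 := bbl_ge0 ts.
have x0r := ballxx x0 r0.
have psiI (x y : V) : ball x0 r x -> ball x0 r y -> psi x = psi y -> x = y.
  move=> hx hy E; have := psiL x y hx hy; rewrite E subrr sub0r normrN => h.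
  apply/eqP; rewrite eq_sym -subr_eq0 -normr_eq0; apply/eqP.
  by have := normr_ge0 (y - x); lra.
have psiB (y : V) : ball x0 r y -> `|y - x0| <= 2 * `|psi y|.
  move=> hy; have := psiL x0 y x0r hy; rewrite psi0 subr0 => h.
  have : `|y - x0| <= `|psi y - (y - x0)| + `|psi y|.
    by rewrite -[X in `|X| <= _](subKr (psi y)) (le_trans (ler_normB _ _))// addrC.
  lra.
have psiD (x y : V) : ball x0 r x -> ball x0 r y -> `|psi y - psi x| <= 2 * `|y - x|.
  move=> hx hy; have h := psiL x y hx hy.
  have : `|psi y - psi x| <= `|psi y - psi x - (y - x)| + `|y - x|.
    by rewrite -[X in `|X| <= _](subrK (y - x)) ler_normD.
  by have := normr_ge0 (y - x); lra.
(* [tau] inverts [psi] on the ball of radius [r / 4]; the value 0 elsewhere is arbitrary. *)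
have [tau htau] : {tau : V -> V & forall z : V, `|z| < r / 4 -> [/\ ball x0 r (tau z), psi (tau z) = z & `|tau z - x0| <= 2 * `|z|]}.
  have /choice[f hf] : forall z : V, exists y : V, `|z| < r / 4 -> [/\ ball x0 r y, psi y = z & `|y - x0| <= 2 * `|z|].
    move=> z; have [hz|hz] := ltP `|z| (r / 4); last by exists 0.
    have [|y hy yz] := near_identity_surjective r0 psiL (z := z); first by rewrite psi0 subr0.
    have yr : ball x0 r y by rewrite -ball_normE /= distrC (le_lt_trans hy)//; lra.
    by exists y => _; split => //; rewrite -yz; exact: psiB.
  by exists f.
(* By [bch_norm] and [r1 <= 1], the product of two vectors shorter than [r1] is shorter than
   [r1 * (2 + C)], hence in the domain of [tau]. The comparison with [r' / 4] puts [tau] in the ball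
   where [psi] is multiplicative. *)
pose r1 := Num.min 1 (Num.min (r / 4) (r' / 4) / (2 + C)).
have C2 : 0 < 2 + C by lra.
have r10 : 0 < r1 by rewrite lt_min ltr01 divr_gt0// lt_min !divr_gt0.
have r11 : r1 <= 1 by rewrite ge_min lexx.
have r1q : r1 * (2 + C) <= Num.min (r / 4) (r' / 4).
  by rewrite -ler_pdivlMr// ge_min lexx orbT.
have r1r : r1 * (2 + C) <= r / 4 by rewrite (le_trans r1q)// ge_min lexx.
have r1r' : r1 * (2 + C) <= r' / 4 by rewrite (le_trans r1q)// ge_min lexx orbT.
have r12 : r1 + r1 <= r1 * (2 + C) by rewrite mulrDr mulr_natr mulr2n lerDl mulr_ge0// ltW.
have tauS (z : V) : `|z| < r1 -> [/\ ball x0 r' (tau z), psi (tau z) = z & `|tau z - x0| <= 2 * `|z|].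
  move=> hz; have [|_ h1 h2] := htau z; first by lra.
  by split => //; rewrite -ball_normE /= distrC (le_lt_trans h2)//; lra.
have sub (x : V) : ball x0 r' x -> ball x0 r x by exact: le_ball.
have x0r' := ballxx x0 r'0.
have cod (x : V) : ball x0 r' x -> chart_cod e x by move=> hx; have [[]] := psiM x x0 hx x0r'.
pose sigma z := chart_inv e (tau z).
(* [psi] is 2-Lipschitz, so [rho * 2 < r1] sends the ball of radius [rho] into the domain of
   [sigma]. *)
have [rho /andP[rho0 rhor'] hrho] : exists2 rho : R, 0 < rho <= r' & rho * 2 < r1.
  exists (Num.min r' (r1 / 4)); first by rewrite lt_min r'0 divr_gt0//= ge_min lexx.
  have : Num.min r' (r1 / 4) <= r1 / 4 by rewrite ge_min lexx orbT.
  lra.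
have subrho (x : V) : ball x0 rho x -> ball x0 r' x by exact: le_ball.
pose U : set G := [set g | chart_dom e g /\ ball x0 rho (chart_map e g)].
have tau0 : tau 0 = x0.
  have [|h1 h2 _] := htau 0; first by rewrite normr0 divr_gt0.
  by apply: psiI => //; rewrite h2 psi0.
(* The inverse inherits the expansion of [psi] at [x0]; [eps / 2] makes up for the factor in
   [|tau z - x0| <= 2 * |z|]. *)
have tauc : forall eps : R, 0 < eps -> \forall z \near (0 : V), `|tau z - x0 - z| <= eps * `|z|.
  move=> eps eps0; have e20 : 0 < eps / 2 by lra.
  have [d /= d0 hd] := (nbhs_ballP x0 _).1 (dpsi (eps / 2) e20).
  pose d1 := Num.min r1 (d / 2).
  have d10 : 0 < d1 by rewrite lt_min r10 divr_gt0.
  apply: filterS (nbhsx_ballx (0 : V) d1 d10) => z.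
  rewrite -ball_normE /= sub0r normrN lt_min => /andP[zr zd].
  have [h1 h2 h3] := tauS z zr.
  have : ball x0 d (tau z) by rewrite -ball_normE /= distrC (le_lt_trans h3)//; lra.
  move=> /hd; rewrite h2 psi0 subr0 mulmx1 distrC => h4; rewrite (le_trans h4)//.
  have := ler_wpM2l (ltW e20) h3; lra.
exists sigma, psi, U, r1; split => //.
- move=> x y hx hy; have [tx px _] := tauS x hx; have [ty py _] := tauS y hy.
  have [[_ _ /= dxy] mr pm] := psiM _ _ tx ty.
  have [|tb pb _] := htau (bch (lbracket m x0) x y).
    rewrite (le_lt_trans (bch_norm ts x y))//.
    have h1 : `|x| + `|y| < r1 + r1 by rewrite ltrD.
    have h2 : C * `|x| * `|y| <= C * r1.
      by rewrite -mulrA ler_wpM2l// (le_trans (ler_wpM2l _ (ltW hy)))// ler_piMl// ?ltW//; lra.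
    by move: r1r; rewrite mulrDr (mulrC r1 C); lra.
  rewrite /sigma (_ : tau (bch _ _ _) = m (tau x, tau y)); last first.
    by apply: (psiI _ _ tb mr); rewrite pb pm px py; reflexivity.
  by rewrite /m/= chart_mapK.
- split; [|split].
  + have nd : nbhs 1%g (chart_dom e) by apply: open_nbhs_nbhs; split; [exact: chart_dom_open|exact: he.2].
    apply: filterI => //; apply: (cont_near (f := chart_map e)); last exact: nbhsx_ballx.
    by apply: chart_map_continuous; exact: he.2.
  + move=> g [dg hg]; have hr' := subrho _ hg.
    have hs : `|psi (chart_map e g)| < r1.
      have := psiD x0 _ x0r (sub _ hr'); rewrite psi0 subr0 => h; rewrite (le_lt_trans h)//.
      by move: hg; rewrite -ball_normE /= distrC => hg; lra.
    split => //; rewrite /sigma (_ : tau _ = chart_map e g) ?chart_mapK//.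
    by have [h1 h2 _] := tauS _ hs; apply: psiI; rewrite ?h2//; exact: sub.
  + move=> g h [dg hg] [dh hh]; have [_ _ <-] := psiM _ _ (subrho _ hg) (subrho _ hh).
    by rewrite /m/= !chart_mapK.
- split; [|split].
  + move=> x hx; have [h1 h2 _] := tauS x hx; have [d1 E1] := chart_cod_inv (cod _ h1).
    by rewrite /sigma E1.
  + have tc : {for 0, continuous tau}.
      apply/(@cvgrPdist_le _ _ _ (nbhs (0 : V))) => eps eps0; rewrite tau0.
      apply: filterS2 (tauc 1 ltr01) (nbhsx_ballx (0 : V) (eps / 2) _) => [z h1|]; last by lra.
      rewrite -ball_normE /= sub0r normrN => h2; rewrite distrC.
      have : `|tau z - x0| <= `|tau z - x0 - z| + `|z| by rewrite -[X in `|X| <= _](subrK z) ler_normD.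
      lra.
    apply: (cont_comp tc); rewrite tau0; apply: chart_inv_continuous; exact: chart_cod_one.
  + move=> eps eps0; apply: filterS2 (tauc eps eps0) (nbhsx_ballx (0 : V) r1 r10) => z h1.
    rewrite -ball_normE /= sub0r normrN => hz; have [h2 _ _] := tauS z hz.
    have [_ E1] := chart_cod_inv (cod _ h2).
    by rewrite /sigma E1 tau0 chart_inv_one mulmx1 subr0.
- by split => //; exists r.
Qed.

End chart_at_identity.

(** * Comparison of an inner product with the sup norm *)

Section inner_product.
Context {R : realType} {n : nat} (q : {dot 'rV[R]_n for idfun}).
Notation V := 'rV[R]_n.

Lemma dotDl (s : R) (u v w : V) : q (s *: u + v) w = s * q u w + q v w.
Proof. by rewrite linearDl linearZl_LR. Qed.

Lemma dotDr (s : R) (u v w : V) : q w (s *: u + v) = s * q w u + q w v.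
Proof. by rewrite linearDr linearZr. Qed.

Lemma dotC (u v : V) : q u v = q v u.
Proof. by rewrite hermC /= expr0 mul1r. Qed.

Lemma dot_bounded : exists K, bounded_bilinear (fun u v : V => q u v : R) K.
Proof.
pose K := \sum_i \sum_j `|q (delta_mx 0 i) (delta_mx 0 j)|.
exists K; split.
- by move=> x y z; have := dotDl 1 x y z; rewrite scale1r mul1r.
- by move=> x y z; have := dotDr 1 y z x; rewrite scale1r mul1r.
- by move=> a x y; exact: linearZl_LR.
- by move=> a x y; exact: linearZr.
- by apply: sumr_ge0 => i _; apply: sumr_ge0.
have ql (w u v : V) : q (u + v) w = q u w + q v w by rewrite linearDl.
have qr (w u v : V) : q w (u + v) = q w u + q w v by rewrite linearDr.
have q0l (w : V) : q 0 w = 0 by have := dotDl (-1) 0 0 w; rewrite scaler0 addr0 mulN1r addNr.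
have q0r (w : V) : q w 0 = 0 by have := dotDr (-1) 0 0 w; rewrite scaler0 addr0 mulN1r addNr.
move=> x y; rewrite mulrAC [leRHS]mulrAC {1}[x]row_sum_delta (big_morph _ (ql y) (q0l y)) !mulr_suml.
rewrite (le_trans (ler_norm_sum _ _ _))//; apply: ler_sum => i _.
rewrite {1}[y]row_sum_delta (big_morph _ (qr _) (q0r _)) !mulr_suml.
rewrite (le_trans (ler_norm_sum _ _ _))//; apply: ler_sum => j _.
rewrite linearZl_LR linearZr /= !normrM mulrA [leRHS]mulrC.
rewrite [leRHS]mulrCA [leRHS]mulrC (mulrC `|y| `|x|).
by apply: ler_wpM2r => //; apply: ler_pM => //; exact: mx_norm_coord.
Qed.

Definition dotn (u : V) : R := Num.sqrt (q u u).

Lemma dot_ge0 u : 0 <= q u u.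
Proof. by have [->|/neq0_dnorm_gt0/ltW//] := eqVneq u 0; rewrite linear0l. Qed.

Lemma dotn_le : exists2 K : R, 0 <= K & forall u, dotn u <= K * `|u|.
Proof.
have [K hK] := dot_bounded; have K0 := bbl_ge0 hK.
exists (Num.sqrt K); first by rewrite sqrtr_ge0.
move=> u; rewrite -[`|u|]ger0_norm// -sqrtr_sqr -sqrtrM//; apply: ler_wsqrtr.
by rewrite (le_trans (ler_norm _))// (le_trans (bbl_le hK u u))// -mulrA.
Qed.

(** The inner product attains a positive minimum on the compact unit sphere. When the sphere is
    empty every vector is 0 and any constant works. *)
Lemma dotn_ge : exists2 K : R, 0 < K & forall u, `|u| <= K * dotn u.
Proof.
pose S := [set u : V | `|u| = 1].
have [[u0 Su0]|S0] := pselect (S !=set0); last first.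
  exists 1 => // u; have [->|u0] := eqVneq u 0.
    by rewrite normr0 mul1r sqrtr_ge0.
  by exfalso; apply: S0; exists (`|u|^-1 *: u); rewrite /S/= normrZ normfV normr_id mulVf// normr_eq0.
have cS : compact S.
  apply: bounded_closed_compact.
    by exists 1; split => // M M1 u /= ->; exact: ltW.
  rewrite (_ : S = (fun u : V => `|u|) @^-1` [set 1])//; apply: closed_comp; last exact: closed_eq.
  by move=> u _; exact: norm_continuous.
have [K hK] := dot_bounded.
have qc : continuous (fun u : V => q u u : R).
  by move=> u; apply: (cont_bbl hK); exact: cvg_id.
have [|c] := compact_EVT_min (ex_intro _ u0 Su0) cS (f := fun u : V => q u u : R).
  exact: continuous_subspaceT.
rewrite inE => Sc hc.
have c0 : c != 0 by apply/eqP => c0; move: Sc; rewrite /S/= c0 normr0 => /eqP; rewrite eq_sym oner_eq0.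
have qc0 : 0 < dotn c by rewrite sqrtr_gt0; exact: neq0_dnorm_gt0.
exists (dotn c)^-1; first by rewrite invr_gt0.
move=> u; rewrite mulrC ler_pdivlMr// mulrC.
have [->|u0'] := eqVneq u 0; first by rewrite normr0 mulr0 sqrtr_ge0.
have nu : 0 < `|u| by rewrite normr_gt0.
have uS : `|u|^-1 *: u \in S by rewrite inE /S/= normrZ normfV normr_id mulVf// gt_eqF.
have := hc _ uS; rewrite linearZl_LR linearZr /= mulrA -expr2 => h.
rewrite -[`|u|]ger0_norm// -sqrtr_sqr -sqrtrM ?dot_ge0//; apply: ler_wsqrtr.
by move: h; rewrite exprVn mulrC ler_pdivlMr ?exprn_gt0.
Qed.

End inner_product.

Section smooth_lipschitz.
Context {R : realType} {n m : nat}.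

Lemma C1_locally_lipschitz (f : 'rV[R]_n -> 'rV[R]_m) (df : 'rV[R]_n -> 'rV[R]_n -> 'rV[R]_m) (x : 'rV[R]_n) :
  (\forall y \near x, forall v, is_derive y v f (df v y)) ->
  (\forall y \near x, forall (s : R) u v, df (s *: u + v) y = s *: df u y + df v y) ->
  (forall v, {for x, continuous (df v)}) ->
  exists M, exists2 d : R, 0 < d & forall y z : 'rV[R]_n, ball x d y -> ball x d z -> `|f z - f y| <= M * `|z - y|.
Proof.
move=> fd dl dc.
have h : \forall y \near x, forall i : 'I_n, `|df (delta_mx 0 i) y| <= `|df (delta_mx 0 i) x| + 1.
  apply: near_forall => i.
  have /(@cvgrPdist_le _ _ _ (nbhs x)) /(_ _ ltr01) := dc (delta_mx 0 i).
  apply: filterS => y; set A := df _ x; set B := df _ y => hx.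
  have -> : B = A - (A - B) by rewrite opprB addrC subrK.
  by rewrite (le_trans (ler_normB _ _))// lerD2l.
have [d /= d0 hd] := (nbhs_ballP x _).1 (filterI fd (filterI dl h)).
exists (\sum_i (`|df (delta_mx 0 i) x| + 1)), d => // y z hy hz.
apply: (lipschitz_ball (df := fun y v => df v y) _ _ hy hz).
  by move=> w v hw; have [h1 _] := hd w hw; exact: h1.
move=> w v hw; have [_ [h1 h2]] := hd w hw.
exact: (row_norm_delta (f := fun v => df v w)).
Qed.

End smooth_lipschitz.

Section continuity.
Context {R : realType} {n : nat} {T : topologicalType}.
Notation V := 'rV[R]_n.

Lemma cont_scale (k : R) (f : T -> V) x : {for x, continuous f} -> {for x, continuous (fun y => k *: f y)}.
Proof. by move=> hf; apply: cvgZl_tmp. Qed.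

Lemma bch_cont (br : V -> V -> V) C (f g : T -> V) x : two_step br C ->
  {for x, continuous f} -> {for x, continuous g} -> {for x, continuous (fun y => bch br (f y) (g y))}.
Proof.
move=> ts hf hg; apply: cont_add; first exact: cont_add.
have h := cont_bbl ts hf hg.
by apply: cont_scale; exact: h.
Qed.

Lemma bch_diff_norm (br : V -> V -> V) C u v : two_step br C ->
  `|bch br (- u) v| <= (1 + 2^-1 * (C * `|u|)) * `|v - u|.
Proof.
move=> ts; rewrite (bch_translate ts) mulrDl mul1r (le_trans (ler_normB _ _))// lerD2l.
by rewrite normrZ ger0_norm ?invr_ge0// -mulrA ler_wpM2l ?invr_ge0// (bbl_le ts).
Qed.

Lemma derive_scale (f : R^o -> V) (v s : R) : differentiable f s -> 'D_v f s = v *: 'D_1 f s.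
Proof.
move=> df; rewrite !deriveE//; have <- : 'd f s (v *: (1 : R^o)) = v *: 'd f s 1 by rewrite linearZ.
by congr ('d f s _); rewrite -[RHS]/(v * 1) mulr1.
Qed.

End continuity.

(** * Curves and distances in exponential coordinates *)

Section exponential_coordinates.
Context {R : realType} {n : nat} {G : lieGroup R n}.
Notation V := 'rV[R]_n.
Variables (e : chart R n G) (br : V -> V -> V) (C : R) (E : V -> G) (lg : G -> V) (psi : V -> V).
Hypothesis ts : two_step br C.
Hypothesis EM : forall x y, E (bch br x y) = (E x * E y)%g.
Hypothesis EK : cancel E lg.
Hypothesis lgK : cancel lg E.
Hypothesis kd : \forall x \near (0 : V), chart_dom e (E x).
Hypothesis kf : frechet (fun x => chart_map e (E x)) 0 1%:M.
Hypothesis Ec : {for 0, continuous E}.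
Hypothesis lgpsi : \forall g \near (1%g : G), chart_dom e g /\ lg g = psi (chart_map e g).
Hypothesis psi0 : psi (chart_map e 1%g) = 0.
Hypothesis psif : frechet psi (chart_map e 1%g) 1%:M.
Hypothesis psil : exists2 d : R, 0 < d & forall x y : V,
  ball (chart_map e 1%g) d x -> ball (chart_map e 1%g) d y -> `|psi y - psi x| <= 2 * `|y - x|.

(** Left translation to the identity of the tangent vector [v] at [x], for the product [bch]: the
    derivative of [bch (- x)] at [x]. *)
Definition tframe (x v : V) : V := v - 2^-1 *: br x v.

Lemma tframe0 x : tframe x 0 = 0.
Proof. by rewrite /tframe (bbl0r ts) scaler0 subr0. Qed.

Lemma E0 : E 0 = 1%g. Proof. exact: exp0 ts EM. Qed.

Lemma bchN_derive (x : R -> V) (t : R) (w : V) : is_derive t 1 x w ->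
  is_derive t 1 (fun s => bch br (- x t) (x s)) (tframe (x t) w).
Proof.
move=> dx.
rewrite (_ : (fun s => _) = fun s => (x s - x t) - 2^-1 *: br (x t) (x s - x t)); last first.
  by apply/funext => s; rewrite (bch_translate ts).
have d1 : is_derive t 1 (fun s => x s - x t) w.
  by apply: is_derive_eq (is_deriveB dx (is_derive_cst (x t) t 1)) _; rewrite subr0.
have d2 := bbl_is_derive ts (is_derive_cst (x t) t 1) d1.
apply: is_derive_eq (is_deriveB d1 (is_deriveZ 2^-1 d2)) _.
by rewrite (bbl0l ts) add0r.
Qed.

(** If the translated curve is differentiable in the chart, applying [psi] shows that [x] is
    differentiable. The two curves are thus non-differentiable together, and then both derivatives
    take the default value 0. *)
Lemma velocity_exp (x : R -> V) (t : R) : {for t, continuous x} ->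
  velocity e (fun s => E (x s)) t = tframe (x t) (derive1 x t).
Proof.
move=> xc; pose y s := bch br (- x t) (x s).
have y0 : y t = 0 by rewrite /y (bchNx ts).
have yE s : ((E (x t))^-1 * E (x s))%g = E (y s) by rewrite EM (expN ts EM).
rewrite /velocity; under eq_fun do rewrite yE.
have K0 : chart_map e (E (y t)) = chart_map e 1%g by rewrite y0 E0.
have [dx|ndx] := pselect (derivable x t 1).
  have h := bchN_derive (derivableP dx).
  have h2 : is_derive t 1 (fun s => chart_map e (E (y s))) (tframe (x t) ('D_1 x t) *m 1%:M).
    have kfy : frechet (fun z => chart_map e (E z)) (y t) 1%:M by rewrite y0.
    exact: (frechet_chain kfy h).
  by rewrite !derive1E (derive_val (is_derive := h2)) mulmx1.
have yc : {for t, continuous y}.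
  have h0 : {for t, continuous (fun _ : R => - x t)} by exact: cont_cst.
  exact: (bch_cont ts h0 xc).
have nE : ~ derivable (fun s => chart_map e (E (y s))) t 1.
  move=> dE; apply: ndx.
  have h := frechet_chain (f := psi) (c := fun s => chart_map e (E (y s))) (t := t).
  rewrite K0 in h; have {}h := h _ _ psif (derivableP dE).
  have nz : \forall s \near t, psi (chart_map e (E (y s))) = y s.
    have : \forall s \near t, chart_dom e (E (y s)) /\ lg (E (y s)) = psi (chart_map e (E (y s))).
      have Eyc : {for t, continuous (fun s => E (y s))} by apply: (cont_comp yc); rewrite y0.
      by apply: (cont_near Eyc (P := fun g => chart_dom e g /\ lg g = psi (chart_map e g))); rewrite y0 E0.
    by apply: filterS => s [_ <-]; rewrite EK.
  have dy := near_eq_is_derive nz h.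
  have dx : is_derive t 1 (fun s => bch br (x t) (y s)) ('D_1 (fun s => chart_map e (E (y s))) t *m 1%:M +
      2^-1 *: br (x t) ('D_1 (fun s => chart_map e (E (y s))) t *m 1%:M)).
    have h1 := is_deriveD (is_deriveD (is_derive_cst (x t) t 1) dy)
      (is_deriveZ 2^-1 (bbl_is_derive ts (is_derive_cst (x t) t 1) dy)).
    by apply: is_derive_eq h1 _; rewrite add0r (bbl0l ts) add0r.
  rewrite (_ : (fun s => _) = x) in dx; last by apply/funext => s; rewrite (bchNKl ts).
  by case: dx.
have pt f : ~ derivable f t (1 : R) -> derive1 f t = 0 :> V.
  move=> nf; rewrite derive1E; apply: etrans (dvgP nf) _.
  by apply/rowP => i; rewrite !mxE.
by rewrite (pt _ nE) (pt _ ndx) tframe0.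
Qed.

Hypothesis he : chart_at_one e.
Notation x0 := (chart_map e 1%g).

Lemma exp_line_group (x u : V) (s t : R) :
  E (bch br x (t *: u)) = (E (bch br x (s *: u)) * E ((t - s) *: u))%g.
Proof. by rewrite -EM -(bchA ts) (bchZ ts) addrC subrK. Qed.

Lemma exp_increment_derive (t : R) (u : V) :
  is_derive t 1 (fun s => chart_map e (E ((s - t) *: u))) u.
Proof.
have h : is_derive t 1 (fun s => (s - t) *: u) u.
  have := is_derive_line (f := fun z : V => z) (is_derive_id (- (t *: u) + t *: u) u).
  by rewrite (_ : (fun s : R => - (t *: u) + s *: u) = fun s => (s - t) *: u)//;
    apply/funext => s; rewrite scalerBl addrC.
have k0 : frechet (fun z => chart_map e (E z)) ((t - t) *: u) 1%:M by rewrite subrr scale0r.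
by have := frechet_chain k0 h; rewrite mulmx1.
Qed.

Definition chart_mulr (a : chart R n G) (p : V * V) : V := chart_map a (chart_inv a p.1 * chart_inv e p.2)%g.

(** Near time [t] the curve is its value at [t] times a short one-parameter piece, so in any chart
    [a] it is the smooth product of a fixed point of [a] with a curve in [e]. *)
Lemma exp_line_derive (a : chart R n G) (x u : V) (t : R) : lie_atlas a ->
  chart_dom a (E (bch br x (t *: u))) ->
  is_derive t 1 (fun s => chart_map a (E (bch br x (s *: u))))
    ('D_(0, u) (chart_mulr a) (chart_map a (E (bch br x (t *: u))), x0)).
Proof.
move=> aa da; set c := fun s => E (bch br x (s *: u)).
pose y0 := chart_map a (c t).
have cmd : differentiable (chart_mulr a) (y0, x0).
  have [h _] := lie_mul_smooth aa (proj1 he) aa 1; apply: h; split => /=.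
  - by exists (c t).
  - exact: chart_cod_one.
  - by rewrite /y0 chart_mapK// chart_inv_one// mulg1.
have dg := is_derive_pair (is_derive_cst y0 t 1) (exp_increment_derive t u).
have cmd' : differentiable (chart_mulr a) (cst y0 t, chart_map e (E ((t - t) *: u))).
  by rewrite subrr scale0r E0.
have := is_derive_diff_comp dg cmd'.
rewrite (_ : (cst y0 t, chart_map e (E ((t - t) *: u))) = (y0, x0)); last by rewrite subrr scale0r E0.
rewrite -deriveE// => h.
apply: near_eq_is_derive h.
have n1 : \forall s \near t, chart_dom e (E ((s - t) *: u)).
  have tc : {for t, continuous (fun s : R => (s - t) *: u)}.
    by apply: cvgZr_tmp; apply: cvgB; [exact: cvg_id|exact: cvg_cst].
  by apply: (cont_near tc (P := fun z => chart_dom e (E z))); rewrite subrr scale0r.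
apply: filterS n1 => s ds.
by rewrite /chart_mulr /= chart_mapK// /y0 chart_mapK// /c -exp_line_group.
Qed.

Lemma exp_line_C1 (x u : V) : C1_curve (fun s : R => E (bch br x (s *: u))).
Proof.
have cc : continuous (fun s : R => E (bch br x (s *: u))).
  rewrite (_ : (fun s => _) = fun s => (E x * E (s *: u))%g); last first.
    by apply/funext => s; rewrite EM.
  move=> s; apply: (cont_comp (f := fun s : R => (E x, E (s *: u))) (g := fun p : G * G => (p.1 * p.2)%g)).
    by apply: cont_pair; [exact: cont_cst|exact: (exp_line_continuous ts EM Ec)].
  exact: mulg_continuous.
split => // a aa; set c := fun s => E (bch br x (s *: u)).
have dc (t : R) : chart_dom a (c t) -> is_derive t 1 (chart_map a \o c) ('D_(0, u) (chart_mulr a) (chart_map a (c t), x0)).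
  by move=> da; exact: exp_line_derive.
split => [t /dc h|v t dt].
  by apply/derivable1_diffP; case: h.
have E1 : \forall s \near t, v *: 'D_(0, u) (chart_mulr a) (chart_map a (c s), x0) = 'D_v (chart_map a \o c : R^o -> V) s.
  have : \forall s \near t, chart_dom a (c s).
    by apply: (cont_near (cc t)); apply: open_nbhs_nbhs; split => //; exact: chart_dom_open.
  apply: filterS => s /dc h; have ds : differentiable (chart_map a \o c : R^o -> V) s.
    by apply/derivable1_diffP; case: h.
  by rewrite (derive_scale _ ds) (derive_val (is_derive := h)).
apply: (cont_near_eq E1); apply: cont_scale.
have [_ h] := lie_mul_smooth aa (proj1 he) aa 1.
apply: (cont_comp (f := fun s => (chart_map a (c s), x0)) (g := fun p => 'D_(0, u) (chart_mulr a) p)).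
  apply: cont_pair; last exact: cont_cst.
  apply: (cont_comp (cc t)); exact: chart_map_continuous.
apply: h; split => /=.
- by exists (c t).
- exact: chart_cod_one.
- by rewrite chart_mapK// chart_inv_one// mulg1.
Qed.

(** The competitor is a left translate of the one-parameter subgroup through [u]; its speed is
    constantly [dotn q u]. *)
Lemma exp_dist_le (q : {dot V for idfun}) : exists2 K : R, 0 <= K & forall x y : V,
  (riem_dist e q (E x) (E y) <= (K * `|bch br (- x) y|)%:E)%E.
Proof.
have [K K0 hK] := dotn_le q; exists K => // x y.
set u := bch br (- x) y; pose c (s : R) := E (bch br x (s *: u)).
apply: (@le_trans _ _ (curve_length e q 0 1 c)).
  apply: ereal_inf_lbound; exists c => //.
  split; [exact: exp_line_C1|by rewrite /c scale0r (bchx0 ts)|].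
  by rewrite /c scale1r (bchNKl ts).
have sp s : speed e q c s = dotn q u.
  rewrite /speed /dotn (_ : velocity e c s = u)//.
  have cE t : ((c s)^-1 * c t)%g = E ((t - s) *: u).
    by rewrite /c (exp_line_group x u s t) mulgA mulVg mul1g.
  rewrite /velocity; under eq_fun do rewrite cE.
  by rewrite derive1E (derive_val (is_derive := exp_increment_derive s u)).
rewrite /curve_length (eq_integral (cst (dotn q u)%:E)) => [|t _]; last by rewrite sp.
rewrite integral_cst//= lebesgue_measure_itv/= lte_fin ltr01 oppr0 adde0 mule1 lee_fin.
exact: hK.
Qed.

Lemma lgM g h : lg (g * h)%g = bch br (lg g) (lg h).
Proof. by rewrite -{1}(lgK g) -{1}(lgK h) -EM EK. Qed.

Lemma bch_left_invariant (a u v : V) : bch br (- bch br a u) (bch br a v) = bch br (- u) v.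
Proof. by rewrite (bchN ts) -(bchA ts) (bchKl ts). Qed.

(** Translating by the inverse of [c t] brings nearby points into the domain of [psi]. The product
    read from a chart [b] at that inverse and a chart [a] at [c t] into [e] is smooth, hence locally
    Lipschitz; left invariance then gives all pairs of nearby times. *)
Lemma C1_log_lipschitz (c : R -> G) (t : R) : C1_curve c ->
  exists M, exists2 d : R, 0 < d & forall s s' : R, ball t d s -> ball t d s' ->
    `|bch br (- lg (c s)) (lg (c s'))| <= M * `|s' - s|.
Proof.
move=> [cc cC1]; have [atl _] := lie_atlas_smooth G.
have [a aa da] := atl (c t); have [b ab db] := atl (c t)^-1%g.
pose m p := chart_map e (chart_inv b p.1 * chart_inv a p.2)%g.
pose yb := chart_map b (c t)^-1%g; pose wa := chart_map a (c t).
pose Ob := [set p : V * V | [/\ chart_cod b p.1, chart_cod a p.2 & chart_dom e (chart_inv b p.1 * chart_inv a p.2)%g]].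
have msm : smooth_on Ob m := lie_mul_smooth ab aa (proj1 he).
have wain : chart_cod a wa by exists (c t).
have iyb : chart_inv b yb = (c t)^-1%g by rewrite chart_mapK.
have iwa : chart_inv a wa = c t by rewrite chart_mapK.
have nO : \forall w \near wa, Ob (yb, w).
  have n1 : \forall w \near wa, chart_cod a w.
    by apply: open_nbhs_nbhs; split => //; exact: chart_cod_open.
  have n2 : \forall w \near wa, chart_dom e (chart_inv b yb * chart_inv a w)%g.
    have c1 : {for wa, continuous (fun w => (chart_inv b yb * chart_inv a w)%g)}.
      apply: (cont_comp (f := fun w => (chart_inv b yb, chart_inv a w)) (g := fun p : G * G => (p.1 * p.2)%g)).
        by apply: cont_pair; [exact: cont_cst|exact: chart_inv_continuous].
      exact: mulg_continuous.
    apply: (cont_near c1); rewrite iyb iwa mulVg.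
    by apply: open_nbhs_nbhs; split; [exact: chart_dom_open|exact: he.2].
  by apply: filterS2 n1 n2 => w h1 h2; split => //; exists (c t)^-1%g.
have [M1 [d1 d10 hM1]] : exists M, exists2 d : R, 0 < d & forall y z : V,
    ball wa d y -> ball wa d z -> `|m (yb, z) - m (yb, y)| <= M * `|z - y|.
  have [md mc] := msm 1.
  apply: (C1_locally_lipschitz (f := fun w => m (yb, w)) (df := fun v w => 'D_(0, v) m (yb, w))).
  - apply: filterS nO => w Ow v.
    by apply/derive_slice2/derivableP/diff_derivable; exact: md.
  - apply: filterS nO => w Ow s u v; rewrite !deriveE; try exact: md.
    rewrite (_ : (0, s *: u + v) = s *: (0, u) + (0, v) :> V * V) ?linearP//.
    by congr pair; rewrite /= scaler0 addr0.
  - move=> v; apply: (cont_comp (f := fun w => (yb, w)) (g := fun p => 'D_(0, v) m p)).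
      by apply: cont_pair; [exact: cont_cst|].
    by apply: mc; exact: nbhs_singleton nO.
have [kdf kc] := cC1 a aa.
pose k : R^o -> V := chart_map a \o c.
have nda : \forall s \near t, chart_dom a (c s).
  by apply: (cont_near (cc t)); apply: open_nbhs_nbhs; split => //; exact: chart_dom_open.
have kct : {for t, continuous k}.
  by apply: (cont_comp (cc t)); exact: chart_map_continuous.
pose B := `|'D_1 k t| + 1.
have nB : \forall s \near t, `|'D_1 k s| <= B.
  have /(@cvgrPdist_le _ _ _ (nbhs t)) /(_ _ ltr01) := kc 1 t da.
  apply: filterS => s; set A := 'D_1 _ t; set D := 'D_1 _ s => hx.
  rewrite /B -/A -/D; have -> : D = A - (A - D) by rewrite opprB addrC subrK.
  by rewrite (le_trans (ler_normB _ _))// lerD2l.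
have nk : \forall s \near t, ball wa d1 (k s).
  by apply: (cont_near kct); exact: nbhsx_ballx.
have [d3 d30 hpsi] := psil.
have uc : {for t, continuous (fun s => ((c t)^-1 * c s)%g)}.
  apply: (cont_comp (f := fun s => ((c t)^-1%g, c s)) (g := fun p : G * G => (p.1 * p.2)%g)).
    by apply: cont_pair; [exact: cont_cst|exact: cc].
  exact: mulg_continuous.
have nl : \forall s \near t, lg ((c t)^-1 * c s)%g = psi (chart_map e ((c t)^-1 * c s)%g) /\
    ball x0 d3 (chart_map e ((c t)^-1 * c s)%g).
  apply: (cont_near uc (P := fun g => lg g = psi (chart_map e g) /\ ball x0 d3 (chart_map e g))).
  rewrite mulVg; apply: filterI; first by apply: filterS lgpsi => g [].
  apply: (cont_near (f := chart_map e)); last exact: nbhsx_ballx.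
  by apply: chart_map_continuous; exact: he.2.
have [d /= d0 hd] := (nbhs_ballP t _).1 (filterI (filterI nda nB) (filterI nk nl)).
pose d' := Num.min d 1.
have d'0 : 0 < d' by rewrite lt_min d0 ltr01.
have sub (s : R) : ball t d' s -> ball t d s by apply: le_ball; rewrite ge_min lexx.
have kl (s s' : R) : ball t d s -> ball t d s' -> `|k s' - k s| <= B * `|s' - s|.
  apply: (lipschitz_ball (df := fun s (v : R^o) => 'D_v k s)) => u v /hd[[h1 h2] _].
    by apply/derivableP/diff_derivable; exact: kdf.
  rewrite derive_scale; last exact: kdf.
  by rewrite normrZ mulrC ler_wpM2r.
pose u s := lg ((c t)^-1 * c s)%g.
pose L := 2 * (`|M1| * B).
have B0 : 0 <= B by rewrite addr_ge0.
have L0 : 0 <= L by rewrite !mulr_ge0.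
have ul (s s' : R) : ball t d' s -> ball t d' s' -> `|u s' - u s| <= L * `|s' - s|.
  move=> /sub hs /sub hs'; have [[dd _] [kb [u1 xb]]] := hd s hs.
  have [[dd' _] [kb' [u2 xb']]] := hd s' hs'; rewrite /u u1 u2.
  have E1 (r : R) : chart_dom a (c r) -> chart_map e ((c t)^-1 * c r)%g = m (yb, k r).
    by move=> hr; rewrite /m /= iyb /k /= chart_mapK.
  rewrite (le_trans (hpsi _ _ xb xb'))// /L -mulrA ler_wpM2l// E1// E1//.
  rewrite (le_trans (hM1 _ _ kb kb'))// (le_trans (ler_wpM2r _ (ler_norm M1)))// -mulrA ler_wpM2l//.
  exact: kl.
have ut : u t = 0.
  have tt : ball t d t by exact: ballxx.
  by have [_ [_ [h _]]] := hd t tt; rewrite /u h mulVg psi0.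
exists ((1 + 2^-1 * (C * L)) * L), d' => // s s' hs hs'.
have lE r : lg (c r) = bch br (lg (c t)) (u r) by rewrite -lgM mulgA mulgV mul1g.
rewrite (lE s) (lE s') bch_left_invariant.
apply: le_trans (bch_diff_norm (u s) (u s') ts) _.
have CL : C * `|u s| <= C * L.
  apply: ler_wpM2l; first exact: (bbl_ge0 ts).
  rewrite -[u s]subr0 -ut; apply: le_trans (ul _ _ (ballxx t d'0) hs) _.
  rewrite ler_piMr// -normrN opprB ltW//; move: hs; rewrite -ball_normE /= => hs.
  by rewrite (lt_le_trans hs)// ge_min lexx orbT.
rewrite -mulrA; apply: ler_pM => //.
  by rewrite addr_ge0// mulr_ge0// mulr_ge0// (bbl_ge0 ts).
  by rewrite lerD2l ler_wpM2l.
exact: ul.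
Qed.

End exponential_coordinates.

(* Global exponential coordinates [E] on the group, with inverse [lg]; nm_vel
   also holds where [x] is not differentiable, both sides being then [0]. *)
Record nil_model (R : realType) (n : nat) (G : lieGroup R n) (e : chart R n G)
    (br : 'rV[R]_n -> 'rV[R]_n -> 'rV[R]_n) (C : R) (E : 'rV[R]_n -> G) (lg : G -> 'rV[R]_n) := {
  nm_ts :> two_step br C;
  nm_M : forall x y, E (bch br x y) = (E x * E y)%g;
  nm_EK : cancel E lg;
  nm_lgK : cancel lg E;
  nm_vel : forall (x : R -> 'rV[R]_n) (t : R), {for t, continuous x} ->
    velocity e (fun s => E (x s)) t = tframe br (x t) (derive1 x t);
  nm_dist : forall q : {dot 'rV[R]_n for idfun}, exists2 K : R, 0 <= K & forall x y,
    (riem_dist e q (E x) (E y) <= (K * `|bch br (- x) y|)%:E)%E;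
  nm_C1 : forall (c : R -> G) (t : R), C1_curve c ->
    exists M, exists2 d : R, 0 < d & forall s s' : R, ball t d s -> ball t d s' ->
    `|bch br (- lg (c s)) (lg (c s'))| <= M * `|s' - s| }.

Lemma nil_model_exists (R : realType) (n : nat) (G : lieGroup R n) (e : chart R n G) :
  chart_at_one e -> simply_connected R G ->
  (forall x y z, lie_bracket e (lie_bracket e x y) z = 0) ->
  exists C E lg, @nil_model R n G e (lie_bracket e) C E lg.
Proof.
move=> he sc nil; have [C ts] := lie_bracket_two_step he nil.
have [sigma [psi [U [r [r0 sigmaM [U1 [UK UM]] [sK [sc0 sf]] [psi0 psif psil]]]]]] := chart_exponential he ts.
pose E := exp_of sigma r.
have EM x y : E (bch (lie_bracket e) x y) = (E x * E y)%g := exp_ofM ts r0 sigmaM x y.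
have Esm x : `|x| < r -> E x = sigma x := exp_of_small ts r0 sigmaM (x := x).
have n0 : \forall x \near (0 : 'rV[R]_n), `|x| < r.
  by apply: filterS (nbhsx_ballx (0 : 'rV[R]_n) r r0) => x; rewrite -ball_normE /= sub0r normrN.
have nE : \forall x \near (0 : 'rV[R]_n), sigma x = E x by apply: filterS n0 => x /Esm.
have Ec : {for 0, continuous E} := cont_near_eq nE sc0.
pose s g := psi (chart_map e g).
have sE : \forall x \near (0 : 'rV[R]_n), s (E x) = x.
  by apply: filterS n0 => x xr; rewrite Esm//; have [] := sK x xr.
have EsK g : U g -> E (s g) = g by move=> /UK[_ h1 h2]; rewrite Esm.
have inj : injective E := exp_injective ts EM U1 UM sE Ec sc.
have sur g : exists x, E x = g.
  by apply: (exp_surjective ts EM U1 EsK); have [h _] := sc; exact: h.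
have [lg lgK] := choice sur.
have EK : cancel E lg by move=> x; apply: inj; rewrite lgK.
have kd : \forall x \near (0 : 'rV[R]_n), chart_dom e (E x).
  by apply: filterS n0 => x xr; rewrite Esm//; have [] := sK x xr.
have kf : frechet (fun x => chart_map e (E x)) 0 1%:M.
  move=> eps eps0; apply: filterS2 (sf eps eps0) n0 => x h xr.
  by rewrite Esm// Esm// normr0.
have lgpsi : \forall g \near (1%g : G), chart_dom e g /\ lg g = psi (chart_map e g).
  apply: filterS U1 => g Ug; split; first by have [] := UK g Ug.
  by apply: inj; rewrite lgK EsK.
exists C, E, lg; split => //.
- move=> x t xc; exact: (velocity_exp ts EM EK kf Ec lgpsi psif xc).
- move=> q; exact: (exp_dist_le ts EM kd kf Ec he q).
- by move=> c t cC; have := C1_log_lipschitz ts EM EK lgK lgpsi psi0 psil he t cC; exact.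
Qed.

(** * Lipschitz curves and their length *)

Lemma derive_norm_le (R : realType) (V : normedModType R) (f : R -> V) (x : R) (d : V) (K : R) :
  is_derive x 1 f d -> (\forall y \near x, `|f y - f x| <= K * `|y - x|) -> `|d| <= K.
Proof.
move=> [df <-] hK; apply/ler_addgt0Pl => e e0.
have : \forall h \near (0 : R)^', `|h^-1 *: (f (h *: 1 + x) - f x)| <= K /\
    `|'D_1 f x - h^-1 *: (f (h *: 1 + x) - f x)| <= e.
  apply: filterI; last by have /cvgrPdist_le/(_ e e0) := df.
  have lim0 : h *: 1 + x @[h --> (0 : R)^'] --> x.
    have : {for (0 : R), continuous (fun h : R => h *: 1 + x)}.
      by apply: cont_add; [apply: cvgZr_tmp; exact: cvg_id|exact: cont_cst].
    rewrite /prop_for /continuous_at scale0r add0r => h; exact: cvg_within_filter h.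
  have n1 : \forall h \near (0 : R)^', h != 0 by exact: nbhs_dnbhs_neq.
  apply: filterS2 n1 (lim0 _ hK) => h h0; rewrite /= addrK -[h *: 1]/(h * 1) mulr1 => hh.
  by rewrite normrZ normfV ler_pdivrMl ?normr_gt0// mulrC.
move=> /filter_ex[h [h1 h2]].
rewrite -[X in `|X| <= _](subrK (h^-1 *: (f (h *: 1 + x) - f x))).
by rewrite (le_trans (ler_normD _ _))// lerD.
Qed.

Lemma leb_itv (R : realType) (a b : R) (x y : bool) : a <= b ->
  lebesgue_measure ([set` Interval (BSide x a) (BSide y b)] : set R) = (b - a)%:E.
Proof.
rewrite lebesgue_measure_itv/= lte_fin le_eqVlt => /predU1P[->|->//].
by rewrite ltxx subrr.
Qed.

Lemma bounded_integrable_itv (R : realType) (g : measurableTypeR R -> R) (K x y : R) :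
  measurable_fun setT g -> (forall t, `|g t| <= K) -> lebesgue_measure.-integrable `[x, y] (EFin \o g).
Proof.
move=> mg gK; have mxy : measurable (`[x, y]%classic : set (measurableTypeR R)) by exact: measurable_itv.
apply: measurable_bounded_integrable => //.
- have [xy|yx] := leP x y; first by apply: (@le_lt_trans _ _ (y - x)%:E); [rewrite le_eqVlt; apply/orP; left; apply/eqP; exact: leb_itv|exact: ltry].
  by rewrite set_itv_ge ?measure0 ?ltry// bnd_simp -ltNge.
- exact: measurable_funS mg.
- by exists K; split => [|M KM t _]; [exact: num_real|exact: le_trans (gK t) (ltW KM)].
Qed.

(** The sum of the two measures agrees with 2K times Lebesgue measure on intervals, hence on all
    measurable sets; so a Lebesgue null set is null for each summand. *)
Lemma measure_sum_dominated (R : realType) (m1 m2 : {measure set (measurableTypeR R) -> \bar R}) (K : R) :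
  0 < K -> (forall a b : R, a <= b -> (m1 `]a, b]%classic + m2 `]a, b]%classic = (2 * K * (b - a))%:E)%E) ->
  forall A : set (measurableTypeR R), measurable A -> lebesgue_measure A = 0%E -> m1 A = 0%E.
Proof.
move=> K0 hm A mA.
pose half : {nonneg R} := NngNum (ltW (divr_gt0 ltr01 (mulr_gt0 (ltr0Sn R 1) K0))).
rewrite (@lebesgue_measure_unique R (mscale half (measure_add m1 m2)))//.
  move=> H; have : ((1 / (2 * K))%:E * (m1 A + m2 A))%E = 0%E by rewrite -measure_addE; exact: H.
  move=> /eqP.
  rewrite mule_eq0 eqe /= gt_eqF ?divr_gt0 ?mulr_gt0//=.
  by rewrite padde_eq0// => /andP[/eqP].
move=> X [[a b] _ <-] /=.
have [ab|ba] := leP a b; last by rewrite set_itv_ge ?measure0// bnd_simp -leNgt ltW.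
transitivity ((1 / (2 * K))%:E * (m1 `]a, b]%classic + m2 `]a, b]%classic))%E; last by rewrite -measure_addE.
rewrite hm// leb_itv//=.
by rewrite -EFinM; congr (_%:E); field; rewrite gt_eqF.
Qed.

(** * A Lipschitz function is the integral of its derivative *)

Section lipschitz_ftc.
Context {R : realType}.
Variables (phi : R -> R) (K : R).
Hypothesis K0 : 0 < K.
Hypothesis phiL : forall x y, `|phi x - phi y| <= K * `|x - y|.
Notation mu := (@lebesgue_measure R).

(** For [s] equal to 1 and to -1 this is nondecreasing because [phi] is K-Lipschitz, and the two
    functions add up to 2Kx. Their Stieltjes measures are therefore absolutely continuous. *)
Let F (s : R) (x : R) : R := K * x + s * phi x.

Let F_nondecreasing s : `|s| = 1 -> {homo F s : x y / x <= y}.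
Proof.
move=> s1 x y xy; rewrite /F -subr_ge0 opprD addrACA -!mulrBr.
have : `|s * (phi y - phi x)| <= K * (y - x).
  by rewrite normrM s1 mul1r (le_trans (phiL _ _))// ger0_norm// subr_ge0.
by rewrite ler_norml => /andP[]; lra.
Qed.

Let phi_cont : continuous phi.
Proof.
move=> x; apply/cvgrPdist_le => e e0; near=> y.
rewrite (le_trans (phiL _ _))// mulrC -ler_pdivlMr//.
by near: y; apply: cvgr_dist_le; rewrite ?divr_gt0.
Unshelve. all: by end_near. Qed.

Let F_cont s : right_continuous (F s).
Proof.
apply: right_continuousW => x; apply: cvgD.
  by apply: cvgM; [exact: cvg_cst|exact: cvg_id].
by apply: cvgM; [exact: cvg_cst|exact: phi_cont].
Qed.

Let F1 := F 1.
Let F2 := F (-1).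
Let F1_nd : nondecreasing F1 := F_nondecreasing (normr1 R).
Let F2_nd : nondecreasing F2 := F_nondecreasing (normrN1 R).
HB.instance Definition _ := isCumulative.Build R _ R F1 F1_nd (fun x => F_cont (s := 1) (x := x)).
HB.instance Definition _ := isCumulative.Build R _ R F2 F2_nd (fun x => F_cont (s := -1) (x := x)).
Local Notation mu1 := (lebesgue_stieltjes_measure F1).
Local Notation mu2 := (lebesgue_stieltjes_measure F2).

Let mu_itv (f : cumulative R R) a b : a <= b -> lebesgue_stieltjes_measure f `]a, b] = (f b - f a)%:E.
Proof.
move=> ab; rewrite /lebesgue_stieltjes_measure /measure_extension/=.
by rewrite measurable_mu_extE/=; [rewrite wlength_itv_bnd// EFinB|exact: is_ocitv].
Qed.

Let mu1_ac (A : set (measurableTypeR R)) : measurable A -> mu A = 0%E -> mu1 A = 0%E.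
Proof.
apply: (measure_sum_dominated K0 (m2 := mu2)) => x y xy.
transitivity ((F1 y - F1 x)%:E + (F2 y - F2 x)%:E)%E; first by congr (_ + _)%E; exact: mu_itv.
by rewrite -EFinD /F1 /F2 /F; congr (_%:E); ring.
Qed.

Variables (a b : R).
Hypothesis ab : a < b.

(** Restricted to a bounded interval so that the measure is finite, as its Radon-Nikodym density is
    to be integrable. *)
Let nu := mrestr mu1 (measurable_itv `]a, b]).
Let nu_fin : fin_num_fun nu.
Proof.
move=> A mA; rewrite ge0_fin_numE ?measure_ge0// (@le_lt_trans _ _ (mu1 `]a, b]))//; last first.
  by have := mu_itv F1 (ltW ab) => ->; rewrite ltry.
by apply: le_measure; rewrite ?inE//; exact: measurableI.
Qed.
HB.instance Definition _ := Measure.on nu.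
HB.instance Definition _ := @Measure_isFinite.Build _ _ _ nu nu_fin.

(** The density of the Stieltjes measure of [K x + phi x], minus K, is the derivative of [phi] at
    every Lebesgue point, hence almost everywhere. *)
Lemma lipschitz_ftc : exists g : measurableTypeR R -> R, [/\ measurable_fun setT g,
  forall x, `|g x| <= K, forall x y, a <= x -> x <= y -> y <= b -> (phi y - phi x = \int[mu]_(t in `[x, y]) g t)%R
  & exists N : set (measurableTypeR R), [/\ measurable N, mu N = 0%E &
     forall x, a < x < b -> ~ N x -> is_derive x 1 phi (g x)]].
Proof.
have nu_ac : nu `<< mu.
  apply/null_content_dominatesP => A mA A0.
  apply/eqP; rewrite eq_le measure_ge0 andbT -(mu1_ac mA A0).
  by apply: le_measure; rewrite ?inE//; exact: measurableI.
have [f [f0 ffin fint nuE]] := radon_nikodym_sigma_finite nu_ac.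
pose g1 x := fine (f x).
have fE : EFin \o g1 = f by apply/funext => x; rewrite /= fineK.
have mg1 : measurable_fun setT g1.
  by apply/measurable_EFinP; rewrite fE; case/integrableP: fint.
pose G y := (\int[mu]_(t in `]a, y]) g1 t)%R.
have GE y : a <= y -> y <= b -> G y = F1 y - F1 a.
  move=> ay yb; rewrite /G /Rintegral.
  under eq_integral do rewrite -[(g1 _)%:E]/((EFin \o g1) _) fE.
  rewrite -nuE//; transitivity (fine (mu1 (`]a, y]%classic `&` `]a, b]%classic))); first by [].
  rewrite setIidl; last by apply/subset_itvl; rewrite bnd_simp.
  by have := mu_itv F1 ay => ->.
have locg : locally_integrable setT g1.
  by apply: open_integrable_locally; [exact: openT|rewrite fE].
have [N [mN N0 hN]] := lebesgue_differentiation locg.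
have dG x : a < x < b -> ~ N x -> is_derive x 1 phi (g1 x - K).
  move=> /andP[ax xb] nNx.
  have lx : lebesgue_pt g1 x by apply: contrapT => h; apply: nNx; exact: hN.
  have [|//|dG GE'] := FTC1_lebesgue_pt (a := BRight a) xb _ _ lx.
    by rewrite fE; exact: integrableS fint.
  have hG : is_derive x 1 G (g1 x) by apply: (DeriveDef dG); rewrite -derive1E; exact: GE'.
  have h := is_deriveB (is_deriveD (is_derive_cst (phi a + K * a) x 1) hG) (is_deriveZ K (is_derive_id x 1)).
  apply: (near_eq_is_derive _ (is_derive_eq h _)); last by rewrite add0r -[_ *: _]/(K * 1) mulr1.
  near=> y; rewrite -[LHS]/(phi a + K * a + G y - K * y) GE.
  + by rewrite /F1 /F; ring.
  + by near: y; apply: filterS (lt_nbhsr ax) => z /ltW.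
  + by near: y; apply: filterS (lt_nbhsl xb) => z /ltW.
(* Truncation makes the bound by K hold everywhere; at points where the derivative exists it changes
   nothing. *)
pose clamp y := Num.max (- K) (Num.min K y).
have clampE y : `|y| <= K -> clamp y = y.
  by rewrite ler_norml /clamp => /andP[h1 h2]; rewrite min_r// max_r.
pose g x := clamp (g1 x - K).
have gE x : a < x < b -> ~ N x -> g x = g1 x - K.
  move=> axb nNx; apply: clampE; apply: (derive_norm_le (dG x axb nNx)).
  by near=> y; exact: phiL.
have mcst c : measurable_fun setT (fun _ : measurableTypeR R => c : R) by exact: measurable_cst.
have mgK : measurable_fun setT (fun x => g1 x - K) by exact: measurable_funB.
have mg : measurable_fun setT g.
  by apply: measurable_maxr => //; exact: measurable_minr.
exists g; split => //.
- move=> x; rewrite ler_norml /g /clamp le_max lexx/= ge_max.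
  by apply/andP; split; [have := K0; lra|rewrite ge_min lexx].
- move=> x y ax xy yb.
  have mxy : measurable (`[x, y]%classic : set (measurableTypeR R)) by exact: measurable_itv.
  have i1 : mu.-integrable `[x, y] (EFin \o g1) by rewrite fE; exact: integrableS fint.
  have -> : (\int[mu]_(t in `[x, y]) g t = \int[mu]_(t in `[x, y]) (g1 t - K))%R.
    rewrite /Rintegral; congr fine; apply: ae_eq_integral => //.
    - by apply/measurable_EFinP; exact: measurable_funS mg.
    - by apply/measurable_EFinP; exact: measurable_funS mgK.
    exists (N `|` ([set a] `|` [set b])); split.
    - by apply: measurableU => //; apply: measurableU; exact: measurable_set1.
    - have ms c : measurable ([set c] : set (measurableTypeR R)) by exact: measurable_set1.
      have m0 c : mu [set c] = 0%E by exact: lebesgue_measure_set1.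
      rewrite measureU0//; first by apply: measurableU; exact: ms.
      exact: (etrans (measureU0 (ms a) (ms b) (m0 b)) (m0 a)).
    move=> t /= h; apply: contrapT => /not_orP[nNt /not_orP[ta tb]]; apply: h => ht.
    rewrite gE//; move: ht; rewrite in_itv/= => /andP[xt ty].
    rewrite !lt_neqAle (le_trans ax xt) (le_trans ty yb) !andbT.
    by rewrite eq_sym; apply/andP; split; exact/eqP.
  rewrite RintegralB//; last first.
    by apply: (bounded_integrable_itv (K := K)) => // t; rewrite gtr0_norm.
  have -> : (\int[mu]_(_ in `[x, y]) K = K * (y - x))%R.
    by rewrite Rintegral_cst//; congr (_ * _); exact: (congr1 fine (leb_itv true false xy)).
  rewrite -Rintegral_itv_obnd_cbnd.
    rewrite -(Rintegral_itvB (a := BRight a)) ?bnd_simp//; last by rewrite fE; exact: integrableS fint.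
    by rewrite -/(G y) -/(G x) !GE// ?(le_trans ax)// ?(le_trans _ yb)// /F1 /F; ring.
  by apply: integrableS i1 => //; apply: subset_itvr; rewrite bnd_simp.
exists N; split => // x axb nNx; rewrite gE//; exact: dG.
Unshelve. all: by end_near. Qed.

End lipschitz_ftc.

Section germ_lipschitz.
Context {R : realType} {n : nat}.
Notation V := 'rV[R]_n.

(** Continuous induction on the supremum [c] of the times up to which the bound holds: the germ at
    [c] first yields the bound at [c], then pushes it beyond [c] unless [c = b]. *)
Lemma germ_mean_value (f : R -> V) (a b M : R) : a <= b ->
  (forall t, a <= t <= b -> \forall s \near t, a <= s <= b -> `|f s - f t| <= M * `|s - t|) ->
  `|f b - f a| <= M * (b - a).
Proof.
move=> ab hf; pose S := [set t : R | a <= t <= b /\ forall s, a <= s <= t -> `|f s - f a| <= M * (s - a)].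
have Sa : S a.
  split; first by rewrite lexx.
  move=> s /andP[h1 h2]; have -> : s = a by apply/eqP; rewrite eq_le h2.
  by rewrite !subrr normr0 mulr0.
have hS : has_sup S by split; [exists a|exists b => t [/andP[]]].
pose c := sup S.
have ac : a <= c by apply: ub_le_sup => //; exact: hS.2.
have cb : c <= b by apply: ge_sup; [exact: hS.1|move=> t [/andP[]]].
have [d /= d0 hd] := (nbhs_ballP c _).1 (hf c (introT andP (conj ac cb))).
have below s : a <= s -> s < c -> `|f s - f a| <= M * (s - a).
  move=> a_s; rewrite -subr_gt0 => sc; have [t [_ St] st] := sup_adherent sc hS.
  by apply: St; rewrite a_s ltW//; move: st; rewrite -/c opprB addrC subrK.
have near_c s : a <= s <= b -> `|s - c| < d -> `|f s - f c| <= M * `|s - c|.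
  by move=> hs hsc; apply: hd => //; rewrite -ball_normE /= distrC.
have at_c : `|f c - f a| <= M * (c - a).
  move: ac; rewrite le_eqVlt => /predU1P[<-|ac']; first by rewrite !subrr normr0 mulr0.
  pose s := Num.max a (c - d / 2).
  have a_s : a <= s by rewrite le_max lexx.
  have sc : s < c by rewrite gt_max ac' /= ltrBlDr ltrDl divr_gt0.
  have dsc : c - s < d.
    have : c - d / 2 <= s by rewrite le_max lexx orbT.
    by move: d0; lra.
  have h1 := below s a_s sc.
  have h2 : `|f s - f c| <= M * (c - s).
    have csE : `|s - c| = c - s by rewrite distrC gtr0_norm ?subr_gt0.
    by rewrite -csE; apply: near_c; rewrite ?a_s ?(le_trans (ltW sc))// csE.
  have -> : f c - f a = (f s - f a) - (f s - f c) by rewrite opprB [RHS]addrC addrA subrK.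
  by rewrite (le_trans (ler_normB _ _))//; move: h1 h2; rewrite !mulrBr; lra.
move: cb; rewrite le_eqVlt => /predU1P[cb|cb]; first by rewrite -cb.
exfalso; pose t := Num.min b (c + d / 2).
have ct : c < t by rewrite lt_min cb ltrDl divr_gt0.
have tb : t <= b by rewrite ge_min lexx.
have tcd : t - c < d.
  have : t <= c + d / 2 by rewrite ge_min lexx orbT.
  by move: d0; lra.
have St : S t.
  split; first by rewrite (le_trans ac (ltW ct)).
  move=> s /andP[a_s st]; have [sc|cs] := ltP s c; first exact: below.
  have h : `|f s - f c| <= M * (s - c).
    rewrite -[X in M * X]ger0_norm ?subr_ge0//; apply: near_c; first by rewrite a_s (le_trans st).
    by rewrite ger0_norm ?subr_ge0//; move: st tcd; lra.
  have -> : f s - f a = (f s - f c) + (f c - f a) by rewrite addrA subrK.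
  by rewrite (le_trans (ler_normD _ _))//; move: h at_c; rewrite !mulrBr; lra.
by have := ub_le_sup hS.2 St; rewrite -/c leNgt ct.
Qed.

End germ_lipschitz.

(** * Lipschitz maps for left-translated increments *)

Section group_lipschitz.
Context {R : realType} {n : nat}.
Notation V := 'rV[R]_n.
Variables (br : V -> V -> V) (C : R).
Hypothesis ts : two_step br C.

Definition ndist (x y : V) : R := `|bch br (- x) y|.

(* Group-Lipschitz germs at every point of [D]: unlike a global bound on
   [ndist], this condition can be glued along closed pieces. *)
Definition glip (T : normedModType R) (D : set T) (f : T -> V) (L : R) :=
  forall p, D p -> \forall p' \near p, D p' -> ndist (f p) (f p') <= L * `|p' - p|.

Lemma ndist_ge0 x y : 0 <= ndist x y. Proof. exact: normr_ge0. Qed.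

Lemma ndistxx x : ndist x x = 0.
Proof. by rewrite /ndist (bchNx ts) normr0. Qed.

Lemma ndistC x y : ndist x y = ndist y x.
Proof. by rewrite /ndist -normrN (bchN ts) opprK. Qed.

Lemma ndist_invariant a x y : ndist (bch br a x) (bch br a y) = ndist x y.
Proof. by rewrite /ndist (bchN ts) -(bchA ts) (bchKl ts). Qed.

Lemma norm_le_ndist x y : `|y - x| <= (1 + 2^-1 * (C * `|x|)) * ndist x y.
Proof.
rewrite /ndist -{1}(bchNKl ts x y); move: (bch br (- x) y) => D.
rewrite /bch addrAC [x + D]addrC addrK mulrDl mul1r (le_trans (ler_normD _ _))// lerD2l.
by rewrite normrZ ger0_norm ?invr_ge0// -mulrA ler_wpM2l ?invr_ge0// (bbl_le ts).
Qed.

(** The increment from [x] to [z] is the [bch] product of the two partial increments; the extra term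
    bounds their bracket, and it is what prevents [ndist] from being a metric. *)
Lemma ndist_triangle x y z : ndist x z <= ndist x y + ndist y z + C * ndist x y * ndist y z.
Proof.
rewrite /ndist (_ : bch br (- x) z = bch br (bch br (- x) y) (bch br (- y) z)); first exact: (bch_norm ts).
by rewrite -(bchA ts) (bchNKl ts).
Qed.

Lemma glip_sub (T : normedModType R) (D D' : set T) f L : D' `<=` D -> glip D f L -> glip D' f L.
Proof. by move=> DD' h p /DD' Dp; apply: filterS (h p Dp) => p' + /DD'; exact. Qed.

Lemma glip_le (T : normedModType R) (D : set T) f L L' : L <= L' -> glip D f L -> glip D f L'.
Proof.
move=> LL h p Dp; apply: filterS (h p Dp) => p' + Dp' => /(_ Dp') h'.
by rewrite (le_trans h')// ler_wpM2r.
Qed.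

Lemma eq_glip (T : normedModType R) (D : set T) f g L : (forall p, D p -> f p = g p) ->
  glip D f L -> glip D g L.
Proof.
move=> fg h p Dp; apply: filterS (h p Dp) => p' + Dp' => /(_ Dp').
by rewrite !fg.
Qed.

(** Around a point outside a closed piece some neighbourhood misses that piece, so that only pieces
    through the point impose a condition. *)
Lemma glip_glue (T : normedModType R) (D D' : set T) f L : closed D -> closed D' ->
  glip D f L -> glip D' f L -> glip (D `|` D') f L.
Proof.
move=> cD cD' h h' p Dp.
have aux (B : set T) : closed B -> glip B f L -> \forall p' \near p, B p' -> ndist (f p) (f p') <= L * `|p' - p|.
  move=> cB hB; have [Bp|nBp] := pselect (B p); first exact: hB.
  have : \forall p' \near p, (~` B) p'.
    by apply: open_nbhs_nbhs; split => //; exact: closed_openC.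
  by apply: filterS => p' /= nB Bp'.
by apply: filterS2 (aux D cD h) (aux D' cD' h') => p' h1 h2 [].
Qed.

Lemma glip_comp (T T' : normedModType R) (D : set T) (D' : set T') (u : T' -> T) f L M : 0 <= L ->
  (forall p, D' p -> D (u p)) -> (forall p p', D' p -> D' p' -> `|u p' - u p| <= M * `|p' - p|) ->
  glip D f L -> glip D' (fun p => f (u p)) (L * M).
Proof.
move=> L0 DD' uM h p Dp.
have [d /= d0 hd] := (nbhs_ballP (u p) _).1 (h _ (DD' _ Dp)).
have M1 : 0 < `|M| + 1 by rewrite ltr_wpDl.
apply: filterS (nbhsx_ballx p (d / (`|M| + 1)) (divr_gt0 d0 M1)) => p' hp' Dp'.
have h1 := uM _ _ Dp Dp'.
have h2 : ball (u p) d (u p').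
  rewrite -ball_normE /= distrC (le_lt_trans h1)//.
  move: hp'; rewrite -ball_normE /= distrC ltr_pdivlMr// => hp'.
  apply: le_lt_trans hp'; rewrite mulrC ler_wpM2l//.
  by rewrite (le_trans (ler_norm M))// lerDl.
by rewrite (le_trans (hd _ h2 (DD' _ Dp')))// -mulrA ler_wpM2l.
Qed.

Lemma glip_continuous (T : normedModType R) (D : set T) f L p : glip D f L -> D p ->
  (\forall p' \near p, D p') -> {for p, continuous f}.
Proof.
move=> h Dp nD.
have [d /= d0 hd] := (nbhs_ballP p _).1 (filterI nD (h p Dp)).
apply/(@cvgrPdist_le _ _ _ (nbhs p)) => e e0.
pose K := (1 + 2^-1 * (C * `|f p|)) * (`|L| + 1).
have K0 : 0 < K.
  by rewrite mulr_gt0// ltr_wpDr// ?mulr_ge0// (bbl_ge0 ts).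
apply: filterS2 (nbhsx_ballx p d d0) (nbhsx_ballx p (e / K) (divr_gt0 e0 K0)) => p' /hd[Dp' h1] h2.
rewrite distrC (le_trans (norm_le_ndist _ _))//.
have := h1 Dp'; move: h2; rewrite -ball_normE /= distrC ltr_pdivlMr// => h2 h3.
apply: (le_trans _ (ltW h2)); 
have -> : `|p' - p| * K = (1 + 2^-1 * (C * `|f p|)) * (`|p' - p| * (`|L| + 1)) by rewrite /K mulrCA.
apply: ler_wpM2l.
  by rewrite addr_ge0// mulr_ge0// mulr_ge0// (bbl_ge0 ts).
rewrite (le_trans h3)// mulrC; apply: ler_wpM2l => //.
by rewrite (le_trans (ler_norm L))// lerDl.
Qed.

Lemma glip_speed (x : R -> V) (t M : R) : 0 <= M ->
  (\forall s \near t, ndist (x t) (x s) <= M * `|s - t|) -> `|tframe br (x t) (derive1 x t)| <= M.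
Proof.
move=> M0 h; have [dx|ndx] := pselect (derivable x t 1).
  rewrite derive1E; apply: (derive_norm_le (bchN_derive ts (derivableP dx))).
  by apply: filterS h => s; rewrite (bchNx ts) subr0.
have -> : derive1 x t = 0.
  rewrite derive1E; apply: etrans (dvgP ndx) _.
  by apply/rowP => i; rewrite !mxE.
by rewrite (tframe0 ts) normr0.
Qed.

(** After translating the start to 0, the part seen by [P] moves at most linearly, since [P] kills
    brackets. The bracket in the increment only depends on that part, so the remaining growth is at
    most quadratic in the length. *)
Lemma ndist_curve : exists2 K, 0 <= K & forall (x : R -> V) (a b M : R), a <= b -> 0 <= M ->
  glip `[a, b] x M -> ndist (x a) (x b) <= K * (M * (b - a) + (M * (b - a)) ^+ 2).
Proof.
have [P [brP Pbr]] := horizontal_projection ts.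
pose k := n%:R * `|P|.
have C0 := bbl_ge0 ts.
have k0 : 0 <= k by rewrite mulr_ge0.
exists (1 + 2^-1 * C * k); first by rewrite addr_ge0// !mulr_ge0.
move=> x a b M ab M0 h; pose y t := bch br (- x a) (x t).
have ya : y a = 0 by rewrite /y (bchNx ts).
have hy t : a <= t <= b -> \forall s \near t, a <= s <= b -> ndist (y t) (y s) <= M * `|s - t|.
  move=> ht; apply: filterS (h t _); last by rewrite /= in_itv.
  by move=> s + hs; rewrite ndist_invariant; apply; rewrite /= in_itv.
have yP t : a <= t <= b -> `|y t *m P| <= k * M * (b - a).
  move=> /andP[at_ tb].
  have : `|y t *m P - y a *m P| <= (k * M) * (t - a).
    apply: (germ_mean_value (f := fun t => y t *m P)) => // s /andP[a_s st].
    have hs : a <= s <= b by rewrite a_s (le_trans st).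
    apply: filterS (hy s hs) => u + /andP[au ut] => /(_ _)/= hu.
    have {}hu : ndist (y s) (y u) <= M * `|u - s| by apply: hu; rewrite au (le_trans ut).
    have -> : y u *m P - y s *m P = bch br (- y s) (y u) *m P.
      by rewrite (bch_translate ts) mulmxBl -scalemxAl brP scaler0 subr0 mulmxBl.
    rewrite (le_trans (mulmx_norm_le _ _))// mulrAC -/k -[leRHS]mulrA.
    by apply: ler_wpM2l.
  rewrite ya mul0mx subr0 => hP; rewrite (le_trans hP)// ler_wpM2l ?mulr_ge0//.
  by rewrite lerD2r.
have : `|y b - y a| <= (M * (1 + 2^-1 * C * (k * M * (b - a)))) * (b - a).
  apply: germ_mean_value => // t ht; apply: filterS (hy t ht) => s hs hsab.
  have D := hs hsab; rewrite -{1}(bchNKl ts (y t) (y s)).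
  set d := bch br (- y t) (y s) in D *.
  rewrite /bch addrAC [y t + d]addrC addrK mulrDr mulr1 mulrDl (le_trans (ler_normD _ _))// lerD//.
  rewrite normrZ ger0_norm ?invr_ge0// -Pbr.
  have hP := yP t ht; have hb := bbl_le ts (y t *m P) d.
  apply: (@le_trans _ _ (2^-1 * (C * (k * M * (b - a)) * (M * `|s - t|)))); last by rewrite /k; lra.
  rewrite ler_wpM2l ?invr_ge0// (le_trans hb)//; apply: ler_pM => //; first by rewrite mulr_ge0.
  by rewrite ler_wpM2l.
rewrite ya subr0 => hb; apply: le_trans hb _.
have Mb : 0 <= M * (b - a) by rewrite mulr_ge0// subr_ge0.
have kC : 0 <= 2^-1 * C * k by rewrite !mulr_ge0.
rewrite (_ : M * _ * _ = M * (b - a) + 2^-1 * C * k * (M * (b - a)) ^+ 2); last by ring.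
rewrite mulrDl mul1r lerD// ?lerDl ?sqr_ge0//.
by rewrite ler_wpM2l// lerDr.
Qed.

End group_lipschitz.

(** * Comparison of integrals without measurability *)

Section lower_integral.
Context d (T : measurableType d) {R : realType} (mu : {measure set T -> \bar R}).
Implicit Types (D : set T) (f h : T -> \bar R).

(* [h] need not be measurable, in which case its integral is a lower integral. *)
Lemma le_lower_integral D' D f h : D' `<=` D -> (forall x, D' x -> 0 <= f x)%E ->
  (forall x, D x -> 0 <= h x)%E -> (forall x, D' x -> f x <= h x)%E ->
  (\int[mu]_(x in D') f x <= \int[mu]_(x in D) h x)%E.
Proof.
move=> DD f0 h0 fh.
rewrite !ge0_integralE//=; apply: le_ereal_sup => _ [s hs <-]; exists s => //= x.
rewrite (le_trans (hs x))// /patch; case: ifPn => [|_]; last first.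
  by case: ifPn => //; rewrite inE; exact: h0.
by rewrite inE => D'x; rewrite ifT ?inE; [exact: fh|exact: DD].
Qed.

(** The exceptional null set is removed on the side of the measurable function [f]; the lower
    integral of [h] then only grows when its domain is enlarged back to [D]. *)
Lemma ae_le_lower_integral D f h : measurable D -> measurable_fun D f ->
  (forall x, D x -> 0 <= f x)%E -> (forall x, D x -> 0 <= h x)%E ->
  {ae mu, forall x, D x -> f x <= h x}%E ->
  (\int[mu]_(x in D) f x <= \int[mu]_(x in D) h x)%E.
Proof.
move=> mD mf f0 h0 [N [mN N0 hN]].
rewrite (ge0_negligible_integral _ _ mf f0 N0)//.
apply: le_lower_integral => // [x [Dx _]|x [Dx nNx]]; first exact: f0.
by apply: contrapT => hx; apply: nNx; apply: hN => /= /(_ Dx).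
Qed.

End lower_integral.

Section vector_measurability.
Context d (T : measurableType d) {R : realType} {n : nat}.
Notation V := 'rV[R]_n.

Definition mvec m (f : T -> 'rV[R]_m) := forall j, measurable_fun setT (fun t => f t 0 j).

Lemma mvecD (f g : T -> V) : mvec f -> mvec g -> mvec (fun t => f t + g t).
Proof.
move=> hf hg j; rewrite (_ : (fun t => _) = fun t => f t 0 j + g t 0 j); last by apply/funext => t; rewrite mxE.
exact: measurable_funD.
Qed.

Lemma mvecZ (k : R) (f : T -> V) : mvec f -> mvec (fun t => k *: f t).
Proof.
move=> hf j; rewrite (_ : (fun t => _) = fun t => k * f t 0 j); last by apply/funext => t; rewrite mxE.
by apply: measurable_funM => //; exact: hf.
Qed.

Lemma measurable_bilinear (B : V -> V -> R) C (f g : T -> V) :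
  bounded_bilinear (B : V -> V -> R) C -> mvec f -> mvec g -> measurable_fun setT (fun t => B (f t) (g t)).
Proof.
move=> hB hf hg.
rewrite (_ : (fun t => _) = fun t => \sum_i \sum_j (f t 0 i * g t 0 j) * B (delta_mx 0 i) (delta_mx 0 j)).
  apply: measurable_sum => i; apply: measurable_sum => j.
  by apply: measurable_funM => //; apply: measurable_funM; [exact: hf|exact: hg].
apply/funext => t; rewrite {1}[f t]row_sum_delta.
rewrite (big_morph (B ^~ _) (fun u v => bblDl hB u v _) (bbl0l hB _)); apply: eq_bigr => i _.
rewrite {1}[g t]row_sum_delta (big_morph _ (bblDr hB _) (bbl0r hB _)); apply: eq_bigr => j _.
by rewrite (bblZl hB) (bblZr hB) /= -[_ *: _]/(_ * _) -[_ *: _]/(_ * _) mulrA.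
Qed.

Lemma mvec_bilinear m (B : V -> V -> 'rV[R]_m) C (f g : T -> V) :
  bounded_bilinear (B : V -> V -> 'rV[R]_m) C -> mvec f -> mvec g -> mvec (fun t => B (f t) (g t)).
Proof.
move=> hB hf hg j; apply: (@measurable_bilinear (fun u v => B u v 0 j) C) => //; split.
- by move=> x y z; rewrite (bblDl hB) mxE.
- by move=> x y z; rewrite (bblDr hB) mxE.
- by move=> a x y; rewrite (bblZl hB) mxE.
- by move=> a x y; rewrite (bblZr hB) mxE.
- exact: bbl_ge0 hB.
- by move=> x y; rewrite (le_trans (mx_norm_coord _ _ _))// (bbl_le hB).
Qed.

End vector_measurability.

Section lipschitz_length.
Context {R : realType}.
Notation mu := (@lebesgue_measure R).

Lemma cont_mvec n (f : R -> 'rV[R]_n) : continuous f -> mvec (f : measurableTypeR R -> 'rV[R]_n).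
Proof.
move=> cf j; apply: continuous_measurable_fun => t.
exact: ((cont_mxP _ _).1 (cf t) 0 j).
Qed.

(** [rho] only has to bound derivatives that exist; [lipschitz_ftc] provides them almost everywhere
    and writes the increment as their integral. *)
Lemma lipschitz_coord_le (phi rho : R -> R) (K a b : R) : 0 < K -> a < b ->
  (forall x y, `|phi x - phi y| <= K * `|x - y|) ->
  measurable_fun setT (rho : measurableTypeR R -> R) -> (forall t, 0 <= rho t) ->
  {ae mu, forall t : measurableTypeR R, a < t < b -> forall w, is_derive t 1 phi w -> `|w| <= rho t} ->
  (`|phi b - phi a|%:E <= \int[mu]_(t in `[a, b]) (rho t)%:E)%E.
Proof.
move=> K0 ab phiL mr r0 hr; have [g [mg gK gI [N [mN N0 dg]]]] := lipschitz_ftc K0 phiL ab.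
have mab : measurable (`[a, b]%classic : set (measurableTypeR R)) by exact: measurable_itv.
have ig := bounded_integrable_itv a b mg gK.
rewrite (gI a b (lexx a) (ltW ab) (lexx b)).
have h1 := le_normr_Rintegral mab ig.
have mng : measurable_fun `[a, b] (fun t : measurableTypeR R => `|g t|).
  by apply: measurableT_comp => //; exact: measurable_funS mg.
apply: (@le_trans _ _ (\int[mu]_(t in `[a, b]) `|g t|%:E)%E).
  have fin : (\int[mu]_(t in `[a, b]) `|g t|%:E)%E \is a fin_num.
    have := integrable_norm ig => /integrable_fin_num; exact.
  by rewrite -(fineK fin) lee_fin.
apply: ae_ge0_le_integral => //.
- exact/measurable_EFinP.
- by move=> t _; rewrite lee_fin.
- by apply/measurable_EFinP; exact: measurable_funS mr.
have [M [mM M0 hM]] := hr.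
exists (M `|` (N `|` ([set a] `|` [set b]))).
have ms c : measurable ([set c] : set (measurableTypeR R)) by exact: measurable_set1.
have m0 c : mu [set c] = 0%E by exact: lebesgue_measure_set1.
have mSS := measurableU _ _ (ms a) (ms b).
have mNS := measurableU _ _ mN mSS.
split.
- exact: measurableU.
- apply: (etrans (measureU0 mM mNS _)) => //.
  by apply: (etrans (measureU0 mN mSS _)) => //; exact: (etrans (measureU0 (ms a) (ms b) (m0 b)) (m0 a)).
move=> t /= h; apply: contrapT => /not_orP[nM /not_orP[nN /not_orP[ta tb]]]; apply: h => ht.
have axb : a < t < b.
  move: ht; rewrite in_itv/= => /andP[h1' h2']; rewrite !lt_neqAle h1' h2' !andbT.
  by rewrite eq_sym; apply/andP; split; exact/eqP.
have : ~ (~` [set t : measurableTypeR R | a < t < b -> forall w, is_derive t 1 phi w -> `|w| <= rho t]) t.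
  by move=> h; apply: nM; exact: hM.
by move=> /contrapT /= /(_ axb _ (dg t axb nN)); rewrite lee_fin.
Qed.

Lemma lipschitz_ae_derive n (x : R -> 'rV[R]_n) (K a b : R) : 0 < K -> a < b ->
  (forall s t, `|x s - x t| <= K * `|s - t|) ->
  exists g : measurableTypeR R -> 'rV[R]_n, [/\ mvec g, forall t, `|g t| <= K &
    {ae mu, forall t : measurableTypeR R, a < t < b -> is_derive (t : R) 1 x (g t)}].
Proof.
move=> K0 ab xL.
have xLj j s t : `|x s 0 j - x t 0 j| <= K * `|s - t|.
  by rewrite (le_trans _ (xL s t))// (le_trans _ (mx_norm_coord _ 0 j))// !mxE.
have /choice[g hg] : forall j, exists g : measurableTypeR R -> R, [/\ measurable_fun setT g, forall t, `|g t| <= K &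
    {ae mu, forall t : measurableTypeR R, a < t < b -> is_derive (t : R) 1 (fun s => x s 0 j) (g t)}].
  move=> j; have [g [mg gK _ [N [mN N0 dg]]]] := lipschitz_ftc K0 (xLj j) ab.
  exists g; split => //; exists N; split => // t /= h; apply: contrapT => nN; apply: h => axb; exact: dg.
exists (fun t => \row_j g j t); split.
- by move=> j; rewrite (_ : (fun t => _) = g j); [have [] := hg j|apply/funext => t; rewrite mxE].
- move=> t; apply/mx_norm_leP; first exact: ltW.
  by move=> i j; rewrite mxE; have [_ h _] := hg j.
have : {ae mu, forall t : measurableTypeR R, forall j, a < t < b -> is_derive (t : R) 1 (fun s => x s 0 j) (g j t)}.
  apply: (@filter_forall _ _ _ _ (ae_filter_ringOfSetsType mu)) => j.
  by have [] := hg j.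
apply: (@filterS _ _ (ae_filter_ringOfSetsType mu)) => t h axb.
by apply/is_derive_mxP => i j; rewrite (ord1 i) mxE; exact: h.
Qed.

End lipschitz_length.

Section group_length.
Context {R : realType} {n : nat}.
Notation V := 'rV[R]_n.
Notation mu := (@lebesgue_measure R).
Variables (br : V -> V -> V) (C : R).
Hypothesis ts : two_step br C.

Lemma norm_bch_diff x s t : `|bch br x s - bch br x t| <= (1 + 2^-1 * (C * `|x|)) * `|s - t|.
Proof.
rewrite (_ : _ - _ = (s - t) + 2^-1 *: br x (s - t)); last first.
  by rewrite /bch (bblBr ts); move: (br x s) (br x t) => u v; mx_ring.
rewrite (le_trans (ler_normD _ _))// mulrDl mul1r lerD2l.
by rewrite normrZ ger0_norm ?invr_ge0// -mulrA ler_wpM2l ?invr_ge0// (bbl_le ts).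
Qed.

(** The two-stage estimate of [ndist_curve] with an almost everywhere bound [sigma] on the speed:
    total length replaces a uniform Lipschitz constant. *)
Lemma ndist_length : exists2 K, 0 <= K & forall (x : R -> V) (sigma : R -> R) (K0 a b lam : R),
  0 < K0 -> a < b -> (forall s t, `|x s - x t| <= K0 * `|s - t|) ->
  measurable_fun setT (sigma : measurableTypeR R -> R) -> (forall t, 0 <= sigma t) ->
  {ae mu, forall t : measurableTypeR R, a < t < b ->
     forall w, is_derive (t : R) 1 x w -> `|tframe br (x t) w| <= sigma t} ->
  0 <= lam -> (\int[mu]_(t in `[a, b]) (sigma t)%:E <= lam%:E)%E ->
  ndist br (x a) (x b) <= K * (lam + lam ^+ 2).
Proof.
have [P [brP Pbr]] := horizontal_projection ts.
pose k := n%:R * `|P|.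
have C0 := bbl_ge0 ts.
have k0 : 0 <= k by rewrite mulr_ge0.
exists (1 + 2^-1 * C * k); first by rewrite addr_ge0// !mulr_ge0.
move=> x sigma K0 a b lam K00 ab xL ms s0 hs lam0 hlam.
have [g [_ _ dx]] := lipschitz_ae_derive K00 ab xL.
pose y t := bch br (- x a) (x t).
have ya : y a = 0 by rewrite /y (bchNx ts).
pose K1 := (1 + 2^-1 * (C * `|- x a|)) * K0.
have K10 : 0 < K1 by rewrite mulr_gt0// ltr_pwDl// !mulr_ge0.
have yL s t : `|y s - y t| <= K1 * `|s - t|.
  rewrite (le_trans (norm_bch_diff _ _ _))// /K1 -mulrA ler_wpM2l//.
  by rewrite addr_ge0// !mulr_ge0.
have dy : {ae mu, forall t : measurableTypeR R, a < t < b -> exists2 D, `|D| <= sigma t &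
    is_derive (t : R) 1 y (D + 2^-1 *: br (y t) D)}.
  have FF := ae_filter_ringOfSetsType mu.
  apply: filterS2 dx hs => t h1 h2 axb; have {}h1 := h1 axb; have {}h2 := h2 axb _ h1.
  exists (tframe br (x t) (g t)) => //.
  have h3 := bbl_is_derive ts (is_derive_cst (- x a) (t : R) 1) h1.
  apply: is_derive_eq (is_deriveD (is_deriveD (is_derive_cst (- x a) (t : R) 1) h1) (is_deriveZ 2^-1 h3)) _.
  rewrite (bbl0l ts) !add0r /tframe /y /bch !(brE ts) !scaler0 ?subr0 ?addr0.
  by move: (br (x a) (g t)) (br (x t) (g t)) => u v; mx_field.
have yP s : a <= s -> s <= b -> `|y s *m P| <= k * lam.
  rewrite le_eqVlt => /predU1P[<-|a_s] sb; first by rewrite ya mul0mx normr0 mulr_ge0.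
  apply/mx_norm_leP; first by rewrite mulr_ge0.
  move=> i j; rewrite (ord1 i) -lee_fin.
  pose phi t := (y t *m P) 0 j.
  have phia : phi a = 0 by rewrite /phi ya mul0mx mxE.
  rewrite -[(_ *m _) _ _]/(phi s) -[phi s]subr0 -phia.
  have kK : 0 < k * K1 + 1 by rewrite ltr_wpDl// mulr_ge0// ltW.
  apply: le_trans (lipschitz_coord_le (rho := fun t => k * sigma t) kK a_s _ _ _ _) _.
  - move=> u v; have -> : phi u - phi v = ((y u - y v) *m P) 0 j by rewrite mulmxBl /phi !mxE.
    rewrite (le_trans (mx_norm_coord _ _ _))// (le_trans (mulmx_norm_le _ _))// mulrAC -/k.
    rewrite (le_trans (ler_wpM2l k0 (yL u v)))// mulrDl mul1r mulrA.
    by rewrite lerDl.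
  - by apply: measurable_funM => //; exact: measurable_cst.
  - by move=> t; rewrite mulr_ge0.
  - have FF := ae_filter_ringOfSetsType mu.
    apply: filterS dy => t h /andP[at_ ts_] w dw.
    have [|D [D1 D2]] := h; first by rewrite at_ (lt_le_trans ts_).
    have h1 : is_derive (t : R) 1 phi (((D + 2^-1 *: br (y t) D) *m P) 0 j).
      exact: ((is_derive_mxP _ _ _ _).1 (is_derive_mulmxr P D2)).
    have -> : w = ((D + 2^-1 *: br (y t) D) *m P) 0 j.
      by rewrite -(derive_val (is_derive := dw)) -(derive_val (is_derive := h1)).
    rewrite mulmxDl -scalemxAl brP scaler0 addr0 (le_trans (mx_norm_coord _ _ _))//.
    by rewrite (le_trans (mulmx_norm_le _ _))// mulrAC -/k ler_wpM2l.
  under eq_integral do rewrite EFinM.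
  have mas : measurable (`[a, s]%classic : set (measurableTypeR R)) by exact: measurable_itv.
  rewrite ge0_integralZl//; last 2 first.
    by apply/measurable_EFinP; exact: measurable_funS ms.
    by move=> t _; rewrite lee_fin.
  rewrite [(k * lam)%:E]EFinM; apply: lee_wpmul2l; first by rewrite lee_fin.
  apply: le_trans hlam.
  apply: le_lower_integral => // [|t _|t _]; rewrite ?lee_fin//.
  by apply: subset_itvl; rewrite bnd_simp.
rewrite /ndist -/(y b) -[y b]subr0 -ya.
have kl : 0 <= k * lam by rewrite mulr_ge0.
have M0 : 0 <= 1 + 2^-1 * (C * (k * lam)) by rewrite addr_ge0// !mulr_ge0.
apply: (@le_trans _ _ ((1 + 2^-1 * (C * (k * lam))) * lam)); last first.
  have kC : 0 <= 2^-1 * C * k by rewrite !mulr_ge0.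
  have := mulr_ge0 kC lam0; have := sqr_ge0 lam; nra.
apply/mx_norm_leP; first by rewrite mulr_ge0.
move=> i j; rewrite (ord1 i) -lee_fin.
pose phi t := y t 0 j.
rewrite (_ : (y b - y a) 0 j = phi b - phi a); last by rewrite [LHS]mxE [X in _ + X]mxE.
apply: le_trans (lipschitz_coord_le (phi := phi) (rho := fun t => (1 + 2^-1 * (C * (k * lam))) * sigma t) K10 ab _ _ _ _) _.
- move=> u v; rewrite (le_trans _ (yL u v))// (le_trans _ (mx_norm_coord _ 0 j))//.
  by rewrite [(y u - y v) 0 j]mxE [X in _ <= `|_ + X|]mxE.
- by apply: measurable_funM => //; exact: measurable_cst.
- by move=> t; rewrite mulr_ge0.
- have FF := ae_filter_ringOfSetsType mu.
  apply: filterS dy => t h axb w dw; have [D [D1 D2]] := h axb.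
  have h1 : is_derive (t : R) 1 phi ((D + 2^-1 *: br (y t) D) 0 j).
    exact: ((is_derive_mxP _ _ _ _).1 D2).
  have -> : w = (D + 2^-1 *: br (y t) D) 0 j.
    by rewrite -(derive_val (is_derive := dw)) -(derive_val (is_derive := h1)).
  rewrite (le_trans (mx_norm_coord _ _ _))// (le_trans (ler_normD _ _))//.
  rewrite mulrDl mul1r; apply: lerD => //; rewrite normrZ ger0_norm ?invr_ge0// -Pbr.
  have yPt : `|y t *m P| <= k * lam by move: axb => /andP[h3 h4]; apply: yP; exact: ltW.
  rewrite -[leRHS]mulrA ler_wpM2l ?invr_ge0// (le_trans (bbl_le ts _ _))//.
  by apply: ler_pM => //; [rewrite mulr_ge0|rewrite ler_wpM2l].
under eq_integral do rewrite EFinM.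
have mab : measurable (`[a, b]%classic : set (measurableTypeR R)) by exact: measurable_itv.
rewrite ge0_integralZl//; last 2 first.
  by apply/measurable_EFinP; exact: measurable_funS ms.
  by move=> t _; rewrite lee_fin.
by rewrite [X in (_ <= X)%E]EFinM; apply: lee_wpmul2l; rewrite ?lee_fin.
Qed.

Definition clamp (a b t : R) : R := Num.max a (Num.min b t).

Lemma clamp_in a b t : a <= b -> a <= clamp a b t <= b.
Proof. by move=> ab; rewrite /clamp le_max lexx ge_max ab ge_min lexx. Qed.

Lemma clamp_id a b t : a <= t <= b -> clamp a b t = t.
Proof. by move=> /andP[h1 h2]; rewrite /clamp min_r// max_r. Qed.

Lemma clamp_lip a b s t : `|clamp a b s - clamp a b t| <= `|s - t|.
Proof.
rewrite ler_norml /clamp !maxEle !minEle.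
have h := ler_norm (s - t); have h' := ler_norm (t - s); rewrite distrC in h'.
by case: (leP b s) => ?; case: (leP b t) => ?; case: (leP a b) => ?; case: (leP a s) => ?; case: (leP a t) => ?; apply/andP; split; lra.
Qed.

(** On a bounded interval the curve stays bounded, so left-translated and ordinary increments are
    comparable. The constant depends on the curve and serves only to obtain differentiability almost
    everywhere. *)
Lemma glip_linear (x : R -> V) (a b M : R) : a <= b -> 0 <= M -> glip br `[a, b] x M ->
  exists2 K0, 0 < K0 & forall s t, a <= s <= b -> a <= t <= b -> `|x s - x t| <= K0 * `|s - t|.
Proof.
move=> ab M0 h; have [K K0 hK] := ndist_curve ts; have C0 := bbl_ge0 ts.
pose K' := K * (M + M ^+ 2 * (b - a)).
have ba : 0 <= b - a by rewrite subr_ge0.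
have K'0 : 0 <= K' by rewrite mulr_ge0// addr_ge0// mulr_ge0// sqr_ge0.
have nd t s : a <= t -> t <= s -> s <= b -> ndist br (x t) (x s) <= K' * (s - t).
  move=> at_ ts_ sb; have h' : glip br `[t, s] x M.
    by apply: glip_sub h; apply: subset_itv; rewrite bnd_simp.
  apply: le_trans (hK _ _ _ _ ts_ M0 h') _; rewrite /K' -mulrA ler_wpM2l//.
  have d0 : 0 <= s - t by rewrite subr_ge0.
  have d1 : 0 <= (b - a) - (s - t) by lra.
  by have := mulr_ge0 (mulr_ge0 (sqr_ge0 M) d0) d1; nra.
pose B := `|x a| + (1 + 2^-1 * (C * `|x a|)) * (K' * (b - a)).
have xB t : a <= t <= b -> `|x t| <= B.
  move=> /andP[at_ tb]; rewrite -[x t](subrK (x a)) addrC (le_trans (ler_normD _ _))// lerD2l.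
  rewrite (le_trans (norm_le_ndist ts _ _))// ler_wpM2l ?addr_ge0 ?mulr_ge0//.
  by rewrite (le_trans (nd _ _ (lexx a) at_ tb))// ler_wpM2l// lerD2r.
exists ((1 + 2^-1 * (C * B)) * K' + 1).
  have B0 : 0 <= B by rewrite (le_trans _ (xB a _))// lexx.
  by rewrite ltr_wpDl// mulr_ge0// addr_ge0// !mulr_ge0.
have main s t : a <= t -> t <= s -> s <= b -> `|x s - x t| <= ((1 + 2^-1 * (C * B)) * K' + 1) * `|s - t|.
  move=> at_ ts_ sb; have xt := xB t (introT andP (conj at_ (le_trans ts_ sb))).
  have B0 : 0 <= B by rewrite (le_trans _ xt).
  rewrite (le_trans (norm_le_ndist ts _ _))// ger0_norm ?subr_ge0//.
  apply: (@le_trans _ _ ((1 + 2^-1 * (C * B)) * (K' * (s - t)))); last first.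
    by rewrite [leRHS]mulrDl mul1r -mulrA lerDl subr_ge0.
  apply: ler_pM; [|exact: ndist_ge0| |exact: nd].
  - by rewrite addr_ge0// !mulr_ge0.
  - by rewrite lerD2l ler_wpM2l// ler_wpM2l.
move=> s t /andP[h1 h2] /andP[h3 h4]; have [st|/ltW ts_] := leP s t; last exact: main.
by rewrite distrC [`|s - t|]distrC; exact: main.
Qed.

End group_length.

(** * Riemannian distance and group increments *)

Section model_distance.
Context {R : realType} {n : nat} {G : lieGroup R n}.
Notation V := 'rV[R]_n.
Notation mu := (@lebesgue_measure R).
Variables (e : chart R n G) (br : V -> V -> V) (C : R) (E : V -> G) (lg : G -> V).
Hypothesis hm : nil_model e br C E lg.
Variable q : {dot V for idfun}.

Lemma speed_exp (x : R -> V) (t : R) : {for t, continuous x} ->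
  speed e q (fun s => E (x s)) t = dotn q (tframe br (x t) (derive1 x t)).
Proof. by move=> xc; rewrite /speed (nm_vel hm xc). Qed.

Lemma speed_near (c c' : R -> G) (t : R) : (\forall s \near t, c s = c' s) -> speed e q c t = speed e q c' t.
Proof.
move=> cc'; rewrite /speed (_ : velocity e c t = velocity e c' t)// /velocity !derive1E.
apply: near_eq_derive; rewrite (nbhs_singleton cc').
by apply: filterS cc' => s ->.
Qed.

(* Any measurable function bounding the speed of a Lipschitz curve from above
   almost everywhere can be taken to have the length as its integral. *)
Lemma curve_speed (x : R -> V) (a b K0 : R) : 0 < K0 -> a < b ->
  (forall s t, `|x s - x t| <= K0 * `|s - t|) ->
  exists sigma : R -> R, [/\ measurable_fun setT (sigma : measurableTypeR R -> R),
    (forall t, 0 <= sigma t), exists B, forall t, sigma t <= B,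
    {ae mu, forall t : measurableTypeR R, a < t < b ->
     forall w, is_derive (t : R) 1 x w -> dotn q (tframe br (x t) w) <= sigma t} &
    forall c, (forall t, a < t < b -> \forall s \near t, c s = E (x s)) ->
    (\int[mu]_(t in `[a, b]) (sigma t)%:E <= curve_length e q a b c)%E].
Proof.
move=> K00 ab xL.
have [g [mg gK dx]] := lipschitz_ae_derive K00 ab xL.
have [Kq hKq] := dot_bounded q.
have xc : continuous x.
  move=> t; apply/(@cvgrPdist_le _ _ _ (nbhs t)) => eps eps0.
  apply: filterS (nbhsx_ballx t (eps / K0) (divr_gt0 eps0 K00)) => s.
  by rewrite -ball_normE /= ltr_pdivlMr// mulrC => h; rewrite (le_trans (xL _ _))// ltW.
(* Clamping the time keeps [x] bounded, so that the speed bound is bounded on the whole line;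
   between [a] and [b] it changes nothing. *)
pose w t := tframe br (x (clamp a b t)) (g t).
have mw : mvec (w : measurableTypeR R -> V).
  have mx : mvec (fun t : measurableTypeR R => x (clamp a b t)).
    apply: cont_mvec => t; apply: (cont_comp (f := clamp a b) (g := x)); last exact: xc.
    apply/(@cvgrPdist_le _ _ _ (nbhs t)) => eps eps0.
    apply: filterS (nbhsx_ballx t eps eps0) => s.
    by rewrite -ball_normE /= => h; rewrite (le_trans (clamp_lip _ _ _ _))// ltW.
  rewrite /w /tframe (_ : (fun t => _) = fun t => g t + (- 2^-1) *: br (x (clamp a b t)) (g t)); last first.
    by apply/funext => t; rewrite scaleNr.
  apply: mvecD => //; apply: mvecZ; exact: (mvec_bilinear hm mx mg).
have C0 := bbl_ge0 hm.
have [Bx hBx] : exists Bx, forall t, `|x (clamp a b t)| <= Bx.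
  exists (`|x a| + K0 * (b - a)) => t.
  have /andP[h1 h2] := clamp_in t (ltW ab).
  rewrite -[X in `|X|](subrK (x a)) addrC (le_trans (ler_normD _ _))// lerD2l (le_trans (xL _ _))//.
  by apply: ler_wpM2l; [exact: ltW|rewrite ger0_norm ?subr_ge0// lerD2r].
have [Kd Kd0 hKd] := dotn_le q.
exists (fun t => dotn q (w t)); split.
- apply: (measurableT_comp (f := @Num.sqrt R)).
    by apply: continuous_measurable_fun; exact: sqrt_continuous.
  exact: (measurable_bilinear hKq mw mw).
- by move=> t; exact: sqrtr_ge0.
- exists (Kd * (K0 + 2^-1 * (C * Bx * K0))) => t; rewrite (le_trans (hKd _))// ler_wpM2l//.
  rewrite (le_trans (ler_normB _ _))// lerD// normrZ ger0_norm ?invr_ge0// ler_wpM2l ?invr_ge0//.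
  by rewrite (le_trans (bbl_le hm _ _))// ler_pM ?mulr_ge0// ler_wpM2l.
- have FF := ae_filter_ringOfSetsType mu.
  apply: filterS dx => t h axb u du; have {}h := h axb.
  have -> : u = g t by rewrite -(derive_val (is_derive := du)) -(derive_val (is_derive := h)).
  by rewrite /w clamp_id//; move: axb => /andP[h1 h2]; rewrite !ltW.
- move=> c hc; have mab : measurable (`[a, b]%classic : set (measurableTypeR R)) by exact: measurable_itv.
  rewrite /curve_length; apply: ae_le_lower_integral => //.
  + apply/measurable_EFinP; apply: measurable_funTS.
    apply: (measurableT_comp (f := @Num.sqrt R)).
      by apply: continuous_measurable_fun; exact: sqrt_continuous.
    exact: (measurable_bilinear hKq mw mw).
  + by move=> t _; rewrite lee_fin sqrtr_ge0.
  + by move=> t _; rewrite lee_fin sqrtr_ge0.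
  + have ae1 (c' : R) : {ae mu, forall t : measurableTypeR R, t <> c'}.
      exists [set c']; split => [| |t /= /contrapT//]; first exact: measurable_set1.
      exact: lebesgue_measure_set1.
    have FF := ae_filter_ringOfSetsType mu.
    apply: filterS2 dx (filterI (ae1 a) (ae1 b)) => t h [ta tb] /=; rewrite in_itv/= => /andP[h1 h2].
    have axb : a < t < b.
      by rewrite !lt_neqAle h1 h2 !andbT eq_sym; apply/andP; split; exact/eqP.
    have {}h := h axb; rewrite lee_fin (speed_near (hc t axb)) speed_exp; last exact: xc.
    by rewrite derive1E (derive_val (is_derive := h)) /w clamp_id// h1.
Qed.

(** A curve of length less than [lam] joins the two points; read through the logarithm it falls
    under [ndist_length], which is where the square comes from. *)
Lemma model_dist : exists2 K, 0 <= K & forall x y (lam : R), (riem_dist e q (E x) (E y) < lam%:E)%E ->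
  ndist br x y <= K * (lam + lam ^+ 2).
Proof.
have [Kl Kl0 hKl] := ndist_length hm.
have [Kg Kg0 hKg] := dotn_ge q.
pose L := Kg + Kg ^+ 2.
have L0 : 0 <= L by rewrite addr_ge0 ?sqr_ge0// ltW.
exists (Kl * L); first by rewrite mulr_ge0.
move=> x y lam hd.
have [_ [c [cC c0 c1] <-] hc] := ereal_inf_lt hd.
pose z t := lg (c t).
have zE : c = fun t => E (z t) by apply/funext => t; rewrite /z (nm_lgK hm).
(* [nm_C1] gives a constant near each time; compactness of the interval makes it uniform. *)
have [M M0 zM] : exists2 M, 0 <= M & glip br `[0 : R, 1 : R] z M.
  pose P (M t : R) := 0 <= M /\ \forall s \near t, ndist br (z t) (z s) <= M * `|s - t|.
  have : \forall M \near +oo, `[0 : R, 1 : R]%classic `<=` P M.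
    apply: (compact_near_coveringP _).1; first exact: segment_compact.
    move=> t _; have [M [d d0 hM]] := nm_C1 hm t cC.
    exists (ball t d, [set M' | `|M| <= M']) => /=.
      split; [exact: nbhsx_ballx|by apply: nbhs_pinfty_ge; exact: num_real].
    move=> [s M'] [/= hs hM']; split; first exact: le_trans hM'.
    have os : \forall u \near s, ball t d u.
      by apply: open_nbhs_nbhs; split => //; exact: ball_open.
    apply: filterS os => u hu.
    by rewrite (le_trans (hM _ _ hs hu))// ler_wpM2r// (le_trans (ler_norm _)).
  move=> /filter_ex[M hM]; exists M; first by have [] := hM 0 (_ : `[0 : R, 1 : R]%classic 0); rewrite /= ?in_itv/= ?lexx ?ler01.
  by move=> t /hM[_]; apply: filterS.
have [K0 K00 zL] := glip_linear hm ler01 M0 zM.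
pose z' t := z (clamp 0 1 t).
have z'L s t : `|z' s - z' t| <= K0 * `|s - t|.
  rewrite (le_trans (zL _ _ _ _)) ?clamp_in//.
  by apply: ler_wpM2l; [exact: ltW|exact: clamp_lip].
have [sigma [ms s0 _ aes lens]] := curve_speed K00 ltr01 z'L.
have hz : (\int[mu]_(t in `[0%R, 1%R]) (sigma t)%:E <= lam%:E)%E.
  apply: le_trans (ltW hc); apply: lens => t /andP[t0 t1].
  apply: filterS2 (lt_nbhsr t0) (lt_nbhsl t1) => s /ltW s0' /ltW s1.
  by rewrite /z' clamp_id ?s0'// zE.
have lam0 : 0 <= lam.
  by rewrite -lee_fin (le_trans _ hz)//; apply: integral_ge0 => t _; rewrite lee_fin.
have mab : measurable (`[0%R, 1%R]%classic : set (measurableTypeR R)) by exact: measurable_itv.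
have := hKl z' (fun t => Kg * sigma t) K0 0 1 (Kg * lam) K00 ltr01 z'L.
have -> : z' 0 = x by rewrite /z' clamp_id ?lexx ?ler01// /z c0 (nm_EK hm).
have -> : z' 1 = y by rewrite /z' clamp_id ?lexx ?ler01// /z c1 (nm_EK hm).
move=> h; apply: le_trans (h _ _ _ _ _) _.
- by apply: measurable_funM => //; exact: measurable_cst.
- by move=> t; rewrite mulr_ge0// ltW.
- have FF := ae_filter_ringOfSetsType mu.
  by apply: filterS aes => t ht tb w dw; rewrite (le_trans (hKg _))//; apply: ler_wpM2l; [exact: ltW|exact: ht].
- by rewrite mulr_ge0// ltW.
- under eq_integral do rewrite EFinM.
  rewrite ge0_integralZl//; last 3 first.
    by apply/measurable_EFinP; exact: measurable_funTS.
    by move=> t _; rewrite lee_fin.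
    by rewrite lee_fin ltW.
  by rewrite [X in (_ <= X)%E]EFinM; apply: lee_wpmul2l; rewrite ?lee_fin// ltW.
rewrite -mulrA ler_wpM2l// /L.
have := sqr_ge0 lam; have := sqr_ge0 Kg; have := mulr_ge0 (ltW Kg0) (sqr_ge0 lam); have := mulr_ge0 (sqr_ge0 Kg) lam0; nra.
Qed.

End model_distance.

(** * Area *)

Section plane_measurability.
Context {R : realType}.
Notation T2 := (measurableTypeR R * measurableTypeR R)%type.
Notation mu := (@lebesgue_measure R).
Notation mu2 := (@lebesgue_measure R \x @lebesgue_measure R)%E.

(** The measurable structure is the product one, so an open set is exhibited as a countable union of
    products of intervals with rational centres. *)
Lemma open_measurable_plane (U : set (R * R)) : open U -> measurable (U : set T2).
Proof.
move=> oU.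
pose B (i : rat * rat * nat) : set T2 :=
  `](ratr i.1.1 - i.2.+1%:R^-1), (ratr i.1.1 + i.2.+1%:R^-1)[%classic `*`
  `](ratr i.1.2 - i.2.+1%:R^-1), (ratr i.1.2 + i.2.+1%:R^-1)[%classic.
pose B' i := if `[< B i `<=` U >] then B i else set0.
have -> : U = \bigcup_(i in setT) B' i.
  apply/seteqP; split => [[x y] Uxy|p [i _]]; last by rewrite /B'; case: asboolP => // h /h.
  have [d /= d0 hd] := (nbhs_ballP (x, y) _).1 (open_nbhs_nbhs (conj oU Uxy)).
  have d20 : 0 < d / 2 by rewrite divr_gt0.
  have [k _ /(_ k (leqnn _)) hk] := near_infty_natSinv_lt (PosNum d20).
  have k0 : 0 < (k.+1%:R^-1 : R) by rewrite invr_gt0.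
  have rin (z : R) : exists a : rat, z - k.+1%:R^-1 < ratr a < z + k.+1%:R^-1.
    have zz : z - k.+1%:R^-1 < z + k.+1%:R^-1 by rewrite ltrBlDr -addrA ltrDl addr_gt0.
    by have [a ha] := rat_in_itvoo zz; exists a; move: ha; rewrite in_itv.
  have [a /andP[a1 a2]] := rin x; have [b /andP[b1 b2]] := rin y.
  exists (a, b, k) => //; rewrite /B'; case: asboolP => [_|].
    split; rewrite /= in_itv/= ltrBlDr; first by rewrite a2 -ltrBlDr a1.
    by rewrite b2 -ltrBlDr b1.
  move=> []; move=> [u v] [/=]; rewrite !in_itv/= => /andP[u1 u2] /andP[v1 v2].
  have aux (z w c r s : R) : r < s / 2 -> z - r < c -> c < z + r -> c - r < w -> w < c + r -> `|z - w| < s.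
    by move=> *; rewrite ltr_norml; apply/andP; split; lra.
  by apply: hd; split; rewrite /= -ball_normE /=; [exact: (aux x u _ _ _ hk a1 a2)|exact: (aux y v _ _ _ hk b1 b2)].
apply: countable_bigcupT_measurable; first exact: countableP.
move=> i; rewrite /B'; case: asboolP => _ //; apply: measurableX; exact: measurable_itv.
Qed.

Lemma closed_measurable_plane (U : set (R * R)) : closed U -> measurable (U : set T2).
Proof. by move=> cU; rewrite -(setCK U); apply: measurableC; apply: open_measurable_plane; exact: closed_openC. Qed.

Lemma continuous_measurable_plane (f : R * R -> R) : continuous f -> measurable_fun setT (f : T2 -> R).
Proof.
move=> cf; apply: (measurability _ (RGenOpens.measurableE R)).
move=> _ [_ [a [b ->] <-]]; rewrite setTI; apply: open_measurable_plane.
by apply: open_comp => // p _; exact: cf.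
Qed.

Section partial_derivatives.
Context {n : nat}.
Notation V := 'rV[R]_n.

Definition partial1 (F : R * R -> V) (p : R * R) : V := derive1 (fun s => F (s, p.2)) p.1.
Definition partial2 (F : R * R -> V) (p : R * R) : V := derive1 (fun s => F (p.1, s)) p.2.
Definition derivable1 (F : R * R -> V) (p : R * R) := derivable (fun s => F (s, p.2)) p.1 1.
Definition derivable2 (F : R * R -> V) (p : R * R) := derivable (fun s => F (p.1, s)) p.2 1.

Let quot (f : R -> V) (x h : R) : V := h^-1 *: (f (h + x) - f x).

Let quotE f x : (fun h : R => h^-1 *: (f (h *: 1 + x) - f x)) = quot f x.
Proof. by apply/funext => h; rewrite /quot -[h *: 1]/(h * 1) mulr1. Qed.

(* Countably many closed conditions express differentiability of [f] at [x]. *)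
Lemma derivable_cauchyP (f : R -> V) (x : R) : continuous f ->
  derivable f x 1 <-> forall m : nat, exists k : nat, forall h h' : rat,
    0 < `|ratr h : R| < k.+1%:R^-1 -> 0 < `|ratr h' : R| < k.+1%:R^-1 ->
    `|quot f x (ratr h) - quot f x (ratr h')| <= m.+1%:R^-1.
Proof.
move=> cf; split=> [df m|H].
  have m20 : 0 < (m.+1%:R^-1 : R) / 2 by rewrite divr_gt0.
  have /cvgrPdist_le/(_ _ m20) : quot f x @ (0 : R)^' --> 'D_1 f x by rewrite -quotE.
  move=> [d /= d0 hd]; have [k _ /(_ k (leqnn _)) /= hk] := near_infty_natSinv_lt (PosNum d0).
  have aux (h : rat) : 0 < `|ratr h : R| < k.+1%:R^-1 -> `|'D_1 f x - quot f x (ratr h)| <= m.+1%:R^-1 / 2.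
    move=> /andP[h0 h1]; apply: hd; last by rewrite -normr_gt0.
    by rewrite /= sub0r normrN (lt_trans h1).
  exists k => h h' /aux h1 /aux h2.
  rewrite (splitr m.+1%:R^-1) -[X in `|X|](subrKA ('D_1 f x)) (le_trans (ler_normD _ _))// lerD//.
  by rewrite distrC.
rewrite /derivable quotE; apply: cauchy_cvg; apply: cauchy_exP => eps eps0.
have eps20 : 0 < eps / 2 by rewrite divr_gt0.
have [m _ /(_ m (leqnn _)) /= hm] := near_infty_natSinv_lt (PosNum eps20).
have [k hk] := H m; pose r : R := k.+1%:R^-1; have r0 : 0 < r by rewrite invr_gt0.
have [a] := rat_in_itvoo r0; rewrite in_itv/= => /andP[a0 ar].
exists (quot f x (ratr a)); rewrite /nbhs/=.
have qc (h : R) : h != 0 -> {for h, continuous (quot f x)}.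
  move=> h0; apply: cvgZ; first exact: inv_continuous.
  apply: cvgB; last exact: cvg_cst.
  apply: (cont_comp (f := fun h : R => h + x) (g := f)); last exact: cf.
  by apply: cvgD; [exact: cvg_id|exact: cvg_cst].
exists r => //= h; rewrite /= sub0r normrN => hr h0.
have /(@cvgrPdist_le _ _ _ (nbhs h))/(_ _ eps20)[d /= d0 hd] := qc h h0.
have nh0 : 0 < `|h| by rewrite normr_gt0.
(* A real increment is approximated by a rational one: within [d] for continuity of the quotient,
   and close enough to [h] to stay nonzero and shorter than [r]. *)
pose eta := Num.min d (Num.min `|h| (r - `|h|)).
have eta0 : 0 < eta by rewrite !lt_min d0 nh0 subr_gt0.
have hh : h - eta < h + eta by rewrite ltrBlDr -addrA ltrDl addr_gt0.
have [b] := rat_in_itvoo hh; rewrite in_itv/= => /andP[b1 b2].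
have hb : `|h - ratr b| < eta by rewrite ltr_norml; apply/andP; split; lra.
have /andP[b0 br] : 0 < `|ratr b : R| < r.
  have e1 : eta <= `|h| by rewrite !ge_min lexx orbT.
  have e2 : eta <= r - `|h| by rewrite !ge_min lexx !orbT.
  have h1 : `|h| <= `|h - ratr b| + `|ratr b : R| by rewrite -{1}(subrK (ratr b) h) ler_normD.
  have h2 : `|ratr b : R| <= `|h| + `|h - ratr b|.
    by rewrite -{1}(subKr h (ratr b)) ler_normB.
  by apply/andP; split; lra.
rewrite -ball_normE /= (splitr eps) -[X in `|X|](subrKA (quot f x (ratr b))) (le_lt_trans (ler_normD _ _))//.
apply: ltr_leD.
  apply: le_lt_trans hm; apply: hk; last by rewrite b0.
  by rewrite gtr0_norm// a0.
by rewrite distrC; apply: hd; rewrite /= (lt_le_trans hb)// ge_min lexx.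
Qed.

Lemma measurable_derivable1 (F : R * R -> V) : continuous F -> measurable (derivable1 F : set T2).
Proof.
move=> cF; have cs y : continuous (fun s => F (s, y)).
  move=> s; apply: (cont_comp (f := fun s => (s, y)) (g := F)); last exact: cF.
  by apply: cont_pair; [exact: cvg_id|exact: cont_cst].
pose q h p := quot (fun s => F (s, p.2)) p.1 h.
pose A m k (hh : rat * rat) : set T2 := [set p |
  0 < `|ratr hh.1 : R| < k.+1%:R^-1 -> 0 < `|ratr hh.2 : R| < k.+1%:R^-1 ->
  `|q (ratr hh.1) p - q (ratr hh.2) p| <= m.+1%:R^-1].
have -> : derivable1 F = \bigcap_m \bigcup_k \bigcap_hh A m k hh.
  apply/seteqP; split => p.
    move=> /(derivable_cauchyP _ (cs p.2)) h m _; have [k hk] := h m.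
    by exists k => // -[h1 h2] _; exact: hk.
  move=> h; apply/(derivable_cauchyP _ (cs p.2)) => m; have [k _ hk] := h m I.
  by exists k => h1 h2; exact: (hk (h1, h2) I).
apply: bigcapT_measurable => m; apply: bigcupT_measurable => k.
apply: closed_measurable_plane; apply: closed_bigI => -[h1 h2] _.
have qc h : continuous (q h).
  move=> p; apply: cvgZl_tmp; apply: cvgB; last first.
    apply: (cont_comp (f := fun p : R * R => (p.1, p.2)) (g := F)); last exact: cF.
    by apply: cont_pair; [exact: cont_fst|exact: cont_snd].
  apply: (cont_comp (f := fun p : R * R => (h + p.1, p.2)) (g := F)); last exact: cF.
  apply: cont_pair; last exact: cont_snd.
  by apply: cvgD; [exact: cvg_cst|exact: cont_fst].
rewrite /A /=.
have [h10|nh1] := boolP (0 < `|ratr h1 : R| < k.+1%:R^-1); last first.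
  by rewrite (_ : [set _ | _] = setT); [exact: closedT|apply/seteqP; split].
have [h20|nh2] := boolP (0 < `|ratr h2 : R| < k.+1%:R^-1); last first.
  by rewrite (_ : [set _ | _] = setT); [exact: closedT|apply/seteqP; split].
rewrite (_ : [set _ | _] = (fun p => `|q (ratr h1) p - q (ratr h2) p|) @^-1` [set y | y <= m.+1%:R^-1]).
  apply: closed_comp; last exact: closed_le.
  move=> p _; apply: (cont_comp (f := fun p => q (ratr h1) p - q (ratr h2) p)); last exact: norm_continuous.
  by apply: cvgB; exact: qc.
by apply/seteqP; split => p /=; [apply|].
Qed.

Lemma mvec_partial1 (F : R * R -> V) : continuous F -> mvec (partial1 F : T2 -> V).
Proof.
move=> cF j; pose D : set T2 := derivable1 F.
have mD := measurable_derivable1 cF.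
(* Where the derivative fails to exist the quotients need not converge; the indicator makes the
   sequence tend to the default value 0 there. *)
pose qn (k : nat) (p : T2) : R := \1_D p * (quot (fun s => F (s, p.2)) p.1 (k.+1%:R^-1)) 0 j.
apply: (@measurable_fun_cvg _ _ _ setT qn) => [k|p _].
  apply: measurable_funM; first exact: measurable_indic.
  have -> : (fun p : T2 => quot (fun s => F (s, p.2)) p.1 k.+1%:R^-1 0 j) =
     fun p => k.+1%:R^-1^-1 * (F (k.+1%:R^-1 + p.1, p.2) 0 j - F (p.1, p.2) 0 j).
    by apply/funext => p; rewrite !mxE.
  apply: continuous_measurable_plane => p; apply: cvgM; first exact: cvg_cst.
  have cc (a : R) : {for p, continuous (fun p : R * R => F (a + p.1, p.2) 0 j)}.
    apply: (cont_comp (f := fun p : R * R => (a + p.1, p.2)) (g := fun p => F p 0 j)).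
      apply: cont_pair; last exact: cont_snd.
      by apply: cvgD; [exact: cvg_cst|exact: cont_fst].
    exact: ((cont_mxP _ _).1 (cF _) 0 j).
  apply: cvgB; first exact: cc.
  have := cc 0; rewrite (_ : (fun p : R * R => F (0 + p.1, p.2) 0 j) = fun p => F (p.1, p.2) 0 j); first exact.
  by apply/funext => r; rewrite add0r.
rewrite /qn; have [Dp|nDp] := pselect (D p); last first.
  rewrite indicE memNset//; under eq_fun do rewrite mul0r.
  have -> : partial1 F p = 0.
    rewrite /partial1 derive1E; apply: etrans (dvgP nDp) _.
    by apply/rowP => i; rewrite !mxE.
  by rewrite mxE; exact: cvg_cst.
rewrite indicE mem_set//; under eq_fun do rewrite mul1r.
have dc : quot (fun s => F (s, p.2)) p.1 @ (0 : R)^' --> partial1 F p.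
  by rewrite -quotE /partial1 derive1E; exact: Dp.
apply/cvgrPdist_le => e e0.
have /cvgrPdist_le/(_ e e0)[d /= d0 hd] := dc.
have [N _ hN] := near_infty_natSinv_lt (PosNum d0).
exists N => // k /hN /= hk.
apply: le_trans (hd k.+1%:R^-1 _ _).
- rewrite (le_trans _ (mx_norm_coord _ 0 j))// !mxE lexx.
  by [].
- by rewrite /= sub0r normrN gtr0_norm// invr_gt0.
- by rewrite invr_neq0.
Qed.

Lemma swap_continuous_fun (F : R * R -> V) : continuous F -> continuous (fun r => F (r.2, r.1)).
Proof.
move=> cF p; apply: (cont_comp (f := fun r : R * R => (r.2, r.1)) (g := F)); last exact: cF.
by apply: cont_pair; [exact: cont_snd|exact: cont_fst].
Qed.

Let mswap : measurable_fun setT (fun r : T2 => (r.2, r.1) : T2).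
Proof. exact: measurable_swap. Qed.

Lemma mvec_partial2 (F : R * R -> V) : continuous F -> mvec (partial2 F : T2 -> V).
Proof.
move=> cF j; have h := mvec_partial1 (swap_continuous_fun cF).
exact: (measurableT_comp (h j) mswap).
Qed.

Lemma measurable_derivable2 (F : R * R -> V) : continuous F -> measurable (derivable2 F : set T2).
Proof.
move=> cF; have h := measurable_derivable1 (swap_continuous_fun cF).
by have := mswap measurableT h; rewrite setTI.
Qed.

Lemma lipschitz_ae_derivable (x : R -> V) (K : R) : 0 < K -> (forall s t, `|x s - x t| <= K * `|s - t|) ->
  {ae mu, forall t : measurableTypeR R, derivable x (t : R) 1}.
Proof.
move=> K0 xL; have FF := ae_filter_ringOfSetsType mu.
have h (m : nat) : {ae mu, forall t : measurableTypeR R, - m.+1%:R < t < m.+1%:R -> derivable x (t : R) 1}.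
  have mm : - m.+1%:R < m.+1%:R :> R by rewrite (lt_trans (_ : _ < 0))// oppr_lt0.
  have [g [_ _ dx]] := lipschitz_ae_derive K0 mm xL.
  by apply: filterS dx => t dt /dt[].
apply: filterS (ae_foralln h) => t ht; apply: (ht (Num.truncn `|t|)).
by rewrite -ltr_norml truncnS_gt.
Qed.

(** Fubini: every vertical slice of [F] is a Lipschitz curve, so each slice of the bad set is
    null. *)
Lemma ae_derivable2 (F : R * R -> V) (K : R) : 0 < K -> continuous F ->
  (forall x s t, `|F (x, s) - F (x, t)| <= K * `|s - t|) -> mu2 (~` derivable2 F) = 0%E.
Proof.
move=> K0 cF FL; have mA : measurable (~` derivable2 F : set T2).
  by apply: measurableC; exact: measurable_derivable2.
rewrite /product_measure1; apply: integral0_eq => x _ /=.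
have [N [mN N0 hN]] := lipschitz_ae_derivable K0 (FL x).
apply/eqP; rewrite eq_le measure_ge0 andbT -N0; apply: le_measure; rewrite ?inE//.
  exact: measurable_xsection.
by move=> y; rewrite /xsection/= inE => h; apply: hN.
Qed.

Lemma ae_derivable1 (F : R * R -> V) (K : R) : 0 < K -> continuous F ->
  (forall y s t, `|F (s, y) - F (t, y)| <= K * `|s - t|) -> mu2 (~` derivable1 F) = 0%E.
Proof.
move=> K0 cF FL; have mA : measurable (~` derivable1 F : set T2).
  by apply: measurableC; exact: measurable_derivable1.
(* The product measure integrates vertical sections; uniqueness allows horizontal ones instead. *)
rewrite (@product_measure_unique _ _ _ _ R mu mu (mu \x^ mu)%E)//; last first.
  by move=> A B mA' mB; exact: product_measure2E.
rewrite /product_measure2; apply: integral0_eq => y _ /=.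
have [N [mN N0 hN]] := lipschitz_ae_derivable K0 (FL y).
apply/eqP; rewrite eq_le measure_ge0 andbT -N0; apply: le_measure; rewrite ?inE//.
  exact: measurable_ysection.
by move=> x; rewrite /ysection/= inE => h; apply: hN.
Qed.

End partial_derivatives.

End plane_measurability.

(** * Areas of parallelograms *)

Section gram.
Context {R : realType} {n : nat} (q : {dot 'rV[R]_n for idfun}).
Notation V := 'rV[R]_n.

Definition gram (u v : V) : R := Num.sqrt (q u u * q v v - q u v ^+ 2).

Lemma gram_le u v : gram u v <= dotn q u * dotn q v.
Proof.
by rewrite /gram /dotn -sqrtrM ?dot_ge0//; apply: ler_wsqrtr; rewrite lerBlDr lerDl sqr_ge0.
Qed.

Lemma dotZl (s : R) u v : q (s *: u) v = s * q u v. Proof. exact: linearZl_LR. Qed.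
Lemma dotZr (s : R) u v : q u (s *: v) = s * q u v. Proof. exact: linearZr. Qed.

Lemma gram_parallel (a b : R) w : gram (a *: w) (b *: w) = 0.
Proof.
rewrite /gram !dotZl !dotZr (_ : _ - _ = 0) ?sqrtr0//; ring.
Qed.

Lemma gramZ (a b : R) u v : 0 <= a -> 0 <= b -> gram (a *: u) (b *: v) = a * b * gram u v.
Proof.
move=> a0 b0; rewrite /gram !dotZl !dotZr.
rewrite (_ : _ - _ = (a * b) ^+ 2 * (q u u * q v v - q u v ^+ 2)); last by ring.
by rewrite sqrtrM ?sqr_ge0// sqrtr_sqr ger0_norm// mulr_ge0.
Qed.

Lemma gram_shift (t : R) (u v : V) : gram u (v - t *: u) = gram u v.
Proof.
rewrite (_ : v - t *: u = (- t) *: u + v); last by rewrite scaleNr addrC.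
rewrite /gram !(dotDl, dotDr) (dotC q v u); congr Num.sqrt; ring.
Qed.

Lemma gram_orth u v : q u v = 0 -> gram u v = dotn q u * dotn q v.
Proof. by move=> h; rewrite /gram h expr0n subr0 sqrtrM ?dot_ge0. Qed.

End gram.

(** The area does not change when [v] is replaced by its component orthogonal to [u]. For orthogonal
    vectors it is the product of the lengths, which [A] multiplies by at most [k], and on the target
    the product of lengths bounds the area from above. *)
Lemma gram_linear (R : realType) (n n' : nat) (q : {dot 'rV[R]_n for idfun}) (q' : {dot 'rV[R]_n' for idfun})
    (A : 'M[R]_(n, n')) : exists2 K, 0 <= K & forall u v, gram q' (u *m A) (v *m A) <= K * gram q u v.
Proof.
have [K1 K10 h1] := dotn_le q'; have [K2 K20 h2] := dotn_ge q.
pose k := K1 * (n%:R * `|A| * K2).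
have k0 : 0 <= k by rewrite !mulr_ge0// ltW.
have hk u : dotn q' (u *m A) <= k * dotn q u.
  rewrite (le_trans (h1 _))// /k -mulrA ler_wpM2l// (le_trans (mulmx_norm_le _ _))//.
  by rewrite mulrAC -[leRHS]mulrA; apply: ler_wpM2l; rewrite ?mulr_ge0.
exists (k ^+ 2); first by rewrite sqr_ge0.
move=> u v; have [->|u0] := eqVneq u 0.
  by rewrite mul0mx -(scale0r (v *m A)) -[X in gram _ _ X]scale1r gram_parallel mulr_ge0 ?sqr_ge0// sqrtr_ge0.
have qu : q u u != 0 by rewrite gt_eqF//; exact: neq0_dnorm_gt0.
pose t := q u v / q u u; pose w := v - t *: u.
have uw : q u w = 0.
  rewrite /w (_ : v - t *: u = (- t) *: u + v); last by rewrite scaleNr addrC.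
  by rewrite dotDr /t; field.
rewrite -(gram_shift q t u v) -/w (gram_orth uw) -(gram_shift q' t (u *m A)).
rewrite (_ : v *m A - _ = w *m A); last by rewrite /w mulmxBl -scalemxAl.
rewrite (le_trans (gram_le _ _ _))// expr2 mulrACA.
by apply: ler_pM; rewrite ?sqrtr_ge0.
Qed.

Section derivatives.
Context {R : realType} {V : normedModType R}.

Lemma is_derive_epsP (f : R -> V) (x : R) (d : V) :
  is_derive x 1 f d <-> forall eps : R, 0 < eps -> \forall s \near x, `|f s - f x - (s - x) *: d| <= eps * `|s - x|.
Proof.
have qE (b : V) (h : R) : h != 0 -> h^-1 *: (f (h *: 1 + x) - f x) - b = h^-1 *: (f (h + x) - f x - h *: b).
  by move=> h0; rewrite -[h *: 1]/(h * 1) mulr1 [RHS]scalerBr scalerA mulVf// scale1r.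
split=> [[df <-] eps eps0|H].
  have /cvgrPdist_le/(_ _ eps0)[d' /= d'0 hd'] := df.
  apply: filterS (nbhsx_ballx x d' d'0) => s; rewrite -ball_normE /= distrC => hs.
  have [->|sx] := eqVneq s x; first by rewrite !subrr scale0r subr0 !normr0 mulr0.
  have sx0 : s - x != 0 by rewrite subr_eq0.
  have := hd' (s - x); rewrite /= sub0r normrN => /(_ hs sx0).
  rewrite distrC -/(derive f x 1) [X in `|X|](qE ('D_1 f x) _ sx0) subrK normrZ normfV.
  by rewrite ler_pdivrMl ?normr_gt0// mulrC.
have dq : h^-1 *: (f (h *: 1 + x) - f x) @[h --> (0 : R)^'] --> d.
  apply/cvgrPdist_le => eps eps0.
  have [d' /= d'0 hd'] := (nbhs_ballP x _).1 (H eps eps0).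
  exists d' => //= h; rewrite /= sub0r normrN => hh h0.
  rewrite distrC qE// normrZ normfV ler_pdivrMl ?normr_gt0// mulrC.
  have := hd' (h + x); rewrite addrK; apply.
  by rewrite -ball_normE /= distrC addrK.
by apply: DeriveDef; [apply/cvg_ex; exists d|apply/cvg_lim].
Qed.

Lemma is_derive_affine (f : R -> V) (a b x : R) (d : V) : is_derive (a * x + b) 1 f d ->
  is_derive x 1 (fun s => f (a * s + b)) (a *: d).
Proof.
move=> /is_derive_epsP h; apply/is_derive_epsP => eps eps0.
have a1 : 0 < `|a| + 1 by rewrite ltr_wpDl.
have [d' /= d'0 hd'] := (nbhs_ballP _ _).1 (h _ (divr_gt0 eps0 a1)).
apply: filterS (nbhsx_ballx x (d' / (`|a| + 1)) (divr_gt0 d'0 a1)) => s.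
rewrite -ball_normE /= distrC ltr_pdivlMr// => hs.
have E : (a * s + b) - (a * x + b) = (s - x) * a by ring.
have nE : `|(s - x) * a| <= `|s - x| * (`|a| + 1) by rewrite normrM ler_wpM2l// lerDl.
have := hd' (a * s + b); rewrite -ball_normE /= distrC E => /(_ (le_lt_trans nE hs)).
rewrite -scalerA => H; rewrite (le_trans H)//.
by rewrite mulrAC ler_pdivrMr// -mulrA ler_wpM2l// ltW.
Qed.

(** [u] need not be invertible. Because its derivative at [t0] is nonzero, the intermediate value
    theorem writes each [s] near [u t0] as [u t] with [t] at distance at most 2|s - u t0|/|c| from
    [t0], and there the expansions of [u] and of [phi (u t)] can be compared. *)
Lemma inverse_derive (u : R -> R) (phi : R -> V) (t0 c : R) (d : V) : continuous u -> c != 0 ->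
  is_derive t0 1 u c -> is_derive t0 1 (fun t => phi (u t)) d -> is_derive (u t0) 1 phi (c^-1 *: d).
Proof.
move=> cu c0 du dphi; apply/is_derive_epsP => eps eps0.
have nc : 0 < `|c| by rewrite normr_gt0.
pose B := 2 / `|c| * (1 + `|d| / `|c|).
have B0 : 0 < B by rewrite mulr_gt0 ?divr_gt0// ltr_pwDl// divr_ge0.
(* The bound |c|/2 lets [u] overshoot [s] on both sides; eps/B makes the two first-order errors add
   up to [eps]. *)
pose eta := Num.min (`|c| / 2) (eps / B).
have eta0 : 0 < eta by rewrite lt_min !divr_gt0.
have h1 := (is_derive_epsP _ _ _).1 dphi eta eta0.
have h2 : \forall s \near t0, `|u s - u t0 - (s - t0) * c| <= eta * `|s - t0|.
  move: du => [du1 du2].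
  have /cvgrPdist_le/(_ _ eta0)[d' /= d'0 hd'] := du1.
  apply: filterS (nbhsx_ballx t0 d' d'0) => s; rewrite -ball_normE /= distrC => hs.
  have [->|sx] := eqVneq s t0; first by rewrite !subrr mul0r subr0 !normr0 mulr0.
  have sx0 : s - t0 != 0 by rewrite subr_eq0.
  have := hd' (s - t0); rewrite /= sub0r normrN => /(_ hs sx0).
  rewrite -/(derive u t0 1) du2 -[(s - t0) *: 1]/((s - t0) * 1) mulr1 subrK.
  rewrite -[_ *: _]/((s - t0)^-1 * (u s - u t0)) => H.
  have -> : u s - u t0 - (s - t0) * c = - ((s - t0) * (c - (s - t0)^-1 * (u s - u t0))) by field.
  by rewrite normrN normrM mulrC ler_wpM2r.
have [del /= del0 hdel] := (nbhs_ballP t0 _).1 (filterI h1 h2).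
have r0 : 0 < `|c| / 2 * (del / 2) by rewrite mulr_gt0// divr_gt0.
apply: filterS (nbhsx_ballx (u t0) _ r0) => s; rewrite -ball_normE /= distrC => hs.
pose k := 2 * `|s - u t0| / `|c|.
have k0 : 0 <= k by rewrite divr_ge0// mulr_ge0.
have kd : k < del.
  rewrite /k ltr_pdivrMr// ; move: hs; rewrite -(ltr_pM2l (_ : 0 < 4)) => // hs; nra.
have bk t : `|t - t0| <= k -> `|u t - u t0 - (t - t0) * c| <= eta * k /\
    `|phi (u t) - phi (u t0) - (t - t0) *: d| <= eta * k.
  move=> ht; have : ball t0 del t by rewrite -ball_normE /= distrC (le_lt_trans ht).
  by move=> /hdel[H1 H2]; split; [apply: le_trans H2 _|apply: le_trans H1 _]; rewrite ler_wpM2l// ltW.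
have ek : eta * k <= `|s - u t0|.
  have : eta <= `|c| / 2 by rewrite ge_min lexx.
  move=> /(ler_wpM2r k0); have -> : `|c| / 2 * k = `|s - u t0| by rewrite /k; field; rewrite gt_eqF.
  by [].
have ck : `|c| * k = 2 * `|s - u t0| by rewrite /k; field; rewrite gt_eqF.
have tk : t0 - k <= t0 + k by lra.
have e1 : t0 + k - t0 = k by rewrite addrAC subrr add0r.
have e2 : t0 - k - t0 = - k by rewrite addrAC subrr add0r.
(* At [t0 - k] and [t0 + k] the function [u] lies on opposite sides of [s], in an order that depends
   on the sign of [c]. *)
have [|t] := IVT tk (continuous_subspaceT cu) (v := s).
  have [H1 _] : _ /\ _ := bk (t0 + k) (ltac:(by rewrite e1 ger0_norm)).
  have [H2 _] : _ /\ _ := bk (t0 - k) (ltac:(by rewrite e2 normrN ger0_norm)).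
  rewrite e1 in H1; rewrite e2 mulNr opprK in H2.
  move: H1 H2; rewrite !ler_norml => /andP[H1 H1'] /andP[H2 H2'].
  have := ler_norm (s - u t0); have := ler_norm (- (s - u t0)); rewrite normrN => N1 N2.
  rewrite ge_min le_max.
  by have [cp|cn] := ltP 0 c; [rewrite (gtr0_norm cp) in ck|rewrite (ler0_norm cn) in ck];
    apply/andP; split; apply/orP; [left; lra|right; lra|right; lra|left; lra].
rewrite in_itv/= => /andP[ht1 ht2] uts.
have [H1 H2] := bk t (ltac:(by rewrite ler_norml; apply/andP; split; lra)).
rewrite uts in H1 H2.
have -> : phi s - phi (u t0) - (s - u t0) *: (c^-1 *: d) =
    (phi s - phi (u t0) - (t - t0) *: d) - (c^-1 * (s - u t0 - (t - t0) * c)) *: d.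
  rewrite -[RHS]addrA -opprD -scalerDl scalerA; congr (_ - _ *: _).
  by field.
rewrite (le_trans (ler_normB _ _))// normrZ normrM normfV.
apply: (@le_trans _ _ (eta * k * (1 + `|d| / `|c|))).
  rewrite mulrDr mulr1 lerD// (_ : eta * k * (`|d| / `|c|) = `|c|^-1 * (eta * k) * `|d|); last by ring.
  by rewrite ler_wpM2r// ler_wpM2l// invr_ge0 ltW.
have -> : eta * k * (1 + `|d| / `|c|) = eta * B * `|s - u t0| by rewrite /k /B; field; rewrite gt_eqF.
by rewrite ler_wpM2r// -ler_pdivlMr// ge_min lexx orbT.
Qed.

End derivatives.

Lemma integral_scaled_image d d' (T : measurableType d) (T' : measurableType d') (R : realType)
    (m : {measure set T -> \bar R}) (m' : {measure set T' -> \bar R}) (phi : T' -> T) (k : R) (h : T -> \bar R) :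
  measurable_fun setT phi -> 0 <= k -> (forall X, measurable X -> m X = k%:E * m' (phi @^-1` X))%E ->
  measurable_fun setT h -> (forall p, 0 <= h p)%E ->
  (\int[m]_p h p = k%:E * \int[m']_p h (phi p))%E.
Proof.
move=> mphi k0 e mh h0.
pose P := measure_function_pushforward__canonical__measure_function_Measure m' mphi.
have -> : (\int[m]_p h p = \int[mscale (NngNum k0) P]_p h p)%E.
  by apply: eq_measure_integral => A mA _; exact: e.
rewrite ge0_integral_mscale//=; congr (_ * _)%E.
by rewrite ge0_integral_pushforward.
Qed.

(** * Affine changes of variables and null sets in the plane *)

Section lebesgue_plane.
Context {R : realType}.
Notation T1 := (measurableTypeR R).
Notation T2 := (measurableTypeR R * measurableTypeR R)%type.
Notation mu := (@lebesgue_measure R).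
Notation mu2 := (@lebesgue_measure R \x @lebesgue_measure R)%E.

Lemma affine_measurable (a b : R) : measurable_fun setT (fun t : T1 => a * t + b : T1).
Proof. by apply: measurable_funD => //; apply: measurable_funM. Qed.

Lemma lebesgue_affine (a b : R) (A : set T1) : 0 < a -> measurable A ->
  mu A = (a%:E * mu ((fun t => (a * t + b)%R) @^-1` A))%E.
Proof.
move=> a0 mA.
pose F (t : T1) : T1 := a * t + b.
have e : forall X : set R, ocitv X -> mu X = (mscale (NngNum (ltW a0)) (pushforward mu F)) X.
  move=> m X; rewrite ocitvP => -[->|[[u v] /= uv ->]]; first by rewrite !measure0.
  have Fuv : F @^-1` `]u, v]%classic = `](u - b) / a, (v - b) / a]%classic.
    apply/seteqP; split => t; rewrite /= !in_itv/= ltr_pdivrMr// ler_pdivlMr// ltrBlDr lerBrDr mulrC //.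
  rewrite [RHS](_ : _ = a%:E * mu (F @^-1` `]u, v]%classic))%E// Fuv.
  rewrite !lebesgue_measure_itv/= !lte_fin uv ltr_pM2r ?invr_gt0// ltrD2r uv -!EFinB -EFinM.
  by congr EFin; field; rewrite gt_eqF.
exact: (lebesgue_measure_unique (e (affine_measurable a b)) mA).
Qed.

Lemma affine_plane_measurable (a b c d : R) :
  measurable_fun setT (fun p : T2 => (a * p.1 + b, c * p.2 + d) : T2).
Proof.
apply: measurable_fun_pair.
- exact: (measurableT_comp (affine_measurable a b) measurable_fst).
- exact: (measurableT_comp (affine_measurable c d) measurable_snd).
Qed.

Lemma integral_affine (a b c d : R) (h : T2 -> \bar R) : 0 < a -> 0 < c ->
  measurable_fun setT h -> (forall p, 0 <= h p)%E ->
  (\int[mu2]_p h p = (a * c)%:E * \int[mu2]_p h ((a * p.1 + b)%R, (c * p.2 + d)%R))%E.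
Proof.
move=> a0 c0 mh h0.
pose F (p : T2) : T2 := (a * p.1 + b, c * p.2 + d).
have mF : measurable_fun setT F := affine_plane_measurable a b c d.
have ac := ltW (mulr_gt0 a0 c0).
have e : forall X : set T2, measurable X -> mu2 X = (mscale (NngNum ac) (pushforward mu2 F)) X.
  move=> m X mX; apply: product_measure_unique mX => // A B mA mB.
  pose A' : set T1 := (fun t : T1 => (a * t + b)%R : T1) @^-1` A.
  pose B' : set T1 := (fun t : T1 => (c * t + d)%R : T1) @^-1` B.
  have mA' : measurable A' by rewrite -[A']setTI; exact: affine_measurable.
  have mB' : measurable B' by rewrite -[B']setTI; exact: affine_measurable.
  transitivity ((a * c)%:E * mu2 (A' `*` B'))%E => //.
  rewrite [mu2 _](product_measure1E mu mu mA' mB').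
  transitivity ((a%:E * mu A') * (c%:E * mu B'))%E; first by rewrite EFinM muleACA.
  by congr (_ * _)%E; symmetry; exact: lebesgue_affine.
exact: (integral_scaled_image mF ac (e mF)).
Qed.

Lemma null_slices (N : set T2) : measurable N -> (forall x, mu (xsection N x) = 0)%E -> mu2 N = 0%E.
Proof. by move=> mN h; apply: integral0_eq => x _; exact: h. Qed.

Lemma null_vertical (c : R) : mu2 [set p : T2 | p.1 = c] = 0%E.
Proof.
rewrite (_ : [set p | _] = [set c] `*` setT); last by apply/seteqP; split => [[x y]|[x y] []].
have -> := product_measure1E mu mu (measurable_set1 c) (@measurableT _ T1).
exact: etrans (congr1 (fun z => z * _)%E (lebesgue_measure_set1 c)) (mul0e _).
Qed.

Lemma null_horizontal (c : R) : mu2 [set p : T2 | p.2 = c] = 0%E.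
Proof.
rewrite (_ : [set p | _] = setT `*` [set c]); last by apply/seteqP; split => [[x y]|[x y] []].
have -> := product_measure1E mu mu (@measurableT _ T1) (measurable_set1 c).
exact: etrans (congr1 (fun z => _ * z)%E (lebesgue_measure_set1 c)) (mule0 _).
Qed.

Lemma circle_closed : closed (@circle R).
Proof.
rewrite (_ : circle = (fun p : R * R => p.1 ^+ 2 + p.2 ^+ 2) @^-1` [set 1])//.
apply: preimage_closed; last exact: closed_eq.
by move=> p _; apply: cvgD; rewrite expr2; apply: cvgM; (exact: cvg_fst || exact: cvg_snd).
Qed.

(** Each vertical slice has at most two points. *)
Lemma null_circle : mu2 (circle : set T2) = 0%E.
Proof.
apply: null_slices; first exact: closed_measurable_plane circle_closed.
move=> x; apply/eqP; rewrite eq_le measure_ge0 andbT.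
pose s := Num.sqrt (1 - x ^+ 2).
have m2 : measurable ([set s] `|` [set - s] : set T1) by apply: measurableU; exact: measurable_set1.
apply: (@le_trans _ _ (mu ([set s] `|` [set - s]))).
  apply: le_measure; rewrite ?inE//; first exact: measurable_xsection (closed_measurable_plane circle_closed).
  move=> y; rewrite /xsection /= inE /circle /= => xy0; have {xy0}xy : 1 - x ^+ 2 = y ^+ 2 by rewrite -xy0 addrC addKr.
  have : y ^+ 2 = s ^+ 2 by rewrite sqr_sqrtr xy ?sqr_ge0.
  by move/eqP; rewrite eqf_sqr => /orP[] /eqP ->; [left|right].
have h (r : R) : mu [set r] = 0%E := lebesgue_measure_set1 r.
rewrite le_eqVlt; apply/orP; left; apply/eqP; refine (etrans (measureU0 _ _ (h _)) (h _)); exact: measurable_set1.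
Qed.

End lebesgue_plane.

(** * Area bounds by measurable majorants *)

Section area.
Context {R : realType} {n : nat}.
Notation V := 'rV[R]_n.
Notation T2 := (measurableTypeR R * measurableTypeR R)%type.
Notation mu2 := (@lebesgue_measure R \x @lebesgue_measure R)%E.
Variables (br : V -> V -> V) (C : R).
Hypothesis ts : two_step br C.
Variable q : {dot V for idfun}.
Implicit Types (F : R * R -> V) (D : set (R * R)) (p : R * R).

Definition jac F p : R := gram q (tframe br (F p) (partial1 F p)) (tframe br (F p) (partial2 F p)).

Lemma jac_ge0 F p : 0 <= jac F p. Proof. exact: sqrtr_ge0. Qed.

Lemma tframeZ (x v : V) (a : R) : tframe br x (a *: v) = a *: tframe br x v.
Proof. by rewrite /tframe (bblZr ts) scalerBr !scalerA mulrC. Qed.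

Lemma near_slice1 (P : R * R -> Prop) p : (\forall p' \near p, P p') -> \forall s \near p.1, P (s, p.2).
Proof. by move=> H; have := cvg_pair (@cvg_id _ (nbhs p.1)) (@cvg_cst _ p.2 _ (nbhs p.1) _); apply; case: p H. Qed.

Lemma near_slice2 (P : R * R -> Prop) p : (\forall p' \near p, P p') -> \forall s \near p.2, P (p.1, s).
Proof. by move=> H; have := cvg_pair (@cvg_cst _ p.1 _ (nbhs p.2) _) (@cvg_id _ (nbhs p.2)); apply; case: p H. Qed.

Lemma jac_near F F' p : (\forall p' \near p, F p' = F' p') -> jac F p = jac F' p.
Proof.
move=> H.
have e1 : partial1 F p = partial1 F' p.
  by rewrite /partial1 !derive1E; apply: near_eq_derive; exact: (near_slice1 H).
have e2 : partial2 F p = partial2 F' p.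
  by rewrite /partial2 !derive1E; apply: near_eq_derive; exact: (near_slice2 H).
by rewrite /jac e1 e2 (nbhs_singleton H).
Qed.

Lemma measurable_jac F : continuous F -> measurable_fun setT (jac F : T2 -> R).
Proof.
move=> cF.
have [K qK] := dot_bounded q.
have mF : mvec (F : T2 -> V).
  by move=> j; apply: continuous_measurable_plane => p; exact: ((cont_mxP _ _).1 (cF p) 0 j).
have mt G : mvec (G : T2 -> V) -> mvec (fun p : T2 => tframe br (F p) (G p)).
  move=> mG; apply: mvecD => // j; under eq_fun do rewrite -scaleNr.
  exact: (mvecZ (- 2^-1) (mvec_bilinear ts mF mG)).
have m1 := mt _ (mvec_partial1 cF); have m2 := mt _ (mvec_partial2 cF).
have mq G H : mvec (G : T2 -> V) -> mvec (H : T2 -> V) -> measurable_fun setT (fun p : T2 => q (G p) (H p)).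
  by move=> mG mH; exact: (measurable_bilinear qK mG mH).
have ms : measurable_fun setT (Num.sqrt : measurableTypeR R -> measurableTypeR R).
  by apply: continuous_measurable_fun; exact: sqrt_continuous.
apply: (measurableT_comp ms (g := fun p : T2 => q _ _ * q _ _ - q _ _ ^+ 2)).
by apply: measurable_funB; [apply: measurable_funM; exact: mq|apply: measurable_funX; exact: mq].
Qed.

(* An upper bound, stable under subsets, for the area of [F] over [D]. *)
Definition area_le F D (A : R) := exists h : T2 -> \bar R, [/\ measurable_fun setT h,
  (forall p, 0 <= h p)%E, (\int[mu2]_p h p <= A%:E)%E & forall p, D p -> ((jac F p)%:E <= h p)%E].

Lemma area_sub F D D' A A' : D' `<=` D -> A <= A' -> area_le F D A -> area_le F D' A'.
Proof.
move=> DD AA [h [mh h0 hA hD]]; exists h; split=> // [|p /DD]; last exact: hD.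
by rewrite (le_trans hA)// lee_fin.
Qed.

Lemma area_near F F' D A : (forall p, D p -> \forall p' \near p, F p' = F' p') -> area_le F' D A -> area_le F D A.
Proof.
move=> H [h [mh h0 hA hD]]; exists h; split; [exact: mh|exact: h0|exact: hA|move=> p Dp].
by have -> := jac_near (H p Dp); apply: hD.
Qed.

Lemma areaU F D D' A A' : area_le F D A -> area_le F D' A' -> area_le F (D `|` D') (A + A').
Proof.
move=> [h [mh h0 hA hD]] [h' [mh' h0' hA' hD']]; exists (fun p => h p + h' p)%E; split.
- exact: emeasurable_funD.
- by move=> p; rewrite adde_ge0.
- by rewrite ge0_integralD// EFinD leeD.
- by move=> p [/hD|/hD'] H; rewrite (le_trans H)// ?leeDl ?leeDr.
Qed.

(** The majorant is infinite on [N]: this costs nothing on a null set and asks nothing of [F]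
    there. *)
Lemma area_null F (N : set T2) : measurable N -> mu2 N = 0%E -> area_le F N 0.
Proof.
move=> mN N0; exists ((cst +oo%E : T2 -> \bar R) \_ N); split.
- exact/(measurable_restrictT _ mN)/measurable_cst.
- by move=> p; rewrite /patch; case: ifP => _; rewrite /= ?lee_fin ?leey.
- by rewrite -integral_mkcond null_set_integral.
- by move=> p Np; rewrite /patch ifT ?inE// leey.
Qed.

Lemma area_bound F D c : D `<=` `[0, 1] `*` `[0, 1] -> 0 <= c -> (forall p, D p -> jac F p <= c) -> area_le F D c.
Proof.
move=> DI c0 hD; pose I : set T2 := `[0 : R, 1 : R]%classic `*` `[0 : R, 1 : R]%classic.
have mI : measurable I by apply: measurableX; exact: measurable_itv.
exists ((cst c%:E : T2 -> \bar R) \_ I); split.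
- exact/(measurable_restrictT _ mI)/measurable_cst.
- by move=> p; rewrite /patch; case: ifP => _; rewrite /= ?lee_fin ?leey.
- have l1 : (@lebesgue_measure R) `[0 : R, 1 : R]%classic = 1%E.
    by rewrite lebesgue_measure_itv/= lte_fin ltr01 oppr0 adde0.
  have mI1 : measurable (`[0 : R, 1 : R]%classic : set (measurableTypeR R)) by exact: measurable_itv.
  have e : mu2 I = 1%E.
    by refine (etrans (product_measure1E _ _ mI1 mI1) _); rewrite -[RHS]mule1; congr (_ * _)%E.
  by rewrite -integral_mkcond integral_cst// [X in (_ * X)%E]e mule1.
- by move=> p Dp; rewrite /patch ifT ?inE ?lee_fin; [exact: hD|exact: DI].
Qed.

Lemma jac_glip : exists2 K, 0 <= K & forall F D M p, 0 <= M -> glip br D F M -> D p -> (\forall p' \near p, D p') ->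
  jac F p <= K * M ^+ 2.
Proof.
have [K K0 hK] := dotn_le q; exists (K ^+ 2); first exact: sqr_ge0.
move=> F D M p M0 FM Dp nD; rewrite /jac (le_trans (gram_le _ _ _))// -exprMn expr2.
have nF : \forall p' \near p, ndist br (F p) (F p') <= M * `|p' - p|.
  by apply: filterS2 nD (FM p Dp) => p' D' h; exact: h.
apply: ler_pM; rewrite ?sqrtr_ge0// (le_trans (hK _))// ler_wpM2l//.
- have := near_slice1 nF; case: p {Dp nD nF} => x y /= H.
  apply: (glip_speed ts M0); apply: filterS H => s; rewrite /= => H.
  by rewrite (le_trans H)// ler_wpM2l// ge_max /= subrr normr0 lexx normr_ge0.
- have := near_slice2 nF; case: p {Dp nD nF} => x y /= H.
  apply: (glip_speed ts M0); apply: filterS H => s; rewrite /= => H.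
  by rewrite (le_trans H)// ler_wpM2l// ge_max /= subrr normr0 lexx normr_ge0.
Qed.

(** The substitution is invertible, so both functions are differentiable at corresponding points or
    neither is, in which case both derivatives are 0. *)
Lemma derive1_affine (f : R -> V) (a b x : R) : 0 < a -> derive1 (fun s => f (a * s + b)) x = a *: derive1 f (a * x + b).
Proof.
move=> a0; have [df|ndf] := pselect (derivable f (a * x + b) 1).
  by rewrite !derive1E; apply: derive_val; apply: is_derive_affine; exact: derivableP.
rewrite !derive1E; have nd : ~ derivable (fun s => f (a * s + b)) x 1.
  move=> dg; apply: ndf; pose g s := f (a * s + b).
  have -> : f = (fun s => g (a^-1 * s + (- b / a))).
    by apply/funext => s; rewrite /g; congr f; field; rewrite gt_eqF.
  have dg' : is_derive (a^-1 * (a * x + b) + (- b / a)) 1 g ('D_1 g x).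
    rewrite (_ : a^-1 * (a * x + b) + (- b / a) = x); last by field; rewrite gt_eqF.
    exact: derivableP.
  by case: (is_derive_affine dg').
have V0 (g : R -> V) y : ~ derivable g y 1 -> 'D_1 g y = 0.
  by move=> ng; apply: etrans (dvgP ng) _; apply/matrixP => i j; rewrite !mxE.
by rewrite !V0// scaler0.
Qed.

Lemma area_affine F D A (a b c d : R) : 0 < a -> 0 < c -> area_le F D A ->
  area_le (fun p => F (a * p.1 + b, c * p.2 + d)) [set p | D (a * p.1 + b, c * p.2 + d)] A.
Proof.
move=> a0 c0 [h [mh h0 hA hD]].
have ac : 0 <= a * c by rewrite ltW// mulr_gt0.
exists (fun p => (a * c)%:E * h ((a * p.1 + b)%R, (c * p.2 + d)%R))%E; split.
- apply: measurable_funeM; exact: (measurableT_comp mh (affine_plane_measurable a b c d)).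
- by move=> p; rewrite mule_ge0// lee_fin.
- rewrite ge0_integralZl_EFin//; first by rewrite -integral_affine.
  exact: (measurableT_comp mh (affine_plane_measurable a b c d)).
- move=> p Dp.
  have -> : jac (fun p => F (a * p.1 + b, c * p.2 + d)) p = a * c * jac F (a * p.1 + b, c * p.2 + d).
    rewrite /jac -gramZ ?(ltW a0) ?(ltW c0)// -!tframeZ /partial1 /partial2 /=.
    by rewrite -(derive1_affine (fun s => F (s, c * p.2 + d)))// -(derive1_affine (fun s => F (a * p.1 + b, s))).
  by rewrite EFinM lee_wpmul2l ?lee_fin//; exact: hD.
Qed.

Lemma area_thin (u : R * R -> R) (phi : R -> V) (Ku Kp : R) : 0 < Ku -> 0 < Kp ->
  (forall p p', `|u p - u p'| <= Ku * `|p - p'|) -> (forall s t, `|phi s - phi t| <= Kp * `|s - t|) ->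
  area_le (fun p => phi (u p)) setT 0.
Proof.
move=> Ku0 Kp0 uL pL.
pose F p := phi (u p); pose u' p : 'rV[R]_1 := const_mx (u p).
have cl m (H : R * R -> 'rV[R]_m) (K : R) : (forall p p', `|H p - H p'| <= K * `|p - p'|) -> continuous H.
  move=> HL p; apply/(@cvgrPdist_le _ _ _ (nbhs p)) => eps eps0.
  have K1 : 0 < `|K| + 1 by rewrite ltr_wpDl.
  apply: filterS (nbhsx_ballx p _ (divr_gt0 eps0 K1)) => p'; rewrite -ball_normE /= ltr_pdivlMr// => hp.
  rewrite (le_trans (HL _ _))// (le_trans _ (ltW hp))// mulrC ler_wpM2l//.
  by rewrite (le_trans (ler_norm _))// lerDl.
have u'L p p' : `|u' p - u' p'| <= Ku * `|p - p'|.
  rewrite mx_norm_leP; last by rewrite mulr_ge0// ltW.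
  by move=> i j; rewrite !mxE; exact: uL.
have FL p p' : `|F p - F p'| <= (Kp * Ku) * `|p - p'|.
  by rewrite (le_trans (pL _ _))// -mulrA ler_wpM2l// ltW.
have n1 (x y y' : R) : `|(x, y) - (x, y')| <= `|y - y'| by rewrite ge_max /= subrr normr0 normr_ge0 lexx.
have n2 (x x' y : R) : `|(x, y) - (x', y)| <= `|x - x'| by rewrite ge_max /= subrr normr0 normr_ge0 lexx.
have sl1 m (H : R * R -> 'rV[R]_m) K : 0 < K -> (forall p p', `|H p - H p'| <= K * `|p - p'|) ->
    area_le F (~` derivable1 H) 0.
  move=> K0 HL; apply: area_null; first by apply: measurableC; apply: measurable_derivable1; exact: cl HL.
  apply: (ae_derivable1 K0 (cl _ _ _ HL)) => y s t.
  by rewrite (le_trans (HL _ _))// ler_wpM2l ?n2// ltW.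
have sl2 m (H : R * R -> 'rV[R]_m) K : 0 < K -> (forall p p', `|H p - H p'| <= K * `|p - p'|) ->
    area_le F (~` derivable2 H) 0.
  move=> K0 HL; apply: area_null; first by apply: measurableC; apply: measurable_derivable2; exact: cl HL.
  apply: (ae_derivable2 K0 (cl _ _ _ HL)) => y s t.
  by rewrite (le_trans (HL _ _))// ler_wpM2l ?n1// ltW.
have FK : 0 < Kp * Ku by rewrite mulr_gt0.
have bad := areaU (areaU (sl1 _ u' Ku Ku0 u'L) (sl2 _ u' Ku Ku0 u'L)) (areaU (sl1 _ F _ FK FL) (sl2 _ F _ FK FL)).
pose Good : set (R * R) := [set p | [/\ derivable1 u' p, derivable2 u' p, derivable1 F p & derivable2 F p]].
have good : area_le F Good 0.
  exists (cst 0%E); split=> //; first by rewrite integral0.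
  move=> p [d1u d2u d1F d2F]; rewrite lee_fin le_eqVlt; apply/orP; left; apply/eqP.
  have coord (w : R -> 'rV[R]_1) (w0 : R -> R) x : w = (fun s => const_mx (w0 s)) -> derivable w x 1 ->
      exists c, is_derive x 1 w0 c.
    move=> -> /derivableP/is_derive_mxP/(_ 0 0) H; eexists; move: H.
    by under [X in is_derive _ _ X _]eq_fun do rewrite mxE; exact.
  have [c1 h1] := coord _ (fun s => u (s, p.2)) _ erefl d1u.
  have [c2 h2] := coord _ (fun s => u (p.1, s)) _ erefl d2u.
  have h3 := derivableP d1F; have h4 := derivableP d2F.
  (* Where [u] is stationary, the Lipschitz bound on [phi] makes the composite stationary. *)
  have flat (w : R -> R) (x : R) (d : V) : is_derive x 1 w 0 -> is_derive x 1 (fun s => phi (w s)) d -> d = 0.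
    move=> dw dd; suff H : is_derive x 1 (fun s => phi (w s)) 0 by rewrite -(derive_val (is_derive := dd)) (derive_val (is_derive := H)).
    apply/is_derive_epsP => eps eps0.
    move/is_derive_epsP : dw => /(_ _ (divr_gt0 eps0 Kp0)); apply: filterS => s.
    rewrite !scaler0 !subr0 => H; rewrite (le_trans (pL _ _))//.
    by rewrite mulrC -ler_pdivlMr// mulrAC.
  have cu : continuous u.
    move=> r; have := (cont_mxP _ _).1 (cl _ _ _ u'L r) 0 0.
    by rewrite (_ : (fun r0 => _) = u)//; apply/funext => r0; rewrite mxE.
  have cs x0 : continuous (fun s => u (s, x0)) /\ continuous (fun s => u (x0, s)).
    by split=> s; [apply: (cont_comp (f := fun s => (s, x0)) (g := u)) (cu _)|
      apply: (cont_comp (f := fun s => (x0, s)) (g := u)) (cu _)]; apply: cont_pair; (exact: cvg_cst || exact: cvg_id).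
  (* When both partial derivatives of [u] are nonzero, each yields a derivative of [phi] at [u p];
     these are equal, so the two partial derivatives of the composite are parallel. *)
  have par : exists w a b, partial1 F p = a *: w /\ partial2 F p = b *: w.
    rewrite /partial1 /partial2 !derive1E.
    have [c10|c10] := eqVneq c1 0.
      rewrite c10 in h1; exists ('D_1 (fun s => F (p.1, s)) p.2), 0, 1.
      by rewrite scale0r scale1r (flat _ _ _ h1 h3).
    have [c20|c20] := eqVneq c2 0.
      rewrite c20 in h2; exists ('D_1 (fun s => F (s, p.2)) p.1), 1, 0.
      by rewrite scale0r scale1r (flat _ _ _ h2 h4).
    have g1 := inverse_derive (cs p.2).1 c10 h1 h3.
    have g2 := inverse_derive (cs p.1).2 c20 h2 h4.
    rewrite -surjective_pairing in g1; rewrite -surjective_pairing in g2.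
    exists (c1^-1 *: 'D_1 (fun s => F (s, p.2)) p.1), c1, c2.
    split; first by rewrite scalerA divff// scale1r.
    have e : c1^-1 *: 'D_1 (fun s => F (s, p.2)) p.1 = c2^-1 *: 'D_1 (fun s => F (p.1, s)) p.2.
      by rewrite -[LHS](derive_val (is_derive := g1)) -[RHS](derive_val (is_derive := g2)).
    by rewrite e scalerA divff// scale1r.
  have [w [a [b [e1 e2]]]] := par.
  by rewrite /jac e1 e2 !tframeZ gram_parallel.
have := areaU bad good; rewrite !addr0; apply: area_sub => // p _.
have [|] := pselect (Good p); first by right.
move=> nG; left; apply: contrapT => nB; apply: nG.
by split; apply: contrapT => h; apply: nB; [left; left|left; right|right; left|right; right].
Qed.

End area.

Section area_projection.
Context {R : realType} {n n' : nat}.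
Notation V := 'rV[R]_n.
Notation V' := 'rV[R]_n'.
Notation T2 := (measurableTypeR R * measurableTypeR R)%type.
Notation mu2 := (@lebesgue_measure R \x @lebesgue_measure R)%E.
Variables (br : V -> V -> V) (C : R) (br' : V' -> V' -> V') (C' : R).
Hypothesis ts : two_step br C.
Hypothesis ts' : two_step br' C'.
Variables (q : {dot V for idfun}) (q' : {dot V' for idfun}) (A : 'M[R]_(n, n')).
Hypothesis brA : forall x y, br' (x *m A) (y *m A) = br x y *m A.

(** At points where both partial derivatives exist, [A] acts on the translated tangent vectors and
    [gram_linear] applies. The other points form a null set, since [F] is Lipschitz in each
    variable. *)
Lemma area_projection : exists2 K, 0 <= K & forall (F : R * R -> V) (D : set T2) (K0 a : R), 0 < K0 ->
  (forall p p', `|F p - F p'| <= K0 * `|p - p'|) -> measurable D ->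
  (\int[mu2]_(p in D) (jac br q F p)%:E <= a%:E)%E -> area_le br' q' (fun p => F p *m A) D (K * a).
Proof.
have [K Kge hK] := gram_linear q q' A; exists K => // F D K0 a K00 FL mD hD.
have cF : continuous F.
  move=> p; apply/(@cvgrPdist_le _ _ _ (nbhs p)) => eps eps0.
  apply: filterS (nbhsx_ballx p _ (divr_gt0 eps0 K00)) => p'; rewrite -ball_normE /= ltr_pdivlMr// => hp.
  by rewrite (le_trans (FL _ _))// (le_trans _ (ltW hp))// mulrC.
have n1 (x y y' : R) : `|(x, y) - (x, y')| <= `|y - y'| by rewrite ge_max /= subrr normr0 normr_ge0 lexx.
have n2 (x x' y : R) : `|(x, y) - (x', y)| <= `|x - x'| by rewrite ge_max /= subrr normr0 normr_ge0 lexx.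
have m1 := measurable_derivable1 cF; have m2 := measurable_derivable2 cF.
have bad1 : area_le br' q' (fun p => F p *m A) (~` derivable1 F) 0.
  apply: (area_null br' q' _ (measurableC m1)).
  apply: (ae_derivable1 K00 cF) => y s t.
  by rewrite (le_trans (FL _ _))// ler_wpM2l ?n2// ltW.
have bad2 : area_le br' q' (fun p => F p *m A) (~` derivable2 F) 0.
  apply: (area_null br' q' _ (measurableC m2)).
  apply: (ae_derivable2 K00 cF) => x s t.
  by rewrite (le_trans (FL _ _))// ler_wpM2l ?n1// ltW.
have mj := measurable_jac ts q cF.
have mKj : measurable_fun setT (fun p : T2 => K%:E * (jac br q F p)%:E)%E.
  by apply: measurable_funeM; apply/measurable_EFinP.
have good : area_le br' q' (fun p => F p *m A) [set p | [/\ D p, derivable1 F p & derivable2 F p]] (K * a).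
  exists ((fun p : T2 => K%:E * (jac br q F p)%:E)%E \_ D); split.
  - exact/(measurable_restrictT _ mD)/measurable_funTS.
  - by move=> p; rewrite /patch; case: ifP => _ //; rewrite mule_ge0 ?lee_fin ?jac_ge0.
  - rewrite -integral_mkcond ge0_integralZl_EFin//; last 2 first.
    + by move=> p _; rewrite lee_fin jac_ge0.
    + by apply/measurable_EFinP; exact: measurable_funTS.
    by rewrite EFinM lee_wpmul2l ?lee_fin.
  - move=> p [Dp d1 d2]; rewrite /patch ifT ?inE// -EFinM lee_fin /jac.
    have tfA x v : tframe br' (x *m A) (v *m A) = tframe br x v *m A.
      by rewrite /tframe brA mulmxBl scalemxAl.
    have e1 : partial1 (fun p => F p *m A) p = partial1 F p *m A.
      by rewrite /partial1 !derive1E; exact: (derive_val (is_derive := is_derive_mulmxr A (derivableP d1))).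
    have e2 : partial2 (fun p => F p *m A) p = partial2 F p *m A.
      by rewrite /partial2 !derive1E; exact: (derive_val (is_derive := is_derive_mulmxr A (derivableP d2))).
    by rewrite e1 e2 !tfA.
have := areaU good (areaU bad1 bad2); rewrite !addr0; apply: area_sub => // p Dp.
have [d1|d1] := pselect (derivable1 F p); last by right; left.
have [d2|d2] := pselect (derivable2 F p); last by right; right.
by left.
Qed.

End area_projection.

Section area_model.
Context {R : realType} {n : nat} {G : lieGroup R n}.
Notation V := 'rV[R]_n.
Variables (e : chart R n G) (br : V -> V -> V) (C : R) (E : V -> G) (lg : G -> V).
Hypothesis hm : nil_model e br C E lg.
Variable q : {dot V for idfun}.

Lemma velocity_near (c c' : R -> G) (t : R) : (\forall s \near t, c s = c' s) -> velocity e c t = velocity e c' t.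
Proof.
move=> cc'; rewrite /velocity !derive1E.
apply: near_eq_derive; rewrite (nbhs_singleton cc').
by apply: filterS cc' => s ->.
Qed.

Lemma jacobian2_exp (g : R * R -> G) (F : R * R -> V) p : {for p, continuous F} ->
  (\forall p' \near p, g p' = E (F p')) -> jacobian2 e q g p = jac br q F p.
Proof.
move=> cF gF.
have v1 : velocity e (fun s => g (s, p.2)) p.1 = tframe br (F p) (partial1 F p).
  rewrite (velocity_near (near_slice1 gF)) (nm_vel hm (x := fun s => F (s, p.2))); first by case: p {cF gF}.
  apply: (cont_comp (f := fun s => (s, p.2)) (g := F)); last by case: p cF {gF}.
  by apply: cont_pair; [exact: cvg_id|exact: cvg_cst].
have v2 : velocity e (fun s => g (p.1, s)) p.2 = tframe br (F p) (partial2 F p).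
  rewrite (velocity_near (near_slice2 gF)) (nm_vel hm (x := fun s => F (p.1, s))); first by case: p {cF gF v1}.
  apply: (cont_comp (f := fun s => (p.1, s)) (g := F)); last by case: p cF {gF v1}.
  by apply: cont_pair; [exact: cvg_cst|exact: cvg_id].
by rewrite /jacobian2 v1 v2.
Qed.

Lemma disc_area_le (F : R * R -> V) A : continuous F -> area_le br q F disc A ->
  (disc_area e q (fun p => E (F p)) <= A%:E)%E.
Proof.
move=> cF [h [mh h0 hA hD]]; apply: le_trans hA.
rewrite /disc_area; apply: le_lower_integral => // [p _|p Dp]; first by rewrite lee_fin sqrtr_ge0.
have -> : jacobian2 e q (fun p => E (F p)) p = jac br q F p.
  by apply: jacobian2_exp; [exact: cF|apply: filterE].
exact: hD.
Qed.

End area_model.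

(** * Horizontal curves *)

Section curves.
Context {R : realType} {n : nat}.
Notation V := 'rV[R]_n.
Notation I01 := (`[0 : R, 1 : R]%classic).
Variables (br : V -> V -> V) (C : R).
Hypothesis ts : two_step br C.
Implicit Types (x y : R -> V) (u v w : V).

Lemma glip_translate (T : normedModType R) (D : set T) (f : T -> V) (L : R) a :
  glip br D f L -> glip br D (fun p => bch br a (f p)) L.
Proof. by move=> h p Dp; apply: filterS (h p Dp) => p'; rewrite (ndist_invariant ts). Qed.

Lemma glip_bound : exists2 K : R, 0 <= K & forall x (M : R), 0 <= M -> glip br I01 x M ->
  forall s t : R, 0 <= s <= 1 -> 0 <= t <= 1 -> ndist br (x s) (x t) <= K * (M + M ^+ 2) * `|t - s|.
Proof.
have [K K0 hK] := ndist_curve ts; exists K => // x M M0 hx.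
have aux (s t : R) : 0 <= s -> t <= 1 -> s <= t -> ndist br (x s) (x t) <= K * (M + M ^+ 2) * (t - s).
  move=> s0 t1 st; have hx' : glip br (`[s, t]%classic : set R) x M.
    by apply: glip_sub hx; apply: subset_itv; rewrite bnd_simp.
  rewrite (le_trans (hK _ _ _ _ st M0 hx'))// -[leRHS]mulrA; apply: ler_wpM2l => //.
  rewrite mulrDl exprMn lerD2l; apply: ler_wpM2l; first exact: sqr_ge0.
  by rewrite expr2 ler_piMr ?subr_ge0//; lra.
move=> s t /andP[s0 s1] /andP[t0 t1]; have [st|ts'] := leP s t.
  by rewrite ger0_norm ?subr_ge0//; exact: aux.
by rewrite ltr0_norm ?subr_lt0// opprB (ndistC ts); apply: aux => //; exact: ltW.
Qed.

Definition cat_curve x y (t : R) : V := if t <= 2^-1 then x (2 * t) else bch br (x 1) (y (2 * t - 1)).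

Lemma glip_cat x y (L : R) : 0 <= L -> glip br I01 x L -> glip br I01 y L -> y 0 = 0 ->
  glip br I01 (cat_curve x y) (L * 2).
Proof.
move=> L0 hx hy y0.
have h1 : glip br `[0 : R, 2^-1]%classic (cat_curve x y) (L * 2).
  apply: (@eq_glip _ _ _ _ _ (fun t : R => x (2 * t))).
    by move=> t; rewrite /= in_itv/= /cat_curve => /andP[_ ->].
  apply: (glip_comp L0) hx => [t|s t _ _]; first by rewrite /= !in_itv/= => ?; lra.
  by rewrite -mulrBr normrM ger0_norm.
have h2 : glip br `[2^-1 : R, 1]%classic (cat_curve x y) (L * 2).
  apply: (@eq_glip _ _ _ _ _ (fun t : R => bch br (x 1) (y (2 * t - 1)))).
    move=> t; rewrite /= in_itv/= /cat_curve => /andP[t1 t2]; case: ifP => // t3.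
    have -> : t = 2^-1 by apply/eqP; rewrite eq_le t3.
    by rewrite divff// subrr y0 (bchx0 ts).
  apply: glip_translate; apply: (glip_comp L0) hy => [t|s t _ _]; first by rewrite /= !in_itv/= => ?; lra.
  by rewrite opprB addrA subrK -mulrBr normrM ger0_norm.
have h12 := glip_glue (@itv_closed _ R 0 2^-1) (@itv_closed _ R 2^-1 1) h1 h2.
refine (glip_sub _ h12) => t /=.
by rewrite !in_itv/= => /andP[-> ->]; rewrite andbT /= ; apply/orP; exact: le_total.
Qed.

Lemma cat_curve0 x y : cat_curve x y 0 = x 0.
Proof. by rewrite /cat_curve invr_ge0 ler0n mulr0. Qed.

Lemma cat_curve1 x y : cat_curve x y 1 = bch br (x 1) (y 1).
Proof.
rewrite /cat_curve ifF; first by congr (bch br _ (y _)); lra.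
by apply/negbTE; rewrite -ltNge invf_lt1// ltr1n.
Qed.

(** Length is encoded as a Lipschitz constant over unit time, so that concatenating two curves
    doubles it. *)
Definition reach (L : R) w := exists x, [/\ glip br I01 x L, x 0 = 0 & x 1 = w].

Lemma reach_le (L L' : R) w : L <= L' -> reach L w -> reach L' w.
Proof. by move=> LL [x [h h0 h1]]; exists x; split=> //; exact: glip_le h. Qed.

Lemma reach_bch (L : R) u v : 0 <= L -> reach L u -> reach L v -> reach (L * 2) (bch br u v).
Proof.
move=> L0 [x [hx x0 x1]] [y [hy y0 y1]]; exists (cat_curve x y); split.
- exact: glip_cat.
- by rewrite cat_curve0.
- by rewrite cat_curve1 x1 y1.
Qed.

Lemma reach_line v : reach `|v| v.
Proof.
exists (fun t => t *: v); split; rewrite ?scale0r ?scale1r//.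
move=> t _; apply: filterE => s _.
by rewrite /ndist -scaleNr (bchZ ts) normrZ addrC mulrC.
Qed.

Lemma commutator_bch u v : bch br (bch br u v) (bch br (- u) (- v)) = br u v.
Proof.
by rewrite /bch !(brE ts) (br_anti ts v u); mx_field.
Qed.

(** The group commutator of [u] and [v] is exactly [br u v]; joining its four factors takes two
    rounds of concatenation, hence the 4. *)
Lemma reach_bracket u v (r : R) : `|u| <= r -> `|v| <= r -> reach (r * 4) (br u v).
Proof.
move=> ur vr; have r0 : 0 <= r by exact: le_trans ur.
have h w : `|w| <= r -> reach r w by move=> wr; exact: reach_le wr (reach_line w).
rewrite -commutator_bch (_ : r * 4 = r * 2 * 2); last by rewrite -mulrA -natrM.
by apply: reach_bch; rewrite ?mulr_ge0//; apply: reach_bch => //; apply: h; rewrite ?normrN.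
Qed.

(** A bracket with coefficient of order r^2 is a commutator of vectors of order r, and the terms of
    the sum are central, so that adding them is multiplying them. *)
Lemma reach_brackets (s : seq (V * V)) : exists2 K : R, 0 <= K & forall (c : nat -> R) (r : R), 0 <= r ->
  (forall i, `|c i| <= r ^+ 2) ->
  reach (K * r) (\sum_(i < size s) c i *: br (nth (0, 0) s i).1 (nth (0, 0) s i).2) /\
  forall y : V, br (\sum_(i < size s) c i *: br (nth (0, 0) s i).1 (nth (0, 0) s i).2) y = 0.
Proof.
elim: s => [|[u v] s [K K0 IH]].
  exists 0 => // c r r0 _; rewrite big_ord0; split=> [|y]; last by rewrite (bbl0l ts).
  by have := reach_line 0; rewrite normr0 mul0r.
pose m := `|u| + `|v|.
have m0 : 0 <= m by rewrite addr_ge0.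
exists ((m * 4 + K) * 2); first by rewrite mulr_ge0// addr_ge0// mulr_ge0.
move=> c r r0 hc; rewrite big_ord_recl /=.
have [h1 h2] := IH (fun i => c i.+1) r r0 (fun i => hc i.+1).
set w := \sum_(i < size s) _ in h1 h2 *.
(* Balanced scaling: since [|c 0| <= r ^+ 2], both factors have norm of order [r]. When [r = 0] the
   coefficient is 0 as well. *)
have -> : c 0%N *: br u v = br ((r^-1 * c 0%N) *: u) (r *: v).
  rewrite (bblZl ts) (bblZr ts) scalerA; have [r00|r00] := eqVneq r 0; last by rewrite mulrAC mulVf// mul1r.
  have := hc 0%N; rewrite r00 expr0n /= normr_le0 => /eqP ->; by rewrite !mulr0 !scale0r.
split; last first.
  by move=> y; rewrite (bblDl ts) (ts_nil ts) h2 addr0.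
rewrite -(bch_central ts _ h2) mulrAC.
have e : (m * 4 + K) * r = r * m * 4 + K * r by ring.
apply: reach_bch; first by rewrite mulr_ge0// addr_ge0// mulr_ge0.
- apply: (@reach_le (r * m * 4)); first by rewrite e lerDl mulr_ge0.
  apply: reach_bracket; last by rewrite normrZ ger0_norm// ler_wpM2l// lerDr.
  rewrite normrZ normrM normfV (ger0_norm r0).
  have [->|r00] := eqVneq r 0; first by rewrite invr0 !mul0r.
  have rp : 0 < r by rewrite lt_neqAle eq_sym r00.
  apply: ler_pM => //; first by rewrite mulr_ge0// invr_ge0.
    by rewrite ler_pdivrMl// -expr2; exact: hc.
  by rewrite lerDl.
- by apply: reach_le h1; rewrite e lerDr !mulr_ge0.
Qed.

(** The coefficients of [w] on the brackets depend linearly on [w], so they are at most [k * |w|];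
    take its square root as [r] in [reach_brackets]. *)
Lemma reach_span (s : seq (V * V)) : exists2 K : R, 0 <= K &
  forall w, w \in <<[seq br p.1 p.2 | p <- s]>>%VS -> reach (K * Num.sqrt `|w|) w.
Proof.
have [K K0 hK] := reach_brackets s.
pose X := in_tuple [seq br p.1 p.2 | p <- s].
pose a i j : R := coord X i (delta_mx 0 j).
pose k := \sum_i \sum_j `|a i j|.
have k0 : 0 <= k by rewrite sumr_ge0// => i _; exact: sumr_ge0.
exists (K * Num.sqrt k); first by rewrite mulr_ge0.
move=> w ws.
have cw i : `|coord X i w| <= k * `|w|.
  rewrite {1}(row_sum_delta w) linear_sum (le_trans (ler_norm_sum _ _ _))//.
  rewrite /k (bigD1 i)//= mulrDl; apply: ler_wpDr; last first.
    rewrite mulr_suml; apply: ler_sum => j _.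
    by rewrite linearZ normrM mulrC ler_wpM2l//; exact: mx_norm_coord.
  by rewrite mulr_ge0// sumr_ge0// => *; exact: sumr_ge0.
pose c (i : nat) : R := if insub i is Some i' then coord X i' w else 0.
have hc i : `|c i| <= (Num.sqrt (k * `|w|)) ^+ 2.
  rewrite sqr_sqrtr ?mulr_ge0// /c; case: insubP => [i' _ _|_]; first exact: cw.
  by rewrite normr0 mulr_ge0.
have [h _] := hK c _ (sqrtr_ge0 _) hc.
suff e : \sum_(i < size s) c i *: br (nth (0, 0) s i).1 (nth (0, 0) s i).2 = w.
  by rewrite -mulrA -sqrtrM// -[X in reach _ X]e.
rewrite [RHS](coord_span (X := X) ws).
have es : size [seq br p.1 p.2 | p <- s] = size s by rewrite size_map.
rewrite (reindex (cast_ord es))/=; last first.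
  by exists (cast_ord (esym es)) => i _; rewrite ?cast_ordK ?cast_ordKV.
apply: eq_bigr => i _; congr (_ *: _).
  rewrite /c; case: insubP => [i' _ e|]; last by move=> /negP[]; exact: ltn_ord.
  by congr (coord X _ w); apply: val_inj; rewrite /= e.
have i1 : (i < size s)%N by rewrite -es.
by rewrite (nth_map (0, 0)).
Qed.

End curves.

(** * Fillings and homotopies *)

Section plane_geometry.
Context {R : realType}.
Implicit Types p : R * R.

Definition eucl p : R := Num.sqrt (p.1 ^+ 2 + p.2 ^+ 2).

Lemma eucl_ge0 p : 0 <= eucl p. Proof. exact: sqrtr_ge0. Qed.

Lemma eucl_sqr p : eucl p ^+ 2 = p.1 ^+ 2 + p.2 ^+ 2.
Proof. by rewrite sqr_sqrtr// addr_ge0 ?sqr_ge0. Qed.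

Lemma norm1_le p p' : `|p.1 - p'.1| <= `|p - p'|. Proof. by rewrite /Num.norm /= le_max lexx. Qed.
Lemma norm2_le p p' : `|p.2 - p'.2| <= `|p - p'|. Proof. by rewrite /Num.norm /= le_max lexx orbT. Qed.

Lemma norm1_le_eucl p : `|p.1| <= eucl p.
Proof. by rewrite /eucl -sqrtr_sqr ler_wsqrtr// lerDl sqr_ge0. Qed.
Lemma norm2_le_eucl p : `|p.2| <= eucl p.
Proof. by rewrite /eucl -sqrtr_sqr ler_wsqrtr// lerDr sqr_ge0. Qed.

Lemma norm_le_euclid p p' : `|p - p'| <= euclid_dist p p'.
Proof.
rewrite ge_max /=; apply/andP; split.
- exact: (norm1_le_eucl (p.1 - p'.1, p.2 - p'.2)).
- exact: (norm2_le_eucl (p.1 - p'.1, p.2 - p'.2)).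
Qed.

Lemma euclid_le_norm p p' : euclid_dist p p' <= 2 * `|p - p'|.
Proof.
have m0 : 0 <= 2 * `|p - p'| by rewrite mulr_ge0.
rewrite -(ger0_norm m0) -sqrtr_sqr /euclid_dist ler_wsqrtr//.
rewrite -(real_normK (num_real (p.1 - _))) -(real_normK (num_real (p.2 - _))).
have := norm1_le p p'; have := norm2_le p p'.
move: `|p.1 - _| `|p.2 - _| (normr_ge0 (p.1 - p'.1)) (normr_ge0 (p.2 - p'.2)) `|p - p'| => a b a0 b0 m h1 h2.
have := ler_pM a0 a0 h2 h2; have := ler_pM b0 b0 h1 h1; nra.
Qed.

Lemma eucl_lip p p' : `|eucl p - eucl p'| <= 2 * `|p - p'|.
Proof.
have r0 := eucl_ge0 p; have r0' := eucl_ge0 p'.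
have [rr|rr] := eqVneq (eucl p + eucl p') 0.
  have -> : eucl p = 0 by lra.
  have -> : eucl p' = 0 by lra.
  by rewrite subrr normr0 mulr_ge0.
have rp : 0 < eucl p + eucl p' by rewrite lt_neqAle eq_sym rr addr_ge0.
rewrite -(ler_pM2r rp) -{1}(gtr0_norm rp) -normrM -subr_sqr !eucl_sqr.
have -> : p.1 ^+ 2 + p.2 ^+ 2 - (p'.1 ^+ 2 + p'.2 ^+ 2) =
  (p.1 - p'.1) * (p.1 + p'.1) + (p.2 - p'.2) * (p.2 + p'.2) by ring.
rewrite (le_trans (ler_normD _ _))// !normrM.
have h1 : `|p.1 + p'.1| <= eucl p + eucl p' by rewrite (le_trans (ler_normD _ _))// lerD ?norm1_le_eucl.
have h2 : `|p.2 + p'.2| <= eucl p + eucl p' by rewrite (le_trans (ler_normD _ _))// lerD ?norm2_le_eucl.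
have := ler_pM (normr_ge0 _) (normr_ge0 _) (norm1_le p p') h1.
have := ler_pM (normr_ge0 _) (normr_ge0 _) (norm2_le p p') h2.
lra.
Qed.

Lemma quotient_lip (N N' D D' d : R) : 0 < d -> d <= D -> d <= D' -> `|N'| <= D' ->
  `|N / D - N' / D'| <= (`|N - N'| + `|D - D'|) / d.
Proof.
move=> d0 dD dD' ND.
have D0 : 0 < D := lt_le_trans d0 dD; have D0' : 0 < D' := lt_le_trans d0 dD'.
have -> : N / D - N' / D' = ((N - N') + (N' / D') * (D' - D)) / D.
  by field; rewrite !gt_eqF.
rewrite normrM normfV (gtr0_norm D0); apply: ler_pM; rewrite ?invr_ge0 ?(ltW D0) ?lef_pV2//.
rewrite (le_trans (ler_normD _ _))// lerD2l normrM distrC ler_piMl//.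
by rewrite normrM normfV (gtr0_norm D0') ler_pdivrMr// mul1r.
Qed.

Lemma discE p : disc p <-> eucl p <= 1.
Proof. by rewrite /disc /= -eucl_sqr -[1]sqrtr1 -[in X in _ <-> X](ger0_norm (eucl_ge0 p)) -sqrtr_sqr sqrtr1 -{2}sqrtr1 ler_sqrt. Qed.

Lemma circleE p : circle p <-> eucl p = 1.
Proof.
rewrite /circle /= -eucl_sqr; split=> [|->]; last by rewrite expr1n.
move/eqP; rewrite -[X in _ == X](expr1n _ 2) eqf_sqr => /orP[/eqP //|/eqP h].
by have := eucl_ge0 p; rewrite h; lra.
Qed.

Lemma eucl_continuous : continuous eucl.
Proof.
move=> p; apply/cvgrPdist_le => eps eps0.
have e2 : 0 < eps / 2 by rewrite divr_gt0.
apply: filterS (nbhsx_ballx p _ e2) => p'; rewrite -ball_normE /= => h.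
by rewrite (le_trans (eucl_lip _ _))//; lra.
Qed.

(** Radial retraction onto the disc: composing with it extends a map on the disc to a Lipschitz map
    on the whole plane. *)
Definition retract p : R * R := (p.1 / Num.max 1 (eucl p), p.2 / Num.max 1 (eucl p)).

Lemma retract_disc p : disc (retract p).
Proof.
have m1 : 1 <= Num.max 1 (eucl p) by rewrite le_max lexx.
have m0 : 0 < Num.max 1 (eucl p) by apply: lt_le_trans m1.
rewrite /disc /retract /= !expr_div_n -mulrDl ler_pdivrMr ?exprn_gt0// mul1r -eucl_sqr.
by rewrite ler_pXn2r ?nnegrE ?eucl_ge0 ?(ltW m0)// le_max lexx orbT.
Qed.

Lemma retract_id p : disc p -> retract p = p.
Proof. by move=> /discE p1; rewrite /retract max_l// !divr1; case: p p1. Qed.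

Lemma retract_lip p p' : `|retract p - retract p'| <= 3 * `|p - p'|.
Proof.
have m1 r : 1 <= Num.max 1 (eucl r) by rewrite le_max lexx.
have ml : `|Num.max 1 (eucl p) - Num.max 1 (eucl p')| <= 2 * `|p - p'|.
  apply: le_trans (eucl_lip p p'); rewrite !maxEle.
  have h := ler_norm (eucl p - eucl p'); have h' := ler_norm (eucl p' - eucl p); rewrite distrC in h'.
  have h0 := normr_ge0 (eucl p - eucl p').
  by case: (leP 1 (eucl p)) => ?; case: (leP 1 (eucl p')) => ?; rewrite ler_norml; apply/andP; split; lra.
have rm r : eucl r <= Num.max 1 (eucl r) by rewrite le_max lexx orbT.
have a1 := quotient_lip p.1 ltr01 (m1 p) (m1 p') (le_trans (norm1_le_eucl p') (rm p')).
have a2 := quotient_lip p.2 ltr01 (m1 p) (m1 p') (le_trans (norm2_le_eucl p') (rm p')).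
rewrite divr1 in a1; rewrite divr1 in a2.
rewrite ge_max; apply/andP; split; [apply: le_trans a1 _|apply: le_trans a2 _].
- by have := norm1_le p p'; lra.
- by have := norm2_le p p'; lra.
Qed.

Lemma sin_lip (x y : R) : `|sin x - sin y| <= `|x - y|.
Proof.
wlog xy : x y / x <= y => [H|].
  by case: (leP x y) => [/H //|/ltW /H]; rewrite distrC (distrC y).
rewrite distrC (distrC x); have [|c _ ->] := @MVT_segment R sin cos x y xy (fun z _ => is_derive_sin z).
  by apply: continuous_subspaceT => z; exact: continuous_sin.
by rewrite normrM ler_piMl// cos_max.
Qed.

Lemma cos_lip (x y : R) : `|cos x - cos y| <= `|x - y|.
Proof.
have := sin_lip (x + pi / 2) (y + pi / 2).
by rewrite !sinDpihalf opprD addrACA subrr addr0.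
Qed.

End plane_geometry.

Section group_fillings.
Context {R : realType} {n n' : nat} {G : lieGroup R n}.
Notation V := 'rV[R]_n.
Notation V' := 'rV[R]_n'.
Notation I01 := (`[0 : R, 1 : R]%classic).
Notation T2 := (measurableTypeR R * measurableTypeR R)%type.
Notation mu2 := (@lebesgue_measure R \x @lebesgue_measure R)%E.
Variables (e : chart R n G) (br : V -> V -> V) (C : R) (E : V -> G) (lg : G -> V).
Hypothesis hm : nil_model e br C E lg.
Variables (q : {dot V for idfun}).

(** The quadratic term of [model_dist] is absorbed in the linear one because the disc has diameter
    2. *)
Lemma lipschitz_logarithm (g : R * R -> G) (D : set (R * R)) : D `<=` disc -> lipschitz_map e q D g ->
  exists2 M, 0 <= M & forall p p', D p -> D p' -> ndist br (lg (g p)) (lg (g p')) <= M * `|p - p'|.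
Proof.
move=> Ddisc [L hL]; have [K Kge hK] := model_dist hm q.
(* The 2 compares the Euclidean distance with the sup norm; the added 1 gives the strict inequality
   that [model_dist] asks for. *)
have [L' L'0 L'E] : exists2 L', 0 < L' & L' = 2 * (`|L| + 1) by exists (2 * (`|L| + 1)); rewrite // mulr_gt0// ltr_wpDl.
exists (K * ((1 + 2 * L') * L')); first by rewrite !mulr_ge0 ?addr_ge0 ?mulr_ge0// ltW.
move=> p p' dp dp'.
have a2 : `|p - p'| <= 2.
  have /discE r1 := Ddisc _ dp; have /discE r2 := Ddisc _ dp'.
  rewrite (le_trans (ler_normB _ _))// -[2]/(1 + 1) lerD//.
    by rewrite ge_max (le_trans (norm1_le_eucl _) r1) (le_trans (norm2_le_eucl _) r1).
  by rewrite ge_max (le_trans (norm1_le_eucl _) r2) (le_trans (norm2_le_eucl _) r2).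
have nd : ndist br (lg (g p)) (lg (g p')) <= K * (L' * `|p - p'| + (L' * `|p - p'|) ^+ 2).
  have [->|pp] := eqVneq p p'.
    by rewrite subrr normr0 mulr0 expr0n addr0 mulr0 (ndistxx hm).
  have m0 : 0 < `|p - p'| by rewrite normr_gt0 subr_eq0.
  apply: hK; rewrite !(nm_lgK hm); apply: le_lt_trans (hL _ _ dp dp') _.
  rewrite lte_fin (@le_lt_trans _ _ (`|L| * (2 * `|p - p'|)))//.
    rewrite (le_trans (ler_wpM2r (sqrtr_ge0 _) (ler_norm L)))// ler_wpM2l// euclid_le_norm//.
  by rewrite L'E; nra.
rewrite (le_trans nd)// -[leRHS]mulrA; apply: ler_wpM2l => //.
move: `|p - p'| (normr_ge0 (p - p')) a2 => a a0 a2.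
have : (L' * a) ^+ 2 <= 2 * L' * (L' * a) by rewrite expr2 ler_wpM2r// ?mulr_ge0 1?mulrC ?ler_wpM2r// ltW.
by lra.
Qed.

Lemma disc_logarithm (g : R * R -> G) : lipschitz_map e q disc g ->
  exists F : R * R -> V, exists K0 L : R, [/\ 0 < K0, 0 <= L, (forall p p', `|F p - F p'| <= K0 * `|p - p'|),
    glip br setT F L & forall p, disc p -> F p = lg (g p)].
Proof.
move=> gL; have C0 := bbl_ge0 hm.
have [M1 M10 nd] := lipschitz_logarithm (@subset_refl _ disc) gL.
pose F p := lg (g (retract p)).
pose M := M1 * 3; have M0 : 0 <= M by rewrite mulr_ge0.
have nF p p' : ndist br (F p) (F p') <= M * `|p - p'|.
  rewrite (le_trans (nd _ _ (retract_disc p) (retract_disc p')))// /M -mulrA.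
  by apply: ler_wpM2l => //; exact: retract_lip.
have dle (p p' : R * R) : `|retract p - retract p'| <= 2.
  have /discE r1 := retract_disc p; have /discE r2 := retract_disc p'.
  rewrite (le_trans (ler_normB _ _))// -[2]/(1 + 1) lerD//.
    by rewrite ge_max (le_trans (norm1_le_eucl _) r1) (le_trans (norm2_le_eucl _) r1).
  by rewrite ge_max (le_trans (norm1_le_eucl _) r2) (le_trans (norm2_le_eucl _) r2).
have [B hB] : exists B, forall p, `|F p| <= B.
  exists (`|F 0| + (1 + 2^-1 * (C * `|F 0|)) * (M1 * 2)) => p.
  rewrite -[F p](subrK (F 0)) addrC (le_trans (ler_normD _ _))// lerD2l.
  rewrite (le_trans (norm_le_ndist hm _ _))// ler_wpM2l ?addr_ge0 ?mulr_ge0//.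
  by rewrite (le_trans (nd _ _ (retract_disc _) (retract_disc _)))// ler_wpM2l.
have B0 : 0 <= B by apply: le_trans (hB 0).
exists F, ((1 + 2^-1 * (C * B)) * M + 1), M; split=> //.
- by rewrite ltr_wpDl// mulr_ge0// addr_ge0// !mulr_ge0.
- move=> p p'; rewrite distrC (le_trans (norm_le_ndist hm _ _))//.
  apply: (@le_trans _ _ ((1 + 2^-1 * (C * B)) * (M * `|p - p'|))).
    by apply: ler_pM; rewrite ?addr_ge0 ?mulr_ge0// ?ndist_ge0// lerD2l ler_wpM2l// ler_wpM2l.
  by rewrite mulrA ler_wpM2r// lerDl.
- by move=> p _; apply: filterE => p' _; rewrite -normrN opprB.
- by move=> p dp; rewrite /F retract_id.
Qed.

Lemma glip_mulmxr (br' : V' -> V' -> V') (A : 'M[R]_(n, n')) :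
  (forall x y, br' (x *m A) (y *m A) = br x y *m A) ->
  exists2 K : R, 0 <= K & forall (T : normedModType R) (D : set T) (f : T -> V) L, glip br D f L ->
    glip br' D (fun p => f p *m A) (K * L).
Proof.
move=> brA; exists (n%:R * `|A|); first by rewrite mulr_ge0.
move=> T D f L h p Dp; apply: filterS (h p Dp) => p' + Dp' => /(_ Dp') {}h.
have -> : ndist br' (f p *m A) (f p' *m A) = `|bch br (- f p) (f p') *m A|.
  by rewrite /ndist /bch -mulNmx brA !mulmxDl scalemxAl.
rewrite (le_trans (mulmx_norm_le _ _))// mulrAC -[leRHS]mulrA; apply: ler_wpM2l => //.
Qed.

(** Two curves with common endpoints as one closed curve on the circle: [a] on the left half and [b]
    on the right half, both parametrized by height, so that the poles carry the common endpoints. *)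
Definition two_arcs (a b : R -> V) (p : R * R) : V :=
  if p.1 <= 0 then a (clamp 0 1 ((1 + p.2) / 2)) else b (clamp 0 1 ((1 + p.2) / 2)).

Let u (p : R * R) := clamp 0 1 ((1 + p.2) / 2).

Let u01 p : 0 <= u p <= 1. Proof. exact: clamp_in ler01. Qed.

Let uL p p' : `|u p - u p'| <= `|p - p'|.
Proof.
rewrite (le_trans (clamp_lip _ _ _ _))//.
have -> : (1 + p.2) / 2 - (1 + p'.2) / 2 = (p.2 - p'.2) / 2 by field.
rewrite normrM [`|2^-1|]ger0_norm// ; have := norm2_le p p'; have := normr_ge0 (p.2 - p'.2); lra.
Qed.

(** Points on the same half are compared along one curve. Points on opposite halves are compared
    through a pole, where the two curves meet. *)
Lemma two_arcs_circle (a b : R -> V) M : 0 <= M -> glip br I01 a M -> glip br I01 b M -> a 0 = b 0 -> a 1 = b 1 ->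
  exists2 L, 0 <= L & forall p p', circle p -> circle p' -> ndist br (two_arcs a b p) (two_arcs a b p') <= L * `|p - p'|.
Proof.
move=> M0 ha hb ab0 ab1; have [K K0 hK] := glip_bound hm; have C0 := bbl_ge0 hm.
have [B B0 BE] : exists2 B, 0 <= B & B = K * (M + M ^+ 2).
  by exists (K * (M + M ^+ 2)); rewrite // mulr_ge0// addr_ge0// sqr_ge0.
have CBB := mulr_ge0 (mulr_ge0 C0 B0) B0.
have nda := hK a M M0 ha; have ndb := hK b M M0 hb; rewrite -BE in nda ndb.
exists (2 * B + C * B * B); first by lra.
have same p p' x : 0 <= M -> glip br I01 x M -> ndist br (x (u p)) (x (u p')) <= (2 * B + C * B * B) * `|p - p'|.
  move=> _ hx; rewrite (le_trans (hK x M M0 hx _ _ (u01 p) (u01 p')))// distrC.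
  rewrite -BE; apply: ler_pM => //; lra.
have uE p : circle p -> u p = (1 + p.2) / 2.
  move=> /circleE p1; have := norm2_le_eucl p; rewrite p1 ler_norml => /andP[h1 h2].
  by apply: clamp_id; apply/andP; split; lra.
have opp p p' : circle p -> circle p' -> p.1 <= 0 -> 0 <= p'.1 ->
    ndist br (a (u p)) (b (u p')) <= (2 * B + C * B * B) * `|p - p'|.
  move=> cp cp' p0 p0'.
  have n1 := norm1_le p p'; have n2 := norm2_le p p'.
  move: (cp) (cp'); rewrite /circle /= => Ep Ep'.
  (* The top pole if one of the points has nonnegative height, the bottom pole otherwise. The
     minimum with 1 serves to absorb the quadratic term of the triangle inequality. *)
  have [q0 [q01 aq h1 h2]] : exists q0, [/\ 0 <= q0 <= 1, a q0 = b q0, `|q0 - u p| <= Num.min 1 `|p - p'| & `|u p' - q0| <= Num.min 1 `|p - p'|].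
    have N1 := ler_norm (p'.1 - p.1); rewrite distrC in N1.
    have N2 := ler_norm (p.2 - p'.2); have N2' := ler_norm (p'.2 - p.2); rewrite distrC in N2'.
    rewrite !uE//; have [y0|y0] := leP 0 (Num.max p.2 p'.2).
      exists 1; split; rewrite ?ler01 ?lexx// le_min !ler_norml.
        move: y0; rewrite le_max => /orP[y0|y0]; do !(apply/andP; split); nra.
      move: y0; rewrite le_max => /orP[y0|y0]; do !(apply/andP; split); nra.
    move: y0; rewrite gt_max => /andP[y0 y0'].
    exists 0; split; rewrite ?ler01 ?lexx// le_min !ler_norml; do !(apply/andP; split); nra.
  rewrite (le_trans (ndist_triangle hm _ (a q0) _))//.
  have H1 : ndist br (a (u p)) (a q0) <= B * Num.min 1 `|p - p'|.
    by rewrite (le_trans (nda _ _ (u01 p) q01))// ler_wpM2l.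
  have H2 : ndist br (a q0) (b (u p')) <= B * Num.min 1 `|p - p'|.
    by rewrite aq (le_trans (ndb _ _ q01 (u01 p')))// ler_wpM2l.
  have m0 : 0 <= Num.min 1 `|p - p'| by rewrite le_min ler01 /=.
  have m1 : Num.min 1 `|p - p'| <= 1 by rewrite ge_min lexx.
  have m2 : Num.min 1 `|p - p'| <= `|p - p'| by rewrite ge_min lexx orbT.
  have H3 : C * ndist br (a (u p)) (a q0) * ndist br (a q0) (b (u p')) <= C * B * (B * Num.min 1 `|p - p'|).
    apply: ler_pM => //; rewrite ?mulr_ge0 ?ndist_ge0//; apply: ler_wpM2l => //.
    by rewrite (le_trans H1)// ler_piMr.
  have H4 : (2 * B + C * B * B) * Num.min 1 `|p - p'| <= (2 * B + C * B * B) * `|p - p'|.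
    by apply: ler_wpM2l => //; lra.
  lra.
move=> p p' cp cp'; rewrite /two_arcs -/(u p) -/(u p'); case: (leP p.1 0) => h; case: (leP p'.1 0) => h'.
- exact: same ha.
- exact: opp (ltW h').
- by rewrite (ndistC hm) distrC; apply: opp => //; exact: ltW.
- exact: same hb.
Qed.

End group_fillings.

(** * Homotopies in the quotient from fillings in the group *)

Section homotopy.
Context {R : realType} {n n' : nat} {G : lieGroup R n}.
Notation V := 'rV[R]_n.
Notation V' := 'rV[R]_n'.
Notation I01 := (`[0 : R, 1 : R]%classic).
Notation T2 := (measurableTypeR R * measurableTypeR R)%type.
Notation mu2 := (@lebesgue_measure R \x @lebesgue_measure R)%E.
Variables (e : chart R n G) (br : V -> V -> V) (C : R) (E : V -> G) (lg : G -> V).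
Hypothesis hm : nil_model e br C E lg.
Variables (q : {dot V for idfun}).
Variables (br' : V' -> V' -> V') (C' : R).
Hypothesis ts' : two_step br' C'.
Variables (q' : {dot V' for idfun}) (A : 'M[R]_(n, n')).
Hypothesis brA : forall x y, br' (x *m A) (y *m A) = br x y *m A.
Hypothesis dehn_le : exists2 K : R, 0 <= K & forall l, 0 <= l -> (dehn e q l <= (K * (1 + l) ^+ 2)%:E)%E.

Let u (p : R * R) : R := clamp 0 1 ((1 + p.2) / 2).

Let u01 p : 0 <= u p <= 1. Proof. exact: clamp_in ler01. Qed.

Let uL p p' : `|u p - u p'| <= 1 * `|p - p'|.
Proof.
rewrite mul1r (le_trans (clamp_lip _ _ _ _))//.
have -> : (1 + p.2) / 2 - (1 + p'.2) / 2 = (p.2 - p'.2) / 2 by field.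
rewrite normrM [`|2^-1|]ger0_norm// ; have := norm2_le p p'; have := normr_ge0 (p.2 - p'.2); lra.
Qed.

Section arcs.
Variables (a b : R -> V) (M : R).
Hypothesis M0 : 0 <= M.
Hypothesis ha : glip br I01 a M.
Hypothesis hb : glip br I01 b M.
Hypothesis ab0 : a 0 = b 0.
Hypothesis ab1 : a 1 = b 1.

Let f := two_arcs a b.

Lemma two_arcs_left (p : R * R) : p.1 <= 0 -> f p = a (u p).
Proof. by rewrite /f /two_arcs => ->. Qed.

(** On the vertical axis the definition uses [a]; but there, outside the open disc, the clamped
    height is 0 or 1, where [a] and [b] agree. *)
Lemma two_arcs_right (p : R * R) : 0 <= p.1 -> 1 <= eucl p -> f p = b (u p).
Proof.
rewrite /f /two_arcs -/(u p) => p0 p1; case: ifP => // p0'.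
have p10 : p.1 = 0 by apply/eqP; rewrite eq_le p0'.
have : 1 <= `|p.2|.
  have : eucl p = `|p.2| by rewrite /eucl p10 expr0n add0r sqrtr_sqr.
  by move=> <-.
rewrite ler_normr => /orP[h|h].
- have -> : u p = 1.
    by rewrite /u /clamp min_l ?max_r//; lra.
  exact: ab1.
- have -> : u p = 0.
    by rewrite /u /clamp max_l// ge_min; apply/orP; right; lra.
  exact: ab0.
Qed.

Lemma glip_left D : glip br D (fun p => a (u p)) M.
Proof.
rewrite -[M]mulr1; apply: (glip_comp (D := I01) M0) ha => [p _|p p' _ _]; last exact: uL.
by rewrite /= in_itv/=; exact: u01.
Qed.

Lemma glip_right D : glip br D (fun p => b (u p)) M.
Proof.
rewrite -[M]mulr1; apply: (glip_comp (D := I01) M0) hb => [p _|p p' _ _]; last exact: uL.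
by rewrite /= in_itv/=; exact: u01.
Qed.

Lemma circle_param_glip : glip br setT (fun t : R => f (cos t, sin t)) M.
Proof.
have r1 (t : R) : 1 <= eucl (cos t, sin t).
  by rewrite /eucl /= cos2Dsin2 sqrtr1.
have uS (s t : R) : `|u (cos s, sin s) - u (cos t, sin t)| <= 1 * `|s - t|.
  rewrite mul1r (le_trans (clamp_lip _ _ _ _))//=.
  have -> : (1 + sin s) / 2 - (1 + sin t) / 2 = (sin s - sin t) / 2 by field.
  rewrite normrM [`|2^-1|]ger0_norm//; have := sin_lip s t; have := normr_ge0 (sin s - sin t); lra.
have cc (Q : set R) : closed Q -> closed [set t : R | Q (cos t)].
  by move=> cQ; apply: preimage_closed cQ => t _; exact: continuous_cos.
pose D1 := [set t : R | cos t <= 0]; pose D2 := [set t : R | 0 <= cos t].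
have h1 : glip br D1 (fun t : R => f (cos t, sin t)) M.
  apply: (@eq_glip _ _ _ _ _ (fun t : R => a (u (cos t, sin t)))) => [t h|].
    by rewrite two_arcs_left.
  rewrite -[M]mulr1; apply: (glip_comp (D := I01) M0) ha => [t _|s t _ _]; last exact: uS.
  by rewrite /= in_itv/=; exact: u01.
have h2 : glip br D2 (fun t : R => f (cos t, sin t)) M.
  apply: (@eq_glip _ _ _ _ _ (fun t : R => b (u (cos t, sin t)))) => [t h|].
    by rewrite two_arcs_right.
  rewrite -[M]mulr1; apply: (glip_comp (D := I01) M0) hb => [t _|s t _ _]; last exact: uS.
  by rewrite /= in_itv/=; exact: u01.
have c1 : closed D1 := cc _ (@closed_le R 0).
have c2 : closed D2 := cc _ (@closed_ge R 0).
have h12 := glip_glue c1 c2 h1 h2.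
by refine (glip_sub _ h12) => t _; rewrite /D1 /D2 /=; apply/orP; exact: le_total.
Qed.

Lemma two_arcs_lipschitz : lipschitz_map e q circle (fun p => E (f p)).
Proof.
have [L L0 hL] := two_arcs_circle hm M0 ha hb ab0 ab1.
have [K K0 hK] := nm_dist hm q.
exists (K * L) => p p' cp cp'; apply: le_trans (hK _ _) _.
rewrite lee_fin -mulrA; apply: ler_wpM2l => //.
by rewrite (le_trans (hL _ _ cp cp'))//; apply: ler_wpM2l => //; exact: norm_le_euclid.
Qed.

Lemma two_arcs_length (K : R) : 0 <= K -> (forall w : V, dotn q w <= K * `|w|) ->
  (circle_length e q (fun p => E (f p)) <= (K * M * (2 * pi))%:E)%E.
Proof.
move=> K0 hK; have pi0 : 0 <= 2 * pi :> R by rewrite mulr_ge0// pi_ge0.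
have mI : measurable (`[0 : R, 2 * pi]%classic : set (measurableTypeR R)) by exact: measurable_itv.
rewrite /circle_length /curve_length.
have := integral_cst (@lebesgue_measure R) mI (K * M)%:E.
rewrite [X in (_ * X)%E]lebesgue_measure_itv/= lte_fin.
have -> : (if (0 : R) < 2 * pi then ((2 * pi)%:E - 0%:E)%E else 0%E) = (2 * pi : R)%:E.
  case: ifP => [_|/negbT]; first by rewrite -EFinB subr0.
  by rewrite -leNgt => h; congr EFin; apply/eqP; rewrite eq_le h pi0.
rewrite -EFinM => <-; apply: le_lower_integral => // t _.
- by rewrite lee_fin sqrtr_ge0.
- by rewrite lee_fin mulr_ge0.
- have gc := circle_param_glip.
  have cg : {for (t : R), continuous (fun s : R => f (cos s, sin s))}.
    by apply: (glip_continuous hm gc) => //; exact: filterT.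
  have sE := speed_exp hm q cg; rewrite lee_fin sE.
  rewrite (le_trans (hK _))//; apply: ler_wpM2l => //.
  by apply: (glip_speed hm M0); apply: filterS (gc t I) => s; exact.
Qed.

End arcs.

(** The loop made of [a] and [b] has length of order [M], so it bounds a disc of area of order M^2
    in G. Outside the disc the map only depends on the height and is continued by [two_arcs]; that
    part factors through a curve, so it adds no area after projection by [A]. *)
Lemma homotopy : exists2 K : R, 0 <= K & forall (a b : R -> V) (M : R), 1 <= M ->
  glip br I01 a M -> glip br I01 b M -> a 0 = 0 -> b 0 = 0 -> a 1 = b 1 ->
  exists H : R * R -> V', exists L : R, [/\ 0 <= L, glip br' setT H L,
    (forall t : R, 0 <= t <= 1 -> H (0, t) = a t *m A /\ H (1, t) = b t *m A),
    (forall s : R, H (s, 0) = 0 /\ H (s, 1) = a 1 *m A) &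
    area_le br' q' H (`]0 : R, 1 : R[%classic `*` `]0 : R, 1 : R[%classic) (K * M ^+ 2)].
Proof.
have [Kd Kd0 hKd] := dehn_le; have [Kq Kq0 hKq] := dotn_le q.
have [Kp Kp0 hKp] := area_projection hm q q' brA.
have [Kg Kg0 hKg] := glip_mulmxr brA.
have pi0 : 0 <= 2 * pi :> R by rewrite mulr_ge0// pi_ge0.
(* Since [1 <= M], the loop length plus 1 is at most a constant times [M]. The final 1 makes the
   bound strict, so that a filling achieving it exists. *)
pose k := Kd * (1 + Kq * (2 * pi)) ^+ 2 + 1.
have k0 : 0 <= k by rewrite addr_ge0// mulr_ge0// sqr_ge0.
exists (Kp * k); first exact: mulr_ge0.
move=> a b M M1 ha hb a0 b0 ab1; have M0 : 0 <= M by exact: le_trans M1.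
have ab0 : a 0 = b 0 by rewrite a0 b0.
pose f := two_arcs a b.
have [g [gL gf] ga] : exists2 g, lipschitz_map e q disc g /\ forall p, circle p -> g p = E (f p) &
    (disc_area e q g <= (k * M ^+ 2)%:E)%E.
  have hl := two_arcs_length M0 ha hb ab0 ab1 Kq0 hKq.
  have fd : (filling_area e q (fun p => E (f p)) <= dehn e q (Kq * M * (2 * pi)))%E.
    by apply: ereal_sup_ubound; exists (fun p => E (f p)) => //; split=> //; exact: (two_arcs_lipschitz M0 ha hb ab0 ab1).
  have kM : Kd * (1 + Kq * M * (2 * pi)) ^+ 2 < k * M ^+ 2.
    have h : (1 + Kq * M * (2 * pi)) ^+ 2 <= ((1 + Kq * (2 * pi)) * M) ^+ 2.
      rewrite ler_pXn2r ?nnegrE ?mulr_ge0 ?addr_ge0 ?mulr_ge0 ?pi_ge0//.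
      have -> : (1 + Kq * (2 * pi)) * M = M + Kq * M * (2 * pi) by ring.
      by rewrite lerD2r.
    apply: le_lt_trans (ler_wpM2l Kd0 h) _; rewrite /k exprMn.
    have m2 : 0 < M ^+ 2 by rewrite exprn_gt0// (lt_le_trans ltr01).
    by rewrite -subr_gt0 (_ : _ - _ = M ^+ 2)//; ring.
  have : (filling_area e q (fun p => E (f p)) < (k * M ^+ 2)%:E)%E.
    apply: le_lt_trans fd _; apply: le_lt_trans (hKd _ _) _; last by rewrite lte_fin.
    by rewrite !mulr_ge0 ?pi_ge0.
  move=> /ereal_inf_lt[_ [g [gL gf] <-] ga].
  by exists g => //; exact: ltW.
have [F [K0 [L [K00 L0 FL gF FE]]]] := disc_logarithm hm gL.
have Ff p : eucl p = 1 -> F p = f p.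
  by move=> p1; rewrite FE ?gf ?(nm_EK hm)//; [exact/circleE|apply/discE; rewrite p1].
(* The two definitions agree on the unit circle, hence the pieces glue over closed sets. *)
pose Psi p := if eucl p <= 1 then F p else f p.
have Psi_in p : eucl p <= 1 -> Psi p = F p by rewrite /Psi => ->.
have Psi_out p : 1 <= eucl p -> Psi p = f p.
  by move=> p1; rewrite /Psi; case: ifP => // p1'; apply: Ff; apply/eqP; rewrite eq_le p1 p1'.
have cr : continuous (eucl : R * R -> R) by exact: eucl_continuous.
have c1 : continuous (fun p : R * R => p.1) by move=> p; exact: cvg_fst.
have cle (h : R * R -> R) (z : R) : continuous h -> closed [set p | h p <= z].
  by move=> ch; apply: (preimage_closed _ (@closed_le R z)) => p _; exact: ch.
have cge (h : R * R -> R) (z : R) : continuous h -> closed [set p | z <= h p].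
  by move=> ch; apply: (preimage_closed _ (@closed_ge R z)) => p _; exact: ch.
have olt (h : R * R -> R) (z : R) : continuous h -> open [set p | h p < z].
  by move=> ch; apply: open_comp (@open_lt R z) => p _; exact: ch.
have ogt (h : R * R -> R) (z : R) : continuous h -> open [set p | z < h p].
  by move=> ch; apply: open_comp (@open_gt R z) => p _; exact: ch.
pose L1 := L + M.
have gPsi : glip br setT Psi L1.
  pose D0 := [set p : R * R | eucl p <= 1].
  pose D1 := [set p : R * R | 1 <= eucl p] `&` [set p | p.1 <= 0].
  pose D2 := [set p : R * R | 1 <= eucl p] `&` [set p | 0 <= p.1].
  have h0 : glip br D0 Psi L1.
    apply: (@glip_le _ _ _ _ _ _ L); first by rewrite lerDl.
    apply: (@eq_glip _ _ _ _ _ F) => [p /Psi_in //|]; exact: glip_sub gF.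
  have h1 : glip br D1 Psi L1.
    apply: (@glip_le _ _ _ _ _ _ M); first by rewrite lerDr.
    apply: (@eq_glip _ _ _ _ _ (fun p => a (u p))) => [p [p1 p0]|]; last exact: glip_left.
    by rewrite Psi_out// /f two_arcs_left.
  have h2 : glip br D2 Psi L1.
    apply: (@glip_le _ _ _ _ _ _ M); first by rewrite lerDr.
    apply: (@eq_glip _ _ _ _ _ (fun p => b (u p))) => [p [p1 p0]|]; last exact: glip_right.
    by rewrite Psi_out// /f two_arcs_right.
  have h12 := glip_glue (closedI (cge _ 1 cr) (cle _ 0 c1)) (closedI (cge _ 1 cr) (cge _ 0 c1)) h1 h2.
  have h012 := glip_glue (cle _ 1 cr) (closedU (closedI (cge _ 1 cr) (cle _ 0 c1)) (closedI (cge _ 1 cr) (cge _ 0 c1))) h0 h12.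
  refine (glip_sub _ h012) => p _.
  have [p1|/ltW p1] := leP (eucl p) 1; [by left|right].
  by have [p0|/ltW p0] := leP p.1 0; [left|right].
pose Phi p := Psi p *m A.
have gPhi : glip br' setT Phi (Kg * L1) by exact: hKg.
have thin (x : R -> V) : glip br I01 x M -> area_le br' q' (fun p => x (u p) *m A) setT 0.
  move=> hx; have [Kx Kx0 hKx] := glip_linear hm ler01 M0 hx.
  pose k1 := n%:R * Kx * `|A| + 1.
  have k10 : 0 < k1 by rewrite ltr_wpDl// !mulr_ge0// ltW.
  have u'L (p p' : R * R) : `|(1 + p.2) / 2 - (1 + p'.2) / 2| <= 1 * `|p - p'|.
    have -> : (1 + p.2) / 2 - (1 + p'.2) / 2 = (p.2 - p'.2) / 2 by field.
    rewrite mul1r normrM [`|2^-1|]ger0_norm// ; have := norm2_le p p'; have := normr_ge0 (p.2 - p'.2); lra.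
  have phL (s t : R) : `|x (clamp 0 1 s) *m A - x (clamp 0 1 t) *m A| <= k1 * `|s - t|; last first.
    exact: (area_thin ts' q' ltr01 k10 u'L phL).
  rewrite -mulmxBl (le_trans (mulmx_norm_le _ _))// /k1.
  have H : `|x (clamp 0 1 s) - x (clamp 0 1 t)| <= Kx * `|s - t|.
    rewrite (le_trans (hKx _ _ (clamp_in _ ler01) (clamp_in _ ler01)))//.
    by rewrite ler_wpM2l ?clamp_lip// ltW.
  have -> : (n%:R * Kx * `|A| + 1) * `|s - t| = n%:R * (Kx * `|s - t|) * `|A| + `|s - t| by ring.
  by apply: ler_wpDr => //; apply: ler_wpM2r => //; apply: ler_wpM2l.
have oD : open [set p : R * R | eucl p < 1] := olt _ 1 cr.
have area0 : area_le br' q' Phi [set p | eucl p < 1] (Kp * (k * M ^+ 2)).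
  apply: (area_near (F' := fun p => F p *m A)).
    by move=> p p1; apply: filterS (open_nbhs_nbhs (conj oD p1)) => p' /= p1'; rewrite /Phi Psi_in// ltW.
  apply: (hKp F [set p | eucl p < 1] K0 _ K00 FL); first exact: open_measurable_plane.
  apply: le_trans ga; rewrite /disc_area; apply: le_lower_integral.
  - by move=> p /= p1; apply/discE; exact: ltW.
  - by move=> p _; rewrite lee_fin jac_ge0.
  - by move=> p _; rewrite lee_fin sqrtr_ge0.
  - move=> p p1; rewrite (jacobian2_exp hm q (F := F) (p := p))//.
      by apply: (glip_continuous hm gF) => //; exact: filterT.
    apply: filterS (open_nbhs_nbhs (conj oD p1)) => p' /= p1'.
    by rewrite FE ?(nm_lgK hm)//; apply/discE; exact: ltW.
have o1 : open ([set p : R * R | 1 < eucl p] `&` [set p | p.1 < 0]) := openI (ogt _ 1 cr) (olt _ 0 c1).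
have o2 : open ([set p : R * R | 1 < eucl p] `&` [set p | 0 < p.1]) := openI (ogt _ 1 cr) (ogt _ 0 c1).
have area1 : area_le br' q' Phi ([set p | 1 < eucl p] `&` [set p | p.1 < 0]) 0.
  apply: (area_near (F' := fun p => a (u p) *m A)).
    move=> p Dp; apply: filterS (open_nbhs_nbhs (conj o1 Dp)) => p' /= [p1' p0'].
    by rewrite /Phi Psi_out ?(ltW p1')// /f two_arcs_left// ltW.
  exact: area_sub (thin a ha).
have area2 : area_le br' q' Phi ([set p | 1 < eucl p] `&` [set p | 0 < p.1]) 0.
  apply: (area_near (F' := fun p => b (u p) *m A)).
    move=> p Dp; apply: filterS (open_nbhs_nbhs (conj o2 Dp)) => p' /= [p1' p0'].
    by rewrite /Phi Psi_out ?(ltW p1')// /f two_arcs_right// ltW.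
  exact: area_sub (thin b hb).
have areac : area_le br' q' Phi circle 0.
  by apply: area_null null_circle; apply: closed_measurable_plane; exact: circle_closed.
have areav : area_le br' q' Phi [set p | p.1 = 0] 0.
  apply: area_null (null_vertical 0); apply: closed_measurable_plane.
  by apply: (preimage_closed _ (@closed_eq R 0)) => p _; exact: c1.
have areaT : area_le br' q' Phi setT (Kp * k * M ^+ 2).
  have := areaU area0 (areaU (areaU area1 area2) (areaU areac areav)).
  rewrite !addr0 mulrA; apply: area_sub => // p _.
  have [p1|p1|p1] := ltgtP (eucl p) 1; [by left| |by right; right; left; apply/circleE].
  by have [p0|p0|p0] := ltgtP p.1 0; right; [left; left|left; right|right; right].
(* The unit square is mapped onto the square circumscribed about the disc, whose left and right
   sides carry [a] and [b] and whose other sides are constant. *)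
exists (fun p => Phi (2 * p.1 + -1, 2 * p.2 + -1)), (Kg * L1 * 2); split.
- by rewrite !mulr_ge0// addr_ge0.
- apply: (glip_comp (D := setT)) gPhi => //; first by rewrite mulr_ge0// addr_ge0.
  move=> p p' _ _; rewrite ge_max /=; apply/andP; split.
  + have -> : 2 * p'.1 - 1 - (2 * p.1 - 1) = 2 * (p'.1 - p.1) by ring.
    by rewrite normrM ger0_norm// ler_wpM2l// norm1_le.
  + have -> : 2 * p'.2 - 1 - (2 * p.2 - 1) = 2 * (p'.2 - p.2) by ring.
    by rewrite normrM ger0_norm// ler_wpM2l// norm2_le.
- have ut (x t : R) : 0 <= t <= 1 -> u (x, 2 * t - 1) = t.
    move=> /andP[t0 t1]; rewrite /u /= (_ : (1 + (2 * t - 1)) / 2 = t); last by field.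
    by apply: clamp_id; rewrite t0.
  move=> t t01; rewrite /Phi /= mulr0 add0r mulr1; split.
    rewrite Psi_out; last by rewrite (le_trans _ (norm1_le_eucl _))//= normrN normr1.
    by rewrite /f two_arcs_left /= ?ut// lerN10.
  have r1 : 1 <= eucl (2 - 1, 2 * t - 1) :> R.
    by rewrite (le_trans _ (norm1_le_eucl _))//= ler_normr; apply/orP; left; lra.
  by rewrite Psi_out// /f two_arcs_right ?ut//=; lra.
- move=> s; rewrite /Phi /= mulr0 add0r mulr1; split.
    rewrite Psi_out; last by rewrite (le_trans _ (norm2_le_eucl _))//= normrN normr1.
    rewrite /f /two_arcs /= (_ : clamp 0 1 _ = 0); first by rewrite a0 b0 if_same mul0mx.
    by rewrite subrr mul0r clamp_id// lexx ler01.
  rewrite Psi_out; last by rewrite (le_trans _ (norm2_le_eucl _))//= ler_normr; apply/orP; left; lra.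
  rewrite /f /two_arcs /= (_ : clamp 0 1 _ = 1); first by rewrite ab1 if_same.
  by rewrite clamp_id; [field|apply/andP; split; lra].
- have two0 : (0 : R) < 2 by [].
  have aff := area_affine ts' (-1) (-1) two0 two0 areaT.
  exact: (area_sub _ (lexx _) aff).
Qed.

End homotopy.

(** * Fillings written on the square *)

Section fillings.
Context {R : realType} {n : nat}.
Notation V := 'rV[R]_n.
Notation I01 := (`[0 : R, 1 : R]%classic).
Variables (br : V -> V -> V) (C : R).
Hypothesis ts : two_step br C.
Variable q : {dot V for idfun}.
Implicit Types (c x : R -> V) (F H : R * R -> V) (p : R * R).

Definition square : set (R * R) := [set p | (0 <= p.1 <= 1) /\ (0 <= p.2 <= 1)].
Definition open_square : set (R * R) := [set p | (0 < p.1 < 1) /\ (0 < p.2 < 1)].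

(* A disc of area at most [A] bounding the loop [c], written on a square whose
   other three sides are mapped to the base point. *)
Definition fill c (A : R) := exists F, exists L : R, [/\ 0 <= L, glip br square F L,
  (forall t : R, 0 <= t <= 1 -> F (0, t) = c t /\ F (1, t) = 0),
  (forall s : R, 0 <= s <= 1 -> F (s, 0) = 0 /\ F (s, 1) = 0) & area_le br q F open_square A].

Lemma eq_fill c c' (A : R) : (forall t : R, 0 <= t <= 1 -> c t = c' t) -> fill c A -> fill c' A.
Proof.
by move=> cc [F [L [L0 h1 h2 h3 h4]]]; exists F, L; split=> // t t01; rewrite -cc//; exact: h2.
Qed.

Lemma fill_le c (A A' : R) : A <= A' -> fill c A -> fill c A'.
Proof.
move=> AA [F [L [L0 h1 h2 h3 h4]]]; exists F, L; split=> //.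
exact: (area_sub _ AA h4).
Qed.

Lemma square_closed : closed square.
Proof.
have cl (h : R * R -> R) (z : R) : continuous h -> closed [set p | h p <= z] /\ closed [set p | z <= h p].
  move=> ch; split; first by apply: (preimage_closed _ (@closed_le R z)) => p _; exact: ch.
  by apply: (preimage_closed _ (@closed_ge R z)) => p _; exact: ch.
have c1 : continuous (fun p : R * R => p.1) by move=> p; exact: cvg_fst.
have c2 : continuous (fun p : R * R => p.2) by move=> p; exact: cvg_snd.
have -> : square = ([set p | 0 <= p.1] `&` [set p | p.1 <= 1]) `&` ([set p | 0 <= p.2] `&` [set p | p.2 <= 1]).
  by apply/seteqP; split => p /=; [move=> [/andP[? ?] /andP[? ?]]|move=> [[a1 a2] [a3 a4]]; split; rewrite ?a1 ?a2 ?a3 ?a4].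
by do !apply: closedI; first [exact: (cl _ _ c1).1|exact: (cl _ _ c1).2|exact: (cl _ _ c2).1|exact: (cl _ _ c2).2].
Qed.

Lemma open_square_open : open open_square.
Proof.
have cl (h : R * R -> R) (z : R) : continuous h -> open [set p | h p < z] /\ open [set p | z < h p].
  by move=> ch; split; [apply: open_comp (@open_lt R z)|apply: open_comp (@open_gt R z)] => p _; exact: ch.
have c1 : continuous (fun p : R * R => p.1) by move=> p; exact: cvg_fst.
have c2 : continuous (fun p : R * R => p.2) by move=> p; exact: cvg_snd.
have -> : open_square = ([set p | 0 < p.1] `&` [set p | p.1 < 1]) `&` ([set p | 0 < p.2] `&` [set p | p.2 < 1]).
  by apply/seteqP; split => p /=; [move=> [/andP[? ?] /andP[? ?]]|move=> [[a1 a2] [a3 a4]]; split; rewrite ?a1 ?a2 ?a3 ?a4].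
by do !apply: openI; first [exact: (cl _ _ c1).1|exact: (cl _ _ c1).2|exact: (cl _ _ c2).1|exact: (cl _ _ c2).2].
Qed.

(** The building block of the gluings: one filling, rescaled into a rectangle, contributes a closed
    Lipschitz piece and its unchanged area on the open rectangle. *)
Lemma affine_piece F F' (L A a b c d : R) : 0 < a -> 0 < c -> 0 <= L -> glip br square F L ->
  area_le br q F open_square A ->
  (forall p, square (a * p.1 + b, c * p.2 + d) -> F' p = F (a * p.1 + b, c * p.2 + d)) ->
  [/\ glip br [set p | square (a * p.1 + b, c * p.2 + d)] F' (L * (a + c)),
      closed [set p | square (a * p.1 + b, c * p.2 + d)] &
      area_le br q F' [set p | open_square (a * p.1 + b, c * p.2 + d)] A].
Proof.
move=> a0 c0 L0 gF aF FF.
have cu : continuous (fun p => (a * p.1 + b, c * p.2 + d)).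
  have h1 p : {for p, continuous (fun p : R * R => a * p.1 + b)}.
    by apply: cvgD; [apply: cvgM; [exact: cvg_cst|exact: cvg_fst]|exact: cvg_cst].
  have h2 p : {for p, continuous (fun p : R * R => c * p.2 + d)}.
    by apply: cvgD; [apply: cvgM; [exact: cvg_cst|exact: cvg_snd]|exact: cvg_cst].
  by move=> p; exact: (cont_pair (h1 p) (h2 p)).
split.
- apply: (eq_glip (f := fun p => F (a * p.1 + b, c * p.2 + d))) => [p /FF //|].
  apply: (glip_comp L0) gF => // p p' _ _; rewrite ge_max /=; apply/andP; split.
    have -> : a * p'.1 + b - (a * p.1 + b) = a * (p'.1 - p.1) by ring.
    rewrite normrM gtr0_norm//; apply: ler_pM => //; [exact: ltW|by rewrite lerDl ltW|exact: norm1_le].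
  have -> : c * p'.2 + d - (c * p.2 + d) = c * (p'.2 - p.2) by ring.
  rewrite normrM gtr0_norm//; apply: ler_pM => //; [exact: ltW|by rewrite lerDr ltW|exact: norm2_le].
- by apply: (preimage_closed _ square_closed) => p _; exact: cu.
- apply: (area_near (F' := fun p => F (a * p.1 + b, c * p.2 + d))); last exact: (area_affine ts b d a0 c0 aF).
  have oD : open [set p | open_square (a * p.1 + b, c * p.2 + d)].
    by apply: (open_comp (f := fun p => (a * p.1 + b, c * p.2 + d)) _ open_square_open) => p _; exact: cu.
  move=> p Dp; apply: filterS (open_nbhs_nbhs (conj oD Dp)) => p' /= [/andP[h1 h2] /andP[h3 h4]].
  by apply: FF; split; rewrite /= ?(ltW h1) ?(ltW h2) ?(ltW h3) ?(ltW h4).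
Qed.

Lemma line_area F (h : R * R -> R) : h = (fun p => p.1) \/ h = (fun p => p.2) -> forall z, area_le br q F [set p | h p = z] 0.
Proof.
by case=> -> z; apply: area_null; [apply: closed_measurable_plane|exact: null_vertical|apply: closed_measurable_plane|exact: null_horizontal];
  apply: (preimage_closed _ (@closed_eq R z)) => p _; (exact: cvg_fst || exact: cvg_snd).
Qed.

(** The homotopy and the filling of its end are put side by side in the first coordinate; the
    segment where they meet is a null set. *)
Lemma fill_homotopy H c c' (L A A' : R) : 0 <= L -> glip br square H L ->
  (forall t : R, 0 <= t <= 1 -> H (0, t) = c t /\ H (1, t) = c' t) ->
  (forall s : R, 0 <= s <= 1 -> H (s, 0) = 0 /\ H (s, 1) = 0) ->
  area_le br q H open_square A -> fill c' A' -> fill c (A + A').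
Proof.
move=> L0 gH H01 Hs aH [F [L' [L'0 gF F01 Fs aF]]].
pose P p := if p.1 <= 2^-1 then H (2 * p.1 + 0, 1 * p.2 + 0) else F (2 * p.1 + -1, 1 * p.2 + 0).
have two0 : (0 : R) < 2 by []. 
have PF p : square (2 * p.1 + -1, 1 * p.2 + 0) -> P p = F (2 * p.1 + -1, 1 * p.2 + 0).
  move=> [/= /andP[h1 h2] hy]; rewrite /P; case: ifP => // h3.
  have -> : 2 * p.1 + 0 = 1 by lra.
  have -> : 2 * p.1 + -1 = 0 by lra.
  by have [_ ->] := H01 _ hy; have [-> _] := F01 _ hy.
have [g1 c1 a1] : _ := @affine_piece H P L A 2 0 1 0 two0 ltr01 L0 gH aH
  (ltac:(by move=> p [/= /andP[_ h] _]; rewrite /P ifT//; lra)).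
have [g2 c2 a2] : _ := @affine_piece F P L' A' 2 (-1) 1 0 two0 ltr01 L'0 gF aF PF.
pose M := (L + L') * 3.
have gP : glip br square P M.
  have h1 := glip_le (_ : L * (2 + 1) <= M) g1; have h2 := glip_le (_ : L' * (2 + 1) <= M) g2.
  have h12 := glip_glue c1 c2 (h1 (ltac:(by rewrite /M; lra))) (h2 (ltac:(by rewrite /M; lra))).
  refine (glip_sub _ h12) => p [/andP[x0 x1] /andP[y0 y1]].
  by have [h|h] := leP p.1 2^-1; [left|right]; split => /=; apply/andP; split; lra.
have M0 : 0 <= M by rewrite /M; lra.
exists P, M; split; [exact: M0|exact: gP| | |].
- move=> t t01; rewrite /P /= mulr0 mul1r !addr0 mulr1 invr_ge0 ler0n ifF; last by apply/negbTE; rewrite -ltNge invf_lt1// ltr1n.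
  have -> : 2 + -1 = 1 :> R by lra.
  by have [-> _] := H01 _ t01; have [_ ->] := F01 _ t01.
- move=> s /andP[s0 s1]; rewrite /P /= mulr0 mulr1 !addr0; case: (leP s 2^-1) => h.
    by apply: Hs; apply/andP; split; lra.
  by apply: Fs; apply/andP; split; lra.
- have := areaU (areaU a1 a2) (line_area P (or_introl erefl) 2^-1); rewrite addr0.
  apply: area_sub => // p [/andP[x0 x1] /andP[y0 y1]].
  by have [h|h|h] := ltgtP p.1 2^-1; [left; left|left; right|right] => //; split => /=; apply/andP; split; lra.
Qed.

Lemma fill_cat c c' (A A' : R) : fill c A -> fill c' A' ->
  fill (fun t => if t <= 2^-1 then c (2 * t) else c' (2 * t - 1)) (A + A').
Proof.
move=> [H [L [L0 gH H01 Hs aH]]] [F [L' [L'0 gF F01 Fs aF]]].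
pose P p := if p.2 <= 2^-1 then H (1 * p.1 + 0, 2 * p.2 + 0) else F (1 * p.1 + 0, 2 * p.2 + -1).
have two0 : (0 : R) < 2 by [].
have PF p : square (1 * p.1 + 0, 2 * p.2 + -1) -> P p = F (1 * p.1 + 0, 2 * p.2 + -1).
  move=> [/= hy /andP[h1 h2]]; rewrite /P; case: ifP => // h3.
  have -> : 2 * p.2 + 0 = 1 by lra.
  have -> : 2 * p.2 + -1 = 0 by lra.
  by have [_ ->] := Hs _ hy; have [-> _] := Fs _ hy.
have [g1 c1 a1] : _ := @affine_piece H P L A 1 0 2 0 ltr01 two0 L0 gH aH
  (ltac:(by move=> p [/= _ /andP[_ h]]; rewrite /P ifT//; lra)).
have [g2 c2 a2] : _ := @affine_piece F P L' A' 1 0 2 (-1) ltr01 two0 L'0 gF aF PF.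
pose M := (L + L') * 3.
have gP : glip br square P M.
  have h1 := glip_le (_ : L * (1 + 2) <= M) g1; have h2 := glip_le (_ : L' * (1 + 2) <= M) g2.
  have h12 := glip_glue c1 c2 (h1 (ltac:(by rewrite /M; lra))) (h2 (ltac:(by rewrite /M; lra))).
  refine (glip_sub _ h12) => p [/andP[x0 x1] /andP[y0 y1]].
  by have [h|h] := leP p.2 2^-1; [left|right]; split => /=; apply/andP; split; lra.
have M0 : 0 <= M by rewrite /M; lra.
exists P, M; split; [exact: M0|exact: gP| | |].
- move=> t /andP[t0 t1]; rewrite /P /= mulr0 mul1r !addr0; case: (leP t 2^-1) => h.
    by apply: H01; apply/andP; split; lra.
  by apply: F01; apply/andP; split; lra.
- move=> s s01; rewrite /P /= mulr0 mul1r !addr0 mulr1 invr_ge0 ler0n ifF; last by apply/negbTE; rewrite -ltNge invf_lt1// ltr1n.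
  have -> : 2 + -1 = 1 :> R by lra.
  by have [-> _] := Hs _ s01; have [_ ->] := Fs _ s01.
- have := areaU (areaU a1 a2) (line_area P (or_intror erefl) 2^-1); rewrite addr0.
  apply: area_sub => // p [/andP[x0 x1] /andP[y0 y1]].
  by have [h|h|h] := ltgtP p.2 2^-1; [left; left|left; right|right] => //; split => /=; apply/andP; split; lra.
Qed.

(** Linear cone to the origin. Its area depends badly on [M], which is harmless because it only ends
    the recursion, at one fixed scale. *)
Lemma fill_cone (M : R) : 0 <= M -> exists2 K : R, 0 <= K & forall x, glip br I01 x M -> x 0 = 0 -> x 1 = 0 -> fill x K.
Proof.
move=> M0; have [K K0 hK] := glip_bound ts; have [Kj Kj0 hKj] := jac_glip ts q; have C0 := bbl_ge0 ts.
have [B B0 BE] : exists2 B, 0 <= B & B = K * (M + M ^+ 2).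
  by exists (K * (M + M ^+ 2)); rewrite // mulr_ge0// addr_ge0// sqr_ge0.
pose k := 1 + 2^-1 * (C * B).
have k0 : 0 <= k by rewrite addr_ge0// !mulr_ge0.
pose L := k * (B + k * M).
have L0 : 0 <= L by rewrite mulr_ge0// addr_ge0// mulr_ge0.
exists (Kj * L ^+ 2); first by rewrite mulr_ge0// sqr_ge0.
move=> x hx x0 x1.
have xB t : 0 <= t <= 1 -> `|x t| <= B.
  move=> t01; have := hK x M M0 hx 0 t (ltac:(by rewrite lexx ler01)) t01.
  rewrite x0 /ndist oppr0 (bch0x ts) subr0 => h; rewrite (le_trans h)// -BE ler_piMr//.
  by move/andP: t01 => [t0 t1]; rewrite ger0_norm.
pose F p := (1 - p.1) *: x p.2.
have gF : glip br square F L.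
  move=> p [sp tp].
  have [d /= d0 hd] := (nbhs_ballP p.2 _).1 (hx p.2 (ltac:(by rewrite /= in_itv/=))).
  apply: filterS (nbhsx_ballx p d d0) => p' hp' [sp' tp'].
  have n1 := norm1_le p' p; have n2 := norm2_le p' p.
  have h : ndist br (x p.2) (x p'.2) <= M * `|p'.2 - p.2|.
    apply: hd; last by rewrite /= in_itv/=.
    by move: hp'; rewrite -!ball_normE /= distrC => hp'; rewrite distrC (le_lt_trans n2).
  have one (v : V) (s : R) : 0 <= s <= 1 -> `|(1 - s) *: v| <= `|v|.
    by move=> /andP[s0 s1]; rewrite normrZ ger0_norm ?subr_ge0// ler_piMl//; lra.
  have hF : `|F p' - F p| <= (B + k * M) * `|p' - p|.
    have -> : F p' - F p = (p.1 - p'.1) *: x p'.2 + (1 - p.1) *: (x p'.2 - x p.2).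
      by rewrite /F scalerBr addrA -scalerDl; congr (_ *: _ - _); ring.
    rewrite (le_trans (ler_normD _ _))// mulrDl lerD//.
      by rewrite normrZ distrC mulrC; apply: ler_pM => //; exact: xB.
    rewrite (le_trans (one _ _ sp))// (le_trans (norm_le_ndist ts _ _))// -mulrA.
    apply: ler_pM; rewrite ?ndist_ge0 ?addr_ge0 ?mulr_ge0//.
      by rewrite /k lerD2l; apply: ler_wpM2l => //; apply: ler_wpM2l => //; exact: xB.
    by rewrite (le_trans h)//; apply: ler_wpM2l.
  have -> : ndist br (F p) (F p') = `|bch br (- F p) (F p') - bch br (- F p) (F p)|.
    by rewrite (bchNx ts) subr0.
  rewrite (le_trans (norm_bch_diff ts _ _ _))// /L -mulrA; apply: ler_pM => //.
    by rewrite addr_ge0// !mulr_ge0.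
  rewrite normrN /k lerD2l; apply: ler_wpM2l => //; apply: ler_wpM2l => //.
  by rewrite (le_trans (one _ _ sp))//; exact: xB.
exists F, L; split=> //.
- by move=> t _; rewrite /F /= subr0 scale1r subrr scale0r.
- by move=> s _; rewrite /F /= x0 x1 !scaler0.
- apply: area_bound; first by move=> p [/andP[a1 a2] /andP[a3 a4]]; split; rewrite /= in_itv/= ?(ltW a1) ?(ltW a2) ?(ltW a3) ?(ltW a4).
    by rewrite mulr_ge0// sqr_ge0.
  have oS : open_square `<=` square.
    by move=> p [/andP[a1 a2] /andP[a3 a4]]; split; rewrite ?(ltW a1) ?(ltW a2) ?(ltW a3) ?(ltW a4).
  move=> p Dp; apply: (hKj _ square) => //; first exact: oS.
  by apply: filterS (open_nbhs_nbhs (conj open_square_open Dp)) => p' /oS.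
Qed.

End fillings.

Lemma exists_pow2 (R : realType) (a : R) : exists k, a <= 2 ^+ k /\ (k = 0%N \/ 2 ^+ k <= 2 * a).
Proof.
have ex : exists k, a <= 2 ^+ k.
  exists (Num.truncn a).+1; rewrite (le_trans (ltW (truncnS_gt _)))// -natrX ler_nat.
  exact/ltnW/ltn_expl.
case: (ex_minnP ex) => -[|k] hk kmin; first by exists 0%N; split=> //; left.
exists k.+1; split=> //; right; rewrite exprS ler_wpM2l// leNgt; apply/negP => h.
by have := kmin k (ltW h); rewrite ltnn.
Qed.

(** * Projected curves ending in the kernel *)

Section central_loops.
Context {R : realType} {n n' : nat} {G : lieGroup R n}.
Notation V := 'rV[R]_n.
Notation V' := 'rV[R]_n'.
Notation I01 := (`[0 : R, 1 : R]%classic).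
Variables (e : chart R n G) (br : V -> V -> V) (C : R) (E : V -> G) (lg : G -> V).
Hypothesis hm : nil_model e br C E lg.
Variables (q : {dot V for idfun}).
Variables (br' : V' -> V' -> V') (C' : R).
Hypothesis ts' : two_step br' C'.
Variables (q' : {dot V' for idfun}) (A : 'M[R]_(n, n')).
Hypothesis brA : forall x y, br' (x *m A) (y *m A) = br x y *m A.
Hypothesis dehn_le : exists2 K : R, 0 <= K & forall l, 0 <= l -> (dehn e q l <= (K * (1 + l) ^+ 2)%:E)%E.
Hypothesis kerA_central : forall w, w *m A = 0 -> forall y, br w y = 0.
Variable Kr : R.
Hypothesis Kr0 : 0 <= Kr.
Hypothesis kerA_reach : forall w, w *m A = 0 -> reach br (Kr * Num.sqrt `|w|) w.

(** The added 1 ensures [1 <= m], so that the curves at every scale satisfy the hypothesis [1 <= M]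
    of [homotopy]. *)
Let m := Kr + 1.

(* Halving the endpoint [w] of a curve replaces the loop by two loops of half
   the size, at a cost proportional to the size: this is where the logarithm
   comes from. *)
Lemma fill_projected_curve : exists2 c : R, 0 <= c &
  forall k (w : V) (x : R -> V), w *m A = 0 -> `|w| <= 2 ^+ k -> glip br I01 x (m * Num.sqrt (2 ^+ k)) ->
  x 0 = 0 -> x 1 = w -> fill br' q' (fun t => x t *m A) (c * (k%:R + 1) * 2 ^+ k).
Proof.
have [Kh Kh0 hKh] := homotopy hm ts' q' brA dehn_le.
have [Kg Kg0 hKg] := glip_mulmxr brA.
have m1 : 1 <= m by rewrite lerDr.
have m0 : 0 <= m by apply: le_trans m1.
have [c0 c00 hc0] := fill_cone ts' q' (mulr_ge0 Kg0 m0).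
(* Passing from [k] to [k + 1] doubles the cost and adds [4 * Kh * m ^+ 2 * 2 ^+ k], which is
   [2 * Kh * m ^+ 2] per unit of [2 ^+ k.+1]; [c0] pays for the cones at the end. *)
pose c := c0 + 2 * Kh * m ^+ 2.
have hm2 : 0 <= Kh * m ^+ 2 by rewrite mulr_ge0// sqr_ge0.
exists c; first by rewrite /c; lra.
elim=> [|k IH] w x wA wk hx x0 x1.
  rewrite expr0 sqrtr1 mulr1 in hx; rewrite expr0 add0r !mulr1.
  apply: (@fill_le _ _ _ _ _ c0); first by rewrite /c; lra.
  by apply: hc0; [exact: hKg|rewrite x0 mul0mx|rewrite x1 wA].
have s0 : 0 < Num.sqrt (2 ^+ k : R) by rewrite sqrtr_gt0 exprn_gt0.
have w2A : (2^-1 *: w) *m A = 0 by rewrite -scalemxAl wA scaler0.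
have w2k : `|2^-1 *: w| <= 2 ^+ k.
  by rewrite normrZ ger0_norm ?invr_ge0// ler_pdivrMl// -exprS.
have [y [hy y0 y1]] := kerA_reach w2A.
have {}hy : glip br I01 y (m * Num.sqrt (2 ^+ k)).
  by apply: glip_le hy; apply: ler_pM => //; [rewrite lerDl|exact: ler_wsqrtr].
pose M := m * Num.sqrt (2 ^+ k) * 2.
have sk1 : 1 <= Num.sqrt (2 ^+ k : R) by rewrite -{1}sqrtr1 ler_wsqrtr// exprn_ege1// ler1n.
have M1 : 1 <= M.
  have := ler_pM ler01 ler01 m1 sk1; rewrite mulr1.
  by rewrite /M; lra.
have ms0 : 0 <= m * Num.sqrt (2 ^+ k) by rewrite mulr_ge0// ltW.
have hx' : glip br I01 x M.
  apply: glip_le hx; rewrite /M -mulrA; apply: ler_wpM2l => //.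
  rewrite exprS sqrtrM// mulrC; apply: ler_wpM2l; first exact: ltW.
  have : Num.sqrt 2 ^+ 2 = 2 :> R by rewrite sqr_sqrtr.
  have := sqrtr_ge0 (2 : R); nra.
have hyy := glip_cat hm ms0 hy hy y0.
have wb : bch br (2^-1 *: w) (2^-1 *: w) = w.
  by rewrite (bchZ hm) -[RHS]scale1r; congr (_ *: _); lra.
have [H [L [L0 gH H01 Hs aH]]] := hKh x (cat_curve br y y) M M1 hx' hyy x0
  (etrans (cat_curve0 br y y) y0) (etrans x1 (esym (etrans (cat_curve1 br y y) (etrans (congr1 (fun z => bch br z z) y1) wb)))).
have fy := IH _ y w2A w2k hy y0 y1.
have fc := fill_cat ts' fy fy.
have e1 : Kh * M ^+ 2 = 4 * (Kh * m ^+ 2) * 2 ^+ k.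
  by rewrite /M !exprMn sqr_sqrtr ?exprn_ge0//; ring.
apply: (@fill_le _ _ _ _ _ (Kh * M ^+ 2 + (c * (k%:R + 1) * 2 ^+ k + c * (k%:R + 1) * 2 ^+ k))).
  rewrite e1 [X in _ <= _ * X]exprS -natr1 /c.
  have h2 : 0 <= (2 : R) ^+ k by rewrite exprn_ge0.
  rewrite -subr_ge0 (_ : _ - _ = 2 * c0 * 2 ^+ k); first by rewrite !mulr_ge0.
  ring.
have gS : glip br' square H L by exact: glip_sub gH.
have sides (s : R) : 0 <= s <= 1 -> H (s, 0) = 0 /\ H (s, 1) = 0 by have [-> ->] := Hs s; rewrite x1 wA.
have aS : area_le br' q' H open_square (Kh * M ^+ 2).
  by apply: (area_sub _ (lexx _) aH) => p [h1 h2]; split; rewrite /= in_itv/=.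
(* The second copy of [y] is translated by [2^-1 *: w], which is central and killed by [A]; after
   projection it is the same loop again. *)
apply: (fill_homotopy ts' L0 gS _ sides aS fc) => t t01; have [-> ->] := H01 t t01; split=> //.
rewrite /cat_curve; case: ifP => // _.
by rewrite y1 /bch (kerA_central w2A) scaler0 addr0 mulmxDl w2A add0r.
Qed.

(** The long curve is first deformed to a short one with the same endpoint, at cost of order M^2;
    then [fill_projected_curve] is used with [2 ^+ k] comparable to M^2, so that [k] is of order
    [ln M]. *)
Lemma fill_loop : exists2 K : R, 0 <= K & forall (x : R -> V) (M : R), 1 <= M -> glip br I01 x M ->
  x 0 = 0 -> x 1 *m A = 0 -> `|x 1| <= M ^+ 2 -> fill br' q' (fun t => x t *m A) (K * (M ^+ 2 * (1 + ln M))).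
Proof.
have [c c0 hc] := fill_projected_curve.
have [Kh Kh0 hKh] := homotopy hm ts' q' brA dehn_le.
have m1 : 1 <= m by rewrite lerDr.
have m0 : 0 <= m by apply: le_trans m1.
have l2 : 0 < ln (2 : R) by rewrite ln_gt0// ltr1n.
pose K1 := Kh * m ^+ 2 + c.
have K10 : 0 <= K1 by rewrite addr_ge0// mulr_ge0// sqr_ge0.
(* From [2 ^+ k <= 2 * M ^+ 2] one gets [k <= 1 + 2 / ln 2 * ln M]. *)
pose a := 2 + 2 / ln 2 : R.
have a0 : 0 <= a by rewrite addr_ge0// divr_ge0// ltW.
exists (K1 * a * 2); first by rewrite !mulr_ge0.
move=> x M M1 hx x0 x1A xM.
have M0 : 0 < M by apply: lt_le_trans M1.
have lM : 0 <= ln M by rewrite ln_ge0.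
have [k [k1 k2]] := exists_pow2 (M ^+ 2).
have {}k2 : 2 ^+ k <= 2 * M ^+ 2.
  by case: k2 => // ->; rewrite expr0; have := exprn_ege1 2 M1; lra.
have kl : k%:R * ln 2 <= ln 2 + 2 * ln M.
  have : ln (2 ^+ k) <= ln (2 * M ^+ 2) by rewrite ler_ln ?posrE ?exprn_gt0 ?mulr_gt0 ?exprn_gt0.
  by rewrite lnM ?posrE ?exprn_gt0// !lnXn// -[ln 2 *+ k]mulr_natl -[ln M *+ 2]mulr_natl.
have ka : k%:R + 1 <= a * (1 + ln M).
  have : k%:R <= 1 + 2 / ln 2 * ln M.
    have -> : 1 + 2 / ln 2 * ln M = (ln 2 + 2 * ln M) / ln 2 by field; rewrite gt_eqF.
    by rewrite ler_pdivlMr.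
  have : 0 <= 2 / ln 2 :> R by rewrite divr_ge0// ltW.
  by rewrite /a; nra.
have Mk : M <= Num.sqrt (2 ^+ k) by rewrite -(ger0_norm (ltW M0)) -sqrtr_sqr ler_wsqrtr.
have s0 : 0 <= Num.sqrt (2 ^+ k : R) by exact: sqrtr_ge0.
have [y [hy y0 y1]] := kerA_reach x1A.
have {}hy : glip br I01 y (m * Num.sqrt (2 ^+ k)).
  apply: glip_le hy; apply: ler_pM => //; first by rewrite lerDl.
  by apply: ler_wsqrtr; exact: le_trans xM k1.
have {}hx : glip br I01 x (m * Num.sqrt (2 ^+ k)).
  by apply: glip_le hx; rewrite (le_trans Mk)// ler_peMl.
have M'1 : 1 <= m * Num.sqrt (2 ^+ k).
  by have := ler_pM ler01 ler01 m1 (le_trans M1 Mk); rewrite mulr1.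
have [H [L [L0 gH H01 Hs aH]]] := hKh x y _ M'1 hx hy x0 y0 (esym y1).
have fy := hc k _ y x1A (le_trans xM k1) hy y0 y1.
have e2 : (m * Num.sqrt (2 ^+ k)) ^+ 2 = m ^+ 2 * 2 ^+ k by rewrite exprMn sqr_sqrtr// exprn_ge0.
rewrite e2 in aH.
have p0 : 0 <= (2 : R) ^+ k by rewrite exprn_ge0.
apply: (@fill_le _ _ _ _ _ (Kh * (m ^+ 2 * 2 ^+ k) + c * (k%:R + 1) * 2 ^+ k)).
  have h1 : Kh * (m ^+ 2 * 2 ^+ k) + c * (k%:R + 1) * 2 ^+ k <= K1 * (k%:R + 1) * 2 ^+ k.
    rewrite mulrA -mulrDl; apply: ler_wpM2r => //; rewrite /K1 mulrDl lerD2r.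
    by rewrite ler_peMr ?mulr_ge0 ?sqr_ge0// lerDr.
  rewrite (le_trans h1)//.
  have -> : K1 * a * 2 * (M ^+ 2 * (1 + ln M)) = K1 * (a * (1 + ln M)) * (2 * M ^+ 2) by ring.
  by apply: ler_pM => //; [rewrite mulr_ge0// addr_ge0|apply: ler_wpM2l].
have gS : glip br' square H L by exact: glip_sub gH.
have sides (s : R) : 0 <= s <= 1 -> H (s, 0) = 0 /\ H (s, 1) = 0 by have [-> ->] := Hs s; rewrite x1A.
have aS : area_le br' q' H open_square (Kh * (m ^+ 2 * 2 ^+ k)).
  by apply: (area_sub _ (lexx _) aH) => p [h1 h2]; split; rewrite /= in_itv/=.
exact: (fill_homotopy ts' L0 gS H01 sides aS fy).
Qed.

End central_loops.

(** * Lifting curves *)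

Section lift.
Context {R : realType} {n n' : nat}.
Notation V := 'rV[R]_n.
Notation V' := 'rV[R]_n'.
Notation I01 := (`[0 : R, 1 : R]%classic).
Variables (br : V -> V -> V) (C : R) (br' : V' -> V' -> V') (C' : R).
Hypothesis ts : two_step br C.
Hypothesis ts' : two_step br' C'.
Variables (A : 'M[R]_(n, n')) (B : 'M[R]_(n', n)).
Hypothesis BA : B *m A = 1%:M.
Hypothesis brA : forall x y, br' (x *m A) (y *m A) = br x y *m A.
Hypothesis kerA_central : forall w, w *m A = 0 -> forall y, br w y = 0.
Hypothesis kerA_br : forall P : 'M[R]_n, (forall x y, br x y *m P = 0) -> forall w : V, w *m A = 0 -> w *m P = 0.

(** The section [B] is linear but not a homomorphism: this is the component in the kernel of [A] of
    half the bracket of two lifted vectors, [1%:M - A *m B] being the projection onto that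
    kernel. *)
Let defect (x y : V') : V := 2^-1 *: (br (x *m B) (y *m B) *m (1%:M - A *m B)).

Let defectA x y : defect x y *m A = 0.
Proof. by rewrite /defect -scalemxAl -mulmxA mulmxBl mul1mx -[A *m B *m A]mulmxA BA mulmx1 subrr mulmx0 scaler0. Qed.

Let defectxx x : defect x x = 0.
Proof. by rewrite /defect (ts_alt ts) mul0mx scaler0. Qed.

Let defectBr x y z : defect x (y - z) = defect x y - defect x z.
Proof. by rewrite /defect mulmxBl (bblBr ts) mulmxBl scalerBr. Qed.

Let defectBl x y z : defect (x - y) z = defect x z - defect y z.
Proof. by rewrite /defect mulmxBl (bblBl ts) mulmxBl scalerBr. Qed.

(* The increments of the lift [x B + w] differ from those of [x] by [defect];
   it only sees horizontal displacements, so that it is quadratic in the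
   distance and can be compensated step by step. *)
Let defect_le : exists2 K : R, 0 <= K & forall x y x' y', `|defect (y - x) (y' - x')| <= K * ndist br' x y * ndist br' x' y'.
Proof.
have C0 := bbl_ge0 ts; have [P [brP Pbr]] := horizontal_projection ts.
pose k := n'%:R * `|B *m P|.
have k0 : 0 <= k by rewrite mulr_ge0.
have hor x y : `|(y - x) *m B *m P| <= k * ndist br' x y.
  have e : br' x y *m B *m P = 0.
    have -> : br' x y = br (x *m B) (y *m B) *m A by rewrite -brA -!mulmxA BA !mulmx1.
    set z := br _ _; have : (z *m A *m B - z) *m P = 0.
      by apply: (kerA_br brP); rewrite mulmxBl -[z *m A *m B *m A]mulmxA BA mulmx1 subrr.
    by rewrite mulmxBl (brP (x *m B) (y *m B)) subr0.
  have -> : (y - x) *m B *m P = bch br' (- x) y *m B *m P.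
    rewrite /bch (bblNl ts') [- x + y]addrC scalerN !mulmxBl -!scalemxAl e scaler0 subr0//.
  by rewrite -mulmxA (le_trans (mulmx_norm_le _ _))// mulrAC.
pose k' := n%:R * `|1%:M - A *m B : 'M[R]_n|.
have k'0 : 0 <= k' by rewrite mulr_ge0.
exists (k' * C * k * k); first by rewrite !mulr_ge0.
move=> x y x' y'; rewrite /defect normrZ ger0_norm ?invr_ge0//.
have h2 : `|br ((y - x) *m B) ((y' - x') *m B)| <= C * (k * ndist br' x y) * (k * ndist br' x' y').
  rewrite -Pbr (br_anti ts) -Pbr normrN (le_trans (bbl_le ts _ _))//.
  rewrite mulrAC; apply: ler_pM => //; first by rewrite mulr_ge0.
  by apply: ler_wpM2l.
apply: (@le_trans _ _ (`|br ((y - x) *m B) ((y' - x') *m B) *m (1%:M - A *m B)|)).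
  by rewrite ler_piMl// invf_le1// ler1n.
rewrite (le_trans (mulmx_norm_le _ _))// mulrAC.
have -> : k' * C * k * k * ndist br' x y * ndist br' x' y' = k' * (C * (k * ndist br' x y) * (k * ndist br' x' y')) by ring.
exact: ler_wpM2l.
Qed.

(** The increment of [b *m B] at time [t] has a kernel part proportional to [b t], which can be of
    order [M] and would give the lift a Lipschitz constant of order M^2. The central correction [w]
    subtracts this part with [b t] replaced by [b] at the last node, so only the displacement since
    that node matters. *)
Lemma lift_curve : exists2 K : R, 1 <= K & forall (b : R -> V') (M : R), 1 <= M -> glip br' I01 b M -> b 0 = 0 ->
  exists x : R -> V, [/\ glip br I01 x (K * M), x 0 = 0 & forall t, x t *m A = b t].
Proof.
have [K1 K10 hK1] := defect_le; have [Kc Kc0 hKc] := ndist_curve ts'.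
pose k := n'%:R * `|B|; have k0 : 0 <= k by rewrite mulr_ge0.
pose K := 1 + k + K1 * (2 * Kc).
have K1c : 0 <= K1 * (2 * Kc) by rewrite mulr_ge0// mulr_ge0.
exists K; first by rewrite /K; lra.
move=> b M M1 hb b0.
have M0 : 0 <= M by apply: le_trans M1.
(* More than [M] pieces: on each one [b] has length at most 1, so its displacement is bounded by a
   constant. *)
pose m := (Num.truncn M).+1; have Mm : M < m%:R by exact: truncnS_gt.
have m0 : 0 < (m%:R : R) by rewrite ltr0n.
pose node (i : nat) : R := i%:R / m%:R.
have node_le i j : (i <= j)%N -> node i <= node j by move=> ij; rewrite ler_pM2r ?invr_gt0// ler_nat.
(* Clamping freezes each correction outside its own interval, so that the sum is a continuous
   primitive of the piecewise correction. *)
pose term (i : nat) t := defect (b (node i)) (b (clamp (node i) (node i.+1) t)).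
pose w t := \sum_(i < m) term i t.
pose x t := b t *m B + w t.
have wA t : w t *m A = 0.
  by rewrite /w mulmx_suml big1// => i _; exact: defectA.
have xA t : x t *m A = b t by rewrite /x mulmxDl wA addr0 -mulmxA BA mulmx1.
have clamp_lo a c t : a <= c -> t <= a -> clamp a c t = a.
  by move=> ac ta; rewrite /clamp min_r ?(le_trans ta ac)// max_l.
have clamp_hi a c t : a <= c -> c <= t -> clamp a c t = c.
  by move=> ac ct; rewrite /clamp min_l// max_r.
have node01 i : (i <= m)%N -> 0 <= node i <= 1.
  by move=> im; rewrite divr_ge0//= ler_pdivrMr// mul1r ler_nat.
have piece j : (j < m)%N -> glip br (`[node j, node j.+1]%classic : set R) x (K * M).
  move=> jm t; rewrite /= in_itv/= => /andP[t1 t2].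
  have /andP[nj0 _] := node01 j (ltnW jm); have /andP[_ nj1] := node01 _ jm.
  have t01 : I01 t by rewrite /= in_itv/= (le_trans nj0)// (le_trans t2).
  apply: filterS (hb t t01) => t' ht'; rewrite in_itv/= => /andP[t'1 t'2].
  have {}ht' := ht' (ltac:(by rewrite /= in_itv/= (le_trans nj0)// (le_trans t'2))).
  have ww : w t' - w t = defect (b (node j)) (b t' - b t).
    have sp s : node j <= s <= node j.+1 -> w s = defect (b (node j)) (b s) + \sum_(i < m | i != Ordinal jm) term i (node j).
      move=> /andP[s1 s2]; rewrite /w (bigD1 (Ordinal jm))//= {1}/term clamp_id ?s1//; congr (_ + _).
      apply: eq_bigr => i ij; rewrite /term.
      have [lt|gt|e] := ltngtP i j; last by case/eqP: ij; exact: val_inj.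
        by rewrite !clamp_hi ?node_le// ?(le_trans _ s1)// node_le.
      by rewrite !clamp_lo ?node_le// ?(le_trans s2)// ?node_le// ltnW.
    rewrite !sp ?t1 ?t2 ?t'1 ?t'2//.
    by rewrite defectBr opprD addrACA subrr addr0.
  (* The kernel part of the increment is a defect at [b t], the correction one at the node; by
     bilinearity only their difference remains. *)
  have e : bch br (- x t) (x t') = bch br' (- b t) (b t') *m B + defect (b (node j) - b t) (b t' - b t).
    have cz s z : br (w s) z = 0 by apply: kerA_central; exact: wA.
    have -> : bch br (- x t) (x t') = (b t' - b t) *m B + (w t' - w t) - 2^-1 *: br (b t *m B) (b t' *m B).
      rewrite /bch (bblNl ts) /x !(bblDl ts) (cz t) addr0 (bblDr ts) (br_anti ts _ (w t')) (cz t') oppr0 addr0 mulmxBl scalerN.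
      by rewrite opprD [- _ + _ + _]addrC addrACA.
    have -> : bch br' (- b t) (b t') *m B = (b t' - b t) *m B - 2^-1 *: (br (b t *m B) (b t' *m B) *m A *m B).
      rewrite /bch (bblNl ts') scalerN mulmxBl -scalemxAl [- b t + _]addrC; congr (_ - _ *: (_ *m _)).
      by rewrite -brA -!mulmxA BA !mulmx1.
    rewrite ww defectBl -addrA -[RHS]addrA; congr (_ + _).
    have -> : defect (b t) (b t' - b t) = 2^-1 *: br (b t *m B) (b t' *m B) - 2^-1 *: (br (b t *m B) (b t' *m B) *m A *m B).
      by rewrite defectBr defectxx subr0 /defect mulmxBr mulmx1 scalerBr mulmxA.
    by move: (defect _ _) (_ *: br _ _) (_ *: (_ *m B)) => d1 d2 d3; mx_ring.
  rewrite /ndist e (le_trans (ler_normD _ _))//.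
  have h1 : `|bch br' (- b t) (b t') *m B| <= k * (M * `|t' - t|).
    by rewrite (le_trans (mulmx_norm_le _ _))// mulrAC; apply: ler_wpM2l.
  have h2 : ndist br' (b t) (b (node j)) <= 2 * Kc.
    rewrite (ndistC ts').
    have hb' : glip br' (`[node j, t]%classic : set R) b M.
      apply: glip_sub hb => s; rewrite /= !in_itv/= => /andP[s1 s2].
      by rewrite (le_trans nj0)//= (le_trans s2)// (le_trans t2).
    rewrite (le_trans (hKc b _ _ M t1 M0 hb'))// mulrC; apply: ler_wpM2r => //.
    have d1 : M * (t - node j) <= 1.
      have : t - node j <= m%:R^-1.
        have -> : m%:R^-1 = node j.+1 - node j.
          by rewrite /node -mulrBl -natrB// subSnn mul1r.
        by rewrite lerD2r.
      move=> /(ler_wpM2l M0) h; rewrite (le_trans h)// ler_pdivrMr// mul1r; exact: ltW.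
    have d0 : 0 <= M * (t - node j) by rewrite mulr_ge0// subr_ge0.
    have := ler_pM d0 d0 d1 d1; rewrite -expr2; lra.
  have h3 : `|defect (b (node j) - b t) (b t' - b t)| <= K1 * (2 * Kc) * (M * `|t' - t|).
    rewrite (le_trans (hK1 _ _ _ _))//; apply: ler_pM => //.
    by rewrite mulr_ge0// ndist_ge0.
    by rewrite ndist_ge0.
    by apply: ler_wpM2l.
  have h4 : 0 <= M * `|t' - t| by rewrite mulr_ge0.
  by rewrite /K -mulrA !mulrDl mul1r; lra.
have all j : (j <= m)%N -> glip br (`[0 : R, node j]%classic) x (K * M).
  elim: j => [_|j IH jm].
    move=> t; rewrite /node mul0r /= in_itv/= -eq_le => /eqP <-; apply: filterE => t'.
    rewrite in_itv/= -eq_le => /eqP <-.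
    by rewrite (ndistxx ts) subrr normr0 mulr0.
  have h := glip_glue (@itv_closed _ R 0 (node j)) (@itv_closed _ R (node j) (node j.+1)) (IH (ltnW jm)) (piece j jm).
  refine (glip_sub _ h) => t; rewrite /= !in_itv/= => /andP[t0 tj].
  by have [h1|h1] := leP t (node j); [left; rewrite t0|right; rewrite (ltW h1)].
exists x; split=> //.
- by have := all m (leqnn m); rewrite /node divff ?gt_eqF.
- rewrite /x b0 mul0mx add0r /w big1// => i _; rewrite /term clamp_lo ?node_le ?defectxx//.
  by rewrite divr_ge0.
Qed.

End lift.

(** * From discs to squares *)

Section loops.
Context {R : realType} {n : nat} {G : lieGroup R n}.
Notation V := 'rV[R]_n.
Notation I01 := (`[0 : R, 1 : R]%classic).
Notation T1 := (measurableTypeR R).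
Notation mu := (@lebesgue_measure R).
Variables (e : chart R n G) (br : V -> V -> V) (C : R) (E : V -> G) (lg : G -> V).
Hypothesis hm : nil_model e br C E lg.
Variables (q : {dot V for idfun}).

Lemma primitive_bounds (sigma : R -> R) (B : R) : measurable_fun setT (sigma : T1 -> R) ->
  (forall t, 0 <= sigma t <= B) ->
  exists I : R -> R, I 0 = 0 /\ forall s t : R, 0 <= s -> s <= t ->
    [/\ I s <= I t, I t - I s <= B * (t - s) & (\int[mu]_(x in `[s, t]) (sigma x)%:E = (I t - I s)%:E)%E].
Proof.
move=> ms sB.
have sK t : `|sigma t| <= B by have /andP[h1 h2] := sB t; rewrite ger0_norm.
have int (x y : R) := bounded_integrable_itv x y ms sK.
pose I t : R := \int[mu]_(x in `[0, t]) sigma x.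
exists I; split; first by rewrite /I set_itv1 Rintegral_set1.
move=> s t s0 st.
have E1 : I t - I s = \int[mu]_(x in `[s, t]) sigma x.
  rewrite /I Rintegral_itvB; [|exact: int|by rewrite bnd_simp|by rewrite bnd_simp].
  rewrite Rintegral_itv_obnd_cbnd//; apply: integrableS (int s t) => //.
  by apply: subset_itvr; rewrite bnd_simp.
have E2 : (\int[mu]_(x in `[s, t]) (sigma x)%:E = (I t - I s)%:E)%E.
  by rewrite E1 /Rintegral fineK//; exact: integrable_fin_num (int s t).
have p0 : 0 <= I t - I s.
  by rewrite E1; apply: Rintegral_ge0 => x _; have /andP[] := sB x.
split=> //; first by rewrite -subr_ge0.
rewrite -lee_fin -E2.
have mI : measurable (`[s, t]%classic : set T1) by exact: measurable_itv.
have h := integral_cst mu mI B%:E.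
have {}h : (\int[mu]_(x in `[s, t]) cst B%:E x = (B * (t - s))%:E)%E.
  by refine (etrans h _); rewrite EFinM; congr (_ * _)%E; exact: leb_itv.
rewrite -h.
apply: le_lower_integral => // x _; rewrite lee_fin; have /andP[h1 h2] := sB x => //.
exact: le_trans h2.
Qed.

Lemma circle_point (t : R) : circle (cos t, sin t). Proof. exact: cos2Dsin2. Qed.

(** Reparametrizing by the length of the loop plus the angle. The angle makes the parameter strictly
    increasing where the loop stands still, hence invertible, and adds only [2 * pi] to the length.
    [S] is kept because it is Lipschitz while its inverse need not be. *)
Lemma loop_parametrization : exists2 K : R, 0 <= K & forall (f : R * R -> G) (l : R), 0 <= l ->
  lipschitz_map e q circle f -> (circle_length e q f <= l%:E)%E ->
  exists c : R -> V, exists S : R -> R, exists Ls : R, [/\ 0 < Ls,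
    glip br I01 c (K * (l + 2 * pi)),
    (forall s t : R, `|S s - S t| <= Ls * `|s - t|), S 0 = 0 /\ S (2 * pi) = 1 &
    forall t : R, 0 <= t <= 2 * pi -> 0 <= S t <= 1 /\
      c (S t) = bch br (- lg (f (1, 0))) (lg (f (cos t, sin t)))].
Proof.
have [Kn Kn0 hKn] := ndist_length hm; have [Kg Kg0 hKg] := dotn_ge q; have C0 := bbl_ge0 hm.
have pi0 : 0 < 2 * pi :> R by rewrite mulr_gt0// pi_gt0.
exists (Kn * (Kg + Kg ^+ 2)); first by rewrite mulr_ge0// addr_ge0 ?sqr_ge0// ltW.
move=> f l l0 fL fl.
have cd : circle `<=` @disc R by move=> p; rewrite /circle /disc /= => ->.
have [M M0 ndf] := lipschitz_logarithm hm cd fL.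
pose x (t : R) := lg (f (cos t, sin t)).
have ndx s t : ndist br (x s) (x t) <= M * `|s - t|.
  rewrite (le_trans (ndf _ _ (circle_point s) (circle_point t)))//; apply: ler_wpM2l => //.
  by rewrite ge_max /= sin_lip andbT cos_lip.
have [B hB] : exists B, forall t, `|x t| <= B.
  exists (`|x 0| + (1 + 2^-1 * (C * `|x 0|)) * (M * 2)) => t.
  rewrite -[x t](subrK (x 0)) addrC (le_trans (ler_normD _ _))// lerD2l.
  rewrite (le_trans (norm_le_ndist hm _ _))// ler_wpM2l ?addr_ge0 ?mulr_ge0//.
  rewrite (le_trans (ndf _ _ (circle_point 0) (circle_point t)))//; apply: ler_wpM2l => //.
  rewrite (le_trans (ler_normB _ _))// -[2]/(1 + 1) lerD// ge_max /=; apply/andP; split;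
    rewrite ?ler_norml ?cos_le1 ?cos_geN1 ?sin_le1 ?sin_geN1//.
have B0 : 0 <= B by apply: le_trans (hB 0).
pose K0 := (1 + 2^-1 * (C * B)) * M + 1.
have K00 : 0 < K0 by rewrite ltr_wpDl// mulr_ge0// addr_ge0// !mulr_ge0.
have xL s t : `|x s - x t| <= K0 * `|s - t|.
  rewrite distrC (le_trans (norm_le_ndist hm _ _))//.
  apply: (@le_trans _ _ ((1 + 2^-1 * (C * B)) * (M * `|s - t|))).
    by apply: ler_pM; rewrite ?addr_ge0 ?mulr_ge0// ?ndist_ge0// lerD2l ler_wpM2l// ler_wpM2l.
  by rewrite mulrA ler_wpM2r// lerDl.
have [sigma [msig sig0 [Bs hBs] sigd sigl]] := curve_speed hm q K00 pi0 xL.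
have sB t : 0 <= sigma t <= Bs by rewrite sig0 hBs.
have Bs0 : 0 <= Bs by apply: le_trans (hBs 0).
have [I [I0 hI]] := primitive_bounds msig sB.
pose Lam := I (2 * pi) + 2 * pi.
have [I2 _ I2E] := hI 0 (2 * pi) (lexx 0) (ltW pi0).
have Lam0 : 0 < Lam by rewrite ltr_wpDl// -I0.
have Laml : Lam <= l + 2 * pi.
  rewrite lerD2r -lee_fin -[I _]subr0 -I0 -I2E (le_trans _ fl)//.
  apply: sigl => t _; apply: filterE => s; by rewrite (nm_lgK hm).
pose cl (t : R) : R := clamp 0 (2 * pi) t.
(* [I] is a measurable substitute for the length: its total is at most the given length even if the
   speed itself is not measurable. *)
pose S t := (I (cl t) + cl t) / Lam.
pose Ls := (Bs + 1) / Lam.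
have Ls0 : 0 < Ls by rewrite divr_gt0// ltr_wpDl.
have cl0 t : 0 <= cl t <= 2 * pi := clamp_in t (ltW pi0).
have Sinc s t : 0 <= s -> s < t -> t <= 2 * pi -> S s < S t.
  move=> s0 st t2; rewrite /S /cl !clamp_id ?s0 ?(le_trans (ltW st))// ?(le_trans s0 (ltW st))//.
  have [h _ _] := hI s t s0 (ltW st).
  by rewrite ltr_pM2r ?invr_gt0//; lra.
have SL s t : `|S s - S t| <= Ls * `|s - t|.
  have aux a b : 0 <= a -> a <= b -> `|(I a + a) - (I b + b)| <= (Bs + 1) * (b - a).
    move=> a0 ab; have [h1 h2 _] := hI a b a0 ab.
    by rewrite ler0_norm; lra.
  rewrite /S -mulrBl normrM [`|Lam^-1|]ger0_norm ?invr_ge0 ?(ltW Lam0)// /Ls mulrAC.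
  apply: ler_wpM2r; first by rewrite invr_ge0 ltW.
  apply: (@le_trans _ _ ((Bs + 1) * `|cl s - cl t|)); last first.
    by apply: ler_wpM2l; [rewrite addr_ge0|exact: clamp_lip].
  have /andP[s0 _] := cl0 s; have /andP[t0 _] := cl0 t.
  have [st|ts] := leP (cl s) (cl t); first by rewrite (le_trans (aux _ _ s0 st))// ler0_norm ?subr_le0// opprB.
  by rewrite distrC (le_trans (aux _ _ t0 (ltW ts)))// gtr0_norm ?subr_gt0.
have S0 : S 0 = 0 by rewrite /S /cl clamp_id ?lexx ?(ltW pi0)// I0 addr0 mul0r.
have S1 : S (2 * pi) = 1 by rewrite /S /cl clamp_id ?lexx ?(ltW pi0)// divff// gt_eqF.
have Scont : continuous S.
  move=> t; apply/cvgrPdist_le => eps eps0.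
  apply: filterS (nbhsx_ballx t _ (divr_gt0 eps0 Ls0)) => s; rewrite -ball_normE /= ltr_pdivlMr// => h.
  by rewrite (le_trans (SL _ _))// mulrC ltW.
have S01 t : 0 <= t <= 2 * pi -> 0 <= S t <= 1.
  move=> /andP[t0 t1]; apply/andP; split.
    have [->|tn] := eqVneq t 0; first by rewrite S0.
    have tp : 0 < t by rewrite lt_neqAle eq_sym tn.
    by have := Sinc 0 t (lexx 0) tp t1; rewrite S0 => h; exact: ltW.
  have [->|tn] := eqVneq t (2 * pi); first by rewrite S1.
  have tp : t < 2 * pi by rewrite lt_neqAle tn.
  by have := Sinc t (2 * pi) t0 tp (lexx _); rewrite S1 => h; exact: ltW.
have inv u : exists t, 0 <= u <= 1 -> 0 <= t <= 2 * pi /\ S t = u.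
  have [u01|nu] := boolP (0 <= u <= 1); last by exists 0 => h; case/negP: nu.
  have [|t] := @IVT R S 0 (2 * pi) u (ltW pi0) (continuous_subspaceT Scont).
    by rewrite S0 S1 min_l ?ler01// max_r ?ler01.
  by rewrite in_itv /=; exists t.
pose T u := projT1 (cid (inv u)).
have hT u : 0 <= u <= 1 -> 0 <= T u <= 2 * pi /\ S (T u) = u := projT2 (cid (inv u)).
have Sinj s t : 0 <= s <= 2 * pi -> 0 <= t <= 2 * pi -> S s = S t -> s = t.
  move=> /andP[s0 s1] /andP[t0 t1] st; have [h|h|//] := ltgtP s t.
    by have := Sinc _ _ s0 h t1; rewrite st ltxx.
  by have := Sinc _ _ t0 h s1; rewrite st ltxx.
pose c u := bch br (- x 0) (x (T u)).
exists c, S, Ls; split=> //; last first.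
  move=> t t02; split; first exact: S01.
  have [h1 h2] := hT _ (S01 _ t02).
  by rewrite /c (Sinj _ _ h1 t02 h2) /x cos0 sin0.
have key u u' : 0 <= u -> u <= u' -> u' <= 1 -> ndist br (c u) (c u') <=
    Kn * (Kg * Lam * (u' - u) + (Kg * Lam * (u' - u)) ^+ 2).
  move=> u0 uu u1; rewrite (ndist_invariant hm).
  have [/andP[a0 a1] Sa] := hT u (ltac:(by rewrite u0 (le_trans uu))).
  have [/andP[b0 b1] Sb] := hT u' (ltac:(by rewrite u1 (le_trans u0))).
  have [ab|ba|ab] := ltgtP (T u) (T u'); last 2 first.
  - by have := Sinc _ _ b0 ba a1; rewrite Sa Sb ltNge uu.
  - by rewrite ab (ndistxx hm) mulr_ge0// addr_ge0 ?sqr_ge0// !mulr_ge0 ?subr_ge0// ltW.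
  have d0 : 0 <= Kg * Lam * (u' - u) by rewrite !mulr_ge0 ?subr_ge0// ltW.
  apply: (hKn x (fun t => Kg * sigma t) K0) => //.
  - exact: measurable_funM.
  - by move=> t; rewrite mulr_ge0// ltW.
  - have FF := ae_filter_ringOfSetsType mu; apply: filterS sigd => t ht /andP[t1 t2] w hw.
    rewrite (le_trans (hKg _))//; apply: ler_wpM2l; first exact: ltW.
    by apply: ht hw; rewrite (le_lt_trans a0 t1) (lt_le_trans t2 b1).
  - have [h1 _ h3] := hI _ _ a0 (ltW ab).
    under eq_integral do rewrite EFinM.
    rewrite ge0_integralZl_EFin//; last 3 first.
    + by move=> t _; rewrite lee_fin.
    + by apply/measurable_EFinP; exact: measurable_funTS.
    + exact: ltW.
    rewrite h3 -EFinM lee_fin -mulrA; apply: ler_wpM2l; first exact: ltW.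
    have e1 : S (T u') - S (T u) = (I (T u') + T u' - (I (T u) + T u)) / Lam.
      by rewrite /S /cl !clamp_id ?a0 ?a1 ?b0 ?b1// mulrBl.
    move: e1; rewrite Sa Sb => ->; rewrite mulrC divfK ?gt_eqF//; lra.
move=> u; rewrite /= in_itv/= => /andP[u0 u1].
(* For times closer than this, [Lam * d <= 1] and the quadratic term of [key] is absorbed in the
   linear one. *)
have Li0 : 0 < Lam^-1 by rewrite invr_gt0.
apply: filterS (nbhsx_ballx u _ Li0) => u'; rewrite -ball_normE /= => hu; rewrite in_itv/= => /andP[u'0 u'1].
have fin d : 0 <= d -> d < Lam^-1 -> Kn * (Kg * Lam * d + (Kg * Lam * d) ^+ 2) <= Kn * (Kg + Kg ^+ 2) * (l + 2 * pi) * d.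
  move=> d0 d1.
  have Ld : Lam * d <= 1 by have := ler_wpM2l (ltW Lam0) (ltW d1); rewrite divff// gt_eqF.
  rewrite -!mulrA; apply: ler_wpM2l => //.
  have h1 : Lam * d <= (l + 2 * pi) * d by rewrite ler_wpM2r.
  have h2 : Kg * (Lam * d) <= Kg * ((l + 2 * pi) * d) by rewrite ler_wpM2l// ltW.
  have h3 : (Kg * (Lam * d)) ^+ 2 <= Kg ^+ 2 * ((l + 2 * pi) * d).
    rewrite exprMn; apply: ler_wpM2l; first exact: sqr_ge0.
    by apply: le_trans h1; rewrite expr2 ler_piMr// mulr_ge0// ltW.
  by rewrite [leRHS]mulrDl lerD.
have [uu|uu] := leP u u'.
  rewrite ger0_norm ?subr_ge0//; apply: le_trans (key _ _ u0 uu u'1) _; apply: fin; first by rewrite subr_ge0.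
  by move: hu; rewrite distrC ger0_norm ?subr_ge0.
rewrite (ndistC hm) ltr0_norm ?subr_lt0// opprB; apply: le_trans (key _ _ u'0 (ltW uu) u1) _.
apply: fin; first by rewrite subr_ge0 ltW.
by move: hu; rewrite gtr0_norm ?subr_gt0.
Qed.

End loops.

(** * Polar angle and collar around an inner square *)

Section collar_geometry.
Context {R : realType}.
Implicit Types p : R * R.

Lemma atan_lip (x y : R) : `|atan x - atan y| <= `|x - y|.
Proof.
wlog xy : x y / x <= y => [H|].
  by case: (leP x y) => [/H //|/ltW /H]; rewrite distrC (distrC y).
rewrite distrC (distrC x).
have [|c _ ->] := @MVT_segment R (@atan R) (fun z => (1 + z ^+ 2)^-1) x y xy (fun z _ => is_derive1_atan z).
  by apply: continuous_subspaceT => z; exact: continuous_atan.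
have c1 : 1 <= 1 + c ^+ 2 by rewrite lerDl sqr_ge0.
by rewrite normrM ler_piMl// ger0_norm ?invr_ge0 ?(le_trans ler01)// invf_le1// (lt_le_trans ltr01).
Qed.

(** Half-angle formula tan(theta/2) = y/(r + |x|): half the polar angle of [p] folded into the right
    half-plane. The maximum with 1/2 only acts near the origin, where it keeps the function
    Lipschitz. *)
Definition half_angle p : R := atan (p.2 / Num.max (eucl p + `|p.1|) 2^-1).

Let den p : R := Num.max (eucl p + `|p.1|) 2^-1.

Let den_ge p : 2^-1 <= den p. Proof. by rewrite le_max lexx orbT. Qed.

Let num_le p : `|p.2| <= den p.
Proof. by rewrite le_max (le_trans (norm2_le_eucl p))// lerDl. Qed.

Lemma half_angle_lip p p' : `|half_angle p - half_angle p'| <= 8 * `|p - p'|.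
Proof.
have h0 : 0 < (2^-1 : R) by rewrite invr_gt0.
rewrite (le_trans (atan_lip _ _))// (le_trans (quotient_lip p.2 h0 (den_ge p) (den_ge p') (num_le p')))//.
have h1 := norm2_le p p'.
have h2 : `|den p - den p'| <= 3 * `|p - p'|.
  have a1 := eucl_lip p p'.
  have a2 : `| `|p.1| - `|p'.1| | <= `|p - p'| by rewrite (le_trans (ler_dist_dist _ _))// norm1_le.
  move: a1 a2; rewrite /den !ler_norml => /andP[a1 a2] /andP[a3 a4].
  have d0 := normr_ge0 (p - p').
  by case: (leP (eucl p + `|p.1|) 2^-1) => ?; case: (leP (eucl p' + `|p'.1|) 2^-1) => ?; apply/andP; split; lra.
by rewrite invrK; lra.
Qed.

Lemma half_angle_bounds p : - (pi / 2) <= half_angle p <= pi / 2.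
Proof. by rewrite !ltW// ?atan_gtNpi2// atan_ltpi2. Qed.

Lemma half_angle_norm p : `|half_angle p| <= 2 * `|p.2|.
Proof.
rewrite -[half_angle p]subr0 -atan0 (le_trans (atan_lip _ _))// subr0 normrM mulrC.
apply: ler_wpM2r => //; rewrite normfV ger0_norm; last by rewrite (le_trans _ (den_ge p)).
have d0 : 0 < den p by rewrite (lt_le_trans _ (den_ge p)).
by rewrite -/(den p) -[leRHS]invrK lef_pV2 ?posrE ?invr_gt0.
Qed.

Lemma half_angle_ge0 p : 0 <= p.2 -> 0 <= half_angle p.
Proof.
move=> p0; have h : 0 <= p.2 / den p by rewrite divr_ge0// (le_trans _ (den_ge p)).
by rewrite -atan0; apply: le_atan.
Qed.

Lemma half_angleN p : half_angle (p.1, - p.2) = - half_angle p.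
Proof. by rewrite /half_angle /eucl /= sqrrN mulNr atanN. Qed.

Lemma half_angle_axis p : p.1 = 0 -> 2^-1 <= p.2 -> half_angle p = pi / 4.
Proof.
move=> p1 p2; rewrite /half_angle /eucl p1 normr0 expr0n add0r addr0 sqrtr_sqr ger0_norm ?(le_trans _ p2)//.
by rewrite max_l// divff ?atan1// gt_eqF// (lt_le_trans _ p2).
Qed.

Lemma cos_sin_half_angle p : circle p -> cos (2 * half_angle p) = `|p.1| /\ sin (2 * half_angle p) = p.2.
Proof.
move=> cp; have r1 := (circleE p).1 cp; move: cp; rewrite /circle /= => cp.
have D1 : Num.max (eucl p + `|p.1|) 2^-1 = 1 + `|p.1|.
  by rewrite r1 max_l//; have := normr_ge0 p.1; lra.
set a := half_angle p; have D0 : 1 + `|p.1| != 0 by rewrite gt_eqF// ltr_wpDr.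
have ta : tan a = p.2 / (1 + `|p.1|) by rewrite /a /half_angle atanK D1.
have ca : 0 < cos a.
  by apply: cos_gt0_pihalf; rewrite atan_gtNpi2 atan_ltpi2.
have sa : sin a = cos a * (p.2 / (1 + `|p.1|)) by rewrite -ta /tan mulrC divfK// gt_eqF.
have c2 : cos a ^+ 2 = (1 + `|p.1|) / 2.
  have := cos2Dsin2 a; rewrite sa exprMn -{1}[cos a ^+ 2]mulr1 -mulrDr => h.
  have e : 1 + (p.2 / (1 + `|p.1|)) ^+ 2 = 2 / (1 + `|p.1|).
    have : p.2 ^+ 2 = 1 - `|p.1| ^+ 2 by rewrite real_normK ?num_real// -cp addrC addKr.
    by rewrite expr_div_n => ->; field.
  rewrite e in h.
  have -> : cos a ^+ 2 = (cos a ^+ 2 * (2 / (1 + `|p.1|))) * ((1 + `|p.1|) / 2) by field.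
  by rewrite h mul1r.
rewrite mulr_natl mulr2n cosD sinD -!expr2 sin2cos2 c2; split; first by field.
rewrite sa (_ : _ + _ = 2 * cos a ^+ 2 * (p.2 / (1 + `|p.1|))); last by ring.
by rewrite c2; field.
Qed.

(** Zero on the unit circle; inside, positive above the axis and negative below. Subtracting a large
    multiple drives the loop parameter out of the unit interval, to the base point. *)
Definition collar_push p : R := Num.max 0 (1 - eucl p) * clamp (-1) 1 p.2.

Lemma collar_push_lip p p' : `|collar_push p - collar_push p'| <= 3 * `|p - p'|.
Proof.
have m1 (r : R * R) : `|Num.max 0 (1 - eucl r)| <= 1.
  by have := eucl_ge0 r; case: (leP 0 (1 - eucl r)) => ? ?; rewrite ?normr0 ?ger0_norm//; lra.
have m2 : `|Num.max 0 (1 - eucl p) - Num.max 0 (1 - eucl p')| <= 2 * `|p - p'|.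
  have := eucl_lip p p'; have := normr_ge0 (p - p'); rewrite !ler_norml => ? /andP[? ?].
  by case: (leP 0 (1 - eucl p)) => ?; case: (leP 0 (1 - eucl p')) => ?; apply/andP; split; lra.
have c1 : `|clamp (-1) 1 p.2| <= 1 by rewrite ler_norml clamp_in//; lra.
have c2 : `|clamp (-1) 1 p.2 - clamp (-1) 1 p'.2| <= `|p - p'|.
  by rewrite (le_trans (clamp_lip _ _ _ _))// norm2_le.
have -> : collar_push p - collar_push p' =
  (Num.max 0 (1 - eucl p) - Num.max 0 (1 - eucl p')) * clamp (-1) 1 p.2 +
  Num.max 0 (1 - eucl p') * (clamp (-1) 1 p.2 - clamp (-1) 1 p'.2) by rewrite /collar_push; ring.
rewrite (le_trans (ler_normD _ _))// !normrM.
have := ler_pM (normr_ge0 _) (normr_ge0 _) m2 c1; have := ler_pM (normr_ge0 _) (normr_ge0 _) (m1 p') c2.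
by rewrite mul1r mulr1; lra.
Qed.

Lemma collar_push_circle p : circle p -> collar_push p = 0.
Proof. by move=> /circleE p1; rewrite /collar_push p1 subrr max_l// mul0r. Qed.

(** The inner square has corners at distance less than 3/4 from the origin, which leaves a margin of
    1/4. *)
Lemma collar_push_square p : `|p.1| <= 2^-1 -> `|p.2| <= 2^-1 ->
  (0 <= p.2 -> 4^-1 * p.2 <= collar_push p) /\ (p.2 <= 0 -> collar_push p <= 4^-1 * p.2).
Proof.
move=> p1 p2; have r34 : eucl p <= 3 / 4.
  rewrite -[3 / 4]ger0_norm// -sqrtr_sqr ler_wsqrtr//.
  rewrite -(real_normK (num_real p.1)) -(real_normK (num_real p.2)).
  have := ler_pM (normr_ge0 _) (normr_ge0 _) p1 p1; have := ler_pM (normr_ge0 _) (normr_ge0 _) p2 p2.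
  by rewrite -!expr2; lra.
have pc : clamp (-1) 1 p.2 = p.2.
  by apply: clamp_id; move: p2; rewrite ler_norml => /andP[? ?]; apply/andP; split; lra.
by rewrite /collar_push pc max_r; [split=> h; nra|lra].
Qed.

End collar_geometry.

(** * From fillings of squares to fillings of discs *)

Section disc_from_square.
Context {R : realType} {n : nat} {G : lieGroup R n}.
Notation V := 'rV[R]_n.
Notation I01 := (`[0 : R, 1 : R]%classic).
Variables (e : chart R n G) (br : V -> V -> V) (C : R) (E : V -> G) (lg : G -> V).
Hypothesis hm : nil_model e br C E lg.
Variables (q : {dot V for idfun}).

Notation c01 := (clamp (0 : R) 1).

Let ts : two_step br C := hm.

Let c01E (t : R) : 0 <= t <= 1 -> c01 t = t. Proof. exact: clamp_id. Qed.

Let c01_in (t : R) : I01 (c01 t).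
Proof. by rewrite /= in_itv/=; exact: clamp_in ler01. Qed.

Lemma thin_area (c : R -> V) (M Lu : R) (u : R * R -> R) : 0 <= M -> glip br I01 c M -> 0 < Lu ->
  (forall p p', `|u p - u p'| <= Lu * `|p - p'|) -> area_le br q (fun p => c (c01 (u p))) setT 0.
Proof.
move=> M0 hc Lu0 uL; have [K K0 hK] := glip_linear ts ler01 M0 hc.
have cL (s t : R) : `|c (c01 s) - c (c01 t)| <= K * `|s - t|.
  rewrite (le_trans (hK _ _ (clamp_in _ ler01) (clamp_in _ ler01)))//.
  by rewrite ler_wpM2l ?clamp_lip// ltW.
exact: (area_thin ts q Lu0 K0 uL cL).
Qed.

Lemma glip_thin (c : R -> V) (M Lu : R) (u : R * R -> R) D : 0 <= M -> glip br I01 c M ->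
  (forall p p', `|u p - u p'| <= Lu * `|p - p'|) -> glip br D (fun p => c (c01 (u p))) (M * Lu).
Proof.
move=> M0 hc uL; apply: (glip_comp (D := I01) M0) hc => [p _|p p' _ _]; first exact: c01_in.
by rewrite (le_trans (clamp_lip _ _ _ _)).
Qed.

(** Straight-line homotopy between [v] and the identity in the parameter: it stays on the curve [c],
    so it has no area. *)
Lemma fill_reparametrize (c : R -> V) (v : R -> R) (M Lv A : R) : 0 <= M -> glip br I01 c M -> c 0 = 0 -> c 1 = 0 ->
  0 < Lv -> (forall s t, `|v s - v t| <= Lv * `|s - t|) -> (forall t, 0 <= v t <= 1) -> v 0 = 0 -> v 1 = 1 ->
  fill br q c A -> fill br q (fun t => c (v t)) A.
Proof.
move=> M0 hc c0 c1 Lv0 vL v01 v0 v1 fc; rewrite -[A]add0r.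
pose w (p : R * R) : R := v p.2 + c01 p.1 * (c01 p.2 - v p.2).
have cin (t : R) : 0 <= c01 t <= 1 by exact: clamp_in ler01.
have wL p p' : `|w p - w p'| <= (2 * Lv + 2) * `|p - p'|.
  have h1 : `|v p.2 - v p'.2| <= Lv * `|p - p'|.
    by rewrite (le_trans (vL _ _))//; apply: ler_wpM2l; [exact: ltW|exact: norm2_le].
  have h2 : `|c01 p.1 - c01 p'.1| <= `|p - p'| by rewrite (le_trans (clamp_lip _ _ _ _))// norm1_le.
  have h3 : `|c01 p.2 - c01 p'.2| <= `|p - p'| by rewrite (le_trans (clamp_lip _ _ _ _))// norm2_le.
  have h4 : `|c01 p.2 - v p.2| <= 1.
    by have /andP[? ?] := cin p.2; have /andP[? ?] := v01 p.2; rewrite ler_norml; apply/andP; split; lra.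
  have h5 : `|c01 p'.1| <= 1 by have /andP[? ?] := cin p'.1; rewrite ger0_norm.
  have h6 : `|c01 p.2 - c01 p'.2 - (v p.2 - v p'.2)| <= (1 + Lv) * `|p - p'|.
    by rewrite (le_trans (ler_normB _ _))//; lra.
  have -> : w p - w p' = (v p.2 - v p'.2) + ((c01 p.1 - c01 p'.1) * (c01 p.2 - v p.2) +
      c01 p'.1 * (c01 p.2 - c01 p'.2 - (v p.2 - v p'.2))) by rewrite /w; ring.
  rewrite (le_trans (ler_normD _ _))// (le_trans (lerD (lexx _) (ler_normD _ _)))// !normrM.
  have := ler_pM (normr_ge0 _) (normr_ge0 _) h2 h4; have := ler_pM (normr_ge0 _) (normr_ge0 _) h5 h6.
  by rewrite mulr1 mul1r; lra.
have Lw0 : 0 < 2 * Lv + 2 by lra.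
apply: (fill_homotopy ts (H := fun p => c (c01 (w p))) (L := M * (2 * Lv + 2))) fc.
- by rewrite mulr_ge0// ltW.
- exact: glip_thin.
- have z01 : 0 <= (0 : R) <= 1 by rewrite lexx ler01.
  have o01 : 0 <= (1 : R) <= 1 by rewrite lexx ler01.
  move=> t t01; rewrite /w /= (c01E z01) (c01E o01) (c01E t01) mul0r addr0 mul1r.
  by rewrite (_ : v t + (t - v t) = t) ?(c01E (v01 t)) ?(c01E t01)//; ring.
- have z01 : 0 <= (0 : R) <= 1 by rewrite lexx ler01.
  have o01 : 0 <= (1 : R) <= 1 by rewrite lexx ler01.
  by move=> s s01; rewrite /w /= v0 v1 (c01E z01) (c01E o01) !subrr !mulr0 !addr0 (c01E z01) (c01E o01).
- by apply: (area_sub _ (lexx _) (thin_area M0 hc Lw0 wL)).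
Qed.


Section collar.
Variables (f : R * R -> G) (c : R -> V) (S : R -> R) (M Ls A : R).
Hypothesis M0 : 0 <= M.
Hypothesis hc : glip br I01 c M.
Hypothesis c0 : c 0 = 0.
Hypothesis c1 : c 1 = 0.
Hypothesis Ls0 : 0 < Ls.
Hypothesis SL : forall s t, `|S s - S t| <= Ls * `|s - t|.
Hypothesis S0 : S 0 = 0.
Hypothesis S1 : S (2 * pi) = 1.
Hypothesis hS : forall t, 0 <= t <= 2 * pi -> 0 <= S t <= 1 /\
  c (S t) = bch br (- lg (f (1, 0))) (lg (f (cos t, sin t))).
Hypothesis fA : forall x : R -> V, glip br I01 x M -> x 0 = 0 -> x 1 = 0 -> fill br q x A.

(** On the top and bottom sides of the inner square the push is at least 1/8 in size, so [k >= 8]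
    moves any value of [S] past 0 or 1. On the right side [S] is within 4 Ls |y| of 0 or 1 and the
    push is at least |y|/4, whence [16 * Ls]. [Lu] is the resulting Lipschitz constant of the
    parameters below. *)
Variables (k Lu : R).
Hypothesis kE : k = 8 + 16 * Ls.
Hypothesis LuE : Lu = 16 * Ls + 3 * k.
(** Loop parameters on three sectors. With a the half-angle, the polar angle is pi - 2a on the left,
    2a in the upper right and 2 pi + 2a in the lower right. *)
Let u1 p := S (pi - 2 * half_angle p) - k * collar_push p.
Let u2 p := S (2 * half_angle p) - k * collar_push p.
Let u3 p := S (2 * pi + 2 * half_angle p) - k * collar_push p.

Let k0 : 0 < k. Proof. by have := Ls0; rewrite kE; lra. Qed.
Let Lu0 : 0 < Lu. Proof. by have := Ls0; have := k0; rewrite LuE; lra. Qed.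

Let u_lip (th : R * R -> R) : (forall p p', `|th p - th p'| <= 16 * `|p - p'|) ->
  forall p p', `|(S (th p) - k * collar_push p) - (S (th p') - k * collar_push p')| <= Lu * `|p - p'|.
Proof.
move=> thL p p'.
have -> : (S (th p) - k * collar_push p) - (S (th p') - k * collar_push p') =
  (S (th p) - S (th p')) - k * (collar_push p - collar_push p') by ring.
rewrite (le_trans (ler_normB _ _))// normrM (gtr0_norm k0).
have h1 : `|S (th p) - S (th p')| <= Ls * (16 * `|p - p'|).
  by rewrite (le_trans (SL _ _))//; apply: ler_wpM2l; [exact: ltW|exact: thL].
have h2 := ler_wpM2l (ltW k0) (collar_push_lip p p').
by rewrite LuE; lra.
Qed.

Let u1L p p' : `|u1 p - u1 p'| <= Lu * `|p - p'|.
Proof.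
apply: (u_lip (th := fun p => pi - 2 * half_angle p)) => r r'.
have -> : pi - 2 * half_angle r - (pi - 2 * half_angle r') = - (2 * (half_angle r - half_angle r')) by ring.
by rewrite normrN normrM ger0_norm//; have := half_angle_lip r r'; lra.
Qed.

Let u2L p p' : `|u2 p - u2 p'| <= Lu * `|p - p'|.
Proof.
apply: (u_lip (th := fun p => 2 * half_angle p)) => r r'.
by rewrite -mulrBr normrM ger0_norm//; have := half_angle_lip r r'; lra.
Qed.

Let u3L p p' : `|u3 p - u3 p'| <= Lu * `|p - p'|.
Proof.
apply: (u_lip (th := fun p => 2 * pi + 2 * half_angle p)) => r r'.
have -> : 2 * pi + 2 * half_angle r - (2 * pi + 2 * half_angle r') = 2 * (half_angle r - half_angle r') by ring.
by rewrite normrM ger0_norm//; have := half_angle_lip r r'; lra.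
Qed.

Let c_le0 (u : R) : u <= 0 -> c (c01 u) = 0.
Proof. by move=> u0; rewrite /clamp min_r ?(le_trans u0)// max_l. Qed.

Let c_ge1 (u : R) : 1 <= u -> c (c01 u) = 0.
Proof. by move=> u0; rewrite /clamp min_l// max_r. Qed.

Let th1_in (p : R * R) : 0 <= pi - 2 * half_angle p <= 2 * pi.
Proof. by have /andP[h1 h2] := half_angle_bounds p; apply/andP; split; lra. Qed.

Let u1_top p : `|p.1| <= 2^-1 -> p.2 = 2^-1 -> u1 p <= 0.
Proof.
move=> p1 p2; have [/andP[_ s1] _] := hS (th1_in p).
have [h _] := collar_push_square p1 (ltac:(by rewrite p2 ger0_norm)).
by have := h (ltac:(by rewrite p2)); rewrite p2 /u1 => {}h; have := ler_wpM2l (ltW k0) h; have := Ls0; rewrite kE; lra.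
Qed.

Let u1_bottom p : `|p.1| <= 2^-1 -> p.2 = - 2^-1 -> 1 <= u1 p.
Proof.
move=> p1 p2; have [/andP[s1 _] _] := hS (th1_in p).
have [_ h] := collar_push_square p1 (ltac:(by rewrite p2 normrN ger0_norm)).
by have := h (ltac:(by rewrite p2; lra)); rewrite p2 /u1 => {}h; have := ler_wpM2l (ltW k0) h; have := Ls0; rewrite kE; lra.
Qed.

Let u2_le0 p : `|p.1| <= 2^-1 -> `|p.2| <= 2^-1 -> 0 <= p.2 -> u2 p <= 0.
Proof.
move=> p1 p2 p20; have [h _] := collar_push_square p1 p2.
have := ler_wpM2l (ltW k0) (h p20) => {}h.
have := SL (2 * half_angle p) 0; rewrite S0 !subr0 normrM ger0_norm// => h1.
have := half_angle_norm p; rewrite (ger0_norm p20) => h2.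
have := ler_wpM2l (ltW Ls0) h2 => h3.
have := ler_norm (S (2 * half_angle p)); rewrite /u2 kE in h *; nra.
Qed.

Let u3_ge1 p : `|p.1| <= 2^-1 -> `|p.2| <= 2^-1 -> p.2 <= 0 -> 1 <= u3 p.
Proof.
move=> p1 p2 p20; have [_ h] := collar_push_square p1 p2.
have := ler_wpM2l (ltW k0) (h p20) => {}h.
have := SL (2 * pi) (2 * pi + 2 * half_angle p); rewrite S1 opprD addrA subrr add0r normrN normrM ger0_norm// => h1.
have := half_angle_norm p; rewrite (ler0_norm p20) => h2.
have := ler_wpM2l (ltW Ls0) h2 => h3.
have := ler_norm (1 - S (2 * pi + 2 * half_angle p)); rewrite /u3 kE in h *; nra.
Qed.

(** Trace of the collar on the left side of the inner square. From bottom to top it runs through [c]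
    backwards, which is why its filling is obtained from the reversed curve. *)
Let b (t : R) : V := c (c01 (u1 (- 2^-1, c01 t - 2^-1))).

Let fill_b : fill br q b A.
Proof.
have hr : glip br I01 (fun t : R => c (1 - t)) M.
  rewrite -[M]mulr1; apply: (glip_comp (D := I01) M0) hc => [t|s t _ _].
    by rewrite /= !in_itv/= => /andP[? ?]; apply/andP; split; lra.
  by rewrite opprB addrC addrA subrK distrC mul1r.
have r0 : c (1 - 0) = 0 by rewrite subr0.
have r1 : c (1 - 1) = 0 by rewrite subrr.
pose v t : R := 1 - c01 (u1 (- 2^-1, c01 t - 2^-1)).
have half : `|(- 2^-1 : R)| <= 2^-1 by rewrite normrN ger0_norm.
have z01 : 0 <= (0 : R) <= 1 by rewrite lexx ler01.
have o01 : 0 <= (1 : R) <= 1 by rewrite lexx ler01.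
have vL s t : `|v s - v t| <= Lu * `|s - t|.
  have -> : v s - v t = - (c01 (u1 (- 2^-1, c01 s - 2^-1)) - c01 (u1 (- 2^-1, c01 t - 2^-1))) by rewrite /v; ring.
  rewrite normrN (le_trans (clamp_lip _ _ _ _))// (le_trans (u1L _ _))//; apply: (ler_wpM2l (ltW Lu0)).
  rewrite ge_max /= subrr normr0 normr_ge0 /= opprD addrACA subrr addr0.
  exact: clamp_lip.
have v01 t : 0 <= v t <= 1.
  by have /andP[? ?] := clamp_in (u1 (- 2^-1, c01 t - 2^-1)) (@ler01 R); rewrite /v; apply/andP; split; lra.
have v0 : v 0 = 0.
  have h := @u1_bottom (- 2^-1, c01 0 - 2^-1) half (ltac:(by rewrite /= (c01E z01) add0r)).
  by rewrite /v /clamp min_l// max_r// subrr.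
have v1 : v 1 = 1.
  have h := @u1_top (- 2^-1, c01 1 - 2^-1) half (ltac:(by rewrite /= (c01E o01); lra)).
  by rewrite /v /clamp min_r ?(le_trans h)// max_l// subr0.
have hv := fill_reparametrize M0 hr r0 r1 Lu0 vL v01 v0 v1 (fA hr r0 r1).
by apply: eq_fill hv => t _; rewrite /v /b subKr.
Qed.

(** Only the inner square has area: the collar depends on one parameter of the curve [c]. On three
    sides of the square the collar is at the base point, on the fourth it is [b], and this is
    exactly the boundary of the filling of [b]. *)
Lemma filling_area_collar : (filling_area e q f <= A%:E)%E.
Proof.
have [F [L [L0 gF F01 Fs aF]]] := fill_b.
pose inQ (p : R * R) := (`|p.1| <= 2^-1) && (`|p.2| <= 2^-1).
(* The cases overlap on the sides of the inner square and on the axes; the formulas agree there, as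
   [G1], [G2] and [G3] show. *)
pose g p := if inQ p then F (1 * p.1 + 2^-1, 1 * p.2 + 2^-1) else if p.1 <= 0 then c (c01 (u1 p)) else
  if 0 <= p.2 then c (c01 (u2 p)) else c (c01 (u3 p)).
have sqQ p : square (1 * p.1 + 2^-1, 1 * p.2 + 2^-1) -> g p = F (1 * p.1 + 2^-1, 1 * p.2 + 2^-1).
  move=> [/= /andP[x0 x1] /andP[y0 y1]]; rewrite /g /inQ !ifT//.
  by rewrite !ler_norml; do !(apply/andP; split); lra.
have [g0 cl0 a0] := affine_piece ts ltr01 ltr01 L0 gF aF sqQ.
have cc1 : continuous (fun p : R * R => p.1) by move=> p; exact: cvg_fst.
have cc2 : continuous (fun p : R * R => p.2) by move=> p; exact: cvg_snd.
have cn1 : continuous (fun p : R * R => `|p.1|).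
  by move=> p; apply: (cont_comp (f := fun p : R * R => p.1) (g := fun x : R => `|x|)); [exact: cc1|exact: norm_continuous].
have cn2 : continuous (fun p : R * R => `|p.2|).
  by move=> p; apply: (cont_comp (f := fun p : R * R => p.2) (g := fun x : R => `|x|)); [exact: cc2|exact: norm_continuous].
have cle (h : R * R -> R) (z : R) : continuous h -> closed [set p | h p <= z].
  by move=> ch; apply: (preimage_closed _ (@closed_le R z)) => p _; exact: ch.
have cge (h : R * R -> R) (z : R) : continuous h -> closed [set p | z <= h p].
  by move=> ch; apply: (preimage_closed _ (@closed_ge R z)) => p _; exact: ch.
have olt (h : R * R -> R) (z : R) : continuous h -> open [set p | h p < z].
  by move=> ch; apply: open_comp (@open_lt R z) => p _; exact: ch.
have ogt (h : R * R -> R) (z : R) : continuous h -> open [set p | z < h p].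
  by move=> ch; apply: open_comp (@open_gt R z) => p _; exact: ch.
pose O := [set p : R * R | 2^-1 <= `|p.1|] `|` [set p | 2^-1 <= `|p.2|].
have cO : closed O := closedU (cge _ _ cn1) (cge _ _ cn2).
have edge p : O p -> inQ p -> [\/ p.1 = - 2^-1, p.1 = 2^-1, p.2 = - 2^-1 | p.2 = 2^-1].
  have abs (x : R) : 2^-1 <= `|x| -> `|x| <= 2^-1 -> x = - 2^-1 \/ x = 2^-1.
    by case: (ger0P x) => ? ? ?; [right|left]; lra.
  move=> [hO|hO] /andP[h1 h2].
    by have [->|->] := abs _ hO h1; [apply: Or41|apply: Or42].
  by have [->|->] := abs _ hO h2; [apply: Or43|apply: Or44].
have Fv p : inQ p -> p.1 = 2^-1 \/ p.2 = 2^-1 \/ p.2 = - 2^-1 -> F (1 * p.1 + 2^-1, 1 * p.2 + 2^-1) = 0.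
  rewrite /inQ !ler_norml => /andP[/andP[x0 x1] /andP[y0 y1]].
  have x01 : 0 <= 1 * p.1 + 2^-1 <= 1 by apply/andP; split; lra.
  have y01 : 0 <= 1 * p.2 + 2^-1 <= 1 by apply/andP; split; lra.
  have [hb ht] := Fs _ x01; have [_ hr] := F01 _ y01.
  move=> [e1|[e1|e1]].
  - by have -> : 1 * p.1 + 2^-1 = 1 by lra.
  - by have -> : 1 * p.2 + 2^-1 = 1 by lra.
  - by have -> : 1 * p.2 + 2^-1 = 0 by lra.
have G1 p : O p -> p.1 <= 0 -> g p = c (c01 (u1 p)).
  move=> Op p1; rewrite /g p1; case: ifP => // Qp; have /andP[q1 q2] := Qp.
  have [ep|ep|ep|ep] := edge p Op Qp.
  - have -> : 1 * p.1 + 2^-1 = 0 by rewrite ep; lra.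
    have y01 : 0 <= 1 * p.2 + 2^-1 <= 1 by move: q2; rewrite ler_norml => /andP[? ?]; apply/andP; split; lra.
    have [-> _] := F01 _ y01; rewrite /b (c01E y01) mul1r addrK.
    by case: p ep {Op p1 Qp q1 q2 y01} => x y /= ->.
  - by exfalso; move: p1; rewrite ep; lra.
  - by rewrite Fv ?c_ge1//; [exact: u1_bottom|right; right].
  - by rewrite Fv ?c_le0//; [exact: u1_top|right; left].
have G2 p : O p -> 0 <= p.1 -> 0 <= p.2 -> g p = c (c01 (u2 p)).
  move=> Op p1 p2; rewrite /g; case: ifP => Qp.
    have /andP[q1 q2] := Qp; rewrite (c_le0 (u2_le0 q1 q2 p2)); apply: Fv => //.
    by case: (edge p Op Qp) => ep; [exfalso; move: p1; rewrite ep; lra|left|exfalso; move: p2; rewrite ep; lra|right; left].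
  case: ifP => p1'; last by rewrite p2.
  have p10 : p.1 = 0 by apply/eqP; rewrite eq_le p1 p1'.
  have h : half_angle p = pi / 4.
    apply: half_angle_axis => //; move/negbT: Qp; rewrite /inQ p10 normr0 invr_ge0 ler0n /= ger0_norm// -ltNge; exact: ltW.
  by rewrite /u1 /u2 h; congr (c (c01 (S _ - _))); lra.
have G3 p : O p -> 0 <= p.1 -> p.2 <= 0 -> g p = c (c01 (u3 p)).
  move=> Op p1 p2; rewrite /g; case: ifP => Qp.
    have /andP[q1 q2] := Qp; rewrite (c_ge1 (u3_ge1 q1 q2 p2)); apply: Fv => //.
    by case: (edge p Op Qp) => ep; [exfalso; move: p1; rewrite ep; lra|left|right; right|exfalso; move: p2; rewrite ep; lra].
  case: ifP => p1'.
    have p10 : p.1 = 0 by apply/eqP; rewrite eq_le p1 p1'.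
    have h : half_angle p = - (pi / 4).
      rewrite -[half_angle p]opprK -half_angleN; congr (- _); apply: half_angle_axis => //=.
      move/negbT: Qp; rewrite /inQ p10 normr0 invr_ge0 ler0n /= ler0_norm// -ltNge; exact: ltW.
    by rewrite /u1 /u3 h; congr (c (c01 (S _ - _))); lra.
  (* The cut along the positive axis: the parameter jumps from 0 to 1, and both give the base
     point. *)
  case: ifP => // p2'; have p20 : p.2 = 0 by apply/eqP; rewrite eq_le p2 p2'.
  have h : half_angle p = 0 by rewrite /half_angle p20 mul0r atan0.
  have h' : collar_push p = 0 by rewrite /collar_push p20 clamp_id ?mulr0//; apply/andP; split; lra.
  have e2 : u2 p = 0 by rewrite /u2 h h' !mulr0 S0 subr0.
  have e3 : u3 p = 1 by rewrite /u3 h h' !mulr0 addr0 S1 subr0.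
  by rewrite c_le0 ?e2// c_ge1// e3.
pose M1 := L * (1 + 1) + M * Lu.
have MLu : 0 <= M * Lu by rewrite mulr_ge0// ltW.
have M10 : 0 <= M1 by rewrite /M1 addr_ge0// mulr_ge0.
have sect D (u : R * R -> R) : (forall p p', `|u p - u p'| <= Lu * `|p - p'|) ->
    (forall p, D p -> g p = c (c01 (u p))) -> glip br D g M1.
  move=> uL gu; apply: (@glip_le _ _ _ _ _ _ (M * Lu)); first by rewrite lerDr mulr_ge0.
  apply: (eq_glip (f := fun p => c (c01 (u p)))) => [p /gu //|]; exact: glip_thin.
have gg : glip br setT g M1.
  have h0 : glip br [set p | square (1 * p.1 + 2^-1, 1 * p.2 + 2^-1)] g M1.
    by apply: glip_le g0; rewrite lerDl.
  have h1 := sect (O `&` [set p | p.1 <= 0]) u1 u1L (fun p (Dp : (O `&` _) p) => G1 p Dp.1 Dp.2).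
  have h2 := sect (O `&` ([set p | 0 <= p.1] `&` [set p | 0 <= p.2])) u2 u2L (fun p (Dp : (O `&` (_ `&` _)) p) => G2 p Dp.1 Dp.2.1 Dp.2.2).
  have h3 := sect (O `&` ([set p | 0 <= p.1] `&` [set p | p.2 <= 0])) u3 u3L (fun p (Dp : (O `&` (_ `&` _)) p) => G3 p Dp.1 Dp.2.1 Dp.2.2).
  have d1 := closedI cO (cle _ 0 cc1).
  have d2 := closedI cO (closedI (cge _ 0 cc1) (cge _ 0 cc2)).
  have d3 := closedI cO (closedI (cge _ 0 cc1) (cle _ 0 cc2)).
  have h := glip_glue (closedU cl0 d1) (closedU d2 d3) (glip_glue cl0 d1 h0 h1) (glip_glue d2 d3 h2 h3).
  refine (glip_sub _ h) => p _.
  have [Op|nO] := pselect (O p); last first.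
    left; left; have [x1 y1] : `|p.1| < 2^-1 /\ `|p.2| < 2^-1.
      by split; rewrite ltNge; apply/negP => hh; apply: nO; [left|right].
    by move: x1 y1; rewrite !ltr_norml => /andP[? ?] /andP[? ?]; split; apply/andP; split => /=; lra.
  have [p1|/ltW p1] := leP p.1 0; first by left; right.
  by right; have [p2|/ltW p2] := leP p.2 0; [right|left].
pose NQ := [set p : R * R | 2^-1 < `|p.1|] `|` [set p | 2^-1 < `|p.2|].
have oNQ : open NQ := openU (ogt _ _ cn1) (ogt _ _ cn2).
have NQO : NQ `<=` O by move=> p [h|h]; [left|right]; exact: ltW.
have thin D (u : R * R -> R) : open D -> (forall p p', `|u p - u p'| <= Lu * `|p - p'|) ->
    (forall p, D p -> g p = c (c01 (u p))) -> area_le br q g D 0.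
  move=> oD uL gu; apply: (area_near (F' := fun p => c (c01 (u p)))).
    by move=> p Dp; apply: filterS (open_nbhs_nbhs (conj oD Dp)) => p' /gu.
  exact: (area_sub _ (lexx _) (thin_area M0 hc Lu0 uL)).
have t1 := thin (NQ `&` [set p | p.1 < 0]) u1 (openI oNQ (olt _ 0 cc1)) u1L
  (fun p (Dp : (NQ `&` _) p) => G1 p (NQO p Dp.1) (ltW Dp.2)).
have t2 := thin (NQ `&` ([set p | 0 < p.1] `&` [set p | 0 < p.2])) u2 (openI oNQ (openI (ogt _ 0 cc1) (ogt _ 0 cc2))) u2L
  (fun p (Dp : (NQ `&` (_ `&` _)) p) => G2 p (NQO p Dp.1) (ltW Dp.2.1) (ltW Dp.2.2)).
have t3 := thin (NQ `&` ([set p | 0 < p.1] `&` [set p | p.2 < 0])) u3 (openI oNQ (openI (ogt _ 0 cc1) (olt _ 0 cc2))) u3L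
  (fun p (Dp : (NQ `&` (_ `&` _)) p) => G3 p (NQO p Dp.1) (ltW Dp.2.1) (ltW Dp.2.2)).
have lx z : area_le br q g [set p | p.1 = z] 0 by apply: line_area; left.
have ly z : area_le br q g [set p | p.2 = z] 0 by apply: line_area; right.
have lines := areaU (areaU (areaU (lx 0) (lx 2^-1)) (lx (- 2^-1))) (areaU (areaU (ly 0) (ly 2^-1)) (ly (- 2^-1))).
have aD : area_le br q g disc A.
  have := areaU (areaU a0 (areaU t1 (areaU t2 t3))) lines; rewrite !addr0; apply: area_sub => // p _.
  have [p10|p10|p10] := ltgtP p.1 0; last by right; left; left; left.
    have [p2|p2] := leP `|p.2| 2^-1; last by left; right; left; split=> //; right.
    have [p1|p1] := leP `|p.1| 2^-1; last by left; right; left; split=> //; left.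
    have [e1|e1] := eqVneq p.1 (- 2^-1); first by right; left; right.
    have [e2|e2] := eqVneq p.2 2^-1; first by right; right; left; right.
    have [e3|e3] := eqVneq p.2 (- 2^-1); first by right; right; right.
    left; left; move: p1 p2; rewrite !ler_norml => /andP[x0 x1] /andP[y0 y1].
    have x0' : - 2^-1 < p.1 by rewrite lt_neqAle eq_sym e1.
    have y0' : - 2^-1 < p.2 by rewrite lt_neqAle eq_sym e3.
    have y1' : p.2 < 2^-1 by rewrite lt_neqAle e2.
    by split; apply/andP; split => /=; lra.
  have [p20|p20|p20] := ltgtP p.2 0; last by right; right; left; left.
    have [p2|p2] := leP `|p.2| 2^-1; last by left; right; right; right; split=> //; right.
    have [p1|p1] := leP `|p.1| 2^-1; last by left; right; right; right; split=> //; left.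
    have [e1|e1] := eqVneq p.1 2^-1; first by right; left; left; right.
    have [e3|e3] := eqVneq p.2 (- 2^-1); first by right; right; right.
    left; left; move: p1 p2; rewrite !ler_norml => /andP[x0 x1] /andP[y0 y1].
    have x1' : p.1 < 2^-1 by rewrite lt_neqAle e1.
    have y0' : - 2^-1 < p.2 by rewrite lt_neqAle eq_sym e3.
    by split; apply/andP; split => /=; lra.
  have [p2|p2] := leP `|p.2| 2^-1; last by left; right; right; left; split=> //; right.
  have [p1|p1] := leP `|p.1| 2^-1; last by left; right; right; left; split=> //; left.
  have [e1|e1] := eqVneq p.1 2^-1; first by right; left; left; right.
  have [e2|e2] := eqVneq p.2 2^-1; first by right; right; left; right.
  left; left; move: p1 p2; rewrite !ler_norml => /andP[x0 x1] /andP[y0 y1].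
  have x1' : p.1 < 2^-1 by rewrite lt_neqAle e1.
  have y1' : p.2 < 2^-1 by rewrite lt_neqAle e2.
  by split; apply/andP; split => /=; lra.
(* [c] was translated to start at 0; translating back by the logarithm of the starting point
   recovers [f]. *)
pose a := lg (f (1, 0)).
pose h p := E (bch br a (g p)).
have hf p : circle p -> h p = f p.
  move=> cp; have [ca sa] := cos_sin_half_angle cp; have pu := collar_push_circle cp.
  have Op : O p.
    have [hO|hO] := leP 2^-1 `|p.1|; [by left|right].
    have [//|hO2] := leP 2^-1 `|p.2|; exfalso; move: cp; rewrite /circle /=.
    rewrite -(real_normK (num_real p.1)) -(real_normK (num_real p.2)).
    have := normr_ge0 p.1; have := normr_ge0 p.2; nra.
  have fin th : 0 <= th <= 2 * pi -> (cos th, sin th) = p -> g p = c (c01 (S th)) -> h p = f p.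
    move=> th01 thp gp; have [s01 cS] := hS th01.
    by rewrite /h gp (c01E s01) cS thp /a (bchNKl ts) (nm_lgK hm).
  have /andP[b1 b2] := half_angle_bounds p.
  have [p1|p1] := leP p.1 0.
    apply: (fin (pi - 2 * half_angle p)).
    - exact: th1_in.
    - rewrite cosB sinB cospi sinpi ca sa ler0_norm// !mulN1r !mul0r addr0 sub0r !opprK.
      by case: p {cp ca sa pu Op fin b1 b2 p1}.
    - by rewrite G1// /u1 pu mulr0 subr0.
  have [p2|p2] := leP 0 p.2.
    have h0 := half_angle_ge0 p2.
    apply: (fin (2 * half_angle p)).
    - by apply/andP; split; lra.
    - rewrite ca sa gtr0_norm//; by case: p {cp ca sa pu Op fin b1 b2 p1 p2 h0}.
    - by rewrite (G2 _ Op (ltW p1) p2) /u2 pu mulr0 subr0.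
  have h0 : half_angle p <= 0.
    by rewrite -oppr_ge0 -half_angleN; apply: half_angle_ge0; rewrite /= oppr_ge0 ltW.
  apply: (fin (2 * pi + 2 * half_angle p)).
  - by apply/andP; split; lra.
  - rewrite [2 * pi + _]addrC [2 * pi]mulr_natl cosD2pi sinD2pi ca sa gtr0_norm//; by case: p {cp ca sa pu Op fin b1 b2 p1 p2 h0}.
  - by rewrite (G3 _ Op (ltW p1) (ltW p2)) /u3 pu mulr0 subr0.
(* Germs become a global bound along segments; the quadratic term is absorbed because the disc is
   bounded. *)
have hL : lipschitz_map e q disc h.
  have [Kd Kd0 hKd] := nm_dist hm q; have [Kc Kc0 hKc] := ndist_curve ts.
  exists (Kd * (Kc * (M1 + 2 * M1 ^+ 2))) => p p' dp dp'.
  apply: le_trans (hKd _ _) _; rewrite lee_fin -mulrA; apply: ler_wpM2l => //.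
  rewrite -/(ndist br (bch br a (g p)) (bch br a (g p'))) (ndist_invariant ts).
  pose d := `|p' - p|; pose x (t : R) := g (p + t *: (p' - p)).
  have hx : glip br I01 x (M1 * d).
    apply: (glip_comp (D := setT) M10) gg => // s t _ _.
    by rewrite opprD addrACA subrr add0r -scalerBl normrZ mulrC.
  have d0 : 0 <= d := normr_ge0 _.
  have := hKc x 0 1 (M1 * d) ler01 (mulr_ge0 M10 d0) hx.
  rewrite /x scale0r addr0 scale1r [p + _]addrC subrK subr0 mulr1 => H.
  apply: (le_trans H); rewrite -mulrA; apply: ler_wpM2l => //.
  have d2 : d <= 2.
    have /discE r1 := dp; have /discE r2 := dp'.
    rewrite /d (le_trans (ler_normB _ _))// -[2]/(1 + 1) lerD//.
      by rewrite ge_max (le_trans (norm1_le_eucl _) r2) (le_trans (norm2_le_eucl _) r2).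
    by rewrite ge_max (le_trans (norm1_le_eucl _) r1) (le_trans (norm2_le_eucl _) r1).
  have de : d <= euclid_dist p p' by rewrite /d distrC norm_le_euclid.
  apply: (@le_trans _ _ ((M1 + 2 * M1 ^+ 2) * d)); last first.
    by apply: ler_wpM2l => //; rewrite addr_ge0// mulr_ge0// sqr_ge0.
  have -> : (M1 + 2 * M1 ^+ 2) * d = M1 * d + M1 ^+ 2 * (2 * d) by ring.
  rewrite lerD2l exprMn; apply: ler_wpM2l; first exact: sqr_ge0.
  by rewrite expr2; apply: ler_wpM2r.
have cg : continuous g.
  by move=> p; apply: (glip_continuous ts gg) => //; exact: filterT.
apply: le_trans (disc_area_le hm cg aD).
(* Left translation does not change velocities, hence not the area. *)
have -> : disc_area e q (fun p => E (g p)) = disc_area e q h.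
  rewrite /disc_area; congr (integral _ _ _); apply/funext => p; congr EFin.
  have vel (x : R -> V) t : velocity e (fun s => E (x s)) t = velocity e (fun s => E (bch br a (x s))) t.
    rewrite /velocity; congr (derive1 _ t); apply/funext => s; congr (chart_map e _).
    by rewrite !(nm_M hm) invgM -mulgA mulKg.
  by rewrite /jacobian2 /h (vel (fun s => g (s, p.2))) (vel (fun s => g (p.1, s))).
by apply: ereal_inf_lbound; exists h.
Qed.

End collar.

End disc_from_square.

(** * The quotient by a central subspace *)

Section graded_brackets.
Context {R : realType} {n : nat}.
Notation V := 'rV[R]_n.
Variables (br : V -> V -> V) (C : R).
Hypothesis bbl : bounded_bilinear (br : V -> V -> V) C.
Hypothesis alt : forall x, br x x = 0.

Lemma lie_prod_in (U W : {vspace V}) x y : x \in U -> y \in W -> br x y \in lie_prod br U W.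
Proof.
move=> Ux Wy; rewrite (coord_vbasis Ux) (coord_vbasis Wy).
rewrite (big_morph (br ^~ _) (fun u v => bblDl bbl u v _) (bbl0l bbl _)).
apply: memv_suml => i _; rewrite (big_morph _ (bblDr bbl _) (bbl0r bbl _)).
apply: memv_suml => j _; rewrite (bblZl bbl) (bblZr bbl); do 2 apply: memvZ.
by apply: memv_span; apply: allpairs_f; apply: mem_nth; rewrite size_tuple.
Qed.

Lemma bracket_sym0 x y : br x y = 0 -> br y x = 0.
Proof.
move=> xy; have := alt (x + y).
by rewrite (bblDl bbl) !(bblDr bbl) !alt xy !add0r addr0.
Qed.

Variables V1 V2 : {vspace V}.
Hypothesis grd : grading br V1 V2.

Lemma bracket_in_top x y : br x y \in V2.
Proof. by case: grd => _ _ _ _ <-; apply: lie_prod_in; exact: memvf. Qed.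

Lemma top_central w : w \in V2 -> forall y, br w y = 0.
Proof.
case: grd => full _ _ [h12 h22] _ Ww y.
have : y \in (V1 + V2)%VS by rewrite full memvf.
move=> /memv_addP[y1 Vy1 [y2 Vy2 ->]]; rewrite (bblDr bbl).
have -> : br w y1 = 0.
  by apply: bracket_sym0; apply/eqP; rewrite -memv0 -h12; exact: lie_prod_in.
by rewrite add0r; apply/eqP; rewrite -memv0 -h22; exact: lie_prod_in.
Qed.

Lemma top_span : exists s : seq (V * V), V2 = <<[seq br p.1 p.2 | p <- s]>>%VS.
Proof.
exists [seq (x, y) | x <- vbasis fullv, y <- vbasis fullv].
by case: grd => _ _ _ _ <-; rewrite /lie_prod map_allpairs.
Qed.

Lemma top_annihilated (P : 'M[R]_n) : (forall x y, br x y *m P = 0) -> forall w, w \in V2 -> w *m P = 0.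
Proof.
move=> hP w; have [s ->] := top_span.
have : (<<[seq br p.1 p.2 | p <- s]>> <= lker (linfun (mulmxr P : V -> V)))%VS.
  by apply/span_subvP => _ /mapP[p _ ->]; rewrite memv_ker lfunE /= hP.
by move=> /subvP h /h; rewrite memv_ker lfunE => /eqP.
Qed.

End graded_brackets.

Lemma linear_section (R : realType) (n n' : nat) (pr : 'Hom('rV[R]_n, 'rV[R]_n')) : limg pr = fullv ->
  exists A : 'M[R]_(n, n'), exists2 B : 'M[R]_(n', n), B *m A = 1%:M & forall x, pr x = x *m A.
Proof.
move=> full; exists (lin1_mx pr), (lin1_mx (pr^-1)%VF) => [|x]; last by rewrite mul_rV_lin1.
apply/row_matrixP => i; rewrite !rowE mulmxA !mul_rV_lin1 mulmx1.
by apply: limg_lfunVK; rewrite full memvf.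
Qed.

Theorem proposition4p8 (R : realType) (n n' : nat)
    (G : lieGroup R n) (G' : lieGroup R n')
    (e : chart R n G) (e' : chart R n' G')
    (q : {dot 'rV[R]_n for idfun}) (q' : {dot 'rV[R]_n' for idfun})
    (V1 V2 W : {vspace 'rV[R]_n}) (pr : 'Hom('rV[R]_n, 'rV[R]_n'))
    (he : chart_at_one e) (he' : chart_at_one e')
    (hGsc : simply_connected R G) (hGnil : nilpotent_group G)
    (hGdehn : quadratic_dehn e q)
    (hgrad : grading (lie_bracket e) V1 V2)
    (hW : (W <= V2)%VS)
    (hG'sc : simply_connected R G') (hG'nil : nilpotent_group G')
    (hG' : lie_quotient (lie_bracket e) (lie_bracket e') W pr) :
  preceq (dehn e' q') (fun l => (l ^+ 2 * ln l)%:E).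
Proof.
have [prM prfull prker] := hG'.
set br := lie_bracket e in hgrad prM *; set br' := lie_bracket e' in prM *.
have alt (x : 'rV[R]_n) : br x x = 0 by rewrite /br /lie_bracket /field_bracket subrr.
have [C bbl] := lie_bracket_bilinear he.
have inV2 := bracket_in_top bbl hgrad; have central := top_central bbl alt hgrad.
have nil x y z : br (br x y) z = 0 by apply: central; exact: inV2.
have [A [B BA prA]] := linear_section prfull.
(* Brackets in the quotient lift, so the quotient inherits two-step nilpotency. *)
have nil' x y z : br' (br' x y) z = 0.
  have lift u : exists v, u = pr v by exists (u *m B); rewrite prA -mulmxA BA mulmx1.
  have [x0 ->] := lift x; have [y0 ->] := lift y; have [z0 ->] := lift z.
  by rewrite -!prM nil linear0.
have [C1 [E [lg hm]]] := nil_model_exists he hGsc nil.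
have [C1' [E' [lg' hm']]] := nil_model_exists he' hG'sc nil'.
have brA (x y : 'rV[R]_n) : br' (x *m A) (y *m A) = br x y *m A by rewrite -!prA prM.
have kerW (w : 'rV[R]_n) : w *m A = 0 -> w \in V2.
  by move=> wA; apply: (subvP hW); rewrite -prker memv_ker prA wA.
have kerA_central (w : 'rV[R]_n) : w *m A = 0 -> forall y, br w y = 0 by move=> /kerW; exact: central.
have kerA_br (P : 'M[R]_n) : (forall x y, br x y *m P = 0) -> forall w : 'rV[R]_n, w *m A = 0 -> w *m P = 0.
  by move=> hP w /kerW; exact: (top_annihilated hgrad hP).
have [Kr Kr0 hKr] : exists2 K : R, 0 <= K & forall w : 'rV[R]_n, w *m A = 0 -> reach br (K * Num.sqrt `|w|) w.
  have [s Vs] := top_span hgrad; have [K K0 hK] := reach_span hm s.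
  by exists K => // w /kerW; rewrite Vs; exact: hK.
(* The affine slack of the coarse relation is absorbed: the square of [c * l + c] contributes
   [c ^+ 3], and the remaining [c * (1 + l)] is at most [c * (1 + l) ^+ 2]. *)
have dehn_le : exists2 K : R, 0 <= K & forall l, 0 <= l -> (dehn e q l <= (K * (1 + l) ^+ 2)%:E)%E.
  have [[c c0 hc] _] := hGdehn; exists (c ^+ 3 + c); first by rewrite addr_ge0 ?exprn_ge0// ltW.
  move=> l l0; apply: le_trans (hc l l0) _; rewrite -EFinM -EFinD lee_fin.
  have -> : c * (c * l + c) ^+ 2 + (c * l + c) = c ^+ 3 * (1 + l) ^+ 2 + c * (1 + l) by ring.
  rewrite mulrDl lerD2l; apply: ler_wpM2l; first exact: ltW.
  by nra.
have [Kf Kf0 hKf] := fill_loop hm hm' q' brA dehn_le kerA_central Kr0 hKr.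
have [Kl Kl1 hKl] := lift_curve hm hm' BA brA kerA_central kerA_br.
have [Kb Kb0 hKb] := glip_bound hm.
have [Kp Kp0 hKp] := loop_parametrization hm' q'.
have [p1 p8] : 1 <= 2 * pi :> R /\ 2 * pi <= 8 :> R by have := @pi_ge2 R; have := @pihalf_lt2 R; split; lra.
(* [Kl] is the cost of lifting. The other factor guarantees that the endpoint of the lift has norm
   at most [(K2 * M) ^+ 2], as [fill_loop] requires. *)
pose K2 := (1 + 2 * Kb) * Kl.
have K21 : 1 <= K2 by have := ler_pM ler01 ler01 (_ : 1 <= 1 + 2 * Kb) Kl1; rewrite mulr1; apply; lra.
have fillA (b : R -> 'rV[R]_n') (M : R) : 1 <= M -> glip br' (`[0 : R, 1 : R]%classic) b M -> b 0 = 0 -> b 1 = 0 ->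
    fill br' q' b (Kf * ((K2 * M) ^+ 2 * (1 + ln (K2 * M)))).
  move=> M1 hb b0 b1; have [x [hx x0 xA]] := hKl b M M1 hb b0.
  have KM1 : 1 <= Kl * M by have := ler_pM ler01 ler01 Kl1 M1; rewrite mulr1.
  have KM0 : 0 <= Kl * M by exact: le_trans KM1.
  have le2 : Kl * M <= K2 * M.
    by rewrite /K2 -mulrA ler_peMl//; lra.
  have x1A : x 1 *m A = 0 by rewrite xA b1.
  have nx : `|x 1| <= (K2 * M) ^+ 2.
    have h := hKb x _ KM0 hx 0 1 (ltac:(by rewrite lexx ler01)) (ltac:(by rewrite lexx ler01)).
    rewrite x0 /ndist oppr0 (bch0x hm) subr0 normr1 mulr1 in h; apply: (le_trans h).
    have -> : (K2 * M) ^+ 2 = (1 + 2 * Kb) ^+ 2 * (Kl * M) ^+ 2 by rewrite /K2; ring.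
    have s1 : Kl * M + (Kl * M) ^+ 2 <= 2 * (Kl * M) ^+ 2 by nra.
    apply: le_trans (ler_wpM2l Kb0 s1) _; rewrite mulrA; apply: ler_wpM2r; first exact: sqr_ge0.
    by have := sqr_ge0 Kb; rewrite expr2; nra.
  by apply: eq_fill (hKf x (K2 * M) (le_trans KM1 le2) (glip_le le2 hx) x0 x1A nx) => t _; exact: xA.
pose K3 := K2 * (Kp + 1).
have K31 : 1 <= K3 by have := ler_pM ler01 ler01 K21 (_ : 1 <= Kp + 1); rewrite mulr1; apply; lra.
have bound (l : R) : 0 <= l ->
    (dehn e' q' l <= (Kf * ((K3 * (l + 2 * pi)) ^+ 2 * (1 + ln (K3 * (l + 2 * pi)))))%:E)%E.
  move=> l0; apply: ge_ereal_sup => _ [f [fL fl] <-].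
  have [c [S [Ls [Ls0 hc SL [S0 S1] hS]]]] := hKp f l l0 fL fl.
  pose M := (Kp + 1) * (l + 2 * pi).
  have M1 : 1 <= M by have := ler_pM ler01 ler01 (_ : 1 <= Kp + 1) (_ : 1 <= l + 2 * pi); rewrite mulr1; apply; lra.
  have {}hc : glip br' (`[0 : R, 1 : R]%classic) c M.
    by apply: glip_le hc; rewrite /M; apply: ler_wpM2r; lra.
  have pi0 : 0 <= 2 * pi :> R by lra.
  have c0 : c 0 = 0.
    have [_] := hS 0 (ltac:(by rewrite lexx)).
    by rewrite S0 cos0 sin0 (bchNx hm').
  have c1 : c 1 = 0.
    have [_] := hS (2 * pi) (ltac:(by rewrite lexx pi0)).
    have -> : cos (2 * pi) = 1 :> R by rewrite mulr_natl -[pi *+ 2]add0r cosD2pi cos0.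
    have -> : sin (2 * pi) = 0 :> R by rewrite mulr_natl -[pi *+ 2]add0r sinD2pi sin0.
    by rewrite S1 (bchNx hm').
  have -> : K3 * (l + 2 * pi) = K2 * M by rewrite /K3 /M mulrA.
  exact: (filling_area_collar hm' (le_trans ler01 M1) hc c0 c1 Ls0 SL S0 S1 hS (fun x hx x0 x1 => fillA x M M1 hx x0 x1) erefl erefl).
(* [8 * K3] dominates [K3 * (l + 2 * pi)] by a multiple of [l + 1], [expR 1] makes [ln Z >= 1] so
   that [1 + ln] is at most [2 * ln Z], and [2 * Kf] is the resulting factor. *)
pose c := 8 * K3 + expR 1 + 2 * Kf.
have e0 : 0 < expR 1 :> R := expR_gt0 1.
exists c; first by rewrite /c; lra.
move=> l l0; apply: le_trans (bound l l0) _; rewrite -EFinM -EFinD lee_fin.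
have cE : c * l + c = c * (l + 1) by ring.
rewrite cE; set Z := c * (l + 1).
have cge : 8 * K3 + expR 1 <= c by rewrite /c; lra.
have Zge : 8 * K3 * (l + 1) <= Z by rewrite /Z; apply: ler_wpM2r; lra.
have Ze : expR 1 <= Z.
  apply: (@le_trans _ _ c); first by rewrite /c; lra.
  have cc0 : 0 <= c by rewrite /c; lra.
  by rewrite /Z -[leLHS]mulr1; apply: (ler_wpM2l cc0); lra.
have Z0 : 0 < Z by apply: lt_le_trans Ze.
have lZ : 1 <= ln Z by rewrite -[1](@expRK R) ler_ln ?posrE.
have MZ : K3 * (l + 2 * pi) <= Z.
  apply: le_trans Zge; have -> : 8 * K3 * (l + 1) = K3 * (8 * (l + 1)) by ring.
  by apply: ler_wpM2l; lra.
have M0 : 0 < K3 * (l + 2 * pi) by rewrite mulr_gt0//; lra.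
have lM : ln (K3 * (l + 2 * pi)) <= ln Z by rewrite ler_ln ?posrE.
have M1 : 1 <= K3 * (l + 2 * pi).
  by have := ler_pM ler01 ler01 K31 (_ : 1 <= l + 2 * pi); rewrite mulr1; apply; lra.
have lM0 : 0 <= ln (K3 * (l + 2 * pi)) by exact: ln_ge0.
have sq : (K3 * (l + 2 * pi)) ^+ 2 <= Z ^+ 2 by rewrite ler_pXn2r ?nnegrE ?(ltW M0) ?(ltW Z0).
apply: (@le_trans _ _ (Kf * (Z ^+ 2 * (2 * ln Z)))).
  apply: ler_wpM2l => //; apply: ler_pM => //; [exact: sqr_ge0|lra|lra].
rewrite ler_wpDr ?(ltW Z0)//.
have -> : Kf * (Z ^+ 2 * (2 * ln Z)) = 2 * Kf * (Z ^+ 2 * ln Z) by ring.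
apply: ler_wpM2r; first by rewrite mulr_ge0 ?sqr_ge0//; lra.
by rewrite /c; lra.
Qed.
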